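(* Let $w\in W$ and $J\subseteq\mathcal{I}_w$, and let $X_{wB}$ denote the corresponding Schubert variety. Then the stabilizer in $L_J$ of every point of $X_{wB}$ is a strongly solvable subgroup of $L_J$.
   Context: $G$ is a connected reductive algebraic group over an algebraically closed field $k$ of arbitrary characteristic, $B\subset G$ a Borel subgroup, $T\subset B$ a maximal torus, $W$ the Weyl group of $(G,T)$, $\mathcal{S}$ the set of simple roots determined by $(G,B,T)$. For $w\in W$ let $\dot w\in N_G(T)$ be a representative and $X_{wB}:=\overline{B\dot wB/B}\subseteq G/B$. Put $\mathcal{I}_w:=\{\alpha\in\mathcal{S}\mid w^{-1}(\alpha)<0\}$. For $J\subseteq\mathcal{S}$, $P_J$ is the standard parabolic subgroup generated by $B$ and the root subgroups $U_{-\alpha}$, $\alpha\in J$, and $L_J$ is its Levi subgroup containing $T$. The stabilizer of $X_{wB}$ in $G$ is $P_{\mathcal{I}_w}$, so $L_J$ acts on $X_{wB}$ for every $J\subseteq\mathcal{I}_w$. A subgroup $H$ of a connected reductive group $K$ is called strongly solvable if it is contained in a Borel subgroup of $K$. *)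

(* Defs.v *)
From HB Require Import structures.
From mathcomp Require Import all_boot all_order all_algebra.
From mathcomp Require Import mpoly.
From mathcomp Require Import boolp classical_sets topology.
Set Implicit Arguments.
Unset Strict Implicit.
Unset Printing Implicit Defensive.
Import GRing.Theory.
Local Open Scope classical_set_scope.
Local Open Scope ring_scope.

(* Algebraic groups are taken in the classical sense:
   Zariski-closed subgroups of GL_n(k), identified with their k-points, where k
   is algebraically closed of arbitrary characteristic. *)

Section Zariski.
Variables (k : closedFieldType) (n : nat).

Definition poly_at (p : {mpoly k[n * n]}) (A : 'M[k]_n) : k :=
  p.@[fun i => mxvec A 0 i].

Definition zero_locus (I : set {mpoly k[n * n]}) : set 'M[k]_n :=
  [set A | forall p, I p -> poly_at p A = 0].

(* An alias of 'M[k]_n, so that the Zariski topology does not compete with the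
   entrywise topology that the library puts on matrices. *)
Definition zariski : Type := 'M[k]_n.
HB.instance Definition _ := Choice.on zariski.

Definition zariski_open : set_system zariski :=
  [set U | exists I, U = ~` zero_locus I].

Lemma zariski_openT : zariski_open setT.
Proof.
exists [set 1]; apply/esym/seteqP; split=> // A _ /(_ _ erefl).
by rewrite /poly_at meval1; apply/eqP; rewrite oner_eq0.
Qed.

Lemma zariski_openI : setI_closed zariski_open.
Proof.
move=> _ _ [I ->] [J ->].
exists [set r | exists p q, [/\ I p, J q & r = p * q]].
rewrite -setCU; congr (~` _); apply/seteqP; split=> [A [IA|JA] _ [p [q [Ip Jq ->]]]|A IJA].
- by rewrite /poly_at mevalM -[meval _ p]/(poly_at p A) IA// mul0r.
- by rewrite /poly_at mevalM -[meval _ q]/(poly_at q A) JA// mulr0.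
have [IA|/existsNP[p /not_implyP[Ip /eqP pA]]] := pselect (zero_locus I A).
  by left.
right=> q Jq; have /eqP := IJA (p * q) (ex_intro _ p (ex_intro _ q (And3 Ip Jq erefl))).
by rewrite /poly_at mevalM mulf_eq0 -[meval _ p]/(poly_at p A) (negbTE pA) => /eqP.
Qed.

Lemma zariski_open_bigU (T : Type) (f : T -> set zariski) :
  (forall i, zariski_open (f i)) -> zariski_open (\bigcup_i f i).
Proof.
move=> fo; exists [set p | exists i I, f i = ~` zero_locus I /\ I p].
apply/seteqP; split=> [A [i _ fiA] IA|A IA].
  have [I fE] := fo i; move: (fiA); rewrite fE; apply=> p Ip.
  by apply: IA; exists i, I.
apply: contrapT => fA; apply: IA => p [i [I [fE Ip]]].
have : ~ f i A by move=> fiA; apply: fA; exists i.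
by rewrite fE => /contrapT; apply.
Qed.

HB.instance Definition _ := isOpenTopological.Build zariski
  zariski_openT zariski_openI zariski_open_bigU.

Definition zclosed (Z : set 'M[k]_n) : Prop := closed (Z : set zariski).
Definition zconnected (Z : set 'M[k]_n) : Prop := connected (Z : set zariski).

Lemma zclosedP (Z : set 'M[k]_n) : zclosed Z <-> exists I, Z = zero_locus I.
Proof.
rewrite /zclosed -[X in closed X]setCK closedC.
split=> [[I /(congr1 setC)]|[I ->]]; last by exists I.
by rewrite !setCK => ->; exists I.
Qed.

End Zariski.

Section Groups.
Variables (k : closedFieldType) (n : nat).
Implicit Types (H K G U P L : set 'M[k]_n).

Definition is_subgroup H : Prop :=
  [/\ H `<=` [set g | g \in unitmx], H 1%:M,
      forall g h, H g -> H h -> H (g *m h)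
    & forall g, H g -> H (invmx g)].

Definition gen (A : set 'M[k]_n) : set 'M[k]_n := smallest is_subgroup A.

Definition algebraic_group H : Prop :=
  is_subgroup H /\
  exists2 Z, zclosed Z & H = Z `&` [set g | g \in unitmx].

Definition normal_in G U : Prop :=
  U `<=` G /\ forall g u, G g -> U u -> U (g *m u *m invmx g).

Definition derived H : set 'M[k]_n :=
  gen [set g *m h *m invmx g *m invmx h | g in H & h in H].

Definition is_solvable H : Prop :=
  exists m, iter m derived H = [set 1%:M].

Definition unipotent_group U : Prop :=
  forall u, U u -> exists m, (u - 1%:M) ^+ m = 0.

Definition unipotent_radical G : set 'M[k]_n :=
  gen (\bigcup_(U in [set U | [/\ algebraic_group U, zconnected U,
                                  normal_in G U & unipotent_group U]]) U).

Definition reductive G : Prop := unipotent_radical G = [set 1%:M].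

Definition borel_subgroup G B : Prop :=
  let csc H :=
    [/\ algebraic_group H, zconnected H, is_solvable H & H `<=` G] in
  csc B /\ forall B', csc B' -> B `<=` B' -> B' = B.

Definition strongly_solvable K H : Prop :=
  [/\ is_subgroup H, H `<=` K & exists2 B, borel_subgroup K B & H `<=` B].

(* The coordinate ring of a closed subgroup of GL_n is generated by the matrix
   entries and 1 / det. *)
Definition regular_on H (f : 'M[k]_n -> k) : Prop :=
  exists p e, forall g, H g -> f g = poly_at p g / (\det g) ^+ e.

Definition centralizer G (A : set 'M[k]_n) : set 'M[k]_n :=
  [set g | G g /\ forall a, A a -> g *m a = a *m g].

Definition normalizer G (A : set 'M[k]_n) : set 'M[k]_n :=
  [set g | G g /\ [set g *m a *m invmx g | a in A] = A].

Definition lcoset (g : 'M[k]_n) H : set 'M[k]_n := [set g *m h | h in H].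

End Groups.

Section Morphisms.
Variables (k : closedFieldType) (m n : nat).

Definition morphism (H : set 'M[k]_m) (K : set 'M[k]_n)
    (f : 'M[k]_m -> 'M[k]_n) : Prop :=
  [/\ forall g, H g -> K (f g),
      forall i j, regular_on H (fun g => f g i j)
    & forall g h, H g -> H h -> f (g *m h) = f g *m f h].

End Morphisms.

Definition isomorphism (k : closedFieldType) (m n : nat)
    (H : set 'M[k]_m) (K : set 'M[k]_n) (f : 'M[k]_m -> 'M[k]_n) : Prop :=
  morphism H K f /\ exists g, [/\ morphism K H g,
    forall x, H x -> g (f x) = x & forall y, K y -> f (g y) = y].

Definition diag_group (k : closedFieldType) (r : nat) : set 'M[k]_r :=
  [set d | is_diag_mx d && (d \in unitmx)].

Definition ga (k : closedFieldType) (x : k) : 'M[k]_2 :=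
  1%:M + x *: delta_mx 0 1.

Section Tori.
Variables (k : closedFieldType) (n : nat).
Implicit Types (G H B T L P U : set 'M[k]_n) (a b c : 'M[k]_n -> k).

Definition torus T : Prop :=
  algebraic_group T /\
  exists r (f : 'M[k]_n -> 'M[k]_r), isomorphism T (@diag_group k r) f.

Definition maximal_torus G T : Prop :=
  [/\ torus T, T `<=` G
    & forall T', torus T' -> T' `<=` G -> T `<=` T' -> T' = T].

(* Characters of T are extended by 0 outside T, so that equality of characters
   is equality of functions.  The group law of X(T), written additively in
   informal use, is pointwise multiplication. *)
Definition character T a : Prop :=
  [/\ regular_on T a, forall t, T t -> a t != 0,
      forall s t, T s -> T t -> a (s *m t) = a s * a t
    & forall t, ~ T t -> a t = 0].

Definition char_add a b : 'M[k]_n -> k := fun t => a t * b t.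
Definition char_opp a : 'M[k]_n -> k := fun t => (a t)^-1.

(* Tangent space at 1, cut out by the differentials at 1 of the polynomials
   vanishing on H. *)
Definition lie_algebra H : set 'M[k]_n :=
  [set X | forall p, (forall g, H g -> poly_at p g = 0) ->
     \sum_(i < n * n) poly_at p^`M(i) 1%:M * mxvec X 0 i = 0].

Definition roots H T : set ('M[k]_n -> k) :=
  [set a | [/\ character T a, exists2 t, T t & a t != 1
    & exists X, [/\ lie_algebra H X, X != 0
        & forall t, T t -> t *m X *m invmx t = a t *: X]]].

(* The positive roots are those of B. *)
Definition simple_roots B T : set ('M[k]_n -> k) :=
  [set a | roots B T a /\
     ~ exists b c, [/\ roots B T b, roots B T c & a = char_add b c]].

Definition weyl_group G T : set (set 'M[k]_n) :=
  [set lcoset d (centralizer G T) | d in normalizer G T].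

(* (w^-1 a)(t) = a (dw t dw^-1) for a representative dw of w.  As dw normalizes
   T, this function is again 0 outside T. *)
Definition weyl_inv_act (dw : 'M[k]_n) a : 'M[k]_n -> k :=
  fun t => a (dw *m t *m invmx dw).

Definition left_descents B T (dw : 'M[k]_n) : set ('M[k]_n -> k) :=
  [set a | simple_roots B T a /\ roots B T (char_opp (weyl_inv_act dw a))].

Definition is_root_subgroup G T a U : Prop :=
  [/\ algebraic_group U, U `<=` G
    & exists2 u : 'M[k]_2 -> 'M[k]_n, isomorphism (range (@ga k)) U u
      & forall t x, T t -> t *m u (ga x) *m invmx t = u (ga (a t * x))].

(* For a root a of a reductive G there is exactly one U in this union. *)
Definition root_subgroup G T a : set 'M[k]_n :=
  \bigcup_(U in [set U | is_root_subgroup G T a U]) U.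

Definition standard_parabolic G B T (J : set ('M[k]_n -> k)) : set 'M[k]_n :=
  gen (B `|` \bigcup_(a in J) root_subgroup G T (char_opp a)).

(* P = L |x R_u(P) as algebraic groups: the projection P -> L with kernel
   R_u(P) is a morphism. *)
Definition levi_subgroup P L : Prop :=
  [/\ algebraic_group L, L `<=` P
    & exists pr, [/\ morphism P L pr, forall g, L g -> pr g = g
        & forall g, P g -> (pr g = 1%:M <-> unipotent_radical P g)]].

Definition flag_variety G B : set (set 'M[k]_n) := [set lcoset g B | g in G].

(* The Zariski topology of G / B is the quotient topology. *)
Definition flag_closed G B (Y : set (set 'M[k]_n)) : Prop :=
  Y `<=` flag_variety G B /\
  exists2 Z, zclosed Z & \bigcup_(C in Y) C = Z `&` G.

Definition schubert G B (dw : 'M[k]_n) : set (set 'M[k]_n) :=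
  smallest (flag_closed G B) [set lcoset (b *m dw) B | b in B].

Definition stabilizer L (x : set 'M[k]_n) : set 'M[k]_n :=
  [set l | L l /\ [set l *m g | g in x] = x].

End Tori.

(* Main.v *)
(* The stabilizer in L of the point gB is H = L n gBg^-1. Let P = LV be the standard parabolic
   subgroup, V its unipotent radical, and let chi be the character by which P acts on a line
   whose stabilizer in G is P. Some power of chi is a product of powers of diagonal entries,
   prod d_i^(a_i) on B with a orthogonal to all relations between the d_i, and the cocharacter
   dual to it gives a closed connected commutative subgroup La of B n L with dense torsion.
   Comparing sum a_i a_(sigma i) with sum a_i^2 shows that La fixes every point of P/B, and
   that it is central in L. As La centralizes H, Borel's fixed point theorem gives a conjugate
   B' of B that contains H and La. For s in La of large prime order the centralizer K of s in
   B' is connected, contains H, and lies in P: otherwise a quotient of eigenfunctions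
   would be a nonconstant function on a complete variety. Finally K fixes a point pB of P/B,
   and H lies in the Borel subgroup pr(p)(B n L)pr(p)^-1 of L, where pr : P -> L is the
   projection. No projective varieties are needed: completeness of G/B means
   that closed right-B-stable families of points of G have closed images. *)
Require Import Defs.
From Stdlib Require List.
From mathcomp Require Import all_boot all_order all_algebra.
From mathcomp Require Import perm closed_field.
From mathcomp Require Import ring.
From mathcomp Require Import mpoly.
From mathcomp Require Import boolp classical_sets topology.
Set Implicit Arguments.
Unset Strict Implicit.
Unset Printing Implicit Defensive.
Import GRing.Theory.
Local Open Scope classical_set_scope.
Local Open Scope ring_scope.

(** * Regular functions and the Zariski topology *)

(** The obstacle is that H may be disconnected, even finite, and a disconnected solvable group need
    not lie in a Borel subgroup, so the fixed point theorem cannot be applied to H itself. The torus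
    La serves to embed H into a group K that is connected and solvable; what remains is to keep K
    inside P. There chi is used twice. It is invariant under conjugation by P, which forces equality
    in the Cauchy-Schwarz inequality between a and its permutation. And an element s of B n L with
    diagonal z^(a_i) has eigenspaces from which the monomial prod d_i^(a_i) can be rebuilt as a
    product of determinants, now on the whole centralizer of s in G; comparing this character with
    chi gives the invariant quotient. Orthogonality of a to the relations is what makes z^(a_i) the
    diagonal of an element of B n L. Elements of finite order prime to the characteristic stand in
    for tori throughout: their centralizers are reached by averaging, so neither Jordan
    decomposition nor the structure theory of tori has to be developed. *)

Inductive pexp (k : Type) : Type :=
  | PC of k | PV of nat | PA of pexp k & pexp k | PM of pexp k & pexp k.

(** Variables are numbered independently of any dimension, so one expression can be evaluated on
    every [var]; and a syntax tree translates directly into a first-order term, as quantifier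
    elimination requires later. *)
Fixpoint peval (k : fieldType) (e : nat -> k) (p : pexp k) : k :=
  match p with
  | PC c => c
  | PV i => e i
  | PA p q => peval e p + peval e q
  | PM p q => peval e p * peval e q
  end.

(* A set of points together with finitely many coordinate functions: the
   regular functions are the polynomials in the coordinates. *)
Record var (k : fieldType) := Var {
  vsort :> Type;
  vdim : nat;
  vgen : vsort -> nat -> k;
  vgen0 : forall x i, (vdim <= i)%N -> vgen x i = 0 }.

Section Regular.
Variable k : fieldType.
Implicit Types X Y W : var k.

Definition reg X (f : X -> k) : Prop :=
  exists p, forall x, f x = peval (vgen x) p.

Lemma reg_eq X (f g : X -> k) : f =1 g -> reg f -> reg g.
Proof. by move=> fg [p fp]; exists p => x; rewrite -fg. Qed.

Lemma regC X (c : k) : reg (fun _ : X => c).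
Proof. by exists (PC c). Qed.

Lemma regV X i : reg (fun x : X => vgen x i).
Proof. by exists (PV k i). Qed.

Lemma regD X (f g : X -> k) : reg f -> reg g -> reg (fun x => f x + g x).
Proof. by move=> [p fp] [q gq]; exists (PA p q) => x; rewrite fp gq. Qed.

Lemma regM X (f g : X -> k) : reg f -> reg g -> reg (fun x => f x * g x).
Proof. by move=> [p fp] [q gq]; exists (PM p q) => x; rewrite fp gq. Qed.

Lemma regN X (f : X -> k) : reg f -> reg (fun x => - f x).
Proof.
by move=> rf; apply: reg_eq (regM (regC X (-1)) rf) => x; rewrite mulN1r.
Qed.

Lemma regB X (f g : X -> k) : reg f -> reg g -> reg (fun x => f x - g x).
Proof. by move=> rf rg; apply: regD => //; apply: regN. Qed.

Lemma regX X (f : X -> k) m : reg f -> reg (fun x => f x ^+ m).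
Proof.
move=> rf; elim: m => [|m IH]; first exact: regC.
by apply: reg_eq (regM rf IH) => x; rewrite exprS.
Qed.

Lemma reg_sum X I (r : seq I) (P : pred I) (f : I -> X -> k) :
  (forall i, P i -> reg (f i)) -> reg (fun x => \sum_(i <- r | P i) f i x).
Proof.
move=> rf; elim: r => [|i r IH].
  by apply: reg_eq (regC X 0) => x; rewrite big_nil.
case Pi: (P i); last by apply: reg_eq IH => x; rewrite big_cons Pi.
by apply: reg_eq (regD (rf i Pi) IH) => x; rewrite big_cons Pi.
Qed.

Lemma reg_prod X I (r : seq I) (P : pred I) (f : I -> X -> k) :
  (forall i, P i -> reg (f i)) -> reg (fun x => \prod_(i <- r | P i) f i x).
Proof.
move=> rf; elim: r => [|i r IH].
  by apply: reg_eq (regC X 1) => x; rewrite big_nil.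
case Pi: (P i); last by apply: reg_eq IH => x; rewrite big_cons Pi.
by apply: reg_eq (regM (rf i Pi) IH) => x; rewrite big_cons Pi.
Qed.

Definition regmap X Y (h : X -> Y) : Prop :=
  forall i, reg (fun x => vgen (h x) i).

Lemma reg_comp X Y (h : X -> Y) f : regmap h -> reg f -> reg (fun x => f (h x)).
Proof.
move=> rh [p fp]; apply: (@reg_eq _ (fun x => peval (vgen (h x)) p)) => [x|].
  by rewrite fp.
elim: p {fp} => [c|i|p IHp q IHq|p IHp q IHq] /=;
  [exact: regC|exact: rh|exact: regD|exact: regM].
Qed.

Lemma regmap_comp X Y W (g : Y -> W) (h : X -> Y) :
  regmap h -> regmap g -> regmap (fun x => g (h x)).
Proof. by move=> rh rg i; apply: (reg_comp rh (rg i)). Qed.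

Lemma regmap_id X : regmap (fun x : X => x).
Proof. by move=> i; apply: regV. Qed.

Lemma regmap_cst X Y (y : Y) : regmap (fun _ : X => y).
Proof. by move=> i; apply: regC. Qed.

Definition prodv_gen X Y (z : X * Y) i : k :=
  if (i < vdim X)%N then vgen z.1 i else vgen z.2 (i - vdim X).

Lemma prodv_gen0 X Y (z : X * Y) i :
  (vdim X + vdim Y <= i)%N -> prodv_gen z i = 0.
Proof.
case: z => x y le_i; rewrite /prodv_gen /= ltnNge (leq_trans (leq_addr _ _) le_i) /=.
by rewrite vgen0 // leq_subRL // (leq_trans (leq_addr _ _) le_i).
Qed.

Definition prodv X Y : var k := Var (@prodv_gen0 X Y).

Lemma regmap_fst X Y : regmap (fun z : prodv X Y => z.1).
Proof.
move=> i; case: (ltnP i (vdim X)) => ltiX.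
  by apply: reg_eq (regV _ i) => x; rewrite /= /prodv_gen ltiX.
by apply: reg_eq (regC _ 0) => x; rewrite vgen0.
Qed.

Lemma regmap_snd X Y : regmap (fun z : prodv X Y => z.2).
Proof.
move=> i; apply: reg_eq (regV (prodv X Y) (vdim X + i)) => x /=.
by rewrite /prodv_gen ltnNge leq_addr /= addKn.
Qed.

Lemma regmap_pair X Y W (f : W -> X) (g : W -> Y) :
  regmap f -> regmap g -> regmap (fun w => (f w, g w) : prodv X Y).
Proof. by move=> rf rg i; rewrite /= /prodv_gen; case: (i < vdim X)%N; [apply: rf|apply: rg]. Qed.

Definition A1_gen (x : k) i : k := if i is 0%N then x else 0.

Lemma A1_gen0 (x : k) i : (1 <= i)%N -> A1_gen x i = 0.
Proof. by case: i. Qed.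

Definition A1 : var k := Var A1_gen0.

Lemma reg_A1 X (f : X -> k) : regmap (f : X -> A1) <-> reg f.
Proof.
split=> [/(_ 0%N)|rf] //= [|i] //=; exact: regC.
Qed.

Lemma reg_idA1 : reg (fun x : A1 => x : k).
Proof. exact: (regV A1 0). Qed.

Definition avar_gen d (x : nat -> k) i : k := if (i < d)%N then x i else 0.

Lemma avar_gen0 d x i : (d <= i)%N -> avar_gen d x i = 0.
Proof. by rewrite /avar_gen ltnNge => ->. Qed.

Definition avar d : var k := Var (@avar_gen0 d).

Definition zc X (Z : set X) : Prop :=
  forall x, ~ Z x -> exists f, [/\ reg f, forall z, Z z -> f z = 0 & f x <> 0].

Definition cl X (Z : set X) : set X :=
  [set x | forall f, reg f -> (forall z, Z z -> f z = 0) -> f x = 0].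

Lemma zc_cl X (Z : set X) : zc (cl Z).
Proof.
move=> x /existsNP[f /not_implyP[rf /not_implyP[fZ fx]]].
by exists f; split=> // z; apply.
Qed.

Lemma sub_cl X (Z : set X) : Z `<=` cl Z.
Proof. by move=> x Zx f _; apply. Qed.

Lemma cl_sub X (Z W : set X) : zc W -> Z `<=` W -> cl Z `<=` W.
Proof.
move=> cW ZW x clx; apply: contrapT => /cW[f [rf fW]]; apply.
by apply: clx => // z /ZW /fW.
Qed.

Lemma cl_id X (Z : set X) : zc Z -> cl Z = Z.
Proof.
by move=> cZ; apply/seteqP; split; [exact: cl_sub|exact: sub_cl].
Qed.

Lemma cl_mono X (Z W : set X) : Z `<=` W -> cl Z `<=` cl W.
Proof. by move=> ZW; apply: cl_sub (@zc_cl _ _) (subset_trans ZW (@sub_cl _ _)). Qed.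

Lemma zc_eq0 X (f : X -> k) : reg f -> zc [set x | f x = 0].
Proof. by move=> rf x /= fx; exists f. Qed.

Lemma zc_forall X I (F : I -> set X) :
  (forall i, zc (F i)) -> zc [set x | forall i, F i x].
Proof.
move=> cF x /existsNP[i /cF[f [rf fF fx]]]; exists f; split=> // z Fz.
exact: fF.
Qed.

Lemma zc_impl X (Q : Prop) (F : set X) : zc F -> zc [set x | Q -> F x].
Proof. by move=> cF; apply: (@zc_forall _ Q (fun _ => F)). Qed.

Lemma zcI X (Z W : set X) : zc Z -> zc W -> zc (Z `&` W).
Proof.
move=> cZ cW x /not_andP[/cZ|/cW] [f [rf fZ fx]]; exists f; split=> // z [] *;
  exact: fZ.
Qed.

Lemma zcU X (Z W : set X) : zc Z -> zc W -> zc (Z `|` W).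
Proof.
move=> cZ cW x /not_orP[/cZ[f [rf fZ /eqP fx]] /cW[g [rg gW /eqP gx]]].
exists (fun x => f x * g x); split; first exact: regM.
  by move=> z [/fZ|/gW] ->; rewrite ?mul0r ?mulr0.
by apply/eqP; rewrite mulf_neq0.
Qed.

Lemma zc0 X : zc (set0 : set X).
Proof. by move=> x _; exists (fun=> 1); split=> //; [exact: regC|apply/eqP/oner_neq0]. Qed.

Lemma zc_preim X Y (h : X -> Y) (Z : set Y) :
  regmap h -> zc Z -> zc [set x | Z (h x)].
Proof.
move=> rh cZ x /cZ[f [rf fZ fx]]; exists (fun x => f (h x)); split=> //.
  exact: reg_comp.
by move=> z; apply: fZ.
Qed.

Lemma zc_bigU X (F : nat -> set X) m :
  (forall i, (i < m)%N -> zc (F i)) ->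
  zc [set x | exists2 i, (i < m)%N & F i x].
Proof.
elim: m => [|m IH] cF.
  by rewrite (_ : [set _ | _] = set0); [exact: zc0|apply/seteqP; split=> x //= []].
rewrite (_ : [set _ | _] = [set x | exists2 i, (i < m)%N & F i x] `|` F m).
  by apply: zcU; [apply: IH => i ltim; apply: cF; rewrite ltnS ltnW|exact: cF].
apply/seteqP; split=> x /=.
  case=> i; rewrite ltnS leq_eqVlt => /predU1P[->|ltim Fx]; first by right.
  by left; exists i.
by case=> [[i ltim Fx]|Fx]; [exists i => //; rewrite ltnS ltnW|exists m].
Qed.

Lemma cl_image X Y (h : X -> Y) (Z : set X) x :
  regmap h -> cl Z x -> cl (h @` Z) (h x).
Proof.
move=> rh clx f rf f0; apply: (clx (fun x => f (h x))); first exact: reg_comp.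
by move=> z Zz; apply: f0; exists z.
Qed.

(** The vanishing ideal is prime. Closedness is left out, so that images, products and generated
    groups can be irreducible before anything is known about their closures. *)
Definition irr X (Z : set X) : Prop :=
  (exists x, Z x) /\
  forall f g, reg f -> reg g -> (forall z, Z z -> f z * g z = 0) ->
    (forall z, Z z -> f z = 0) \/ (forall z, Z z -> g z = 0).

Lemma irr_cl X (Z : set X) : irr Z -> irr (cl Z).
Proof.
move=> [[x Zx] iZ]; split; first by exists x; exact: sub_cl.
move=> f g rf rg fg0; have [z Zz|f0|g0] := iZ f g rf rg.
- by apply: fg0; exact: sub_cl.
- by left=> z; apply.
- by right=> z; apply.
Qed.

Lemma irr_image X Y (h : X -> Y) (Z : set X) :
  regmap h -> irr Z -> irr (h @` Z).
Proof.
move=> rh [[x Zx] iZ]; split; first by exists (h x), x.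
move=> f g rf rg fg0.
have [z Zz|f0|g0] := iZ _ _ (reg_comp rh rf) (reg_comp rh rg).
- by apply: fg0; exists z.
- by left=> _ [z Zz <-]; apply: f0.
- by right=> _ [z Zz <-]; apply: g0.
Qed.

(** Slicing: for each [w] irreducibility of [Z] makes f(-,w) or g(-,w) vanish on [Z], so f(x1,w)
    g(x2,w) = 0 for all [w], and irreducibility of [W] excludes that both factors are nonzero
    somewhere. *)
Lemma irr_setX X Y (Z : set X) (W : set Y) :
  irr Z -> irr W -> irr [set z : prodv X Y | Z z.1 /\ W z.2].
Proof.
move=> [[x Zx] iZ] [[y Wy] iW]; split; first by exists (x, y).
move=> f g rf rg fg0; apply: contrapT => /not_orP[].
move=> /existsNP[[x1 y1] /not_implyP[[/= Zx1 Wy1] /eqP f1]].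
move=> /existsNP[[x2 y2] /not_implyP[[/= Zx2 Wy2] /eqP g1]].
have rfst y' (h : prodv X Y -> k) : reg h -> reg (fun x => h (x, y')).
  by apply: reg_comp; apply: regmap_pair; [exact: regmap_id|exact: regmap_cst].
have rsnd x' (h : prodv X Y -> k) : reg h -> reg (fun y => h (x', y)).
  by apply: reg_comp; apply: regmap_pair; [exact: regmap_cst|exact: regmap_id].
have [w Ww|f0|g0] := iW _ _ (rsnd x1 f rf) (rsnd x2 g rg).
- have [z Zz|f0|g0] := iZ _ _ (rfst w f rf) (rfst w g rg); first exact: fg0.
    by rewrite f0 ?mul0r.
  by rewrite g0 ?mulr0.
- by rewrite f0 ?eqxx in f1.
- by rewrite g0 ?eqxx in g1.
Qed.

Lemma irr_sub_setU X (Z A B : set X) : irr Z -> zc A -> zc B ->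
  Z `<=` A `|` B -> Z `<=` A \/ Z `<=` B.
Proof.
move=> [_ iZ] cA cB ZAB; apply: contrapT => /not_orP[].
move=> /existsNP[a /not_implyP[Za /cA[f [rf fA fa]]]].
move=> /existsNP[b /not_implyP[Zb /cB[g [rg gB gb]]]].
have [z /ZAB zAB|f0|g0] := iZ f g rf rg.
- by case: zAB => [/fA|/gB] ->; rewrite ?mul0r ?mulr0.
- by apply: fa; exact: f0.
- by apply: gb; exact: g0.
Qed.

Lemma irr_sub_bigU X (Z : set X) (F : nat -> set X) m : irr Z ->
  (forall i, (i < m)%N -> zc (F i)) ->
  Z `<=` [set x | exists2 i, (i < m)%N & F i x] ->
  exists2 i, (i < m)%N & Z `<=` F i.
Proof.
move=> iZ; elim: m => [|m IH] cF ZF.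
  by have [[x /ZF[]]] := iZ.
have [|||ZA|ZB] := @irr_sub_setU _ Z [set x | exists2 i, (i < m)%N & F i x] (F m) iZ.
- by apply: zc_bigU => i ltim; apply: cF; rewrite ltnS ltnW.
- exact: cF.
- move=> x /ZF[i]; rewrite ltnS leq_eqVlt => /predU1P[->|ltim Fx]; first by right.
  by left; exists i.
- case: (IH _ ZA) => [i ltim|i ltim ZFi]; first by apply: cF; rewrite ltnS ltnW.
  by exists i => //; rewrite ltnS ltnW.
- by exists m.
Qed.

(** The recurrent use of irreducibility: eigenvalues of a fixed matrix or roots of unity that depend
    regularly on a point of [Z] cannot vary. *)
Lemma irr_finite_values X (Z : set X) (f : X -> k) (s : seq k) : irr Z -> reg f ->
  (forall z, Z z -> f z \in s) -> exists c, forall z, Z z -> f z = c.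
Proof.
move=> iZ rf; elim: s => [|c s IH] fs.
  by have [[x /fs]] := iZ.
have [|||Zc|Zs] := @irr_sub_setU _ Z [set x | f x - c = 0]
    [set x | \prod_(a <- s) (f x - a) = 0] iZ.
- by apply: zc_eq0; apply: regB => //; exact: regC.
- apply: zc_eq0; apply: (@reg_prod X _ s predT (fun a x => f x - a)) => a _.
  by apply: regB => //; exact: regC.
- move=> z /fs; rewrite inE => /predU1P[fzc|fzs]; first by left; rewrite /= fzc subrr.
  by right; apply/eqP; rewrite (big_rem _ fzs) /= subrr mul0r.
- by exists c => z /Zc /eqP; rewrite subr_eq0 => /eqP.
apply: IH => z /Zs /= /eqP; rewrite prodf_seq_eq0 => /hasP[a as_] /=.
by rewrite subr_eq0 => /eqP ->.
Qed.

Lemma irr_open_dense X (Z : set X) (h : X -> k) : irr Z -> reg h ->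
  (exists2 z, Z z & h z <> 0) -> Z `<=` cl [set x | Z x /\ h x <> 0].
Proof.
move=> [_ iZ] rh [z0 Zz0 hz0] z Zz f rf f0.
have [x Zx|/(_ z Zz)|/(_ z0 Zz0)] // := iZ f h rf rh.
by have [->|/eqP hx] := eqVneq (h x) 0; rewrite ?mulr0 // f0 ?mul0r.
Qed.

Lemma irr_directed X (T : Type) (F : T -> set X) :
  (exists t : T, True) -> (forall t, irr (F t)) ->
  (forall s t, exists u, F s `<=` F u /\ F t `<=` F u) ->
  irr [set x | exists t, F t x].
Proof.
move=> [t0 _] iF dF; split; first by have [[x Fx] _] := iF t0; exists x, t0.
move=> f g rf rg fg0; apply: contrapT => /not_orP[].
move=> /existsNP[a /not_implyP[[s Fsa] fa]] /existsNP[b /not_implyP[[t Ftb] gb]].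
have [u [su tu]] := dF s t; have [_ iu] := iF u.
have [z Fz|f0|g0] := iu f g rf rg; first by apply: fg0; exists u.
- by apply: fa; apply: f0; apply: su.
- by apply: gb; apply: g0; apply: tu.
Qed.

End Regular.

(** * Noetherianity *)

Section Hilbert.
Variables (k : fieldType) (T : Type).
Implicit Types (f g t : T -> k) (M A I J : set (T -> k)).

Definition fadd f g : T -> k := fun x => f x + g x.
Definition fmul f g : T -> k := fun x => f x * g x.

(** Ideals, seen as sets of functions stable under the multipliers [M]. In the induction below [M]
    consists of the constants and some of the coordinates. *)
Definition msub M I : Prop :=
  [/\ I (fun=> 0), forall f g, I f -> I g -> I (fadd f g)
    & forall m f, M m -> I f -> I (fmul m f)].

(* Finite generation is phrased impredicatively, so that no coefficients have
   to be carried around: every submodule containing the list contains [I]. *)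
Definition noeth M A : Prop := forall I, msub M I -> I `<=` A ->
  exists s : seq (T -> k), (forall g, List.In g s -> I g) /\
    forall J, msub M J -> (forall g, List.In g s -> J g) -> I `<=` J.

Fixpoint polyd A t (d : nat) : set (T -> k) :=
  if d is d'.+1 then
    [set f | exists a g, [/\ A a, polyd A t d' g
       & f = fadd (fmul a (fun x => t x ^+ d')) g]]
  else [set f | f = fun=> 0].

Definition adjoin A t : set (T -> k) := [set f | exists d, polyd A t d f].

Variables (M A : set (T -> k)) (t : T -> k).
Hypothesis sA : msub M A.
Hypothesis M1 : M (fun=> -1).
Let M' : set (T -> k) := M `|` [set t].

Lemma polyd_msub d : msub M (polyd A t d).
Proof.
elim: d => [|d [p0 pD pM]] /=.
  split=> // [f g -> ->|m f _ ->]; apply/funext => x; rewrite /fadd /fmul ?addr0 //.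
  by rewrite mulr0.
case: sA => A0 AD AM; split.
- by exists (fun=> 0), (fun=> 0); split=> //; apply/funext => x; rewrite /fadd /fmul mul0r addr0.
- move=> f g [a [f' [Aa pf ->]]] [b [g' [Ab pg ->]]].
  exists (fadd a b), (fadd f' g'); split; [exact: AD|exact: pD|].
  by apply/funext => x; rewrite /fadd /fmul mulrDl addrACA.
- move=> m f Mm [a [f' [Aa pf ->]]]; exists (fmul m a), (fmul m f').
  split; [exact: AM|exact: pM|].
  by apply/funext => x; rewrite /fadd /fmul mulrDr mulrA.
Qed.

Lemma polydS d f : polyd A t d f -> polyd A t d.+1 f.
Proof.
move=> pf; case: sA => A0 _ _; exists (fun=> 0), f; split=> //.
by apply/funext => x; rewrite /fadd /fmul mul0r add0r.
Qed.

Lemma polyd_le d e f : (d <= e)%N -> polyd A t d f -> polyd A t e f.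
Proof. by move=> /subnKC <- pf; elim: (e - d)%N => [|m IH]; rewrite ?addn0 ?addnS //; apply: polydS. Qed.

Lemma polydX d f : polyd A t d f -> polyd A t d.+1 (fmul t f).
Proof.
elim: d f => [|d IH] f.
  move=> /= ->; rewrite (_ : fmul _ _ = fun=> 0); last by apply/funext=> x; rewrite /fmul mulr0.
  by case: (polyd_msub 1).
move=> [a [g [Aa pg ->]]]; exists a, (fmul t g); split=> //; first exact: IH.
by apply/funext => x; rewrite /fadd /fmul mulrDr exprS mulrCA.
Qed.

Lemma adjoin_msub : msub M' (adjoin A t).
Proof.
split; first by exists 0%N.
- move=> f g [d pf] [e pg]; exists (maxn d e); have [_ pD _] := polyd_msub (maxn d e).
  by apply: pD; [apply: polyd_le pf; exact: leq_maxl|apply: polyd_le pg; exact: leq_maxr].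
- move=> m f [Mm|->] [d pf]; last by exists d.+1; exact: polydX.
  by exists d; have [_ _ pM] := polyd_msub d; apply: pM.
Qed.

(** The function [t] may be algebraic over [A], so the degree of a function is not well defined;
    this collects the leading coefficients at degree [d] of all presentations of elements of [I]. *)
Definition lcoefs I d : set (T -> k) :=
  [set a | A a /\ exists2 g, polyd A t d g & I (fadd (fmul a (fun x => t x ^+ d)) g)].

Lemma lcoefs_msub I d : msub M' I -> msub M (lcoefs I d).
Proof.
case: sA => A0 AD AM [I0 ID IM]; have [p0 pD pM] := polyd_msub d; split.
- split=> //; exists (fun=> 0) => //.
  by rewrite (_ : fadd _ _ = fun=> 0) //; apply/funext => x; rewrite /fadd /fmul mul0r addr0.
- move=> a b [Aa [f pf If]] [Ab [g pg Ig]]; split; first exact: AD.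
  exists (fadd f g); first exact: pD.
  rewrite (_ : fadd _ _ = fadd (fadd (fmul a (fun x => t x ^+ d)) f)
     (fadd (fmul b (fun x => t x ^+ d)) g)); first exact: ID.
  by apply/funext => x; rewrite /fadd /fmul mulrDl addrACA.
- move=> m a Mm [Aa [f pf If]]; split; first exact: AM.
  exists (fmul m f); first exact: pM.
  rewrite (_ : fadd _ _ = fmul m (fadd (fmul a (fun x => t x ^+ d)) f)).
    by apply: IM => //; left.
  by apply/funext => x; rewrite /fadd /fmul mulrDr mulrA.
Qed.

Lemma lcoefsS I d : msub M' I -> lcoefs I d `<=` lcoefs I d.+1.
Proof.
move=> [I0 ID IM] a [Aa [f pf If]]; split=> //; exists (fmul t f); first exact: polydX.
rewrite (_ : fadd _ _ = fmul t (fadd (fmul a (fun x => t x ^+ d)) f)).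
  by apply: IM => //; right.
by apply/funext => x; rewrite /fadd /fmul mulrDr exprS mulrCA.
Qed.

Lemma lcoefs_le I d e : msub M' I -> (d <= e)%N -> lcoefs I d `<=` lcoefs I e.
Proof.
move=> sI /subnKC <-; elim: (e - d)%N => [|m IH]; rewrite ?addn0 ?addnS //.
exact: subset_trans IH (lcoefsS sI).
Qed.

(** Hilbert's basis theorem. The chosen elements of [I] have leading coefficients that generate
    [lcoefs I d] for every [d] up to [D], and [D] is so large that generators of the union of all
    [lcoefs I d] occur in degree [D]. *)
Lemma noeth_adjoin : noeth M A -> noeth M' (adjoin A t).
Proof.
move=> nA I sI IA.
have lift d : exists s : seq (T -> k), (forall g, List.In g s -> I g) /\
    forall J, msub M' J -> (forall g, List.In g s -> J g) ->
    lcoefs I d `<=` lcoefs (I `&` J) d.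
  have [s [sL sP]] := nA _ (lcoefs_msub d sI) (fun a => @proj1 _ _).
  have [u [uI uP]] : exists u : seq (T -> k), (forall g, List.In g u -> I g) /\
     forall J, (forall g, List.In g u -> J g) -> forall a, List.In a s -> lcoefs (I `&` J) d a.
    elim: s sL {sP} => [|a s IH] sL; first by exists [::].
    have [u [uI uP]] := IH (fun g gs => sL g (or_intror gs)).
    have [Aa [f pf If]] := sL a (or_introl erefl).
    exists (fadd (fmul a (fun x => t x ^+ d)) f :: u); split=> [g [<-|/uI]|J uJ b [<-|bs]] //.
      by split=> //; exists f => //; split=> //; apply: uJ; left.
    by apply: uP => // g gu; apply: uJ; right.
  exists u; split=> // J sJ uJ; apply: sP; last exact: uP.
  apply: lcoefs_msub; case: sI sJ => I0 ID IM [J0 JD JM]; split=> //.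
    by move=> f g [If Jf] [Ig Jg]; split; [exact: ID|exact: JD].
  by move=> m f Mm [If Jf]; split; [exact: IM|exact: JM].
pose Linf : set (T -> k) := [set a | exists d, lcoefs I d a].
have sLinf : msub M Linf.
  split; first by exists 0%N; case: (lcoefs_msub 0 sI).
  - move=> f g [d Ld] [e Le]; exists (maxn d e).
    have [_ LD _] := lcoefs_msub (maxn d e) sI.
    by apply: LD; [apply: lcoefs_le Ld|apply: lcoefs_le Le]; rewrite ?leq_maxl ?leq_maxr.
  - by move=> m f Mm [d Ld]; exists d; have [_ _ LM] := lcoefs_msub d sI; apply: LM.
have [s [sL sP]] := nA _ sLinf (fun a '(ex_intro d (conj Aa _)) => Aa).
have [D sD] : exists D, forall a, List.In a s -> lcoefs I D a.
  elim: s sL {sP} => [|a s IH] sL; first by exists 0%N.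
  have [D sD] := IH (fun g gs => sL g (or_intror gs)).
  have [d Ld] := sL a (or_introl erefl).
  exists (maxn d D) => b [<-|/sD bs]; first by apply: lcoefs_le Ld; rewrite ?leq_maxl.
  by apply: lcoefs_le bs; rewrite ?leq_maxr.
have [u [uI uP]] : exists u : seq (T -> k), (forall g, List.In g u -> I g) /\
    forall J, msub M' J -> (forall g, List.In g u -> J g) ->
    forall d, (d <= D)%N -> lcoefs I d `<=` lcoefs (I `&` J) d.
  elim: D {sD} => [|D [u [uI uP]]].
    have [u [uI uP]] := lift 0%N; exists u; split=> // J sJ uJ [|//] _.
    exact: uP.
  have [v [vI vP]] := lift D.+1; exists (u ++ v); split.
    by move=> g guv; have [/uI|/vI] := List.in_app_or _ _ _ guv.
  move=> J sJ uvJ d; rewrite leq_eqVlt => /predU1P[->|]; last first.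
    by apply: uP => // g gu; apply: uvJ; apply: List.in_or_app; left.
  by apply: vP => // g gu; apply: uvJ; apply: List.in_or_app; right.
exists u; split=> // J sJ uJ.
have sIJ : msub M' (I `&` J).
  case: sI sJ => I0 ID IM [J0 JD JM]; split=> //.
    by move=> f g [If Jf] [Ig Jg]; split; [exact: ID|exact: JD].
  by move=> m f Mm [If Jf]; split; [exact: IM|exact: JM].
have key d : lcoefs I d `<=` lcoefs (I `&` J) d.
  case: (leqP d D) => [|/ltnW leDd]; first exact: uP.
  apply: (@subset_trans _ Linf) => [a La|]; first by exists d.
  apply: sP; first exact: lcoefs_msub.
  by move=> a /sD La; apply: (lcoefs_le sIJ leDd); apply: uP.
move=> f If; have [d pf] := IA _ If.
elim: d f pf If => [|d IH] f pf If; first by rewrite pf; case: sJ.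
case: pf => a [g [Aa pg fE]].
(* Some element common to [I] and [J] has the same leading term as [f]; the difference lies in [I]
   and has a presentation of lower degree. *)
have [|_ [h ph [Ih Jh]]] := key d a; first by split=> //; exists g => //; rewrite -fE.
have [_ ID IM] := sI; have [_ JD JM] := sJ; have [_ pD pM] := polyd_msub d.
have -> : f = fadd (fadd g (fmul (fun=> -1) h)) (fadd (fmul a (fun x => t x ^+ d)) h).
  by rewrite fE; apply/funext => x; rewrite /fadd /fmul mulN1r addrCA addrNK addrC.
apply: (JD _ _ _ Jh); apply: IH; first by apply: pD => //; apply: pM.
have -> : fadd g (fmul (fun=> -1) h) =
    fadd f (fmul (fun=> -1) (fadd (fmul a (fun x => t x ^+ d)) h)).
  by rewrite fE; apply/funext => x; rewrite /fadd /fmul !mulN1r opprD addrACA subrr add0r.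
by apply: ID => //; apply: IM => //; left.
Qed.

End Hilbert.

Section Noether.
Variables (k : fieldType) (X : var k).

Fixpoint gens d : set (X -> k) :=
  if d is d'.+1 then gens d' `|` [set fun x => vgen x d'] else
  [set f | exists c, f = fun=> c].

Fixpoint polys d : set (X -> k) :=
  if d is d'.+1 then adjoin (polys d') (fun x => vgen x d') else
  [set f | exists c, f = fun=> c].

Lemma gensC d c : gens d (fun=> c).
Proof. by elim: d => [|d IH]; [exists c|left]. Qed.

Lemma polys_msub d : msub (gens d) (polys d).
Proof.
elim: d => [|d IH] /=; last exact: adjoin_msub.
split; first by exists 0.
- by move=> _ _ [c ->] [e ->]; exists (c + e).
- by move=> _ _ [c ->] [e ->]; exists (c * e).
Qed.

Lemma polys_noeth d : noeth (gens d) (polys d).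
Proof.
elim: d => [|d IH]; last first.
  by apply: noeth_adjoin IH; [exact: polys_msub|exact: gensC].
move=> I [I0 ID IM] IA.
have [[c [c0 Ic]]|/forallNP In] := pselect (exists c : k, c != 0 /\ I (fun=> c)).
  exists [:: fun=> c]; split=> [g [<-|]|J [J0 JD JM] Jc f /IA[e ->]] //.
  have -> : (fun _ : X => e) = fmul (fun=> e / c) (fun=> c).
    by apply/funext => x; rewrite /fmul divfK.
  by apply: JM; [exists (e / c)|apply: Jc; left].
exists [::]; split=> // J [J0 _ _] _ f If; have [e fe] := IA _ If.
suff e0 : e = 0 by rewrite fe e0.
by apply: contrapT => /eqP e0; apply: (In e); split; rewrite -?fe.
Qed.

Lemma reg_polys f : reg f -> polys (vdim X) f.
Proof.
have [_ pD pM] := polys_msub (vdim X).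
have p1 : polys (vdim X) (fun=> 1).
  elim: (vdim X) => [|d IH]; first by exists 1.
  exists 1%N, (fun=> 1), (fun=> 0); split=> //.
  by apply/funext => x; rewrite /fadd /fmul expr0 mulr1 addr0.
(* [polys] is known to be stable only under multiplication by generators. The extra factor [g] lets
   a product of expressions be multiplied in one generator at a time. *)
have key p g : polys (vdim X) g -> polys (vdim X) (fun x => peval (vgen x) p * g x).
  elim: p g => [c|i|p IHp q IHq|p IHp q IHq] g pg /=.
  - exact: (pM _ _ (gensC _ _) pg).
  - have [ltid|led] := ltnP i (vdim X).
      apply: (pM (fun x => vgen x i) _ _ pg).
      elim: (vdim X) ltid => // d IH; rewrite ltnS leq_eqVlt => /predU1P[->|ltid]; first by right.
      by left; apply: IH.
    have [p0 _ _] := polys_msub (vdim X).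
    by rewrite (_ : (fun _ => _) = fun=> 0) //; apply/funext => x; rewrite vgen0 ?mul0r.
  - rewrite (_ : (fun _ => _) = fadd (fun x => peval (vgen x) p * g x) (fun x => peval (vgen x) q * g x)).
      by apply: pD; [exact: IHp|exact: IHq].
    by apply/funext => x; rewrite /fadd mulrDl.
  - rewrite (_ : (fun _ => _) = fun x => peval (vgen x) p * (peval (vgen x) q * g x)).
      by apply: IHp; apply: IHq.
    by apply/funext => x; rewrite mulrA.
move=> [p fp]; have := key p _ p1; congr (polys _ _); apply/funext => x.
by rewrite mulr1 fp.
Qed.

Lemma reg_gens d f : gens d f -> reg f.
Proof.
elim: d f => [|d IH] f /=; first by case=> c ->; exact: regC.
by case=> [/IH//|->]; exact: regV.
Qed.

Lemma noeth_reg (I : set (X -> k)) : I `<=` @reg k X -> msub (@reg k X) I ->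
  exists s : seq (X -> k), (forall g, List.In g s -> I g) /\
    forall J, msub (@reg k X) J -> (forall g, List.In g s -> J g) -> I `<=` J.
Proof.
move=> Ir [I0 ID IM].
have [||s [sI sP]] := @polys_noeth (vdim X) I.
- by split=> // m f /reg_gens; apply: IM.
- by move=> f /Ir /reg_polys.
exists s; split=> // J [J0 JD JM] Js; apply: sP => //.
by split=> // m f /reg_gens; apply: JM.
Qed.

Lemma vanish_msub (Z : set X) : msub (@reg k X) [set f | reg f /\ forall z, Z z -> f z = 0].
Proof.
split=> [|f g [rf fZ] [rg gZ]|m f rm [rf fZ]].
- by split=> //; exact: regC.
- by split=> [|z Zz]; [exact: regD|rewrite /fadd fZ ?gZ ?addr0].
- by split=> [|z Zz]; [exact: regM|rewrite /fmul fZ ?mulr0].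
Qed.

Lemma zc_equations (Z : set X) : zc Z ->
  exists s : seq (pexp k), forall x, Z x <-> forall p, List.In p s -> peval (vgen x) p = 0.
Proof.
move=> cZ; have [|s [sI sP]] := @noeth_reg _ _ (vanish_msub Z); first by move=> f [].
have [u uP] : exists u : seq (pexp k), forall x,
    (forall f, List.In f s -> f x = 0) <-> (forall p, List.In p u -> peval (vgen x) p = 0).
  elim: s sI {sP} => [|f s IH] sI; first by exists [::].
  have [u uP] := IH (fun g gs => sI g (or_intror gs)).
  have [[p fp] _] := sI f (or_introl erefl).
  exists (p :: u) => x; split=> H.
    by move=> q [<-|qu]; [rewrite -fp; apply: H; left|apply: (uP x).1 => // g gs; apply: H; right].
  by move=> g [<-|gs]; [rewrite fp; apply: H; left|apply: (uP x).2 => // q qs; apply: H; right].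
exists u => x; split=> [Zx|/uP sx].
  by apply/uP => f /sI[_]; apply.
apply: contrapT => /cZ[f [rf fZ]]; apply.
apply: (sP [set f | f x = 0]) => //; split=> // [g h /= g0 h0|m g _ /= g0].
  by rewrite /fadd g0 h0 addr0.
by rewrite /fmul g0 mulr0.
Qed.

(** Descending chain condition. Along a strictly descending sequence the functions that vanish on
    some member form an ideal; its finitely many generators vanish on a common member [F N], so
    [F N] cannot be larger than [F N.+1]. *)
Lemma zmin (Q : set X -> Prop) : (exists2 Z, zc Z & Q Z) ->
  exists Z, [/\ zc Z, Q Z & forall Z', zc Z' -> Q Z' -> Z' `<=` Z -> Z' = Z].
Proof.
move=> [Z0 cZ0 QZ0]; apply: contrapT => nomin.
have step (Z : {Z | zc Z /\ Q Z}) :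
    exists Z' : {Z | zc Z /\ Q Z}, sval Z' `<=` sval Z /\ ~ sval Z `<=` sval Z'.
  case: Z => Z [cZ QZ] /=; apply: contrapT => no; apply: nomin; exists Z; split=> //.
  move=> Z' cZ' QZ' sub; apply/seteqP; split=> //; apply: contrapT => nsub.
  by apply: no; exists (exist _ Z' (conj cZ' QZ')).
have [nxt nxtP] := choice step.
pose F n := sval (iter n nxt (exist _ Z0 (conj cZ0 QZ0))).
have Fc n : zc (F n) by rewrite /F; case: (iter _ _ _) => Z [].
have Fle m n : (m <= n)%N -> F n `<=` F m.
  move=> /subnKC <-; elim: (n - m)%N => [|d IH]; rewrite ?addn0 // addnS.
  by apply: subset_trans IH; have [] := nxtP (iter (m + d) nxt (exist _ Z0 (conj cZ0 QZ0))).
pose I : set (X -> k) := [set f | reg f /\ exists n, forall z, F n z -> f z = 0].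
have [||s [sI sP]] := @noeth_reg I; first by move=> f [].
  split; first by split; [exact: regC|exists 0%N].
  - move=> f g [rf [m fm]] [rg [n gn]]; split; first exact: regD.
    exists (maxn m n) => z Fz; rewrite /fadd fm ?gn ?addr0 //; apply: Fle Fz;
      by rewrite ?leq_maxl ?leq_maxr.
  - move=> m f rm [rf [n fn]]; split; first exact: regM.
    by exists n => z Fz; rewrite /fmul fn ?mulr0.
have [N sN] : exists N, forall f, List.In f s -> reg f /\ forall z, F N z -> f z = 0.
  elim: s sI {sP} => [|f s IH] sI; first by exists 0%N.
  have [N sN] := IH (fun g gs => sI g (or_intror gs)).
  have [rf [m fm]] := sI f (or_introl erefl).
  exists (maxn m N) => g [<-|/sN[rg gN]]; split=> // z Fz; [apply: fm|apply: gN];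
    by apply: Fle Fz; rewrite ?leq_maxl ?leq_maxr.
have IN := sP _ (vanish_msub (F N)) sN.
have [_] := nxtP (iter N nxt (exist _ Z0 (conj cZ0 QZ0))); apply.
move=> z FNz; apply: contrapT => nz; have [f [rf fF]] := Fc N.+1 z nz; apply.
have [|_] := IN f; last exact.
by split=> //; exists N.+1.
Qed.

(** Noetherian induction: a minimal closed set without such a covering is nonempty and reducible,
    and the zero sets in it of two functions with product zero are smaller and cover it. *)
Lemma irr_decomp (Z : set X) : zc Z -> exists m (F : nat -> set X),
  (forall i, (i < m)%N -> [/\ zc (F i), irr (F i) & F i `<=` Z]) /\
  Z `<=` [set x | exists2 i, (i < m)%N & F i x].
Proof.
move=> cZ; apply: contrapT => nZ.
have [|{cZ nZ}Z [cZ nZ minZ]] := @zmin (fun Z => ~ exists m (F : nat -> set X),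
  (forall i, (i < m)%N -> [/\ zc (F i), irr (F i) & F i `<=` Z]) /\
  Z `<=` [set x | exists2 i, (i < m)%N & F i x]); first by exists Z.
apply: (nZ); have [iZ|niZ] := pselect (irr Z).
  by exists 1%N, (fun=> Z); split=> [i _|x Zx]; [split|exists 0%N].
have [Z0|/forallNP Z0] := pselect (exists x, Z x); last first.
  by exists 0%N, (fun=> Z); split=> // x /Z0.
have [f [g [rf rg fg0 [a Za fa] [b Zb gb]]]] : exists f g, [/\ reg f, reg g,
    forall z, Z z -> f z * g z = 0, exists2 a, Z a & f a <> 0 & exists2 b, Z b & g b <> 0].
  apply: contrapT => no; apply: niZ; split=> // f g rf rg fg0; apply: contrapT.
  move=> /not_orP[/existsNP[a /not_implyP[Za fa]] /existsNP[b /not_implyP[Zb gb]]].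
  by apply: no; exists f, g; split=> //; [exists a|exists b].
have sub h c : reg h -> Z c -> h c <> 0 -> exists m (F : nat -> set X),
    (forall i, (i < m)%N -> [/\ zc (F i), irr (F i) & F i `<=` Z]) /\
    Z `&` [set x | h x = 0] `<=` [set x | exists2 i, (i < m)%N & F i x].
  move=> rh Zc hc; apply: contrapT => no.
  have E : Z `&` [set x | h x = 0] = Z.
    apply: minZ => [||x []//]; first exact: zcI cZ (zc_eq0 rh).
    move=> [m [F [FP FZ]]].
    apply: no; exists m, F; split=> // i ltim; have [? ? FiZ] := FP _ ltim; split=> //.
    by apply: subset_trans FiZ _ => x [].
  by move: Zc; rewrite -E => -[].
have [m [F [FP FZ]]] := sub f a rf Za fa.
have [m' [F' [FP' FZ']]] := sub g b rg Zb gb.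
exists (m + m')%N, (fun i => if (i < m)%N then F i else F' (i - m)%N); split.
  move=> i ltim; case: (ltnP i m) => lim; first exact: FP.
  by apply: FP'; rewrite ltn_subLR.
move=> x Zx; have /eqP := fg0 x Zx; rewrite mulf_eq0 => /orP[/eqP fx|/eqP gx].
  by have [i ltim Fx] := FZ x (conj Zx fx); exists i; rewrite ?ltim ?ltn_addr.
have [i ltim Fx] := FZ' x (conj Zx gx).
by exists (m + i)%N; rewrite ?ltn_add2l // ltnNge leq_addr /= addKn.
Qed.

Lemma irr_dominant_part (W : var k) (h : X -> W) (S : set X) (Z : set W) :
  regmap h -> zc S -> irr Z -> Z `<=` cl (h @` S) ->
  exists F, [/\ zc F, irr F, F `<=` S & Z `<=` cl (h @` F)].
Proof.
move=> rh cS iZ ZS; have [m [F [FP FS]]] := irr_decomp cS.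
have [||i ltim Zi] := @irr_sub_bigU _ _ Z (fun i => cl (h @` F i)) m iZ.
- by move=> i _; exact: zc_cl.
- apply: subset_trans ZS _; apply: cl_sub; first by apply: zc_bigU => i _; exact: zc_cl.
  move=> _ [x /FS[i ltim Fx] <-]; exists i => //; apply: sub_cl; by exists x.
- by have [? ? ?] := FP _ ltim; exists (F i); split.
Qed.

End Noether.

(** * Finite projections *)

Section MatrixRegular.
Variables (k : fieldType) (X : var k).

Definition regm p q (h : X -> 'M[k]_(p, q)) : Prop :=
  forall i j, reg (fun x => h x i j).

Lemma regm_cst p q (A : 'M[k]_(p, q)) : regm (fun=> A).
Proof. by move=> i j; exact: regC. Qed.

Lemma regm_add p q (g h : X -> 'M[k]_(p, q)) :
  regm g -> regm h -> regm (fun x => g x + h x).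
Proof.
by move=> rg rh i j; apply: reg_eq (regD (rg i j) (rh i j)) => x; rewrite mxE.
Qed.

Lemma regm_sub p q (g h : X -> 'M[k]_(p, q)) :
  regm g -> regm h -> regm (fun x => g x - h x).
Proof.
by move=> rg rh i j; apply: reg_eq (regB (rg i j) (rh i j)) => x; rewrite !mxE.
Qed.

Lemma regm_mul p q r (g : X -> 'M[k]_(p, q)) (h : X -> 'M[k]_(q, r)) :
  regm g -> regm h -> regm (fun x => g x *m h x).
Proof.
move=> rg rh i j; apply: (@reg_eq _ _ (fun x => \sum_l g x i l * h x l j)).
  by move=> x; rewrite mxE.
by apply: reg_sum => l _; apply: regM.
Qed.

Lemma regm_scale p q (f : X -> k) (h : X -> 'M[k]_(p, q)) :
  reg f -> regm h -> regm (fun x => f x *: h x).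
Proof.
by move=> rf rh i j; apply: reg_eq (regM rf (rh i j)) => x; rewrite mxE.
Qed.

Lemma regm_sum p q I (r : seq I) (P : pred I) (h : I -> X -> 'M[k]_(p, q)) :
  (forall i, P i -> regm (h i)) -> regm (fun x => \sum_(i <- r | P i) h i x).
Proof.
move=> rh a b; apply: (@reg_eq _ _ (fun x => \sum_(i <- r | P i) h i x a b)).
  by move=> x; rewrite summxE.
by apply: reg_sum => i /rh; apply.
Qed.

Lemma regm_exp p (h : X -> 'M[k]_p) m : regm h -> regm (fun x => h x ^+ m).
Proof.
move=> rh; elim: m => [|m IH].
  by move=> i j; apply: reg_eq (regC X ((1%:M : 'M[k]_p) i j)).
by move=> i j; apply: reg_eq (regm_mul rh IH i j) => x; rewrite exprS.
Qed.

Lemma reg_det p (h : X -> 'M[k]_p) : regm h -> reg (fun x => \det (h x)).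
Proof.
by move=> rh; apply: reg_sum => s _; apply: regM (regC _ _) _; apply: reg_prod.
Qed.

Lemma regm_adj p (h : X -> 'M[k]_p) : regm h -> regm (fun x => \adj (h x)).
Proof.
move=> rh i j; apply: (@reg_eq _ _ (fun x => cofactor (h x) j i)) => [x|].
  by rewrite mxE.
apply: regM (regC _ _) _; apply: reg_det => a b.
by apply: reg_eq (rh (lift j a) (lift i b)) => x; rewrite !mxE.
Qed.

End MatrixRegular.

Section PolynomialForm.
Variables (k : fieldType) (X : var k).

Definition regp (P : X -> {poly k}) e : Prop :=
  (forall x, (size (P x) <= e)%N) /\ forall i, reg (fun x => (P x)`_i).

Lemma regpC f : reg f -> regp (fun x => (f x)%:P) 1.
Proof.
move=> rf; split=> [x|[|i]]; first exact: size_polyC_leq1.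
- by apply: reg_eq rf => x; rewrite coefC.
- by apply: reg_eq (regC X 0) => x; rewrite coefC.
Qed.

Lemma regpD P Q d e : regp P d -> regp Q e -> regp (fun x => P x + Q x) (maxn d e).
Proof.
move=> [sP rP] [sQ rQ]; split=> [x|i].
  rewrite (leq_trans (size_polyD _ _)) // geq_max.
  by rewrite (leq_trans (sP x)) ?leq_maxl // (leq_trans (sQ x)) ?leq_maxr.
by apply: reg_eq (regD (rP i) (rQ i)) => x; rewrite coefD.
Qed.

Lemma regpM P Q d e : regp P d -> regp Q e -> regp (fun x => P x * Q x) (d + e).
Proof.
move=> [sP rP] [sQ rQ]; split=> [x|i].
  by rewrite (leq_trans (size_polyMleq _ _)) // (leq_trans (leq_pred _)) // leq_add.
apply: (@reg_eq _ _ (fun x => \sum_(j < i.+1) (P x)`_j * (Q x)`_(i - j))).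
  by move=> x; rewrite coefM.
by apply: reg_sum => j _; apply: regM.
Qed.

Lemma polyrep (F : prodv X (A1 k) -> k) : reg F ->
  exists e P, regp P e /\ forall x t, F (x, t) = (P x).[t].
Proof.
case=> p Fp; suff [e [P [rP PE]]] : exists e P, regp P e /\
    forall x t, peval (vgen ((x, t) : prodv X (A1 k))) p = (P x).[t].
  by exists e, P; split=> // x t; rewrite Fp PE.
elim: p {Fp} => [c|i|p [d [P [rP PE]]] q [e [Q [rQ QE]]]|p [d [P [rP PE]]] q [e [Q [rQ QE]]]] /=.
- by exists 1%N, (fun=> c%:P); split=> [|x t]; [apply: regpC; exact: regC|rewrite hornerC].
- rewrite /prodv_gen; case: (ltnP i (vdim X)) => [ltiX|leXi] /=.
    exists 1%N, (fun x => (vgen x i)%:P); split=> [|x t]; first by apply: regpC; exact: regV.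
    by rewrite hornerC.
  case: (i - vdim X)%N => [|j] /=.
    exists 2%N, (fun=> 'X); split=> [|x t]; last by rewrite hornerX.
    by split=> [x|j]; [rewrite size_polyX|exact: regC].
  exists 1%N, (fun=> 0); split=> [|x t]; last by rewrite horner0.
  by split=> [x|l]; [rewrite size_poly0|exact: regC].
- by exists (maxn d e), (fun x => P x + Q x); split=> [|x t]; [exact: regpD|rewrite hornerD PE QE].
- by exists (d + e)%N, (fun x => P x * Q x); split=> [|x t]; [exact: regpM|rewrite hornerM PE QE].
Qed.

Lemma polyrep_reg P e : regp P e -> reg (fun z : prodv X (A1 k) => (P z.1).[z.2]).
Proof.
move=> [sP rP].
apply: (@reg_eq _ _ (fun z : prodv X (A1 k) => \sum_(i < e) (P z.1)`_i * (z.2 : k) ^+ i)).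
  by move=> z; rewrite (horner_coef_wide _ (sP z.1)).
apply: reg_sum => i _; apply: regM.
  exact: (reg_comp (@regmap_fst _ X (A1 k)) (rP i)).
by apply: regX; apply: (reg_comp (@regmap_snd _ X (A1 k)) (@reg_idA1 k)).
Qed.

End PolynomialForm.

Section Companion.
Variables (k : closedFieldType) (m : nat).
Implicit Types (p q : {poly k}).

Definition companion p : 'M[k]_m.+1 :=
  \matrix_(j, i) if i == ord_max then - p`_j else (j == i.+1 :> nat)%:R.

Lemma mul_companion p (v : 'rV[k]_m.+1) (i : 'I_m.+1) :
  (v *m companion p) 0 i =
  if i == ord_max then - \sum_(j < m.+1) p`_j * v 0 j else v 0 (inord i.+1).
Proof.
rewrite mxE; case: eqP => [->|/eqP ni].
  by rewrite -sumrN; apply: eq_bigr => j _; rewrite mxE eqxx mulrN mulrC.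
have ltim : (i.+1 < m.+1)%N.
  by rewrite ltn_neqAle ltn_ord andbT; apply: contraNneq ni => /succn_inj im; apply/eqP/val_inj.
rewrite (bigD1 (inord i.+1)) //= big1 ?addr0 => [|j nj].
  by rewrite mxE (negbTE ni) inordK // eqxx mulr1.
rewrite mxE (negbTE ni); case: eqP => [ji|_]; last by rewrite mulr0.
by case/eqP: nj; apply: val_inj; rewrite /= inordK.
Qed.

Lemma companion_root p t : (size p <= m.+2)%N -> p`_m.+1 = 1 -> root p t ->
  (\row_(i < m.+1) t ^+ i) *m companion p = t *: \row_(i < m.+1) t ^+ i.
Proof.
move=> sp p1 /rootP pt; apply/rowP => i; rewrite mul_companion !mxE.
case: eqP => [->|/eqP ni]; last first.
  rewrite inordK ?exprS //.
  by rewrite ltn_neqAle ltn_ord andbT; apply: contraNneq ni => /succn_inj im; apply/eqP/val_inj.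
rewrite -exprS; apply/eqP; rewrite -subr_eq0 -opprD oppr_eq0; apply/eqP.
rewrite -[RHS]pt (horner_coef_wide _ sp) [in RHS]big_ord_recr /= p1 mul1r; congr (_ + _).
by apply: eq_bigr => j _; rewrite mxE.
Qed.

Lemma root_companion p t (v : 'rV[k]_m.+1) : (size p <= m.+2)%N -> p`_m.+1 = 1 ->
  v != 0 -> v *m companion p = t *: v -> root p t.
Proof.
move=> sp p1 v0 vC.
have vi (i : 'I_m.+1) : v 0 i = t ^+ i * v 0 0.
  case: i; elim=> [|i IH] lti; first by rewrite mul1r; congr (v 0 _); exact: val_inj.
  have := congr1 (fun w : 'rV_m.+1 => w 0 (Ordinal (ltnW lti))) vC.
  rewrite /= mul_companion !mxE IH ifF; last by apply/eqP => /(congr1 val)/= im; rewrite im ltnn in lti.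
  by rewrite exprS -mulrA => <-; congr (v 0 _); apply: val_inj; rewrite /= inordK.
have v00 : v 0 0 != 0.
  by apply: contraNneq v0 => v00; apply/eqP/rowP => i; rewrite vi v00 mulr0 mxE.
have := congr1 (fun w : 'rV_m.+1 => w 0 ord_max) vC.
rewrite /= mul_companion eqxx !mxE vi /= mulrA -exprS => /eqP.
rewrite eq_sym -subr_eq0 opprK => /eqP E; apply/rootP/(mulIf v00).
rewrite mul0r -E (horner_coef_wide _ sp) big_ord_recr /= p1 mul1r mulrDl addrC.
congr (_ + _); rewrite mulr_suml; apply: eq_bigr => j _.
by rewrite (vi j) mulrA.
Qed.

Lemma horner_companion p q t : (size p <= m.+2)%N -> p`_m.+1 = 1 -> root p t ->
  (\row_(i < m.+1) t ^+ i) *m horner_mx (companion p) q = q.[t] *: \row_(i < m.+1) t ^+ i.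
Proof.
move=> sp p1 pt; elim/poly_ind: q => [|q c IH].
  by rewrite rmorph0 mulmx0 horner0 scale0r.
rewrite rmorphD rmorphM /= horner_mx_X horner_mx_C mulmxDr -mulmxE mulmxA IH.
by rewrite -scalemxAl companion_root // mul_mx_scalar scalerA -scalerDl hornerMXaddC.
Qed.

(** The determinant is the resultant of [p] and [q]: factoring [q] gives a product of determinants
    of [companion p - i%:M], and each eigenvalue of the companion matrix is a root of [p]. *)
Lemma det_companion p q : (size p <= m.+2)%N -> p`_m.+1 = 1 ->
  q != 0 -> \det (horner_mx (companion p) q) = 0 -> exists2 t, root p t & root q t.
Proof.
move=> sp p1 q0; have [rs qE] := closed_field_poly_normal q.
rewrite {1}qE linearZ /= rmorph_prod /= detZ => /eqP.
rewrite mulf_eq0 expf_eq0 /= lead_coef_eq0 (negbTE q0) /=.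
have detP (s : seq k) : \det (\prod_(i <- s) horner_mx (companion p) ('X - i%:P)) =
    \prod_(i <- s) \det (companion p - i%:M).
  elim: s => [|a s IH]; first by rewrite !big_nil det1.
  by rewrite !big_cons -mulmxE det_mulmx IH rmorphB /= horner_mx_X horner_mx_C.
rewrite detP prodf_seq_eq0 => /hasP[t trs /= /det0P[v v0 vt]].
exists t; last by rewrite qE rootZ ?lead_coef_eq0 // root_prod_XsubC.
apply: (root_companion sp p1 v0).
by move/eqP: vt; rewrite mulmxBr mul_mx_scalar subr_eq0 => /eqP.
Qed.

End Companion.

Section FiniteProjection.
Variable k : closedFieldType.
Implicit Types X Y : var k.

(** A finite projection is closed. If no point over [x0] lay in the closure, one function [G]
    vanishing on [N] would be nonzero at all points over [x0] that satisfy the equation [P]. The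
    resultant of [P] and [G] in the last variable vanishes on the projection of [N], hence at [x0],
    and gives a common root. *)
Lemma fin_monic X (N : set (prodv X (A1 k))) P e x0 : regp P e.+1 ->
  (forall x, (P x)`_e = 1) -> (forall z, N z -> (P z.1).[z.2] = 0) ->
  cl [set x | exists t, N (x, t)] x0 -> exists t, cl N (x0, t).
Proof.
case: e => [|m] rP P1 NP cx0.
  suff /eqP : (1 : k) = 0 by rewrite oner_eq0.
  apply: (cx0 _ (regC X 1)) => x [t /NP /=]; have [sP _] := rP.
  by rewrite (size1_polyC (sP x)) hornerC P1.
have [sP rPi] := rP.
apply: contrapT => /forallNP noclN.
have [G [rG GN Groot]] : exists G, [/\ reg G, forall z, N z -> G z = 0
    & forall t, root (P x0) t -> G (x0, t) != 0].
  have [rs PE] := closed_field_poly_normal (P x0).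
  suff [G [rG GN Gs]] : exists G, [/\ reg G, forall z, N z -> G z = 0
      & forall t, t \in rs -> G (x0, t) != 0].
    exists G; split=> // t; rewrite PE rootZ ?root_prod_XsubC; first exact: Gs.
    by rewrite lead_coef_eq0; apply/eqP => P0; move: (P1 x0); rewrite P0 coef0 => /eqP; rewrite eq_sym oner_eq0.
  elim: rs {PE} => [|r s [G [rG GN Gs]]].
    by exists (fun=> 0); split=> //; exact: regC.
  have [Gr|Gr] := eqVneq (G (x0, r)) 0; last first.
    by exists G; split=> // t; rewrite inE => /predU1P[->//|/Gs].
  have /existsNP[H /not_implyP[rH /not_implyP[HN /eqP Hr]]] := noclN r.
  have rs : r \notin s by apply/negP => /Gs; rewrite Gr eqxx.
  (* The correction does not change [G] at the roots in [s] and makes it nonzero at the new root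
     [r]. *)
  exists (fun z => G z + (\prod_(a <- s) ((z.2 : k) - a)) * H z); split.
  - apply: regD => //; apply: regM => //.
    apply: (@reg_prod _ (prodv X (A1 k)) _ s predT (fun a z => (z.2 : k) - a)) => a _; apply: regB.
      exact: (reg_comp (@regmap_snd _ X (A1 k)) (@reg_idA1 k)).
    exact: regC.
  - by move=> z Nz; rewrite GN ?HN // mulr0 addr0.
  - move=> t; rewrite inE => /predU1P[->|ts] /=.
      rewrite Gr add0r mulf_neq0 // prodf_seq_neq0.
      by apply/allP => a as_ /=; rewrite subr_eq0; apply: contraNneq rs => ->.
    by rewrite (big_rem _ ts) /= subrr !mul0r addr0; exact: Gs.
have [e [Q [[sQ rQ] GQ]]] := polyrep rG.
pose D x := \det (\sum_(i < e) (Q x)`_i *: companion m (P x) ^+ i).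
have DE x : D x = \det (horner_mx (companion m (P x)) (Q x)).
  congr (\det _); rewrite /horner_mx /horner_morph.
  rewrite (@horner_coef_wide _ e) ?(leq_trans (size_poly _ _)) //.
  by apply: eq_bigr => i _; rewrite coef_map /= -mul_scalar_mx.
have D0 : D x0 = 0.
  apply: cx0 => [|x [t Nxt]].
    apply: reg_det; apply: regm_sum => i _; apply: regm_scale => //.
    apply: regm_exp => a b; have [->|nb] := eqVneq b ord_max.
      by apply: reg_eq (regN (rPi a)) => x; rewrite mxE eqxx.
    by apply: reg_eq (regC X (a == b.+1 :> nat)%:R) => x; rewrite mxE (negbTE nb).
  rewrite DE; apply/eqP/det0P; exists (\row_(i < m.+1) t ^+ i).
    by apply/eqP => /rowP/(_ 0)/eqP; rewrite !mxE expr0 oner_eq0.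
  rewrite horner_companion ?P1 //; last by apply/rootP; exact: (NP _ Nxt).
  by rewrite -GQ GN // scale0r.
have Px0 : size (P x0) != 1%N.
  apply/eqP => /eqP/size_poly1P[c _ Pc]; move/eqP: (P1 x0).
  by rewrite Pc coefC /= eq_sym oner_eq0.
have [t0 rt0] := closed_rootP _ Px0.
have Q0 : Q x0 != 0.
  by apply/eqP => Q0; move: (Groot _ rt0); rewrite GQ Q0 horner0 eqxx.
rewrite DE in D0; have [t pt qt] := det_companion (sP x0) (P1 x0) Q0 D0.
by move: (Groot _ pt); rewrite GQ (rootP qt) eqxx.
Qed.

(** With leading coefficient [a], the product u = a t satisfies a monic equation [P'], obtained from
    a^m P(t) = 0. Over [x0] the value of [t] is recovered by dividing by [a x0]. *)
Lemma fin1 X (N : set (prodv X (A1 k))) P e x0 : regp P e.+1 ->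
  (P x0)`_e != 0 -> (forall z, N z -> (P z.1).[z.2] = 0) ->
  cl [set x | exists t, N (x, t)] x0 -> exists t, cl N (x0, t).
Proof.
case: e => [|m] [sP rP] Px0 NP cx0.
  have P00 : (P x0)`_0 = 0.
    apply: (cx0 _ (rP 0%N)) => x [t /NP /=].
    by rewrite {1}(size1_polyC (sP x)) hornerC.
  by rewrite P00 eqxx in Px0.
pose a x := (P x)`_m.+1; have ra : reg a := rP _.
pose N' : set (prodv X (A1 k)) := [set z | exists2 t, N (z.1, t) & z.2 = a z.1 * t].
pose P' x := \poly_(i < m.+2) (if i == m.+1 then 1 else (P x)`_i * a x ^+ (m - i)).
have [||| |u cu] := @fin_monic X N' P' m.+1 x0.
- split=> [x|i]; first exact: size_poly.
  apply: (@reg_eq _ _ (fun x => if (i < m.+2)%N then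
      if i == m.+1 then 1 else (P x)`_i * a x ^+ (m - i) else 0)).
    by move=> x; rewrite coef_poly.
  case: (i < m.+2)%N; last exact: regC.
  by case: (i == m.+1); [exact: regC|apply: regM (rP i) (regX _ ra)].
- by move=> x; rewrite coef_poly ltnSn eqxx.
- move=> [x u] /= [t /NP /= Pt ->].
  rewrite horner_poly; transitivity (a x ^+ m * (P x).[t]); last by rewrite Pt mulr0.
  rewrite (horner_coef_wide _ (sP x)) mulr_sumr.
  apply: eq_bigr => i _; case: eqP => [->|/eqP ni].
    by rewrite mul1r exprMn exprSr -mulrA.
  have leim : (i <= m)%N by rewrite -ltnS ltn_neqAle ni -ltnS ltn_ord.
  have -> : a x ^+ m = a x ^+ (m - i) * a x ^+ i by rewrite -exprD subnK.
  by rewrite exprMn; ring.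
- apply: cl_mono cx0 => x [t Nt]; by exists (a x * t), t.
exists (u / a x0) => F rF F0; have [e [Q [[sQ rQ] FQ]]] := polyrep rF.
pose Q' x := \poly_(i < e) ((Q x)`_i * a x ^+ (e - i)).
have rQ' : regp Q' e.
  split=> [x|i]; first exact: size_poly.
  apply: (@reg_eq _ _ (fun x => if (i < e)%N then (Q x)`_i * a x ^+ (e - i) else 0)).
    by move=> x; rewrite coef_poly.
  by case: (i < e)%N; [apply: regM (rQ i) (regX _ ra)|exact: regC].
have Q'E x t : (Q' x).[a x * t] = a x ^+ e * (Q x).[t].
  rewrite horner_poly (horner_coef_wide _ (sQ x)) mulr_sumr; apply: eq_bigr => i _.
  have -> : a x ^+ e = a x ^+ (e - i) * a x ^+ i by rewrite -exprD subnK // ltnW.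
  by rewrite exprMn; ring.
have : (Q' x0).[u] = 0.
  by apply: (cu _ (polyrep_reg rQ')) => -[x b] [t /= Nt ->]; rewrite Q'E -FQ F0 ?mulr0.
move/eqP; rewrite /= -{1}(divfK Px0 u) [_ * _]mulrC Q'E mulf_eq0 expf_eq0.
by rewrite (negbTE Px0) andbF /= FQ => /eqP.
Qed.

(** The leading coefficient has to be nonzero at [x0] only: the projections to come are finite near
    one point, not globally. *)
Definition algebraic_at (E : Type) X (N : set E) (e : E -> X) (x0 : X) (t : E -> k) :=
  exists d (P : X -> {poly k}), [/\ regp P d.+1, (P x0)`_d != 0
    & forall m, N m -> (P (e m)).[t m] = 0].

Lemma fin_lift (E : Type) (N : set E) d (t : nat -> E -> k) X (e : E -> X) x0 :
  cl (e @` N) x0 -> (forall i, (i < d)%N -> algebraic_at N e x0 (t i)) ->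
  exists X' (e' : E -> X') x' p, [/\ regmap p, (forall m, p (e' m) = e m), p x' = x0,
    cl (e' @` N) x' & forall i, (i < d)%N -> exists2 T, reg T & forall m, T (e' m) = t i m].
Proof.
move=> cx0; elim: d => [|d IH] at_.
  by exists X, e, x0, id; split=> //; exact: regmap_id.
have [|X' [e' [x' [p [rp pe px cx' tP]]]]] := IH.
  by move=> i ltid; apply: at_; rewrite ltnS ltnW.
have [c [P [[sP rP] Pc Pt]]] := at_ d (ltnSn d).
pose N' : set (prodv X' (A1 k)) := (fun m => (e' m, t d m)) @` N.
have [||||u cu] := @fin1 X' N' (P \o p) c x'.
- by split=> [x|i] /=; [exact: sP|apply: (reg_comp rp (rP i))].
- by rewrite /= px.
- by move=> _ [m Nm <-] /=; rewrite pe; apply: Pt.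
- by apply: cl_mono cx' => _ [m Nm <-]; exists (t d m), m.
exists (prodv X' (A1 k)), (fun m => (e' m, t d m)), (x', u), (fun z => p z.1); split=> //.
  exact: regmap_comp (@regmap_fst _ _ _) rp.
move=> i; rewrite ltnS leq_eqVlt => /predU1P[->|/tP[T rT TE]].
  exists (fun z : prodv X' (A1 k) => z.2 : k) => //.
  exact: (reg_comp (@regmap_snd _ X' (A1 k)) (@reg_idA1 k)).
by exists (fun z => T z.1) => //; apply: (reg_comp (@regmap_fst _ X' (A1 k)) rT).
Qed.

(* The points of [N] are the solutions in affine space of the equations of [N];
   this fails for instance for the set of all matrices with the coordinate
   [(\det A)^-1]. *)
Definition affine X (N : set X) : Prop := forall tau : avar k (vdim X),
  cl ((fun m => vgen m : avar k (vdim X)) @` N) tau ->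
  exists2 m, N m & forall i, vgen m i = vgen tau i.

Lemma peval_ext (e e' : nat -> k) p : e =1 e' -> peval e p = peval e' p.
Proof. by move=> ee'; elim: p => //= p -> q ->. Qed.

Lemma affine_vanish X (N : set X) (tau : avar k (vdim X)) : 
  (forall p, (forall m, N m -> peval (vgen m) p = 0) -> peval (vgen tau) p = 0) ->
  cl ((fun m => vgen m : avar k (vdim X)) @` N) tau.
Proof.
move=> H f [p fp] f0; rewrite fp; apply: H => m Nm.
rewrite -[RHS](f0 (vgen m)); last by exists m.
rewrite fp; apply: peval_ext => i /=; rewrite /avar_gen; case: ltnP => // led.
by rewrite vgen0.
Qed.

Lemma affine_peval X (N : set X) (tau : avar k (vdim X)) p :
  cl ((fun m => vgen m : avar k (vdim X)) @` N) tau ->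
  (forall m, N m -> peval (vgen m) p = 0) -> peval (vgen tau) p = 0.
Proof.
move=> ct p0; apply: (ct (fun x => peval (vgen x) p)); first by exists p.
move=> _ [m Nm <-]; rewrite -[RHS](p0 m Nm); apply: peval_ext => i /=.
by rewrite /avar_gen; case: ltnP => // led; rewrite vgen0.
Qed.

Lemma affine_closed X (M N : set X) : affine N -> zc M -> M `<=` N -> affine M.
Proof.
move=> aN cM MN tau ct.
have [m Nm mt] := aN tau (cl_mono (@image_subset _ _ _ _ _ MN) ct).
exists m => //; apply: contrapT => /cM[f [[p fp] fM]]; apply.
rewrite fp (peval_ext _ mt); apply: affine_peval ct _ => x Mx.
by rewrite -fp fM.
Qed.

Lemma affine_prod X Y (S : set X) (T : set Y) : affine S -> affine T ->
  affine [set z : prodv X Y | S z.1 /\ T z.2].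
Proof.
move=> aS aT tau ct.
have pe1 (z : X * Y) p : peval (vgen z.1) p =
    peval (vgen (z : prodv X Y)) ((fix sub p := match p with PC c => PC c
      | PV i => if (i < vdim X)%N then PV k i else PC 0
      | PA p q => PA (sub p) (sub q) | PM p q => PM (sub p) (sub q) end) p).
  elim: p => //= [i|p -> q ->|p -> q ->] //; case: ltnP => leX /=; last by rewrite vgen0.
  by rewrite /prodv_gen leX.
have pe2 (z : X * Y) p : peval (vgen z.2) p =
    peval (vgen (z : prodv X Y)) ((fix sub p := match p with PC c => PC c
      | PV i => PV k (vdim X + i)
      | PA p q => PA (sub p) (sub q) | PM p q => PM (sub p) (sub q) end) p).
  elim: p => //= [i|p -> q ->|p -> q ->] //.
  by rewrite /prodv_gen ltnNge leq_addr /= addKn.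
have [|s Ss sE] := aS tau.
  apply: affine_vanish => p p0.
  have := affine_peval ct (p := (fix sub p := match p with PC c => PC c
      | PV i => if (i < vdim X)%N then PV k i else PC 0
      | PA p q => PA (sub p) (sub q) | PM p q => PM (sub p) (sub q) end) p).
  move=> <- => [|z [Sz _]]; last by rewrite -pe1 p0.
  elim: p {p0} => //= [i|p -> q ->|p -> q ->] //; rewrite /avar_gen; case: ifP => //= ltX.
  by rewrite /avar_gen (leq_trans ltX) ?leq_addr.
have [|t Tt tE] := aT (fun i => tau (vdim X + i)%N).
  apply: affine_vanish => p p0.
  have := affine_peval ct (p := (fix sub p := match p with PC c => PC c
      | PV i => PV k (vdim X + i)
      | PA p q => PA (sub p) (sub q) | PM p q => PM (sub p) (sub q) end) p).
  move=> <- => [|z [_ Tz]]; last by rewrite -pe2 p0.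
  elim: p {p0} => //= [i|p -> q ->|p -> q ->] //; rewrite /avar_gen ltn_add2l.
  by [].
exists (s, t) => // i; rewrite /= /prodv_gen /=; case: ltnP => leX.
  by rewrite sE /= /avar_gen leX (leq_trans leX) ?leq_addr.
by rewrite tE /= /avar_gen subnKC // ltn_subLR.
Qed.

(** A map that is finite near [y0] is closed there, even after a product with any [W]; the parameter
    is carried along because completeness is a statement about families. [fin_lift] gives values for
    all coordinates over [y0], and affinity of [M] turns these values into a point. *)
Lemma fin_proj X W Y (M : set X) (N : set (prodv X W)) (e : X -> Y) y0 w0 :
  regmap e -> affine M -> zc N -> (forall z, N z -> M z.1) ->
  cl [set z : prodv Y W | exists2 m, N (m, z.2) & z.1 = e m] (y0, w0) ->
  (forall i, (i < vdim X)%N -> algebraic_at M e y0 (fun m => vgen m i)) ->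
  exists2 m, N (m, w0) & forall i, vgen (e m) i = vgen y0 i.
Proof.
move=> re aM cN NM cy0 alg.
pose eW (z : prodv X W) : prodv Y W := (e z.1, z.2).
have cy0' : cl (eW @` N) (y0, w0).
  by apply: cl_mono cy0 => -[y w] [m Nm /= ->]; exists (m, w).
have [|X' [e' [x' [p [rp pe px cx' tP]]]]] :=
  @fin_lift _ N (vdim X) (fun i z => vgen z.1 i) _ eW _ cy0'.
  move=> i /alg[d [P [[sP rP] Pd PM]]]; exists d, (fun z => P z.1); split=> //.
    split=> [z|j]; first exact: sP.
    exact: (reg_comp (@regmap_fst _ Y W) (rP j)).
  by move=> z /NM /PM.
have tP' i : exists T : X' -> k, reg T /\ forall z, T (e' z) = vgen z.1 i.
  case: (ltnP i (vdim X)) => [/tP[T rT TE]|led]; first by exists T.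
  by exists (fun=> 0); split=> [|z]; [exact: regC|rewrite vgen0].
have [T TP] := choice tP'.
have rT q : reg (fun x => peval (T^~ x) q).
  elim: q => /= [c|i|a IHa b IHb|a IHa b IHb]; [exact: regC|exact: (TP i).1|exact: regD|exact: regM].
have TE q z : peval (T^~ (e' z)) q = peval (vgen z.1) q.
  by apply: peval_ext => i; exact: (TP i).2.
pose tau : avar k (vdim X) := T^~ x'.
have tauE : vgen tau =1 T^~ x'.
  move=> i; rewrite /= /avar_gen; case: ltnP => // led; apply/esym.
  by apply: cx' => [|_ [m _ <-]]; [exact: (TP i).1|rewrite (TP i).2 vgen0].
have [|m Mm mE] := aM tau.
  apply: affine_vanish => q q0; rewrite (peval_ext _ tauE).
  apply: (cx' (fun x => peval (T^~ x) q)) => // _ [z /NM Mz <-].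
  by rewrite TE q0.
exists m; last first.
  move=> i; have [q qE] := re i.
  rewrite qE (peval_ext _ mE) (peval_ext _ tauE); apply/eqP; rewrite -subr_eq0; apply/eqP.
  have -> : vgen y0 i = vgen (p x').1 i by rewrite px.
  apply: (cx' (fun x => peval (T^~ x) q - vgen (p x).1 i)).
    by apply: regB => //; exact: (reg_comp rp (@regmap_fst _ Y W i)).
  by move=> _ [z _ <-]; rewrite TE pe -qE subrr.
apply: contrapT => /cN[f [[q fq] fN]]; apply.
pose U i x := if (i < vdim X)%N then T i x else vgen (p x).2 (i - vdim X).
have rU : reg (fun x => peval (U^~ x) q).
  elim: q {fq} => /= [c|i|a IHa b IHb|a IHa b IHb]; [exact: regC| |exact: regD|exact: regM].
  rewrite /U; case: (i < vdim X)%N; first exact: (TP i).1.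
  pose g (z : prodv Y W) := vgen z.2 (i - vdim X).
  by apply: (@reg_comp _ _ _ p g rp); exact: regmap_snd.
rewrite fq -[RHS](cx' _ rU) => [|_ [z Nz <-]].
  apply: peval_ext => i; rewrite /U /= /prodv_gen; case: ifP => lti /=.
    by rewrite mE tauE.
  by rewrite px.
rewrite -[RHS](fN z Nz) fq; apply: peval_ext => i; rewrite /U /= /prodv_gen.
by case: ifP => lti; rewrite ?(TP i).2 ?pe.
Qed.

End FiniteProjection.

(** * Constructibility of images *)

Section Chevalley.
Variable k : closedFieldType.
Implicit Types X Y : var k.

Fixpoint pterm (sh : nat) (p : pexp k) : GRing.term k :=
  match p with
  | PC c => GRing.Const c
  | PV i => GRing.Var k (sh + i)
  | PA p q => GRing.Add (pterm sh p) (pterm sh q)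
  | PM p q => GRing.Mul (pterm sh p) (pterm sh q)
  end.

Lemma pterm_rterm sh p : GRing.rterm (pterm sh p).
Proof. by elim: p => //= p -> q ->. Qed.

Lemma eval_pterm e sh p : GRing.eval e (pterm sh p) = peval (fun i => e`_(sh + i)) p.
Proof. by elim: p => //= p -> q ->. Qed.

Definition coords Y (y : Y) : seq k := mkseq (vgen y) (vdim Y).

Lemma nth_coords Y (y : Y) i : (coords y)`_i = vgen y i.
Proof.
have [ltid|led] := ltnP i (vdim Y); first by rewrite nth_mkseq.
by rewrite nth_default ?size_mkseq // vgen0.
Qed.

Lemma reg_eval Y (t : GRing.term k) : GRing.rterm t ->
  reg (fun y : Y => GRing.eval (coords y) t).
Proof.
elim: t => //=.
- by move=> i _; apply: reg_eq (regV Y i) => y; rewrite nth_coords.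
- by move=> c _; exact: regC.
- by move=> i _; exact: regC.
- by move=> t IHt u IHu /andP[/IHt rt /IHu ru]; exact: regD.
- by move=> t IHt /IHt rt; exact: regN.
- move=> t IHt i /IHt rt; elim: i => [|i IH]; first exact: regC.
  by apply: reg_eq (regD rt IH) => y; rewrite mulrS.
- by move=> t IHt u IHu /andP[/IHt rt /IHu ru]; exact: regM.
- by move=> t IHt i /IHt rt; exact: regX.
Qed.

Lemma irr_nonzeroM X (Z : set X) (f g : X -> k) : irr Z -> reg f -> reg g ->
  (exists2 z, Z z & f z <> 0) -> (exists2 z, Z z & g z <> 0) ->
  exists2 z, Z z & f z * g z <> 0.
Proof.
move=> [_ iZ] rf rg [a Za fa] [b Zb gb]; apply: contrapT => /forall2NP no.
have [z Zz|/(_ a Za)|/(_ b Zb)] // := iZ f g rf rg.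
by have [//|/contrapT] := no z.
Qed.

(** An equation either holds on all of [Z] or fails on a nonempty open part, and finitely many
    nonempty open parts of an irreducible set meet. *)
Lemma qf_generic Y (Z : set Y) (f : GRing.formula k) : irr Z ->
  GRing.qf_form f -> GRing.rformula f ->
  exists h b, [/\ reg h, exists2 z, Z z & h z <> 0
    & forall z, Z z -> h z <> 0 -> GRing.qf_eval (coords z) f = b].
Proof.
move=> iZ; have ex1 : exists2 z : Y, Z z & (1 : k) <> 0.
  by have [[z Zz] _] := iZ; exists z => //; apply/eqP; rewrite oner_eq0.
have comb (op : bool -> bool -> bool) f1 f2 :
    (exists h b, [/\ reg h, exists2 z, Z z & h z <> 0
      & forall z, Z z -> h z <> 0 -> GRing.qf_eval (coords z) f1 = b]) ->
    (exists h b, [/\ reg h, exists2 z, Z z & h z <> 0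
      & forall z, Z z -> h z <> 0 -> GRing.qf_eval (coords z) f2 = b]) ->
    exists h b, [/\ reg h, exists2 z, Z z & h z <> 0 & forall z, Z z -> h z <> 0 ->
      op (GRing.qf_eval (coords z) f1) (GRing.qf_eval (coords z) f2) = b].
  move=> [h1 [b1 [r1 e1 P1]]] [h2 [b2 [r2 e2 P2]]].
  exists (fun z => h1 z * h2 z), (op b1 b2); split; first exact: regM.
    exact: irr_nonzeroM.
  move=> z Zz /eqP; rewrite mulf_eq0 negb_or => /andP[/eqP h1z /eqP h2z].
  by rewrite P1 // P2.
elim: f => //=.
- by move=> b _ _; exists (fun=> 1), b; split=> //; exact: regC.
- move=> t u _ /andP[rt ru]; pose h (y : Y) := GRing.eval (coords y) t - GRing.eval (coords y) u.
  have rh : reg h by apply: regB; exact: reg_eval.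
  have [h0|/existsNP[z /not_implyP[Zz hz]]] := pselect (forall z, Z z -> h z = 0).
    exists (fun=> 1), true; split=> //; first exact: regC.
    by move=> z Zz _; rewrite -subr_eq0; apply/eqP; exact: h0.
  exists h, false; split=> //; first by exists z.
  by move=> y _ hy; rewrite -subr_eq0; apply/eqP.
- by move=> f1 IH1 f2 IH2 /andP[q1 q2] /andP[r1 r2]; apply: (comb andb); [exact: IH1|exact: IH2].
- by move=> f1 IH1 f2 IH2 /andP[q1 q2] /andP[r1 r2]; apply: (comb orb); [exact: IH1|exact: IH2].
- by move=> f1 IH1 f2 IH2 /andP[q1 q2] /andP[r1 r2]; apply: (comb implb); [exact: IH1|exact: IH2].
- move=> f1 IH1 q1 r1; have [h [b [rh eh hP]]] := IH1 q1 r1.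
  by exists h, (~~ b); split=> // z Zz hz; rewrite hP.
Qed.

Lemma formula_generic Y (Z : set Y) (f : GRing.formula k) : irr Z -> GRing.rformula f ->
  exists h, [/\ reg h, exists2 z, Z z & h z <> 0
    & (forall z, Z z -> h z <> 0 -> GRing.holds (coords z) f) \/
      (forall z, Z z -> h z <> 0 -> ~ GRing.holds (coords z) f)].
Proof.
move=> iZ rf; pose q := GRing.quantifier_elim (@ClosedFieldQE.ex_elim k) f.
have qP e := @GRing.quantifier_elim_rformP k _ (@ClosedFieldQE.wf_ex_elim k)
  (ClosedFieldQE.holds_ex_elim (@solve_monicpoly k)) e f rf.
have /andP[qf rq] := GRing.quantifier_elim_wf (@ClosedFieldQE.wf_ex_elim k) rf.
have [h [b [rh eh hP]]] := qf_generic iZ qf rq.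
exists h; split=> //; case: b hP => hP; [left|right] => z Zz hz.
  by apply/qP; exact: hP.
by move/qP; rewrite hP.
Qed.

(** Membership in the image is a first-order formula: its first [dY] variables are the coordinates
    of [y], the next [d] are bound and describe a point of [M]. By quantifier elimination its truth
    value is constant on a nonempty open part of the closure of the image. *)
Theorem chevalley X Y (M : set X) (e : X -> Y) : regmap e -> affine M -> irr M ->
  exists h, [/\ reg h, exists2 y, cl (e @` M) y & h y <> 0
    & forall y, cl (e @` M) y -> h y <> 0 -> exists2 m, M m & forall i, vgen (e m) i = vgen y i].
Proof.
move=> re aM iM; set d := vdim X; set dY := vdim Y.
have [s sP] := zc_equations (@zc_cl _ _ ((fun m => vgen m : avar k d) @` M)).
have [p pP] := choice re.
pose F1 := foldr (fun q f => GRing.And (GRing.Equal (pterm dY q) (GRing.Const 0)) f) (GRing.Bool true) s.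
pose F2 (r : seq nat) := foldr (fun i f => GRing.And (GRing.Equal (GRing.Var k i) (pterm dY (p i))) f) (GRing.Bool true) r.
pose F := foldr (@GRing.Exists k) (GRing.And F1 (F2 (iota 0 dY))) (iota dY d).
have rF : GRing.rformula F.
  rewrite /F; elim: (iota dY d) => //=.
  have -> : GRing.rformula F1 by rewrite /F1; elim: (s) => //= q u ->; rewrite pterm_rterm.
  by elim: (iota 0 dY) => //= i r ->; rewrite pterm_rterm.
have F1P u : GRing.holds u F1 <->
    forall q, List.In q s -> peval (fun i => u`_(dY + i)) q = 0.
  rewrite /F1; elim: (s) => [|q r IH] /=; first by split.
  rewrite eval_pterm; split=> [[q0 /IH rP] q' [<-|/rP]|qr] //.
  by split; [apply: qr; left|apply/IH => q' q'r; apply: qr; right].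
have F2P u r : GRing.holds u (F2 r) <->
    forall i, i \in r -> u`_i = peval (fun i => u`_(dY + i)) (p i).
  elim: r => [|i r IH] /=; first by split.
  rewrite eval_pterm; split=> [[i0 /IH rP] j|ir].
    by rewrite inE => /predU1P[->|/rP].
  by split; [apply: ir; rewrite mem_head|apply/IH => j jr; apply: ir; rewrite inE jr orbT].
have FP (y : Y) : GRing.holds (coords y) F <->
    exists2 m, M m & forall i, vgen (e m) i = vgen y i.
  split.
    move/GRing.foldExistsP => [u uy [/F1P u1 /F2P u2]].
    have u0 i : (d <= i)%N -> u`_(dY + i) = 0.
      move=> led; have := uy (dY + i)%N; rewrite nth_coords vgen0 ?leq_addr // => <- //.
      by rewrite !inE mem_iota leq_addr /= -leqNgt leq_add2l.
    pose tau : avar k d := fun i => u`_(dY + i).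
    have tauE : vgen tau =1 fun i => u`_(dY + i).
      by move=> i; rewrite /= /avar_gen; case: ltnP => // /u0.
    have [|m Mm mE] := aM tau.
      by apply/sP => q qs; rewrite (peval_ext _ tauE); exact: u1.
    exists m => // i; have [ltid|led] := ltnP i dY; last by rewrite !vgen0.
    rewrite pP (peval_ext _ mE) (peval_ext _ tauE) -u2 ?mem_iota //.
    by rewrite -nth_coords uy // !inE mem_iota negb_and -ltnNge ltid.
  move=> [m Mm mE]; apply/GRing.foldExistsP.
  pose u := mkseq (fun j => if (j < dY)%N then vgen y j else vgen m (j - dY)) (dY + d).
  have uE i : u`_(dY + i) = vgen m i.
    have [ltid|led] := ltnP i d.
      by rewrite nth_mkseq ?ltn_add2l // ltnNge leq_addr /= addKn.
    by rewrite nth_default ?size_mkseq ?leq_add2l // vgen0.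
  have uE' i : (i < dY)%N -> u`_i = vgen y i.
    by move=> lti; rewrite nth_mkseq ?lti // ltn_addr.
  exists u.
    move=> i; rewrite !inE mem_iota negb_and -ltnNge -leqNgt nth_coords => /orP[/uE'//|lei].
    rewrite nth_default ?size_mkseq // vgen0 //; exact: leq_trans (leq_addr _ _) lei.
  split.
    apply/F1P => q qs; rewrite (peval_ext _ uE).
    have := (sP (vgen m)).1 _ q qs; rewrite (@peval_ext _ _ (vgen m)).
      by apply; apply: sub_cl; exists m.
    by move=> i /=; rewrite /avar_gen; case: ltnP => // led; rewrite vgen0.
  apply/F2P => i; rewrite mem_iota /= add0n => ltid.
  by rewrite uE' // (peval_ext _ uE) -pP mE.
have iZ : irr (cl (e @` M)) by apply: irr_cl; exact: irr_image.
have [h [rh [z0 Zz0 hz0] hP]] := formula_generic iZ rF.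
exists h; split=> //; first by exists z0.
case: hP => hP; first by move=> y Zy hy; apply/FP; exact: hP.
(* The generic truth value cannot be false: [h] would vanish on the whole image, hence on its
   closure, which contains [z0]. *)
case: hz0; apply: Zz0 => // _ [m Mm <-]; apply: contrapT => hm.
by apply: (hP (e m)) => //; [apply: sub_cl; exists m|apply/FP; exists m].
Qed.

End Chevalley.

(** * The general linear group *)

Section GeneralLinear.
Variables (k : closedFieldType) (n : nat).

Definition gl_coords (A : 'M[k]_n) : seq k :=
  rcons [seq A p.1 p.2 | p <- enum {: 'I_n * 'I_n}] (\det A)^-1.

Lemma gl_gen0 (A : 'M[k]_n) i :
  (#|{: 'I_n * 'I_n}|.+1 <= i)%N -> (gl_coords A)`_i = 0.
Proof. by move=> le; rewrite nth_default // size_rcons size_map -cardT. Qed.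

(* As [0^-1 = 0], all matrices are points here; the invertible ones form a
   closed subset. *)
Definition glv : var k := Var gl_gen0.

Lemma reg_entry i j : reg (fun A : glv => (A : 'M[k]_n) i j).
Proof.
apply: reg_eq (regV glv (index (i, j) (enum {: 'I_n * 'I_n}))) => A /=.
rewrite nth_rcons size_map index_mem mem_enum /= (nth_map (i, j)) ?nth_index ?mem_enum //.
by rewrite index_mem mem_enum.
Qed.

Lemma reg_detV : reg (fun A : glv => (\det (A : 'M[k]_n))^-1).
Proof.
apply: reg_eq (regV glv #|{: 'I_n * 'I_n}|) => A /=.
by rewrite nth_rcons size_map -cardT ltnn eqxx.
Qed.

Lemma regm_id : regm (fun A : glv => A : 'M[k]_n).
Proof. by move=> i j; exact: reg_entry. Qed.

Lemma regmap_gl (X : var k) (h : X -> 'M[k]_n) : regm h ->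
  reg (fun x => (\det (h x))^-1) -> regmap (h : X -> glv).
Proof.
move=> rh rd i; have [lt|le] := ltnP i #|{: 'I_n * 'I_n}|; last first.
  move: le; rewrite leq_eqVlt => /predU1P[<-|lt].
    by apply: reg_eq rd => x /=; rewrite nth_rcons size_map -cardT ltnn eqxx.
  by apply: reg_eq (regC X 0) => x; rewrite vgen0.
have [p0 _] : exists p0 : 'I_n * 'I_n, True.
  by move: lt; case: (pickP {: 'I_n * 'I_n}) => [p0|/eq_card0 ->] //; exists p0.
apply: reg_eq (rh (nth p0 (enum {: 'I_n * 'I_n}) i).1 (nth p0 (enum {: 'I_n * 'I_n}) i).2) => x /=.
by rewrite nth_rcons size_map -cardT lt (nth_map p0) // -cardT.
Qed.

Lemma regmap_regm (X : var k) (h : X -> 'M[k]_n) : regmap (h : X -> glv) -> regm h.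
Proof. by move=> rh i j; exact: (reg_comp rh (reg_entry i j)). Qed.

Lemma regmap_detV (X : var k) (h : X -> 'M[k]_n) : regmap (h : X -> glv) ->
  reg (fun x => (\det (h x))^-1).
Proof. by move=> rh; exact: (reg_comp rh reg_detV). Qed.

Lemma glv_inj (A B : glv) : (forall i, vgen A i = vgen B i) -> A = B.
Proof.
move=> AB; apply/matrixP => i j.
have gE (C : glv) : vgen C (index (i, j) (enum {: 'I_n * 'I_n})) = (C : 'M[k]_n) i j.
  rewrite /= nth_rcons size_map index_mem mem_enum /= (nth_map (i, j)) ?nth_index ?mem_enum //.
  by rewrite index_mem mem_enum.
by have := AB (index (i, j) (enum {: 'I_n * 'I_n})); rewrite !gE.
Qed.

Definition units : set 'M[k]_n := [set g | g \in unitmx].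

Lemma units_det g : units g <-> \det g * (\det g)^-1 = 1.
Proof.
rewrite /units /= unitmxE unitfE; split=> [/divff//|d1].
by apply: contra_eq_neq d1 => ->; rewrite mul0r eq_sym oner_eq0.
Qed.

Lemma zc_units : zc (units : set glv).
Proof.
rewrite (_ : (units : set glv) = [set g : glv | \det (g : 'M[k]_n) * (\det (g : 'M[k]_n))^-1 - 1 = 0]).
  apply: zc_eq0; apply: regB (regC _ _); apply: regM reg_detV.
  by apply: reg_det; exact: regm_id.
by apply/seteqP; split=> g /=; [move/units_det => ->; rewrite subrr|move/eqP; rewrite subr_eq0 => /eqP/units_det].
Qed.

Lemma affine_units : affine (units : set glv).
Proof.
move=> tau ct; set N := #|{: 'I_n * 'I_n}| in tau ct *.
pose idx i j := index (i, j) (enum {: 'I_n * 'I_n}).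
have rM : regm (fun t : avar k N.+1 => \matrix_(i, j) vgen t (idx i j)).
  by move=> i j; apply: reg_eq (regV (avar k N.+1) (idx i j)) => x; rewrite mxE.
pose A : 'M[k]_n := \matrix_(i, j) vgen tau (idx i j).
have idxN i j : (idx i j < N)%N by rewrite /N cardE /idx index_mem mem_enum.
have gE (B : 'M[k]_n) i j : avar_gen N.+1 (vgen (B : glv)) (idx i j) = B i j.
  rewrite /avar_gen (leq_trans (idxN i j)) //= nth_rcons size_map -cardT idxN.
  by rewrite (nth_map (i, j)) ?nth_index ?mem_enum // -cardT.
have dA : \det A * vgen tau N = 1.
  apply/eqP; rewrite -subr_eq0; apply/eqP.
  apply: (ct (fun t : avar k N.+1 => \det (\matrix_(i, j) vgen t (idx i j)) * vgen t N - 1)).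
    by apply: regB (regC _ _); apply: regM (regV _ _); exact: reg_det.
  move=> _ [B /units_det Bu <-] /=.
  rewrite (_ : \matrix_(i, j) _ = B); last by apply/matrixP => i j; rewrite mxE gE.
  by rewrite /avar_gen ltnSn nth_rcons size_map -cardT ltnn eqxx Bu subrr.
have uA : units A.
  by rewrite /units /= unitmxE unitfE; apply: contra_eq_neq dA => ->; rewrite mul0r eq_sym oner_eq0.
exists (A : glv) => // i /=; rewrite /avar_gen; case: ltnP => [|le]; last by rewrite gl_gen0.
rewrite ltnS leq_eqVlt => /predU1P[->|lt]; rewrite nth_rcons size_map -cardT.
  rewrite ltnn eqxx; move/units_det: uA => uA; move: dA; rewrite /= /avar_gen ltnSn => dA.
  by apply: (@mulfI _ (\det A)); [apply: contra_eq_neq dA => ->; rewrite mul0r eq_sym oner_eq0|rewrite uA dA].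
rewrite lt; have [p0 _] : exists p0 : 'I_n * 'I_n, True.
  by move: lt; rewrite /N; case: (pickP {: 'I_n * 'I_n}) => [p0|/eq_card0 ->] //; exists p0.
rewrite (nth_map p0) -?cardT // mxE /= /avar_gen /idx -surjective_pairing index_uniq ?enum_uniq -?cardT //.
by rewrite ltnS ltnW.
Qed.

(** Unlike [invmx], this formula is regular on all matrices in the coordinates of [glv]. It sends
    noninvertible matrices to 0, so that [ginvM] holds without hypotheses. *)
Definition ginv (g : 'M[k]_n) : 'M[k]_n := (\det g)^-1 *: \adj g.

Lemma ginvE g : units g -> ginv g = invmx g.
Proof. by rewrite /units /= /ginv /invmx => ->. Qed.

Lemma mulVg g : units g -> ginv g *m g = 1%:M.
Proof. by move=> ug; rewrite ginvE // mulVmx. Qed.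

Lemma mulgV g : units g -> g *m ginv g = 1%:M.
Proof. by move=> ug; rewrite ginvE // mulmxV. Qed.

Lemma ginv_nonunit g : ~ units g -> ginv g = 0.
Proof.
rewrite /units /= /ginv unitmxE unitfE => /negP; rewrite negbK => /eqP ->.
by rewrite invr0 scale0r.
Qed.

Lemma unitsM g h : units (g *m h) <-> units g /\ units h.
Proof. by rewrite /units /= unitmx_mul; split=> [/andP|[-> ->]]. Qed.

Lemma units1 : units 1%:M.
Proof. exact: unitmx1. Qed.

Lemma unitsV g : units g -> units (ginv g).
Proof. by move=> ug; rewrite ginvE // /units /= unitmx_inv. Qed.

Lemma ginvM g h : ginv (g *m h) = ginv h *m ginv g.
Proof.
have [ug|ng] := pselect (units g); last first.
  by rewrite (ginv_nonunit ng) mulmx0 ginv_nonunit // => /unitsM[].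
have [uh|nh] := pselect (units h); last first.
  by rewrite (ginv_nonunit nh) mul0mx ginv_nonunit // => /unitsM[].
have ugh : units (g *m h) by apply/unitsM.
apply: (can_inj (mulmxK ugh)); rewrite mulVg // -mulmxA [_ *m (g *m _)]mulmxA mulVg //.
by rewrite mul1mx mulVg.
Qed.

Lemma ginvK g : units g -> ginv (ginv g) = g.
Proof. by move=> ug; rewrite [ginv g]ginvE // ginvE ?invmxK // /units /= unitmx_inv. Qed.

Lemma ginv1 : ginv 1%:M = 1%:M.
Proof. by rewrite ginvE ?invmx1 //; exact: units1. Qed.

Lemma det_ginv g : (\det (ginv g))^-1 = \det g.
Proof.
have [ug|ng] := pselect (units g); first by rewrite ginvE // det_inv invrK.
have dg : \det g = 0 by move: ng; rewrite /units /= unitmxE unitfE => /negP; rewrite negbK => /eqP.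
by rewrite (ginv_nonunit ng) dg -(scale0r g) detZ dg mulr0 invr0.
Qed.

Lemma rgM (X : var k) (g h : X -> 'M[k]_n) : regmap (g : X -> glv) -> regmap (h : X -> glv) ->
  regmap ((fun x => g x *m h x) : X -> glv).
Proof.
move=> rg rh; apply: regmap_gl; first by apply: regm_mul; exact: regmap_regm.
apply: (@reg_eq _ _ (fun x => (\det (g x))^-1 * (\det (h x))^-1)).
  by move=> x; rewrite det_mulmx invfM.
by apply: regM; exact: regmap_detV.
Qed.

Lemma rgV (X : var k) (g : X -> 'M[k]_n) : regmap (g : X -> glv) ->
  regmap ((fun x => ginv (g x)) : X -> glv).
Proof.
move=> rg; apply: regmap_gl.
  by apply: regm_scale (regmap_detV rg) (regm_adj (regmap_regm rg)).
apply: (@reg_eq _ _ (fun x => \det (g x))); first by move=> x; rewrite det_ginv.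
by apply: reg_det; exact: regmap_regm.
Qed.

Lemma rgX (X : var k) (g : X -> 'M[k]_n) m : regmap (g : X -> glv) ->
  regmap ((fun x => g x ^+ m) : X -> glv).
Proof.
move=> rg; elim: m => [|m IH] i.
  by apply: reg_eq (regmap_cst X ((1%:M : 'M[k]_n) : glv) i).
by apply: reg_eq (rgM rg IH i) => x; rewrite exprS.
Qed.

End GeneralLinear.

Ltac reg_tac := repeat first
  [ assumption | exact: regmap_cst | exact: regmap_id | exact: regmap_fst
  | exact: regmap_snd | exact: regC | apply: rgM | apply: rgV | apply: rgX
  | apply: regmap_pair ].

Section ClosureMore.
Variables (k : closedFieldType) (X : var k).

Lemma cl_setU (A B : set X) x : zc B -> cl (A `|` B) x -> ~ B x -> cl A x.
Proof.
move=> cB cAB /cB[g [rg gB gx]] f rf fA.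
have /eqP : f x * g x = 0.
  apply: (cAB (fun x => f x * g x)); first exact: regM.
  by move=> z [/fA|/gB] ->; rewrite ?mul0r ?mulr0.
by rewrite mulf_eq0 => /orP[/eqP//|/eqP].
Qed.

Lemma cl_open (A : set X) (h : X -> k) x : reg h -> cl A x -> h x <> 0 ->
  cl [set z | A z /\ h z <> 0] x.
Proof.
move=> rh cA hx f rf f0.
have /eqP : f x * h x = 0.
  apply: (cA (fun x => f x * h x)); first exact: regM.
  by move=> z Az; have [->|/eqP hz] := eqVneq (h z) 0; rewrite ?mulr0 // f0 ?mul0r.
by rewrite mulf_eq0 => /orP[/eqP//|/eqP].
Qed.

Lemma cl_stable (A : set X) (h : X -> X) : regmap h -> (forall x, A x -> A (h x)) ->
  forall x, cl A x -> cl A (h x).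
Proof.
move=> rh hA x cx; apply: cl_mono (cl_image rh cx) => _ [z Az <-]; exact: hA.
Qed.

End ClosureMore.

(** * Complete homogeneous spaces *)

Section Complete.
Variables (k : closedFieldType) (n : nat).
Implicit Types (S D R : set 'M[k]_n).

(* Completeness of the quotient of [S] by the right action of [D]. *)
Definition complete S D : Prop :=
  forall (W : var k) (Y : set (prodv (glv k n) W)), zc Y ->
    (forall x w, Y (x, w) -> S x) ->
    (forall x w d, D d -> Y (x, w) -> Y (x *m d, w)) ->
    zc [set w | exists x, Y (x, w)].

Lemma complete_sub S S' D : complete S D -> S' `<=` S -> complete S' D.
Proof. by move=> cSD S'S W Y cY YS YD; apply: cSD => // x w /YS /S'S. Qed.

Definition Tri : set 'M[k]_n := [set g | units g /\ is_trig_mx g].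

Definition el (a b : 'I_n) (v : k) : 'M[k]_n := 1%:M + v *: delta_mx a b.

Lemma mul_el (x : 'M[k]_n) a b v i j :
  (x *m el a b v) i j = x i j + v * x i a * (j == b)%:R.
Proof.
rewrite mulmxDr mulmx1 -scalemxAr !mxE; congr (_ + _); rewrite -mulrA; congr (_ * _).
rewrite (bigD1 a) //= big1 ?addr0 => [|l nl]; first by rewrite mxE eqxx.
by rewrite mxE (negbTE nl) mulr0.
Qed.

Lemma elE a b v i j : el a b v i j = (i == j)%:R + v * ((i == a) && (j == b))%:R.
Proof. by rewrite !mxE. Qed.

Lemma mul_elel a b v w : a != b -> el a b v *m el a b w = el a b (v + w).
Proof.
move=> ab; apply/matrixP => i j; rewrite mul_el !elE (negbTE ab) andbF mulr0 addr0.
by case: (i == a); case: (j == b); rewrite /=; ring.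
Qed.

Lemma el0 a b : el a b 0 = 1%:M.
Proof. by rewrite /el scale0r addr0. Qed.

Lemma units_el a b v : a != b -> units (el a b v).
Proof.
move=> ab; have : units (el a b v *m el a b (- v)).
  by rewrite mul_elel // subrr el0; exact: units1.
by case/unitsM.
Qed.

Lemma ginv_el a b v : a != b -> ginv (el a b v) = el a b (- v).
Proof.
move=> ab; apply: (can_inj (mulKmx (units_el v ab))).
by rewrite mulgV ?mul_elel ?subrr ?el0 //; exact: units_el.
Qed.

Lemma det_el (a b : 'I_n) v : (a < b)%N -> \det (el a b v) = 1.
Proof.
move=> ltab; rewrite -det_tr det_trig.
  rewrite big1 // => i _; rewrite mxE elE eqxx; case: (altP (i =P a)) => [->|_].
    by rewrite (_ : (a == b) = false) ?mulr0 ?addr0 //; apply/eqP => ab; rewrite ab ltnn in ltab.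
  by rewrite mulr0 addr0.
apply/is_trig_mxP => i j ltij; rewrite mxE elE (_ : (j == i) = false); last first.
  by apply/eqP => ji; rewrite ji ltnn in ltij.
case: eqP => [ja|_]; last by rewrite mulr0 addr0.
case: eqP => [ib|_]; last by rewrite mulr0 addr0.
by move: ltij; rewrite ja ib ltnNge ltnW.
Qed.

Definition swp (a b : 'I_n) : 'M[k]_n := tperm_mx a b.

Lemma mul_swp (x : 'M[k]_n) a b i j : (x *m swp a b) i j = x i (tperm a b j).
Proof. by rewrite -xcolE mxE. Qed.

Lemma swp_swp a b : swp a b *m swp a b = 1%:M.
Proof. by apply/matrixP => i j; rewrite mul_swp -[swp a b]mul1mx mul_swp tpermK. Qed.

Lemma units_swp a b : units (swp a b).
Proof. exact: unitmx_perm. Qed.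

Lemma ginv_swp a b : ginv (swp a b) = swp a b.
Proof.
apply: (can_inj (mulKmx (units_swp a b))).
by rewrite mulgV ?swp_swp //; exact: units_swp.
Qed.

(** For adjacent indices this is a minimal parabolic subgroup of the general linear group above the
    lower triangular [Tri]. *)
Definition Par (a b : 'I_n) : set 'M[k]_n := [set p | units p /\
  forall i j : 'I_n, (i < j)%N -> ~~ ((i == a) && (j == b)) -> p i j = 0].

Definition adjacent (ab : 'I_n * 'I_n) : Prop := ab.2 = ab.1.+1 :> nat.

Lemma adjacent_lt ab : adjacent ab -> (ab.1 < ab.2)%N.
Proof. by rewrite /adjacent => ->. Qed.

Lemma adjacent_neq ab : adjacent ab -> ab.1 != ab.2.
Proof. by move/adjacent_lt; apply: contraTneq => ->; rewrite ltnn. Qed.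

Lemma Par_Tri a b p d : adjacent (a, b) -> Par a b p -> Tri d -> Par a b (p *m d).
Proof.
move=> adj [up pP] [ud /is_trig_mxP dP]; split; first by apply/unitsM.
move=> i j ltij nab; rewrite mxE big1 // => l _.
have [lelj|ltjl] := ltnP l j; first by rewrite dP ?mulr0.
rewrite pP ?mul0r ?(leq_trans ltij) //; apply: contra nab => /andP[/eqP ia /eqP lb].
rewrite ia eqxx /=; apply/eqP/val_inj/eqP; rewrite /= eqn_leq -{1}lb ltjl /=.
by move: adj ltij; rewrite /adjacent /= => ->; rewrite ia.
Qed.

Lemma Par_el a b v : adjacent (a, b) -> Par a b (el a b v).
Proof.
move=> adj; split; first exact: units_el (adjacent_neq adj).
move=> i j ltij nab; rewrite elE (negbTE nab) mulr0 addr0.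
by case: eqP => // ij; rewrite ij ltnn in ltij.
Qed.

Lemma Par_swp a b : adjacent (a, b) -> Par a b (swp a b).
Proof.
move=> adj; split; first exact: units_swp.
move=> i j ltij nab; rewrite -[swp a b]mul1mx mul_swp mxE.
case: tpermP => [ja|jb|ja jb]; case: eqP => // E; move: nab ltij.
- by rewrite E ja ltnNge ltnW // (adjacent_lt adj).
- by rewrite E jb !eqxx.
- by rewrite E ltnn.
Qed.

(** The projective line of cosets of [Tri] in [Par a b]: an affine line parametrized by [el a b],
    and the point [swp a b] at infinity. *)
Lemma Par_decomp a b p : adjacent (a, b) -> Par a b p ->
  (exists u, Tri (p *m el a b u)) \/ Tri (p *m swp a b).
Proof.
move=> adj [up pP]; have ltab := adjacent_lt adj; have ab := adjacent_neq adj.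
have ltb (i : 'I_n) : (i < b)%N -> (i == a) || (i < a)%N.
  by move: adj; rewrite /adjacent /= => ->; rewrite ltnS leq_eqVlt.
have [paa|paa] := eqVneq (p a a) 0.
  right; split; first by apply/unitsM; split=> //; exact: units_swp.
  apply/is_trig_mxP => i j ltij; rewrite mul_swp; case: tpermP => [ja|jb|/eqP ja /eqP jb].
  - have ltia : (i < a)%N by rewrite -ja.
    apply: pP; first exact: ltn_trans ltia ltab.
    by apply/negP => /andP[/eqP ia _]; rewrite ia ltnn in ltia.
  - have ltib : (i < b)%N by rewrite -jb.
    case/orP: (ltb i ltib) => [/eqP ->//|ltia].
    by rewrite pP // (negbTE ab) andbF.
  - by rewrite pP // (negbTE jb) andbF.
left; exists (- p a b / p a a); split; first by apply/unitsM; split=> //; exact: units_el.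
apply/is_trig_mxP => i j ltij; rewrite mul_el.
have [jb|jb] := eqVneq j b; last by rewrite mulr0 addr0 pP // (negbTE jb) andbF.
have ltib : (i < b)%N by rewrite -jb.
rewrite mulr1; case/orP: (ltb i ltib) => [/eqP ->|ltia].
  by rewrite jb mulfVK // addrC addNr.
have pij : p i j = 0.
  by apply: pP => //; apply/negP => /andP[/eqP ia _]; rewrite ia ltnn in ltia.
have pia : p i a = 0 by apply: pP => //; rewrite (negbTE ab) andbF.
by rewrite pij pia mulr0 addr0.
Qed.

Section Step.
Variables (W : var k) (Y : set (prodv (glv k n) W)) (a b : 'I_n).
Hypotheses (adj : adjacent (a, b)) (cY : zc Y) (YU : forall x w, Y (x, w) -> units x).
Hypothesis YT : forall x w d, Tri d -> Y (x, w) -> Y (x *m d, w).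

Lemma el_swp_Tri v : v != 0 -> Tri (el a b (- v) *m swp a b *m el a b v^-1).
Proof.
move=> v0; have ab := adjacent_neq adj; have ltab := adjacent_lt adj.
split; first by apply/unitsM; split; [apply/unitsM; split|]; first [exact: units_el|exact: units_swp].
apply/is_trig_mxP => i j ltij; rewrite mul_el !mul_swp !elE tpermL eqxx andbT.
have [ja|ja] := eqVneq j a.
  rewrite ja tpermL (negbTE ab) mulr0 addr0 eqxx andbT.
  have ia : i == a = false by apply/eqP => ia; rewrite ia ja ltnn in ltij.
  have ib : i == b = false by apply/eqP => ib; move: ltij; rewrite ib ja ltnNge ltnW.
  by rewrite ia ib mulr0 addr0.
have [jb|jb] := eqVneq j b.
  have ib : i == b = false by apply/eqP => ib; rewrite ib jb ltnn in ltij.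
  rewrite jb tpermR ib (negbTE ab) andbF mulr0 addr0 add0r mulr1.
  by case: (i == a); rewrite ?mulr0 ?addr0 // mulr1 mulrN mulVf ?subrr.
rewrite tpermD 1?eq_sym // (negbTE jb) andbF mulr0 addr0 mulr0 addr0.
by case: eqP => // ij; rewrite ij ltnn in ltij.
Qed.

Definition pstep : set (prodv (glv k n) W) :=
  [set z | exists2 p, Par a b p & Y (z.1 *m ginv p, z.2)].

Lemma pstep_Tri x w d : Tri d -> pstep (x, w) -> pstep (x *m d, w).
Proof.
move=> Td [p Pp /= Yp]; exists (p *m d); first exact: Par_Tri.
by rewrite /= ginvM mulmxA -[x *m d *m _]mulmxA mulgV ?mulmx1 //; case: Td.
Qed.

Lemma pstep_units x w : pstep (x, w) -> units x.
Proof. by case=> p _ /= /YU /unitsM[]. Qed.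

Lemma pstepE : pstep = [set z | exists v, Y (z.1 *m el a b v, z.2)] `|`
  [set z | Y (z.1 *m swp a b, z.2)].
Proof.
have ab := adjacent_neq adj.
apply/seteqP; split=> -[x w] /=.
  move=> [p Pp /= Yp]; have [up _] := Pp.
  case: (Par_decomp adj Pp) => [[u Tu]|Ts]; [left; exists u|right].
    have := YT Tu Yp; rewrite mulmxA -[_ *m ginv p *m p]mulmxA mulVg // mulmx1 //.
  by have := YT Ts Yp; rewrite mulmxA -[_ *m ginv p *m p]mulmxA mulVg // mulmx1.
case=> [[v Yv]|Ys].
  by exists (el a b (- v)); [exact: Par_el|rewrite /= ginv_el // opprK].
by exists (swp a b); [exact: Par_swp|rewrite /= ginv_swp].
Qed.

Lemma regmap_el (X : var k) (g : X -> 'M[k]_n) : regmap (g : X -> glv k n) ->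
  regmap ((fun z => g z.1 *m el a b z.2) : prodv X (A1 k) -> glv k n).
Proof.
move=> rg; apply: rgM; first exact: (regmap_comp (@regmap_fst _ X (A1 k)) rg).
apply: regmap_gl => [i j|].
  apply: (@reg_eq _ _ (fun z : prodv X (A1 k) => (i == j)%:R + (z.2 : k) * ((i == a) && (j == b))%:R)).
    by move=> z; rewrite elE.
  apply: regD (regC _ _) _; apply: regM (regC _ _).
  exact: (reg_comp (@regmap_snd _ X (A1 k)) (@reg_idA1 k)).
by apply: reg_eq (regC _ 1) => z; rewrite det_el ?invr1 //; exact: adjacent_lt adj.
Qed.

(** Completeness of the projective line by hand. If the point at infinity over [(x, w)] is outside
    [Y], a function [F] separates it from [Y]. The finite points over [(x, w)] then satisfy a
    polynomial equation whose leading coefficient is a value of [F] at infinity, and the projection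
    is finite there. *)
Lemma pstep_zc : zc pstep.
Proof.
suff <- : cl pstep = pstep by exact: zc_cl.
apply/seteqP; split; last exact: sub_cl.
have ab := adjacent_neq adj.
move=> [x w]; rewrite {1 2}pstepE => cz.
have rs : regmap (fun z : prodv (glv k n) W => (z.1 *m swp a b, z.2) : prodv (glv k n) W).
  by reg_tac.
have cB : zc [set z : prodv (glv k n) W | Y (z.1 *m swp a b, z.2)] := zc_preim rs cY.
have [?|nB] := pselect (Y (x *m swp a b, w)); first by right.
left; have [F [rF FY F0]] := cY nB.
pose X := prodv (glv k n) W.
pose N : set (prodv X (A1 k)) := [set z | Y (z.1.1 *m el a b z.2, z.1.2)].
have rN (g : X -> 'M[k]_n) : regmap (g : X -> glv k n) ->
    regmap (fun z : prodv X (A1 k) => (g z.1 *m el a b z.2, z.1.2) : X).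
  move=> rg; apply: regmap_pair; first exact: regmap_el.
  exact: (regmap_comp (@regmap_fst _ X (A1 k)) (@regmap_snd _ (glv k n) W)).
have cN : zc N by apply: (zc_preim (rN (fun z => z.1) (@regmap_fst _ _ _)) cY).
have rs1 : regmap ((fun z => z.1 *m swp a b) : X -> glv k n) by reg_tac.
have [e [Q [[sQ rQ] QE]]] := polyrep (reg_comp (rN _ rs1) rF).
have Q0 : (Q (x, w))`_0 != 0.
  have := QE (x, w) 0; rewrite /= el0 mulmx1 horner_coef0 => <-; exact/eqP.
(* This is v^e Q(1/v): by [el_swp_Tri] the points [el a b v] and [swp a b *m el a b v^-1] agree
   modulo [Tri]. Its top coefficient is Q(0), the value of [F] at infinity, and its constant
   coefficient 0 takes care of v = 0. *)
pose P z := \poly_(i < e.+1) (if i == 0%N then 0 else (Q z)`_(e - i)).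
have e0 : (0 < e)%N.
  rewrite lt0n; apply: contraNneq Q0 => e0; have := sQ (x, w).
  by rewrite e0 size_poly_leq0 => /eqP ->; rewrite coef0.
have [||||v cv] := @fin1 k X N P e (x, w).
- split=> [z|i]; first exact: size_poly.
  apply: (@reg_eq _ _ (fun z => if (i < e.+1)%N then if i == 0%N then 0 else (Q z)`_(e - i) else 0)).
    by move=> z; rewrite coef_poly.
  case: (i < e.+1)%N; last exact: regC.
  by case: (i == 0%N); [exact: regC|exact: rQ].
- by rewrite coef_poly ltnSn gtn_eqF // subnn.
- move=> [[y u] v] /= Nv; have [->|v0] := eqVneq v 0.
    by rewrite horner_coef0 coef_poly.
  have Qv : (Q (y, u)).[v^-1] = 0.
    rewrite -QE /=; apply: FY.
    have := YT (el_swp_Tri v0) Nv; congr Y; congr pair.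
    by rewrite -!mulmxA; congr (_ *m _); rewrite !mulmxA mul_elel // subrr el0 mul1mx.
  rewrite horner_poly; transitivity (v ^+ e * (Q (y, u)).[v^-1]); last by rewrite Qv mulr0.
  rewrite (horner_coef_wide _ (sQ _)) mulr_sumr big_ord_recl /= mul0r add0r.
  rewrite (reindex_inj rev_ord_inj) /=; apply: eq_bigr => i _; rewrite /= /bump /= add1n.
  have lie := ltn_ord i; rewrite -subSn // subSS subKn 1?ltnW // exprVn.
  have -> : v ^+ e = v ^+ (e - i) * v ^+ i by rewrite -exprD subnK // ltnW.
  by rewrite mulrCA mulfK // expf_neq0.
- by apply: cl_setU cz nB.
by exists v; move: cv; rewrite (cl_id cN).
Qed.

End Step.

Fixpoint psteps (W : var k) (Y : set (prodv (glv k n) W)) (js : seq ('I_n * 'I_n)) :=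
  if js is ab :: js' then pstep (psteps Y js') ab.1 ab.2 else Y.

Lemma psteps_zc (W : var k) (Y : set (prodv (glv k n) W)) js :
  (forall ab, ab \in js -> adjacent ab) -> zc Y -> (forall x w, Y (x, w) -> units x) ->
  (forall x w d, Tri d -> Y (x, w) -> Y (x *m d, w)) ->
  [/\ zc (psteps Y js), forall x w, psteps Y js (x, w) -> units x
    & forall x w d, Tri d -> psteps Y js (x, w) -> psteps Y js (x *m d, w)].
Proof.
move=> adjs cY YU YT; elim: js adjs => [|[a b] js IH] adjs //=.
have [|cY' YU' YT'] := IH; first by move=> ab abjs; apply: adjs; rewrite inE abjs orbT.
have adj : adjacent (a, b) by apply: adjs; rewrite mem_head.
split; [exact: pstep_zc|exact: pstep_units|exact: pstep_Tri].
Qed.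

Lemma psteps_ex (W : var k) (Y : set (prodv (glv k n) W)) js w :
  (exists x, psteps Y js (x, w)) -> exists x, Y (x, w).
Proof.
elim: js => //= ab js IH [x [p _ /= Yp]]; apply: IH.
by exists (x *m ginv p).
Qed.

Fixpoint reach (js : seq ('I_n * 'I_n)) (g : 'M[k]_n) : Prop :=
  if js is ab :: js' then exists2 p, Par ab.1 ab.2 p & reach js' (g *m ginv p) else Tri g.

Lemma reach_psteps (W : var k) (Y : set (prodv (glv k n) W)) js x w g :
  (forall x w d, Tri d -> Y (x, w) -> Y (x *m d, w)) ->
  Y (x, w) -> reach js g -> psteps Y js (x *m g, w).
Proof.
move=> YT Yx; elim: js g => [|ab js IH] g /=; first by move=> Tg; apply: YT.
by move=> [p Pp /IH rp]; exists p => //=; rewrite -mulmxA.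
Qed.

(** Column elimination, clearing the rows from the top and each row from the right. One list of
    steps serves all matrices, because a minimal parabolic contains both the shear and the swap
    needed when the pivot is zero. *)
Lemma reach_units : exists js, (forall ab, ab \in js -> adjacent ab) /\
  forall g, units g -> reach js g.
Proof.
pose good r c (g : 'M[k]_n) := units g /\ forall i j : 'I_n, (i < j)%N ->
  (i < r)%N || ((i == r :> nat) && (c <= j)%N) -> g i j = 0.
suff key r : (r <= n)%N -> exists js, (forall ab, ab \in js -> adjacent ab) /\
    forall g, good (n - r)%N n g -> reach js g.
  have [js [adj jsP]] := key n (leqnn n); exists js; split=> // g ug; apply: jsP.
  rewrite subnn; split=> // i j _; rewrite ltn0 /= => /andP[_]; by rewrite leqNgt ltn_ord.
elim: r => [|r IH] lern.
  exists [::]; split=> // g [ug gP]; split=> //; apply/is_trig_mxP => i j ltij.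
  by rewrite gP // subn0 ltn_ord.
have [js [adj jsP]] := IH (ltnW lern); set q := (n - r.+1)%N.
have qE : (n - r)%N = q.+1 by rewrite /q -subSn.
have ltqn : (q < n)%N by rewrite -qE leq_subr.
suff keyc c : (q + c < n)%N -> exists js, (forall ab, ab \in js -> adjacent ab) /\
    forall g, good q (q + c).+1 g -> reach js g.
  have [|js' [adj' jsP']] := keyc (n - q).-1; first by rewrite -ltnS -addnS prednK ?subn_gt0 // subnKC // ltnW.
  by exists js'; split=> // g gg; apply: jsP'; rewrite -addnS prednK ?subn_gt0 // subnKC // ltnW.
elim: c => [|c IHc] ltn.
  exists js; split=> // g [ug gP]; apply: jsP; split=> // i j ltij.
  rewrite qE addn0 in gP *; case/orP => [|/andP[_]]; last by rewrite leqNgt ltn_ord.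
  rewrite ltnS leq_eqVlt => /predU1P[iq|ltiq]; apply: gP => //; last by rewrite ltiq.
  by rewrite iq eqxx /= orbC -iq ltij.
have [|js' [adj' jsP']] := IHc; first by rewrite (leq_trans _ ltn) // addnS.
have ltan : (q + c < n)%N by rewrite (leq_trans _ ltn) // addnS.
pose a : 'I_n := Ordinal ltan; pose b : 'I_n := Ordinal ltn; pose ro : 'I_n := Ordinal ltqn.
have ab : adjacent (a, b) by rewrite /adjacent /= addnS.
exists ((a, b) :: js'); split=> [z|g [ug gP]]; first by rewrite inE => /predU1P[->//|/adj'].
have ltab := adjacent_lt ab; have nab := adjacent_neq ab.
have [ga|ga] := eqVneq (g ro a) 0.
  exists (swp a b); first exact: Par_swp.
  rewrite ginv_swp; apply: jsP'; split; first by apply/unitsM; split=> //; exact: units_swp.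
  move=> i j ltij /orP[ltiq|/andP[/eqP iq lej]]; rewrite mul_swp.
    case: tpermP => [ja|jb|_ _]; rewrite gP ?ltiq //=.
      by rewrite (ltn_trans ltiq) // addnS ltnS leq_addr.
    by rewrite (leq_trans ltiq) // leq_addr.
  have -> : i = ro by apply: val_inj.
  case: tpermP => [ja|jb|/eqP ja /eqP jb] //; first by rewrite ja /= ltnn in lej.
  rewrite gP ?eqxx ?orbT //=; first by rewrite -iq.
  suff -> : (q + c.+1 < j)%N by rewrite orbT.
  rewrite ltn_neqAle addnS lej andbT.
  by rewrite eq_sym; apply: contraNneq jb => jE; apply/eqP/val_inj; rewrite /= addnS.
exists (el a b (g ro b / g ro a)); first exact: Par_el.
rewrite ginv_el //; apply: jsP'; split; first by apply/unitsM; split=> //; exact: units_el.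
move=> i j ltij /orP[ltiq|/andP[/eqP iq lej]]; rewrite mul_el.
  rewrite gP ?ltiq // add0r; case: eqP => [jb|_]; last by rewrite mulr0.
  have gia : g i a = 0 by apply: gP; rewrite ?ltiq //= (leq_trans ltiq) // leq_addr.
  by rewrite gia mulr0 mul0r.
have -> : i = ro by apply: val_inj.
have [->|jb] := eqVneq j b; first by rewrite mulr1 mulNr divfK // subrr.
rewrite mulr0 addr0 gP ?eqxx //=; first by rewrite -iq.
suff -> : (q + c.+1 < j)%N by rewrite orbT.
rewrite ltn_neqAle addnS lej andbT.
by rewrite eq_sym; apply: contraNneq jb => jE; apply/eqP/val_inj; rewrite /= addnS.
Qed.

(** The steps of [reach_units] saturate a [Tri]-stable family to the whole group while keeping it
    closed, so a fibre is nonempty exactly if the saturated fibre contains the identity; this is a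
    closed condition on [w]. *)
Lemma complete_Tri : complete (@units k n) Tri.
Proof.
move=> W Y cY YU YT; have [js [adj jsP]] := reach_units.
have [cP _ _] := psteps_zc adj cY YU YT.
rewrite (_ : [set w | _] = [set w | psteps Y js (1%:M, w)]).
  apply: (zc_preim _ cP); apply: regmap_pair; [exact: regmap_cst|exact: regmap_id].
apply/seteqP; split=> w /=; last by move=> Yw; apply: (@psteps_ex W Y js); exists 1%:M.
move=> [x Yx]; have ux := YU _ _ Yx; rewrite -(mulgV ux).
by apply: reach_psteps => //; apply: jsP; exact: unitsV.
Qed.

End Complete.

(** * Closed orbits and completeness of stabilizer quotients *)

Section Subgroups.
Variables (k : closedFieldType) (n : nat).
Implicit Types (H R D S : set 'M[k]_n).

Lemma sgU H g : is_subgroup H -> H g -> units g.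
Proof. by case=> HU _ _ _ /HU. Qed.

Lemma sg1 H : is_subgroup H -> H 1%:M.
Proof. by case. Qed.

Lemma sgM H g h : is_subgroup H -> H g -> H h -> H (g *m h).
Proof. by case=> _ _ HM _; exact: HM. Qed.

Lemma sgV H g : is_subgroup H -> H g -> H (ginv g).
Proof. by move=> sH Hg; rewrite ginvE; [case: sH => _ _ _; apply|exact: sgU Hg]. Qed.

Lemma sgI H R : is_subgroup H -> is_subgroup R -> is_subgroup (H `&` R).
Proof.
move=> [HU H1 HM HV] [RU R1 RM RV]; split=> //; first by move=> g [/HU].
- by move=> g h [Hg Rg] [Hh Rh]; split; [exact: HM|exact: RM].
- by move=> g [Hg Rg]; split; [exact: HV|exact: RV].
Qed.

Lemma is_subgroup_ginv H : H `<=` @units k n -> H 1%:M ->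
  (forall g h, H g -> H h -> H (g *m h)) -> (forall g, H g -> H (ginv g)) ->
  is_subgroup H.
Proof. by move=> HU H1 HM HV; split=> // g Hg; rewrite -ginvE; [exact: HV|exact: HU]. Qed.

Lemma cl_pair (X W : var k) (A : set X) x (w : W) : cl A x ->
  cl [set z : prodv X W | A z.1 /\ z.2 = w] (x, w).
Proof.
have r : regmap (fun x : X => (x, w) : prodv X W).
  by apply: regmap_pair; [exact: regmap_id|exact: regmap_cst].
by move=> /(cl_image r); apply: cl_mono => _ [y Ay <-].
Qed.

Section Fix.
Variables (R D S : set 'M[k]_n).
Hypotheses (sR : is_subgroup R) (cR : zc (R : set (glv k n))) (iR : irr (R : set (glv k n))).
Hypotheses (sD : is_subgroup D) (cD : zc (D : set (glv k n))) (iD : irr (D : set (glv k n))).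
Hypotheses (cS : zc (S : set (glv k n))) (SU : S `<=` @units k n) (S0 : exists x, S x).
Hypothesis RSD : forall r s d, R r -> S s -> D d -> S (r *m s *m d).
Hypothesis coS : complete S D.

Let E := prodv (glv k n) (glv k n).
Let RD : set E := [set p | R p.1 /\ D p.2].
Let mu z (p : E) : glv k n := p.1 *m z *m p.2.

Lemma mu_reg z : regmap (mu z).
Proof. by rewrite /mu /=; reg_tac. Qed.

Lemma RD_affine M : zc M -> M `<=` RD -> affine M.
Proof.
move=> cM MRD; apply: (affine_closed (affine_prod (@affine_units k n) (@affine_units k n))) => //.
by move=> p /MRD[/(sgU sR) ? /(sgU sD) ?].
Qed.

Lemma RD_zc : zc RD.
Proof.
by apply: zcI; [apply: (zc_preim (@regmap_fst _ _ _) cR)|apply: (zc_preim (@regmap_snd _ _ _) cD)].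
Qed.

(** A minimal closed stable subset is the closure of each of its double cosets. By Chevalley's
    theorem the double coset of [z] contains an open part of it, which every other double coset
    meets by density. *)
Lemma closed_double_coset : exists z (Z : set (glv k n)), [/\ zc Z, Z `<=` S, Z z
  & forall y, Z y <-> exists r d, [/\ R r, D d & y = r *m z *m d]].
Proof.
pose stab (Z : set (glv k n)) := forall r s d, R r -> Z s -> D d -> Z (r *m s *m d).
have [|Z [cZ [Zst ZS [z Zz]] minZ]] := @zmin _ (glv k n)
  (fun Z => [/\ stab Z, Z `<=` S & exists x, Z x]); first by exists S => //; split.
have clO y : Z y -> cl (mu y @` RD) = Z.
  move=> Zy; apply: minZ; first exact: zc_cl.
    split.
    - move=> r s d Rr cs Dd.
      have rh : regmap ((fun x => r *m x *m d) : glv k n -> glv k n) by reg_tac.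
      apply: (cl_stable rh _ cs) => _ [[r' d'] [/= Rr' Dd'] <-].
      exists (r *m r', d' *m d); first by split; exact: sgM.
      by rewrite /mu /= !mulmxA.
    - apply: cl_sub => // _ [[r d] [/= Rr Dd] <-]; by apply: RSD => //; exact: ZS.
    - exists y; apply: sub_cl; exists (1%:M, 1%:M); first by split; exact: sg1.
      by rewrite /mu /= mul1mx mulmx1.
  by apply: cl_sub => // _ [[r d] [/= Rr Dd] <-]; exact: Zst.
have iRD : irr RD by exact: irr_setX.
exists z, Z; split=> // y; split; last by move=> [r [d [Rr Dd ->]]]; exact: Zst.
move=> Zy.
have [h [rh [y0 y0Z hy0] hP]] := chevalley (mu_reg z) (RD_affine RD_zc (fun _ => id)) iRD.
rewrite (clO z Zz) in y0Z hP.
have [r [d [Rr Dd hrd]]] : exists r d, [/\ R r, D d & h (r *m y *m d) <> 0].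
  apply: contrapT => no; apply: hy0; rewrite -(clO y Zy) in y0Z.
  apply: y0Z => // _ [[r d] [/= Rr Dd] <-]; apply: contrapT => hrd.
  by apply: no; exists r, d.
have [|[r' d'] [/= Rr' Dd'] /glv_inj E1] := hP (r *m y *m d) _ hrd; first exact: Zst.
exists (ginv r *m r'), (d' *m ginv d); split; [by apply: sgM => //; exact: sgV|by apply: sgM => //; exact: sgV|].
have -> : ginv r *m r' *m z *m (d' *m ginv d) = ginv r *m (r' *m z *m d') *m ginv d.
  by rewrite !mulmxA.
rewrite -[r' *m z *m d']/(mu z (r', d')) E1 !mulmxA mulVg ?mul1mx; last exact: sgU Rr.
by rewrite -mulmxA mulgV ?mulmx1 //; exact: sgU Dd.
Qed.

(** On a closed double coset the quotient of [R] by the stabilizer of a point inherits completeness.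
    The orbit map may be inseparable, so the two quotients cannot simply be identified; closed
    families are transported by a finite projection instead. *)
Lemma complete_fix : exists2 z, S z &
  complete R [set r | R r /\ D (ginv z *m r *m z)].
Proof.
have [z [Z [cZ ZS Zz ZE]]] := closed_double_coset.
have Uz : units z by apply/SU/ZS.
exists z; first exact: ZS.
have iRD : irr RD by exact: irr_setX.
have muRD : mu z @` RD = Z.
  apply/seteqP; split=> y; first by move=> [[r d] [/= Rr Dd] <-]; apply/ZE; exists r, d.
  by move/ZE => [r [d [Rr Dd ->]]]; exists (r, d).
have iZ : irr Z by rewrite -muRD; apply: irr_image => //; exact: mu_reg.
(* A minimal irreducible subset dominating the orbit is generically finite over
   it; translating by the group, the orbit map is closed. *)
have [|M [cM [iM MRD ZM] minM]] := @zmin _ E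
    (fun M => [/\ irr M, M `<=` RD & Z `<=` cl (mu z @` M)]).
  exists RD; first exact: RD_zc.
  by split=> //; rewrite muRD; exact: sub_cl.
have muM m : M m -> Z (mu z m) by move=> /MRD RDm; rewrite -muRD; exists m.
(* Each coordinate on [M] is algebraic over the orbit. If it satisfied no equation, a slice of [M]
   by a fixed value of the coordinate would still dominate [Z]; by minimality a dominating component
   of the slice is all of [M], so the coordinate is constant. *)
have alg i : exists d (P : glv k n -> {poly k}), [/\ regp P d.+1,
    exists2 y, Z y & (P y)`_d <> 0 & forall m, M m -> (P (mu z m)).[vgen m i] = 0].
  pose e2 (m : E) : prodv (glv k n) (A1 k) := (mu z m, vgen m i).
  have re2 : regmap e2 by apply: regmap_pair; [exact: mu_reg|apply/reg_A1; exact: regV].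
  have [[G [rG GM [y0 [t0 [Zy0 Gy0]]]]]|noG] := pselect (exists G, [/\ reg G,
      forall m, M m -> G (e2 m) = 0 & exists y t, Z y /\ G (y, t) <> 0]).
    have [e [Q [[sQ rQ] QE]]] := polyrep rG.
    have exd : exists d, `[< exists2 y, Z y & (Q y)`_d <> 0 >].
      have : Q y0 != 0 by apply/eqP => Q0; apply: Gy0; rewrite QE Q0 horner0.
      rewrite -lead_coef_eq0 => Q0; exists (size (Q y0)).-1; apply/asboolP.
      by exists y0 => //; apply/eqP.
    have ubd d : `[< exists2 y, Z y & (Q y)`_d <> 0 >] -> (d <= e)%N.
      move/asboolP => [y _ Qd]; rewrite leqNgt; apply/negP => lted; apply: Qd.
      by rewrite nth_default // (leq_trans (sQ y)) // ltnW.
    case: (ex_maxnP exd ubd) => d /asboolP exy dmax.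
    exists d, (fun y => \poly_(j < d.+1) (Q y)`_j); split.
    - split=> [y|j]; first exact: size_poly.
      apply: (@reg_eq _ _ (fun y => if (j < d.+1)%N then (Q y)`_j else 0)).
        by move=> y; rewrite coef_poly.
      by case: (j < d.+1)%N; [exact: rQ|exact: regC].
    - by case: exy => y Zy Qy; exists y => //; rewrite coef_poly ltnSn.
    - move=> m Mm; rewrite -[RHS](GM m Mm) QE; congr (_.[_]); apply/polyP => j.
      rewrite coef_poly; case: ltnP => // ltdj; apply/esym; apply: contrapT => Qj.
      have : (j <= d)%N by apply: dmax; apply/asboolP; exists (mu z m) => //; exact: muM.
      by rewrite leqNgt ltdj.
  have Z2 y t : Z y -> cl (e2 @` M) (y, t).
    move=> Zy G rG GM; apply: contrapT => Gy; apply: noG; exists G; split=> //.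
      by move=> m Mm; apply: GM; exists m.
    by exists y, t.
  have [h [rh [[y1 c] cy1 hy1] hP]] := chevalley re2 (RD_affine cM MRD) iM.
  have Zy1 : Z y1.
    have cZ1 : zc [set p : prodv (glv k n) (A1 k) | Z p.1] := zc_preim (@regmap_fst _ _ _) cZ.
    by apply: (cl_sub cZ1 _ cy1) => _ [m Mm <-]; exact: muM.
  have rt : reg (fun m : E => vgen m i - c) by apply: regB (regV _ _) (regC _ _).
  pose M' := M `&` [set m : E | vgen m i - c = 0].
  have cM' : zc M' := zcI cM (zc_eq0 rt).
  have rhc : reg (fun y : glv k n => h (y, c)).
    by apply: (reg_comp _ rh); apply: regmap_pair; [exact: regmap_id|exact: regmap_cst].
  have ZM' : Z `<=` cl (mu z @` M').
    apply: subset_trans (irr_open_dense iZ rhc _) _; first by exists y1.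
    apply: cl_mono => y [Zy hy]; have [m Mm mE] := hP _ (Z2 y c Zy) hy.
    have /(congr1 fst)/= E1 : e2 m = (y, c).
      rewrite /e2; congr pair.
        apply: glv_inj => j; have [ltj|lej] := ltnP j (vdim (glv k n)); last by rewrite !vgen0.
        by have := mE j; rewrite /= /prodv_gen ltj.
      by have := mE (vdim (glv k n)); rewrite /= /prodv_gen ltnn subnn.
    exists m => //; split=> //=; apply/eqP; rewrite subr_eq0; apply/eqP.
    by have := mE (vdim (glv k n)); rewrite /= /prodv_gen ltnn subnn.
  have [F [cF iF FM' ZF]] := irr_dominant_part (mu_reg z) cM' iZ ZM'.
  have FM : F = M.
    apply: minM => //; last by move=> m /FM'[].
    by split=> // m /FM'[/MRD].
  exists 1%N, (fun=> 'X - c%:P); split.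
  - by split=> [y|j]; [rewrite size_XsubC|exact: regC].
  - by exists y1 => //; rewrite coefB coefX coefC subr0; apply/eqP; rewrite oner_eq0.
  - by move=> m; rewrite -FM hornerXsubC => /FM'[].
have [al [ral [x1 Zx1 alx1] alP]] : exists al, [/\ reg al, exists2 y, Z y & al y <> 0
    & forall y, al y <> 0 -> forall i, (i < vdim E)%N -> algebraic_at M (mu z) y (fun m => vgen m i)].
  elim: (vdim E) => [|d [al [ral exal alP]]].
    exists (fun=> 1); split=> //; first exact: regC.
    by exists z => //; apply/eqP; rewrite oner_eq0.
  have [e [P [rP exP PM]]] := alg d.
  exists (fun y => al y * (P y)`_e); split.
  - by apply: regM => //; exact: rP.2.
  - by apply: irr_nonzeroM => //; exact: rP.2.
  - move=> y /eqP; rewrite mulf_eq0 negb_or => /andP[/eqP aly Py] i.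
    rewrite ltnS leq_eqVlt => /predU1P[->|ltid]; last exact: alP.
    by exists e, P.
have aM := RD_affine cM MRD.
have liftM y : Z y -> al y <> 0 -> exists2 m, M m & mu z m = y.
  move=> Zy aly.
  have [||||m [Mm _] /glv_inj mE] := @fin_proj k E (A1 k) (glv k n) M
      [set p : prodv E (A1 k) | M p.1 /\ (p.2 : k) - 0 = 0] (mu z) y 0 (mu_reg z) aM.
  - apply: zcI; first exact: (zc_preim (@regmap_fst _ _ _) cM).
    apply: zc_eq0; apply: regB (regC _ _).
    exact: (reg_comp (@regmap_snd _ E (A1 k)) (@reg_idA1 k)).
  - by move=> p [].
  - apply: cl_mono (@cl_pair (glv k n) (A1 k) _ y (0 : k) (ZM _ Zy)) => -[y' t] /= [[m Mm <-] ->].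
    by exists m => //=; rewrite subrr.
  - exact: alP.
  by exists m.
move=> W Y cY YR YD.
pose Yt : set (prodv (glv k n) W) := [set p | exists r d, [/\ Y (r, p.2), D d & p.1 = r *m z *m d]].
suff cYt : zc Yt.
  rewrite (_ : [set w | _] = [set w | exists x, Yt (x, w)]).
    apply: coS => //.
    - move=> x w [r [d [/= /YR Rr Dd ->]]]; apply: RSD => //; exact: ZS.
    - move=> x w d Dd [r [d' [/= Yr Dd' ->]]]; exists r, (d' *m d); split=> //=; first exact: sgM.
      by rewrite mulmxA.
  apply/seteqP; split=> w /= [x Yx]; last by case: Yx => r [d [/= Yr _ _]]; exists r.
  by exists (x *m z), x, 1%:M; split=> //; [exact: sg1|rewrite mulmx1].
suff <- : cl Yt = Yt by exact: zc_cl.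
apply/seteqP; split; last exact: sub_cl.
move=> [x w] cx.
have Zx : Z x.
  have cZ1 : zc [set p : prodv (glv k n) W | Z p.1] := zc_preim (@regmap_fst _ _ _) cZ.
  apply: (cl_sub cZ1 _ cx) => p [r [d [/YR Rr Dd pE]]] /=; rewrite pE.
  by apply/ZE; exists r, d.
have [r0 [d0 [Rr0 Dd0 xE]]] := (ZE x).1 Zx.
have [r1 [d1 [Rr1 Dd1 x1E]]] := (ZE x1).1 Zx1.
have [ur0 ur1] := (sgU sR Rr0, sgU sR Rr1); have [ud0 ud1] := (sgU sD Dd0, sgU sD Dd1).
(* The projection from [M] is known to be finite only where [al] is nonzero; [g] and [d'] translate
   the given point [x] to such a point [x1]. *)
pose g := r1 *m ginv r0; pose d' := ginv d0 *m d1.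
have Rg : R g by apply: sgM => //; exact: sgV.
have Dd' : D d' by apply: sgM => //; exact: sgV.
have [ug ud'] := (sgU sR Rg, sgU sD Dd').
have gx : g *m x *m d' = x1.
  rewrite xE x1E /g /d' !mulmxA -[r1 *m ginv r0 *m r0]mulmxA mulVg // mulmx1.
  by rewrite -[_ *m d0 *m _]mulmxA mulgV // mulmx1.
clearbody g d'.
pose Y' : set (prodv (glv k n) W) :=
  [set p | exists r d, [/\ Y (ginv g *m r, p.2), R r, D d & p.1 = r *m z *m d]].
have cx1 : cl Y' (x1, w).
  have rh : regmap (fun p : prodv (glv k n) W => (g *m p.1 *m d', p.2) : prodv (glv k n) W) by reg_tac.
  rewrite -gx; apply: cl_mono (cl_image rh cx) => _ [[y u] [r [d [/= Yr Dd ->]]] <-].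
  exists (g *m r), (d *m d'); split=> /=; first by rewrite mulmxA mulVg // mul1mx.
  - by apply: sgM => //; exact: YR Yr.
  - exact: sgM.
  - by rewrite !mulmxA.
pose N : set (prodv E W) := [set p | M p.1 /\ Y (ginv g *m p.1.1, p.2)].
have cN : zc N.
  apply: zcI; first exact: (zc_preim (@regmap_fst _ E W) cM).
  apply: (@zc_preim _ _ _ (fun p : prodv E W => (ginv g *m p.1.1, p.2) : prodv (glv k n) W)) => //.
  apply: regmap_pair; last exact: regmap_snd.
  apply: rgM; first exact: regmap_cst.
  exact: (regmap_comp (@regmap_fst _ E W) (@regmap_fst _ (glv k n) (glv k n))).
have ral2 : reg (fun p : prodv (glv k n) W => al p.1) := reg_comp (@regmap_fst _ _ _) ral.
have [//|p []//|||[r d] [/= Mrd Yr] /glv_inj mE] := @fin_proj k E W (glv k n) M N (mu z) x1 w (mu_reg z) aM.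
- apply: cl_mono (cl_open ral2 cx1 alx1) => -[y u] [[r [d [/= Yr Rr Dd yE]]] aly].
  have Zy : Z y by apply/ZE; exists r, d.
  have [[r2 d2] Mm mE] := liftM y Zy aly; exists (r2, d2) => //; split=> //=.
  have [/= Rr2 Dd2] := MRD _ Mm; have [ur ud] := (sgU sR Rr, sgU sD Dd).
  have [ur2 ud2] := (sgU sR Rr2, sgU sD Dd2).
  have rE : r2 *m z = r *m z *m (d *m ginv d2).
    rewrite !mulmxA -yE -mE /mu /= -mulmxA mulgV ?mulmx1 //.
  have -> : ginv g *m r2 = ginv g *m r *m (ginv r *m r2).
    by rewrite -!mulmxA; congr (_ *m _); rewrite mulmxA mulgV // mul1mx.
  apply: YD => //; split; first by apply: sgM => //; exact: sgV.
  have -> : ginv z *m (ginv r *m r2) *m z = d *m ginv d2.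
    rewrite -!mulmxA rE !mulmxA -[ginv z *m ginv r *m r]mulmxA mulVg // mulmx1 mulVg //.
    by rewrite mul1mx.
  by apply: sgM => //; exact: sgV.
- exact: alP.
have [/= Rr Dd] := MRD _ Mrd.
exists (ginv g *m r), (d *m ginv d'); split=> //=; first by apply: sgM => //; exact: sgV.
have -> : ginv g *m r *m z *m (d *m ginv d') = ginv g *m (r *m z *m d) *m ginv d' by rewrite !mulmxA.
rewrite -[r *m z *m d]/(mu z (r, d)) mE -gx.
rewrite !mulmxA mulVg // mul1mx.
by rewrite -mulmxA mulgV // mulmx1.
Qed.

End Fix.
End Subgroups.

(** * Generated groups and identity components *)

Section IrreducibleGroups.
Variables (k : closedFieldType) (n : nat).
Implicit Types (H Q X Y : set 'M[k]_n).
Local Notation gl := (glv k n).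
Local Notation irrg X := (@irr k gl X).

Lemma irr_mulset X Y : irrg X -> irrg Y ->
  irrg [set g | exists x y, [/\ X x, Y y & g = x *m y]].
Proof.
move=> iX iY; have r : regmap ((fun p => p.1 *m p.2) : prodv gl gl -> gl) by reg_tac.
have := irr_image r (irr_setX iX iY); congr irr; apply/seteqP; split=> g.
  by move=> [[x y] [/= Xx Yy] <-]; exists x, y.
by move=> [x [y [Xx Yy ->]]]; exists (x, y).
Qed.

Lemma irr_invset X : irrg X -> irrg [set g | exists2 x, X x & g = ginv x].
Proof.
move=> iX; have r : regmap ((fun x => ginv x) : gl -> gl) by reg_tac.
by have := irr_image r iX; congr irr; apply/seteqP; split=> g [x Xx E]; exists x.
Qed.

Lemma units_subgroup : is_subgroup (@units k n).
Proof.
apply: is_subgroup_ginv => //; [exact: units1| |exact: unitsV].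
by move=> g h ug uh; apply/unitsM.
Qed.

Lemma gen_subgroup X : X `<=` @units k n -> is_subgroup (gen X).
Proof.
move=> XU; split.
- by move=> g; apply; split=> //; exact: units_subgroup.
- by move=> Y [sY _]; exact: sg1.
- by move=> g h Gg Gh Y [sY XY]; apply: sgM => //; [exact: Gg|exact: Gh].
- by move=> g Gg Y [sY XY]; have [_ _ _] := sY; apply; exact: Gg.
Qed.

Lemma sub_gen X : X `<=` gen X.
Proof. by move=> g Xg Y [_]; apply. Qed.

Lemma gen_sub X H : is_subgroup H -> X `<=` H -> gen X `<=` H.
Proof. by move=> sH XH g; apply; split. Qed.

(** The group is the union of the products over all words in the [U i] and their inverses. These are
    irreducible, and directed because every factor contains 1. *)
Lemma irr_gen (I : Type) (U : I -> set 'M[k]_n) :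
  (forall i, irrg (U i)) -> (forall i, U i 1%:M) ->
  (forall i, U i `<=` @units k n) -> irrg (gen [set g | exists i, U i g]).
Proof.
move=> iU U1 UU; set A := [set g | _].
have AU : A `<=` @units k n by move=> g [i /UU].
pose Ub (ib : I * bool) : set 'M[k]_n :=
  if ib.2 then [set g | exists2 x, U ib.1 x & g = ginv x] else U ib.1.
pose F := fix F (l : seq (I * bool)) : set 'M[k]_n :=
  if l is ib :: l' then [set g | exists x y, [/\ Ub ib x, F l' y & g = x *m y]]
  else [set 1%:M].
have iUb ib : irrg (Ub ib) by case: ib => i [] /=; [exact: irr_invset|exact: iU].
have Ub1 ib : Ub ib 1%:M by case: ib => i [] //=; exists 1%:M; rewrite ?ginv1.
have i1 : irrg [set 1%:M].
  split; first by exists 1%:M.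
  move=> f g _ _ /(_ _ erefl)/eqP; rewrite mulf_eq0 => /orP[/eqP f0|/eqP g0].
    by left=> z ->.
  by right=> z ->.
have iF l : irrg (F l) by elim: l => [|ib l IH] //=; exact: irr_mulset.
have F1 l : F l 1%:M.
  by elim: l => [|ib l IH] //=; exists 1%:M, 1%:M; rewrite mul1mx.
have Fcat l l' x y : F l x -> F l' y -> F (l ++ l') (x *m y).
  elim: l x => [|ib l IH] x /=; first by move=> ->; rewrite mul1mx.
  move=> [u [v [Uu Fv ->]]] Fy; exists u, (v *m y); split=> //; first exact: IH.
  by rewrite mulmxA.
have genE : gen A = [set g | exists l, F l g].
  apply/seteqP; split.
    apply: gen_sub; last first.
      move=> g [i Ug]; exists [:: (i, false)]; exists g, 1%:M; split=> //.
      by rewrite mulmx1.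
    have FU l g : F l g -> units g.
      elim: l g => [|[i b] l IH] g /=; first by move=> ->; exact: units1.
      move=> [x [y [Ux /IH uy ->]]]; apply/unitsM; split=> //.
      by case: b Ux => /= [[z /UU uz ->]|/UU//]; exact: unitsV.
    apply: is_subgroup_ginv.
    - by move=> g [l]; exact: FU.
    - by exists [::].
    - by move=> g h [l Fg] [l' Fh]; exists (l ++ l'); exact: Fcat.
    - move=> g [l]; elim: l g => [|[i b] l IH] g /=; first by move=> ->; exists [::]; rewrite /= ginv1.
      move=> [x [y [Ux Fy ->]]]; have [l' Fl'] := IH _ Fy.
      exists (l' ++ [:: (i, ~~ b)]); rewrite ginvM; apply: Fcat => //=.
      exists (ginv x), 1%:M; split=> //; last by rewrite mulmx1.
      case: b Ux => /= [[z Uz ->]|Ux]; last by exists x.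
      by rewrite /Ub /= ginvK //; exact: UU Uz.
  move=> g [l]; have sA := gen_subgroup AU.
  elim: l g => [|[i b] l IH] g /=; first by move=> ->; exact: sg1.
  move=> [x [y [Ux /IH Gy ->]]]; apply: (sgM sA) => //.
  case: b Ux => /= [[z Uz ->]|Ux]; last by apply: sub_gen; exists i.
  by apply: (sgV sA); apply: sub_gen; exists i.
rewrite genE; apply: (@irr_directed k gl _ F) => //; first by exists [::].
move=> l l'; exists (l ++ l'); split=> g Fg.
  by rewrite -[g]mulmx1; exact: Fcat.
by rewrite -[g]mul1mx; exact: Fcat.
Qed.

Lemma cl_subgroup H : is_subgroup H -> is_subgroup (@cl k gl H).
Proof.
move=> sH; have clU : @cl k gl H `<=` @units k n.
  by apply: cl_sub; [exact: zc_units|move=> g; exact: sgU].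
have Hcl h g : H h -> @cl k gl H g -> @cl k gl H (h *m g).
  move=> Hh; apply: (@cl_stable _ gl H (fun g => h *m g)); first by reg_tac.
  by move=> x Hx; exact: sgM.
apply: is_subgroup_ginv => //.
- by apply: (@sub_cl _ gl); exact: sg1.
- move=> g h cg ch.
  have := @cl_image _ gl gl (fun x => x *m h) H g _ cg.
  move=> /(_ _)-c1; have {}c1 := c1 ltac:(by reg_tac).
  by apply: (cl_sub (@zc_cl _ _ _) _ c1) => _ [x Hx <-]; exact: Hcl.
- move=> g cg; apply: (@cl_stable _ gl H (fun g => ginv g)) => //; first by reg_tac.
  by move=> x Hx; exact: sgV.
Qed.

(** The products of two such subsets are again such subsets, so for a group the union is directed
    and itself irreducible. *)
Definition idcomp Q : set 'M[k]_n :=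
  [set g | exists X, [/\ irrg X, X `<=` Q, X 1%:M & X g]].

Lemma idcomp_sub Q : idcomp Q `<=` Q.
Proof. by move=> g [X [_ XQ _ /XQ]]. Qed.

Lemma sub_idcomp Q X : irrg X -> X `<=` Q -> X 1%:M -> X `<=` idcomp Q.
Proof. by move=> iX XQ X1 g Xg; exists X. Qed.

Section IdComp.
Variable Q : set 'M[k]_n.
Hypotheses (sQ : is_subgroup Q) (cQ : zc (Q : set gl)).

Lemma idcomp_mul X Y : irrg X -> X `<=` Q -> X 1%:M -> irrg Y -> Y `<=` Q -> Y 1%:M ->
  let XY := [set g | exists x y, [/\ X x, Y y & g = x *m y]] in
  [/\ irrg XY, XY `<=` Q, XY 1%:M & X `<=` XY /\ Y `<=` XY].
Proof.
move=> iX XQ X1 iY YQ Y1; split; first exact: irr_mulset.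
- by move=> g [x [y [/XQ Qx /YQ Qy ->]]]; exact: sgM.
- by exists 1%:M, 1%:M; rewrite mulmx1.
- by split=> g gP; [exists g, 1%:M; rewrite mulmx1|exists 1%:M, g; rewrite mul1mx].
Qed.

Lemma idcomp_irr : irrg (idcomp Q).
Proof.
have i1 : irrg [set 1%:M].
  split; first by exists 1%:M.
  move=> f g _ _ /(_ _ erefl)/eqP; rewrite mulf_eq0 => /orP[/eqP f0|/eqP g0].
    by left=> z ->.
  by right=> z ->.
pose T := {X : set 'M[k]_n | [/\ irrg X, X `<=` Q & X 1%:M]}.
have -> : idcomp Q = [set g | exists X : T, sval X g].
  apply/seteqP; split=> g [X]; first by move=> [iX XQ X1 Xg]; exists (exist _ X (And3 iX XQ X1)).
  by case: X => X [iX XQ X1] /= Xg; exists X.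
pose F (X : T) : set gl := sval X.
apply: (@irr_directed k gl T F).
- by exists (exist _ [set 1%:M] (And3 i1 (fun g gE => ecast x (Q x) (esym gE) (sg1 sQ)) erefl)).
- by case=> X [].
- move=> [X [iX XQ X1]] [Y [iY YQ Y1]].
  have [i1' i2 i3 i4] := idcomp_mul iX XQ X1 iY YQ Y1.
  by exists (exist (fun X : set 'M[k]_n => [/\ irrg X, X `<=` Q & X 1%:M]) _ (And3 i1' i2 i3)).
Qed.

Lemma idcomp1 : idcomp Q 1%:M.
Proof.
by have [[x [X [iX XQ X1 _]]] _] := idcomp_irr; exists X.
Qed.

Lemma idcomp_subgroup : is_subgroup (idcomp Q).
Proof.
apply: is_subgroup_ginv.
- by move=> g /idcomp_sub; exact: sgU.
- exact: idcomp1.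
- move=> g h [X [iX XQ X1 Xg]] [Y [iY YQ Y1 Yh]].
  have [i1 i2 i3 _] := idcomp_mul iX XQ X1 iY YQ Y1.
  by eexists; split; [exact: i1|exact: i2|exact: i3|exists g, h].
- move=> g [X [iX XQ X1 Xg]]; exists [set g | exists2 x, X x & g = ginv x]; split.
  + exact: irr_invset.
  + by move=> h [x /XQ Qx ->]; exact: sgV.
  + by exists 1%:M; rewrite ?ginv1.
  + by exists g.
Qed.

Lemma idcomp_zc : zc (idcomp Q : set gl).
Proof.
suff <- : @cl k gl (idcomp Q) = idcomp Q by exact: zc_cl.
apply/seteqP; split; last exact: sub_cl.
apply: sub_idcomp; first exact: irr_cl idcomp_irr.
  exact: (@cl_sub _ gl _ _ cQ (@idcomp_sub Q)).
by apply: (@sub_cl _ gl); exact: idcomp1.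
Qed.

Lemma idcomp_index : exists m (q : nat -> 'M[k]_n), (forall i, (i < m)%N -> Q (q i)) /\
  forall g, Q g -> exists2 i, (i < m)%N & idcomp Q (ginv (q i) *m g).
Proof.
have [m [F [FP FQ]]] := irr_decomp cQ.
have qP i : exists x : 'M[k]_n, (i < m)%N -> F i x.
  case: (ltnP i m) => [/FP[_ [[x Fx] _] _]|_]; first by exists x.
  by exists 0.
have [q qF] := choice qP; exists m, q; split=> [i ltim|g /FQ[i ltim Fg]].
  by have [_ _] := FP _ ltim; apply; exact: qF.
exists i => //; have [cF iF FiQ] := FP _ ltim.
have Qq : Q (q i) by apply: FiQ; exact: qF.
exists [set h | exists2 x, F i x & h = ginv (q i) *m x]; split.
- have r : regmap ((fun x => ginv (q i) *m x) : gl -> gl) by reg_tac.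
  by have := irr_image r iF; congr irr; apply/seteqP; split=> h [x Fx E]; exists x.
- by move=> h [x /FiQ Qx ->]; apply: sgM => //; exact: sgV.
- by exists (q i); [exact: qF|rewrite mulVg //; exact: sgU Qq].
- by exists g.
Qed.

End IdComp.

Definition commset H : set 'M[k]_n :=
  [set g *m h *m invmx g *m invmx h | g in H & h in H].

Lemma commsetP H g : is_subgroup H -> commset H g <->
  exists x y, [/\ H x, H y & g = x *m y *m ginv x *m ginv y].
Proof.
move=> sH; split=> [[x Hx [y Hy <-]]|[x [y [Hx Hy ->]]]].
  by exists x, y; split=> //; rewrite !ginvE //; exact: (sgU sH).
by exists x => //; exists y => //; rewrite !ginvE //; exact: (sgU sH).
Qed.

Lemma commset_sub H : is_subgroup H -> commset H `<=` H.
Proof.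
move=> sH g /(commsetP _ sH)[x [y [Hx Hy ->]]].
by apply: sgM; [|apply: sgM; [|exact: sgM|exact: sgV]|exact: sgV].
Qed.

Lemma derived_subgroup H : is_subgroup H -> is_subgroup (derived H).
Proof.
move=> sH; apply: gen_subgroup => g /(commset_sub sH); exact: sgU.
Qed.

Lemma derived_sub H : is_subgroup H -> derived H `<=` H.
Proof. by move=> sH; apply: gen_sub => //; exact: commset_sub. Qed.

Lemma irr_commset H : is_subgroup H -> irrg H -> irrg (commset H).
Proof.
move=> sH iH.
have r : regmap ((fun p => p.1 *m p.2 *m ginv p.1 *m ginv p.2) : prodv gl gl -> gl) by reg_tac.
have := irr_image r (irr_setX iH iH); congr irr; apply/seteqP; split=> g.
  by move=> [[x y] [/= Hx Hy] <-]; apply/commsetP => //; exists x, y.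
by move=> /(commsetP _ sH)[x [y [Hx Hy ->]]]; exists (x, y).
Qed.

Lemma irr_derived H : is_subgroup H -> irrg H -> irrg (derived H).
Proof.
move=> sH iH; have := @irr_gen unit (fun=> commset H).
have -> : [set g | exists i : unit, commset H g] = commset H.
  by apply/seteqP; split=> g; [case|exists tt].
apply=> _; first exact: irr_commset.
- by apply/commsetP => //; exists 1%:M, 1%:M; rewrite ginv1 !mulmx1; split=> //; exact: sg1.
- by move=> g /(commset_sub sH); exact: sgU.
Qed.

End IrreducibleGroups.

(** * The Lie-Kolchin theorem *)

Section LieKolchin.
Variable k : closedFieldType.

(** The span of an arbitrary set of rows. Minimality of [U] is expressed by maps [K] that kill [A],
    and [U] is found as a matrix of greatest rank with this property. *)
Lemma span_ex m (A : set 'rV[k]_m) : exists U : 'M[k]_m,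
  (forall a, A a -> (a <= U)%MS) /\
  forall q (K : 'M[k]_(m, q)), (forall a, A a -> a *m K = 0) -> U *m K = 0.
Proof.
pose ok (U : 'M[k]_m) := forall q (K : 'M[k]_(m, q)), (forall a, A a -> a *m K = 0) -> U *m K = 0.
have ex0 : exists r, `[< exists2 U : 'M[k]_m, ok U & \rank U = r >].
  by exists 0%N; apply/asboolP; exists 0; [move=> q K _; rewrite mul0mx|rewrite mxrank0].
have ub r : `[< exists2 U : 'M[k]_m, ok U & \rank U = r >] -> (r <= m)%N.
  by move/asboolP => [U _ <-]; exact: rank_leq_row.
case: (ex_maxnP ex0 ub) => r /asboolP[U okU rU] maxr.
exists U; split=> // a Aa; apply: contrapT => naU.
have okUa : ok (U + a)%MS.
  move=> q K AK; apply/eqP; rewrite -sub_kermx addsmx_sub !sub_kermx okU // AK //.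
  by rewrite !eqxx.
have : (\rank (U + a)%MS <= \rank U)%N.
  by rewrite rU; apply: maxr; apply/asboolP; exists (U + a)%MS.
rewrite leqNgt => /negP; apply; rewrite ltn_neqAle mxrankS ?addsmxSl // andbT.
apply/eqP => rE; apply: naU; apply: submx_trans (addsmxSr U a) _.
by have := mxrank_leqif_sup (addsmxSl U a) => /geq_leqif <-; rewrite rE.
Qed.

Variable n : nat.
Local Notation gl := (glv k n).
Local Notation irrg X := (@irr k gl X).

(** Induction on the derived length, for groups that are irreducible but not assumed closed, since
    derived groups are merely generated. On a minimal stable subspace [W1] the derived group acts by
    scalars; these are 1, so [H] acts on [W1] by commuting operators, and minimality makes all of
    them scalar. *)
Lemma lie_kolchin_sub m (rho : gl -> 'M[k]_m) : regm rho ->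
  forall l (H : set 'M[k]_n), is_subgroup H -> irrg H ->
  iter l (@derived k n) H = [set 1%:M] ->
  (forall g h, H g -> H h -> rho (g *m h) = rho g *m rho h) -> rho 1%:M = 1%:M ->
  forall W : 'M[k]_m, W != 0 -> (forall g, H g -> (W *m rho g <= W)%MS) ->
  exists2 v : 'rV_m, v != 0 /\ (v <= W)%MS & forall g, H g -> exists c, v *m rho g = c *: v.
Proof.
move=> rrho; elim=> [|l IH] H sH iH Hl rhoM rho1 W W0 Wst.
  have /rowV0Pn[v vW v0] := W0; exists v => // g; rewrite (_ : H = [set 1%:M]) // => ->.
  by exists 1; rewrite rho1 mulmx1 scale1r.
have [W1 [W10 W1W W1st] minW1] : exists2 W1 : 'M[k]_m,
    [/\ W1 != 0, (W1 <= W)%MS & forall g, H g -> (W1 *m rho g <= W1)%MS]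
    & forall U : 'M[k]_m, U != 0 -> (U <= W1)%MS -> (forall g, H g -> (U *m rho g <= U)%MS) -> (W1 <= U)%MS.
  have ex : exists r, `[< exists2 U : 'M[k]_m, [/\ U != 0, (U <= W)%MS
      & forall g, H g -> (U *m rho g <= U)%MS] & \rank U = r >].
    by exists (\rank W); apply/asboolP; exists W.
  case: (ex_minnP ex) => r /asboolP[U [U0 UW Ust] rU] minr; exists U => // V V0 VU Vst.
  have := mxrank_leqif_sup VU => /geq_leqif <-; rewrite rU; apply: minr; apply/asboolP.
  by exists V => //; split=> //; exact: submx_trans UW.
suff scal : forall g, H g -> exists c, forall w : 'rV_m, (w <= W1)%MS -> w *m rho g = c *: w.
  have /rowV0Pn[v vW1 v0] := W10; exists v; first by split=> //; exact: submx_trans W1W.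
  by move=> g /scal[c cP]; exists c; exact: cP.
have rhoV g : H g -> rho (ginv g) *m rho g = 1%:M /\ rho g *m rho (ginv g) = 1%:M.
  move=> Hg; have ug := sgU sH Hg; have Hgi := sgV sH Hg.
  by rewrite -!rhoM // mulVg // mulgV.
(* By minimality of [W1] the orbit of any nonzero vector spans it, so linear identities need
   checking on one orbit only. *)
have orb (v : 'rV_m) q (K : 'M[k]_(m, q)) : v != 0 -> (v <= W1)%MS ->
    (forall g, H g -> v *m rho g *m K = 0) -> forall w : 'rV_m, (w <= W1)%MS -> w *m K = 0.
  move=> v0 vW1 vK w wW1.
  have [U [UA UK]] := span_ex [set a : 'rV[k]_m | exists2 g, H g & a = v *m rho g].
  have vU : (v <= U)%MS.
    by apply: UA; exists 1%:M; [exact: sg1|rewrite rho1 mulmx1].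
  have W1U : (W1 <= U)%MS.
    apply: minW1.
    - by apply: contraNneq v0 => U0; rewrite U0 submx0 in vU.
    - rewrite submxE; apply/eqP; apply: UK => _ [g Hg ->]; apply/eqP; rewrite -submxE.
      exact: submx_trans (submxMr _ vW1) (W1st g Hg).
    - move=> g Hg; rewrite submxE -mulmxA; apply/eqP; apply: UK => _ [h Hh ->].
      rewrite mulmxA; apply/eqP; rewrite -submxE; apply: UA.
      by exists (h *m g); [exact: sgM|rewrite rhoM // mulmxA].
  have /submxP[D ->] := submx_trans wW1 W1U; rewrite -mulmxA UK ?mulmx0 //.
  by move=> a [g Hg ->]; exact: vK.
pose H' := derived H; have sH' : is_subgroup H' := derived_subgroup sH.
have iH' : irrg H' := irr_derived sH iH.
have H'H : H' `<=` H := derived_sub sH.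
have [|g h /H'H Hg /H'H Hh|g /H'H Hg|v [v0 vW1] veig] := IH H' sH' iH' _ _ rho1 W1 W10.
- by rewrite -iterSr.
- exact: rhoM.
- exact: W1st.
have /rV0Pn[j vj] := v0; pose chi r := (v *m rho r) 0 j / v 0 j.
have rv : regm (fun r : gl => v *m rho r) by apply: regm_mul => //; exact: regm_cst.
have rchi : @reg k gl chi by exact: regM (rv 0 j) (regC _ _).
have chiP r : H' r -> v *m rho r = chi r *: v.
  by move=> /veig[c cE]; rewrite /chi cE mxE mulfK.
have H'n g r : H g -> H' r -> H' (g *m r *m ginv g).
  move=> Hg H'r; have Hr := H'H _ H'r.
  have -> : g *m r *m ginv g = g *m r *m ginv g *m ginv r *m r.
    by rewrite -!mulmxA mulVg ?mulmx1 //; exact: sgU Hr.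
  by apply: (sgM sH') => //; apply: (@sub_gen _ _ (commset H)); apply/commsetP => //; exists g, r.
(* As [g] varies over the irreducible [H], this value stays among the finitely many eigenvalues of
   [rho r]. *)
have chi_const r g : H' r -> H g -> chi (g *m r *m ginv g) = chi r.
  move=> H'r; have [rs rsE] := closed_field_poly_normal (char_poly (rho r)).
  have rf : @reg k gl (fun g => chi (g *m r *m ginv g)).
    by apply: (@reg_comp _ gl gl (fun g => g *m r *m ginv g)) rchi; reg_tac.
  have [|c cP] := irr_finite_values iH rf (s := rs).
    move=> h Hh; have H'c := H'n _ _ Hh H'r.
    have ev : eigenvalue (rho r) (chi (h *m r *m ginv h)).
      apply/eigenvalueP; exists (v *m rho h); last first.
        apply: contraNneq v0 => vh; have [_ E] := rhoV h Hh.
        by rewrite -[v]mulmx1 -E mulmxA vh mul0mx.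
      have Hr := H'H _ H'r; have Hc := H'H _ H'c.
      rewrite -mulmxA -rhoM // -{1}[h *m r]mulmx1 -(mulVg (sgU sH Hh)) mulmxA rhoM //.
      by rewrite mulmxA chiP // -scalemxAl.
    move: ev; rewrite eigenvalue_root_char rsE rootZ ?root_prod_XsubC //.
    by rewrite lead_coef_eq0 monic_neq0 ?char_poly_monic.
  move=> Hg; rewrite (cP g Hg) -(cP 1%:M (sg1 sH)) ginv1 mul1mx mulmx1.
  by [].
have H'scal r (w : 'rV_m) : H' r -> (w <= W1)%MS -> w *m rho r = chi r *: w.
  move=> H'r wW1; apply/eqP; rewrite -subr_eq0 -mul_mx_scalar -mulmxBr; apply/eqP.
  apply: (orb v) => // g Hg; apply/eqP; rewrite mulmxBr subr_eq0 mul_mx_scalar; apply/eqP.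
  have Hr := H'H _ H'r; have H'c := H'n _ _ Hg H'r; have Hc := H'H _ H'c.
  rewrite -mulmxA -rhoM // -[g *m r]mulmx1 -(mulVg (sgU sH Hg)) mulmxA rhoM //.
  by rewrite mulmxA (chiP _ H'c) -scalemxAl chi_const.
pose d := \rank W1; pose be : 'M[k]_(d, m) := row_base W1.
have beW : (be :=: W1)%MS := eq_row_base W1.
pose rho' g := be *m rho g *m pinvmx be.
have rho'E g : H g -> be *m rho g = rho' g *m be.
  by move=> Hg; rewrite mulmxKpV // beW (eqmxMr _ beW) W1st.
have rho'M g h : H g -> H h -> rho' (g *m h) = rho' g *m rho' h.
  by move=> Hg Hh; rewrite {1}/rho' rhoM // mulmxA rho'E // /rho' -!mulmxA.
have rho'1 : rho' 1%:M = 1%:M.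
  by rewrite /rho' rho1 mulmx1 mulmxVp ?row_base_free.
have d0 : (0 < d)%N by rewrite lt0n mxrank_eq0.
have detV g : H g -> \det (rho' g) * \det (rho' (ginv g)) = 1.
  move=> Hg; have ug := sgU sH Hg; have Hi := sgV sH Hg.
  by rewrite -det_mulmx -rho'M // mulgV // rho'1 det1.
have det1' r : H' r -> \det (rho' r) = 1.
  have sK : is_subgroup [set g | H g /\ \det (rho' g) = 1].
    apply: is_subgroup_ginv.
    - by move=> g [/(sgU sH)].
    - by split; [exact: sg1|rewrite rho'1 det1].
    - by move=> g h [Hg dg] [Hh dh]; split; [exact: sgM|rewrite rho'M // det_mulmx dg dh mulr1].
    - by move=> g [Hg dg]; split; [exact: sgV|have := detV g Hg; rewrite dg mul1r].
  suff /(_ r) : H' `<=` [set g | H g /\ \det (rho' g) = 1] by move=> sub /sub[].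
  apply: gen_sub => // c cc; split; first exact: commset_sub cc.
  have /(commsetP _ sH)[x [y [Hx Hy ->]]] := cc.
  have [Hxi Hyi] := (sgV sH Hx, sgV sH Hy).
  have Hxy := sgM sH Hx Hy; have Hxyx := sgM sH Hxy Hxi.
  rewrite !rho'M // !det_mulmx [\det (rho' x) * _ * _]mulrAC detV // mul1r.
  exact: detV.
(* Products of commutators have determinant 1 on [W1], so [chi] takes values in the roots of unity
   of order dividing [d]; on the irreducible [H'] it is constant. *)
have chi1 r : H' r -> chi r = 1.
  have chid x : H' x -> chi x ^+ d = 1.
    move=> H'x; rewrite -(det1' x H'x) /rho'.
    have -> : be *m rho x = chi x *: be.
      apply/row_matrixP => i; rewrite row_mul linearZ /= H'scal //.
      by rewrite -beW row_sub.
    by rewrite -scalemxAl mulmxVp ?row_base_free // detZ det1 mulr1.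
  have [rs rsE] := closed_field_poly_normal ('X^d - 1 : {poly k}).
  have [|c cP] := irr_finite_values iH' rchi (s := rs).
    move=> x /chid xd; have : root ('X^d - 1) (chi x) by rewrite /root !hornerE xd subrr.
    rewrite rsE rootZ ?root_prod_XsubC // lead_coef_eq0 -size_poly_eq0.
    by rewrite -polyC1 size_XnsubC.
  move=> H'r; rewrite (cP r H'r) -(cP 1%:M (sg1 sH')).
  by rewrite /chi rho1 mulmx1 divff.
move=> g Hg.
have cs : size (char_poly (rho' g)) != 1%N by rewrite size_char_poly eqSS -lt0n.
have [a] := closed_rootP _ cs; rewrite -eigenvalue_root_char => /eigenvalueP[u ua u0].
exists a => w wW1; apply/eqP; rewrite -subr_eq0 -mul_mx_scalar -mulmxBr; apply/eqP.
have ube : (u *m be <= W1)%MS by rewrite -beW submxMl.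
apply: (orb (u *m be)) => //.
  apply: contraNneq u0 => ub0; apply/eqP.
  by rewrite -[u]mulmx1 -(mulmxVp (row_base_free W1)) mulmxA ub0 mul0mx.
move=> h Hh; apply/eqP; rewrite mulmxBr subr_eq0 mul_mx_scalar; apply/eqP.
have [uh ug] := (sgU sH Hh, sgU sH Hg).
have H'c : H' (h *m g *m ginv h *m ginv g).
  by apply: (@sub_gen _ _ (commset H)); apply/commsetP => //; exists h, g.
rewrite -[u *m be *m _ *m _]mulmxA -rhoM //.
have -> : h *m g = (h *m g *m ginv h *m ginv g) *m (g *m h).
  by rewrite -!mulmxA [ginv g *m _]mulmxA mulVg // mul1mx mulVg // mulmx1.
rewrite rhoM //; [|exact: H'H|exact: sgM].
rewrite mulmxA (H'scal _ _ H'c ube) chi1 // scale1r rhoM // mulmxA -[u *m be *m _]mulmxA rho'E // mulmxA ua.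
by rewrite -!scalemxAl.
Qed.

Theorem lie_kolchin m (rho : gl -> 'M[k]_m) (H : set 'M[k]_n) : regm rho ->
  is_subgroup H -> irrg H -> is_solvable H ->
  (forall g h, H g -> H h -> rho (g *m h) = rho g *m rho h) -> rho 1%:M = 1%:M ->
  (0 < m)%N ->
  exists2 v : 'rV_m, v != 0 & forall g, H g -> exists c, v *m rho g = c *: v.
Proof.
move=> rrho sH iH [l Hl] rhoM rho1 m0.
have [||v [v0 _] vP] := lie_kolchin_sub rrho sH iH Hl rhoM rho1 (W := 1%:M).
- by rewrite -mxrank_eq0 mxrank1 -lt0n.
- by move=> g _; rewrite submx1.
- by exists v.
Qed.

End LieKolchin.

(** * Stabilizers of lines *)

Section Skeleton.
Variable k : closedFieldType.

Definition sep (X T : Type) (F : X -> T -> k) : Prop :=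
  exists (I : finType) (u : X -> I -> k) (v : T -> I -> k),
    forall x t, F x t = \sum_i u x i * v t i.

Lemma sep_l (X T : Type) (f : X -> k) : sep (fun x (_ : T) => f x).
Proof.
exists unit, (fun x _ => f x), (fun _ _ => 1) => x t.
by rewrite big_const cardT enumT unlock /= addr0 mulr1.
Qed.

Lemma sep_r (X T : Type) (f : T -> k) : sep (fun (_ : X) t => f t).
Proof.
exists unit, (fun _ _ => 1), (fun t _ => f t) => x t.
by rewrite big_const cardT enumT unlock /= addr0 mul1r.
Qed.

Lemma sepD (X T : Type) (F G : X -> T -> k) :
  sep F -> sep G -> sep (fun x t => F x t + G x t).
Proof.
move=> [I [u [v E]]] [J [u' [v' E']]]; exists (I + J)%type,
  (fun x s => match s with inl i => u x i | inr j => u' x j end),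
  (fun t s => match s with inl i => v t i | inr j => v' t j end) => x t.
by rewrite big_sumType E E'.
Qed.

Lemma sepM (X T : Type) (F G : X -> T -> k) :
  sep F -> sep G -> sep (fun x t => F x t * G x t).
Proof.
move=> [I [u [v E]]] [J [u' [v' E']]].
exists (I * J)%type, (fun x s => u x s.1 * u' x s.2), (fun t s => v t s.1 * v' t s.2) => x t.
rewrite E E' mulr_suml -(pair_big predT predT (fun i j => u x i * u' x j * (v t i * v' t j))) /=.
by apply: eq_bigr => i _; rewrite mulr_sumr; apply: eq_bigr => j _; rewrite mulrACA.
Qed.

Lemma sep_eq (X T : Type) (F G : X -> T -> k) : (forall x t, F x t = G x t) -> sep F -> sep G.
Proof. by move=> FG [I [u [v E]]]; exists I, u, v => x t; rewrite -FG. Qed.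

Lemma sep_comp (X T X' T' : Type) (a : X' -> X) (b : T' -> T) (F : X -> T -> k) :
  sep F -> sep (fun x t => F (a x) (b t)).
Proof. by move=> [I [u [v E]]]; exists I, (fun x => u (a x)), (fun t => v (b t)) => x t; rewrite E. Qed.

Lemma sep_sum (X T I : Type) (r : seq I) (F : I -> X -> T -> k) :
  (forall i, sep (F i)) -> sep (fun x t => \sum_(i <- r) F i x t).
Proof.
move=> sF; elim: r => [|i r IH]; first by apply: sep_eq (sep_l _ (fun=> 0)) => x t; rewrite big_nil.
by apply: sep_eq (sepD (sF i) IH) => x t; rewrite big_cons.
Qed.

Lemma sep_prod (X T I : Type) (r : seq I) (F : I -> X -> T -> k) :
  (forall i, sep (F i)) -> sep (fun x t => \prod_(i <- r) F i x t).
Proof.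
move=> sF; elim: r => [|i r IH]; first by apply: sep_eq (sep_l _ (fun=> 1)) => x t; rewrite big_nil.
by apply: sep_eq (sepM (sF i) IH) => x t; rewrite big_cons.
Qed.

Lemma sep_reg (X Y : var k) (f : prodv X Y -> k) : reg f -> sep (fun x y => f (x, y)).
Proof.
case=> p fp; apply: (@sep_eq _ _ (fun x y => peval (vgen ((x, y) : prodv X Y)) p)).
  by move=> x y; rewrite fp.
elim: p {fp} => [c|i|p IHp q IHq|p IHp q IHq] /=; [exact: sep_l| |exact: sepD|exact: sepM].
rewrite /prodv_gen; case: (i < vdim X)%N; [exact: (sep_l _ (fun x : X => vgen x i))|].
exact: (sep_r _ (fun y : Y => vgen y (i - vdim X))).
Qed.

(** A function of finite rank is determined by its values on an invertible minor [M] of greatest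
    size: every bordering of [M] is singular, and its Schur complement vanishes. *)
Lemma skeleton (X T : Type) (F : X -> T -> k) : sep F ->
  exists d (xs : 'I_d -> X) (ts : 'I_d -> T),
    let M := \matrix_(i, j) F (xs i) (ts j) in
    M \in unitmx /\ forall x t,
      F x t = ((\row_j F x (ts j)) *m invmx M *m \col_i F (xs i) t) 0 0.
Proof.
move=> [I [u [v E]]].
pose ok d := exists (xs : 'I_d -> X) (ts : 'I_d -> T), \matrix_(i, j) F (xs i) (ts j) \in unitmx.
have ex0 : exists d, `[< ok d >].
  have f0 (Y : Type) : 'I_0 -> Y by case.
  exists 0%N; apply/asboolP; exists (f0 X), (f0 T).
  by rewrite unitmxE det_mx00 unitr1.
have ub d : `[< ok d >] -> (d <= #|I|)%N.
  move/asboolP => [xs [ts]]; set M := \matrix_(_, _) _ => uM.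
  have -> : d = \rank M by rewrite mxrank_unit.
  have -> : M = (\matrix_(i < d, a < #|I|) u (xs i) (enum_val a)) *m
      \matrix_(a < #|I|, j < d) v (ts j) (enum_val a).
    apply/matrixP => i j; rewrite !mxE E (reindex (@enum_val I I)) /=.
      by apply: eq_bigr => a _; rewrite !mxE.
    by exists enum_rank => a _; [exact: enum_valK|exact: enum_rankK].
  exact: leq_trans (mulmx_max_rank _ _) (leqnn _).
case: (ex_maxnP ex0 ub) => d /asboolP[xs [ts uM]] maxd.
exists d, xs, ts; split=> // x t; set M := \matrix_(_, _) _ in uM *.
set r := \row__ _; set c := \col__ _.
pose xs' (i : 'I_(d + 1)) := match split i with inl i => xs i | inr _ => x end.
pose ts' (i : 'I_(d + 1)) := match split i with inl i => ts i | inr _ => t end.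
have NE : \matrix_(i, j) F (xs' i) (ts' j) = block_mx M c r (F x t)%:M.
  apply/matrixP => i j; rewrite !mxE /xs' /ts'.
  by case: (split i) => i'; rewrite !mxE; case: (split j) => j'; rewrite !mxE ?ord1.
have : \det (block_mx M c r (F x t)%:M) = 0.
  apply/eqP/negP => /negP det0; have : (d + 1 <= d)%N.
    by apply: maxd; apply/asboolP; exists xs', ts'; rewrite NE unitmxE unitfE.
  by rewrite addn1 ltnn.
have -> : block_mx M c r (F x t)%:M =
    block_mx M 0 r 1%:M *m block_mx 1%:M (invmx M *m c) 0 ((F x t)%:M - r *m invmx M *m c).
  rewrite mulmx_block !mulmx1 !mulmx0 !mul0mx !mul1mx !addr0 mulKVmx //.
  by congr block_mx; rewrite mulmxA addrC subrK.
rewrite det_mulmx det_lblock det_ublock !det1 mulr1 mul1r => /eqP.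
rewrite mulf_eq0 -[\det M == 0]negbK -unitfE -unitmxE uM /= det_mx11 !mxE eqxx mulr1n subr_eq0.
by move/eqP.
Qed.

Lemma mul_adj_replace d (A : 'M[k]_d) (r : 'rV[k]_d) i :
  (r *m \adj A) 0 i = \det (\matrix_(a, b) if a == i then r 0 b else A a b).
Proof.
rewrite mxE (expand_det_row _ i); apply: eq_bigr => j _; rewrite !mxE eqxx; congr (_ * _).
rewrite /cofactor; congr (_ * \det _); apply/matrixP => a b; rewrite !mxE.
by rewrite eq_sym (negbTE (neq_lift _ _)).
Qed.

Variable n : nat.
Local Notation gl := (glv k n).

(** Chevalley's construction. The equations of [D], translated on the right by [D], span a
    finite-dimensional space of functions with basis [w]; its top exterior power is a line in a
    representation of [H] and has stabilizer [D]. Two applications of [skeleton] provide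
    coordinates. The clause on [xi] says that the orbit of [v] spans. *)
Theorem line_stabilizer (H D : set 'M[k]_n) : is_subgroup H -> is_subgroup D ->
  D `<=` H -> zc (D : set gl) ->
  exists m (rho : gl -> 'M[k]_m) (v : 'cV[k]_m),
  [/\ regm rho, (forall g h, H g -> H h -> rho (g *m h) = rho g *m rho h), rho 1%:M = 1%:M,
      (forall xi : 'rV_m, (forall g, H g -> xi *m (rho g *m v) = 0) -> xi = 0)
    & v != 0 /\ forall g, H g -> D g <-> exists c, rho g *m v = c *: v].
Proof.
move=> sH sD DH cD; have [s sP] := zc_equations cD.
pose q l (g : gl) := peval (vgen g) (nth (PC 0) s l).
have rq l : reg (q l) by exists (nth (PC 0) s l).
have qD g : D g <-> forall l, q l g = 0.
  rewrite sP; split=> [gs l|gq p].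
    rewrite /q; case: (ltnP l (size s)) => [lts|les]; last by rewrite nth_default.
    apply: gs; move: l lts; elim: (s) => //= p r IH [|l] lts; first by left.
    by right; exact: IH.
  move=> ps; have [l <-] : exists l, nth (PC 0) s l = p; last exact: gq.
  elim: (s) ps => //= r u IH [<-|/IH[l lE]]; first by exists 0%N.
  by exists l.+1.
pose X := {g : 'M[k]_n | H g}; pose T := ({d : 'M[k]_n | D d} * 'I_(size s))%type.
pose F1 (x : X) (t : T) := q t.2 (sval x *m sval t.1).
have sF1 : sep F1.
  have sq l : sep (fun x y : gl => q l (x *m y)).
    apply: (@sep_reg gl gl (fun p => q l (p.1 *m p.2))).
    by apply: (@reg_comp _ _ gl (fun p : prodv gl gl => p.1 *m p.2)) (rq l); reg_tac.
  apply: (@sep_eq _ _ (fun x t => \sum_(l < size s) (l == t.2)%:R * q l (sval x *m sval t.1))).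
    move=> x t; rewrite (bigD1 t.2) //= eqxx mul1r big1 ?addr0 // => l nl.
    by rewrite (negbTE nl) mul0r.
  apply: sep_sum => l; apply: sepM; first exact: (sep_r _ (fun t : T => (l == t.2)%:R)).
  exact: (sep_comp (fun x : X => sval x) (fun t : T => sval t.1) (sq l)).
have [d [xs [ts [uM F1E]]]] := skeleton sF1; set M1 := \matrix_(_, _) _ in uM F1E.
pose w (g : gl) : 'rV[k]_d := \row_j q (ts j).2 (g *m sval (ts j).1).
pose C (t : T) : 'cV[k]_d := invmx M1 *m \col_i F1 (xs i) t.
have wC (x : X) t : F1 x t = (w (sval x) *m C t) 0 0.
  by rewrite F1E -mulmxA; congr ((_ *m _) 0 0).
have rw : regm w.
  move=> i j; apply: (@reg_eq _ _ (fun g : gl => q (ts j).2 (g *m sval (ts j).1))).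
    by move=> g; rewrite mxE.
  by apply: (@reg_comp _ gl gl (fun g => g *m sval (ts j).1)) (rq _); reg_tac.
have wD g : H g -> D g <-> w g = 0.
  move=> Hg; split=> [Dg|wg].
    apply/rowP => j; rewrite !mxE; apply: (qD _).1.
    by apply: (sgM sD) => //; exact: svalP.
  apply/qD => l; case: (ltnP l (size s)) => [lts|les]; last by rewrite /q nth_default.
  have := wC (exist _ g Hg) (exist _ 1%:M (sg1 sD), Ordinal lts).
  by rewrite /F1 /= mulmx1 wg mul0mx mxE.
have wMD d' : D d' -> exists A : 'M[k]_d, forall g, H g -> w (g *m d') = w g *m A.
  move=> Dd'; pose tj j : T := (exist _ (d' *m sval (ts j).1) (sgM sD Dd' (svalP (ts j).1)), (ts j).2).
  exists (\matrix_(l, j) C (tj j) l 0) => g Hg; apply/rowP => j; rewrite !mxE.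
  have := wC (exist _ g Hg) (tj j); rewrite /F1 /= mulmxA => ->.
  by rewrite mxE; apply: eq_bigr => l _; rewrite [in RHS]mxE.
(* The exterior product of the functions [w], translated by [x] and evaluated at the points [a]. *)
pose f (x : gl) (a : 'I_d -> X) := \det (\matrix_(i, j) w (sval (a i) *m x) 0 j).
have rf a : reg (f^~ a).
  apply: reg_det => i j; apply: (@reg_eq _ _ (fun x : gl => w (sval (a i) *m x) 0 j)).
    by move=> x; rewrite [RHS]mxE.
  by apply: (@reg_comp _ gl gl (fun x => sval (a i) *m x)) (rw 0 j); reg_tac.
have sF2 : sep (fun (x : X) a => f (sval x) a).
  apply: sep_sum => p; apply: sepM; first exact: sep_l.
  apply: (@sep_eq _ _ (fun (x : X) a => \prod_i w (sval (a i) *m sval x) 0 (p i))).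
    by move=> x a; apply: eq_bigr => i _; rewrite [RHS]mxE.
  apply: sep_prod => i.
  apply: (sep_comp (fun x : X => sval x) (fun a : 'I_d -> X => sval (a i))
     (F := fun x y => w (y *m x) 0 (p i))).
  apply: (@sep_reg gl gl (fun z => w (z.2 *m z.1) 0 (p i))).
  by apply: (@reg_comp _ _ gl (fun z : prodv gl gl => z.2 *m z.1)) (rw _ _); reg_tac.
have [m [xs' [as_ [uM2 fE]]]] := skeleton sF2; set M2 := \matrix_(_, _) _ in uM2 fE.
pose phi (x : gl) : 'cV[k]_m := \col_l f x (as_ l).
have fphi (x : X) a : f (sval x) a = (\sum_j phi (sval x) j 0 * (invmx M2 *m \col_i f (sval (xs' i)) a) j 0).
  rewrite fE -mulmxA mxE; apply: eq_bigr => j _; congr (_ * _); rewrite ?mxE //.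
pose rho (g : gl) : 'M[k]_m := \matrix_(l, j) (invmx M2 *m \col_i f (g *m sval (xs' i)) (as_ l)) j 0.
have mulf x g a : f (g *m x) a = \det (\matrix_(i, j) w (sval (a i) *m g *m x) 0 j).
  by congr (\det _); apply/matrixP => i j; rewrite !mxE mulmxA.
have phiM g x : H g -> H x -> phi (g *m x) = rho g *m phi x.
  move=> Hg Hx; apply/colP => l; rewrite !mxE mulf.
  pose ag i : X := exist _ (sval (as_ l i) *m g) (sgM sH (svalP (as_ l i)) Hg).
  have := fphi (exist _ x Hx) ag; rewrite /f /= => ->.
  apply: eq_bigr => j _; rewrite mulrC [rho g l j]mxE; congr (_ * _).
  rewrite !mxE; apply: eq_bigr => i _; congr (_ * _); rewrite !mxE.
  by congr (\det _); apply/matrixP => a b; rewrite !mxE mulmxA.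
have phi_sep p (A : 'M[k]_(p, m)) : (forall g, H g -> A *m phi g = 0) -> A = 0.
  move=> A0; suff : A *m M2^T = 0.
    have uM2T : M2^T \in unitmx by rewrite unitmx_tr.
    by move=> E; rewrite -[A]mulmx1 -(mulmxV uM2T) mulmxA E mul0mx.
  apply/matrixP => a i; have := congr1 (fun B : 'cV_p => B a 0) (A0 _ (svalP (xs' i))).
  by rewrite !mxE => E; rewrite -[RHS]E; apply: eq_bigr => j _; rewrite !mxE.
have rhoM g h : H g -> H h -> rho (g *m h) = rho g *m rho h.
  move=> Hg Hh; apply/eqP; rewrite -subr_eq0; apply/eqP; apply: phi_sep => x Hx.
  rewrite mulmxBl -mulmxA -!phiM //; first by rewrite mulmxA subrr.
  - exact: sgM.
  - exact: sgM.
have rho1 : rho 1%:M = 1%:M.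
  apply/eqP; rewrite -subr_eq0; apply/eqP; apply: phi_sep => x Hx.
  by rewrite mulmxBl -phiM ?mul1mx ?subrr //; exact: sg1.
have H1 := sg1 sH; have phi1 g : H g -> phi g = rho g *m phi 1%:M.
  by move=> Hg; rewrite -phiM // mulmx1.
have f1 : f 1%:M xs != 0.
  rewrite -unitfE -unitmxE; move: uM; congr (_ \in unitmx); apply/matrixP => i j.
  by rewrite !mxE mulmx1.
exists m, rho, (phi 1%:M); split=> //.
- move=> l j; apply: (@reg_eq _ _ (fun g : gl => \sum_i invmx M2 j i * f (g *m sval (xs' i)) (as_ l))).
    by move=> g; rewrite !mxE; apply: eq_bigr => i _; rewrite mxE.
  apply: reg_sum => i _; apply: regM (regC _ _) _.
  by apply: (@reg_comp _ gl gl (fun g => g *m sval (xs' i))) (rf _); reg_tac.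
- by move=> xi xi0; apply: phi_sep => g Hg; rewrite phi1 // xi0.
split.
  apply: contraNneq f1 => v0; have := fphi (exist _ _ H1) xs; rewrite /= => ->.
  by apply/eqP; rewrite big1 // => j _; rewrite v0 mxE mul0r.
move=> g Hg; rewrite -phi1 //; split=> [Dg|[c cE]].
  have [A wA] := wMD g Dg; exists (\det A); apply/colP => l; rewrite !mxE /f mulrC -det_mulmx.
  congr (\det _); apply/matrixP => i j; rewrite [LHS]mxE wA; last exact: svalP.
  rewrite [LHS]mxE [RHS]mxE; apply: eq_bigr => b _; congr (_ * _).
  by rewrite [RHS]mxE mulmx1.
have fc a : f g a = c * f 1%:M a.
  have -> := fphi (exist _ g Hg) a; have -> := fphi (exist _ _ H1) a.
  by rewrite mulr_sumr; apply: eq_bigr => j _; rewrite /= cE mxE mulrA.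
have c0 : c != 0.
  apply: contraNneq f1 => c0.
  have E : phi 1%:M = 0.
    have rV : rho (ginv g) *m rho g = 1%:M.
      by rewrite -rhoM // ?mulVg //; [exact: sgU Hg|exact: sgV].
    by rewrite -[phi _]mul1mx -rV -mulmxA -phi1 // cE c0 scale0r mulmx0.
  have := fphi (exist _ _ H1) xs; rewrite /= => ->.
  by apply/eqP; rewrite big1 // => j _; rewrite E mxE mul0r.
pose A : 'M[k]_d := \matrix_(i, j) w (sval (xs i) *m g) 0 j.
have uA : A \in unitmx by rewrite unitmxE -/(f g xs) fc unitfE mulf_neq0.
(* Cramer's rule: each entry is the value of [f g] with one of the points [xs] replaced by 1. It is
   proportional to the same value of [f 1%:M], a determinant with the zero row [w 1%:M]. *)
apply/wD => //; have : w g *m \adj A = 0.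
  apply/rowP => i; rewrite mul_adj_replace mxE.
  pose a j : X := if j == i then exist _ _ H1 else xs j.
  have <- : f g a = 0.
    rewrite fc; apply/eqP; rewrite mulf_eq0; apply/orP; right; apply/eqP.
    rewrite /f (expand_det_row _ i) big1 // => j _.
    rewrite (_ : (\matrix_(_, _) _) i j = w 1%:M 0 j); last by rewrite [LHS]mxE /a eqxx /= mul1mx.
    by rewrite ((wD _ H1).1 (sg1 sD)) mxE mul0r.
  congr (\det _); apply/matrixP => j b; rewrite [LHS]mxE [RHS]mxE /a; case: eqP => _ /=.
    by rewrite mul1mx.
  by rewrite [A j b]mxE.
move=> /(congr1 (mulmx^~ A)); rewrite mul0mx -mulmxA mul_adj_mx mul_mx_scalar => /eqP.
rewrite scaler_eq0 => /orP[/eqP dA|/eqP//].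
by move: uA; rewrite unitmxE dA unitr0.
Qed.

End Skeleton.

(** * The fixed point theorem *)

Section FixedPoint.
Variable k : closedFieldType.

Lemma closed_field_infinite (s : seq k) : exists c : k, c \notin s.
Proof.
pose p : {poly k} := 'X * \prod_(a <- s) ('X - a%:P) + 1.
have mp : \prod_(a <- s) ('X - a%:P) != 0 :> {poly k} by rewrite monic_neq0 ?monic_prod_XsubC.
have sp : size p != 1%N.
  rewrite /p mulrC size_polyDl size_mulX // ?size_poly1 ?ltnS ?size_poly_gt0 //.
  by rewrite eqSS size_poly_eq0.
have [c] := closed_rootP _ sp; rewrite rootE !hornerE => pc; exists c.
apply: contraTN pc => cs; have -> : (\prod_(a <- s) ('X - a%:P)).[c] = 0.
  by apply/eqP; rewrite -rootE root_prod_XsubC.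
by rewrite mulr0 add0r oner_eq0.
Qed.

Lemma reg_A1_poly (f : A1 k -> k) : reg f -> exists p : {poly k}, forall t : k, f t = p.[t].
Proof.
case=> p fp; suff [q qE] : exists q : {poly k}, forall t : k, peval (A1_gen t) p = q.[t].
  by exists q => t; rewrite fp qE.
elim: p {fp} => [c|i|p [P PE] q [Q QE]|p [P PE] q [Q QE]] /=.
- by exists c%:P => t; rewrite hornerC.
- by case: i => [|i]; [exists 'X|exists 0] => t; rewrite ?hornerX ?horner0.
- by exists (P + Q) => t; rewrite hornerD PE QE.
- by exists (P * Q) => t; rewrite hornerM PE QE.
Qed.

Lemma closed_A1 (Z : set (A1 k)) : zc Z ->
  (forall c, Z c) \/ exists s : seq k, forall c : k, Z c -> c \in s.
Proof.
move=> cZ; have [?|/existsNP[x /cZ[f [rf fZ fx]]]] := pselect (forall c, Z c); first by left.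
right; have [p pE] := reg_A1_poly rf; have [s sE] := closed_field_poly_normal p.
have p0 : p != 0 by apply/eqP => p0; apply: fx; rewrite pE p0 horner0.
exists s => c /fZ; rewrite pE => /eqP; rewrite -rootE sE rootZ ?lead_coef_eq0 //.
by rewrite root_prod_XsubC.
Qed.

Variable n : nat.
Local Notation gl := (glv k n).
Local Notation irrg X := (@irr k gl X).
Local Notation zcg X := (@zc k gl X).
Implicit Types S D R H : set 'M[k]_n.

(** The ratio f / Phi is a function on the complete quotient of [S] by [D]. Both its values and
    their inverses form closed subsets of the line. If all values occurred, all nonzero numbers
    would be inverses of values, hence by closedness 0 would satisfy 0 f = Phi at some point. *)
Lemma ratio_finite S D (f Phi : gl -> k) : zcg S -> complete S D -> reg f -> reg Phi ->
  (forall x d, S x -> D d -> S (x *m d)) -> (forall x, S x -> Phi x != 0) ->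
  (forall x d, S x -> D d -> f (x *m d) * Phi x = f x * Phi (x *m d)) ->
  exists s : seq k, forall x, S x -> exists2 c, c \in s & f x = c * Phi x.
Proof.
move=> cS coS rf rPhi SD Phi0 fPhi.
have r1 (h : gl -> k) : reg h -> reg (fun z : prodv gl (A1 k) => h z.1).
  exact: (reg_comp (@regmap_fst _ gl (A1 k))).
have r2 : reg (fun z : prodv gl (A1 k) => z.2 : k).
  exact: (reg_comp (@regmap_snd _ gl (A1 k)) (@reg_idA1 k)).
have key (a b : gl -> k) : reg a -> reg b ->
    (forall x d (c : k), S x -> D d -> c * a x = b x -> c * a (x *m d) = b (x *m d)) ->
    @zc k (A1 k) [set c : k | exists2 x, S x & c * a x = b x].
  move=> ra rb ab.
  have := coS (A1 k) [set z | S z.1 /\ (z.2 : k) * a z.1 - b z.1 = 0].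
  rewrite (_ : [set w | exists x, _] = [set c : k | exists2 x, S x & c * a x = b x]); last first.
    apply/seteqP; split=> c /=; first by move=> [x [Sx /eqP]]; rewrite subr_eq0 => /eqP; exists x.
    by move=> [x Sx E]; exists x; rewrite E subrr.
  apply.
  - apply: zcI; first exact: (zc_preim (@regmap_fst _ gl (A1 k)) cS).
    by apply: zc_eq0; apply: regB (r1 _ rb); apply: regM r2 (r1 _ ra).
  - by move=> x w [].
  - move=> x w d Dd [/= Sx /eqP]; rewrite subr_eq0 => /eqP E; split=> /=; first exact: SD.
    by rewrite (ab x d w) ?subrr.
have z1 := key _ _ rPhi rf; have z2 := key _ _ rf rPhi.
have /closed_A1[all|[s sP]] : @zc k (A1 k) [set c : k | exists2 x, S x & c * Phi x = f x].
- apply: z1 => x d c Sx Dd E; apply: (mulIf (Phi0 x Sx)).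
  by rewrite fPhi // -E mulrAC.
- have : @zc k (A1 k) [set c : k | exists2 x, S x & c * f x = Phi x].
    apply: z2 => x d c Sx Dd E; apply: (mulIf (Phi0 x Sx)).
    by rewrite -mulrA fPhi // mulrA E mulrC.
  case/closed_A1 => [/(_ 0)[x Sx /eqP]|[s sP]]; first by rewrite mul0r eq_sym (negbTE (Phi0 x Sx)).
  have [c] := closed_field_infinite (0 :: s); rewrite inE negb_or => /andP[c0 /negP[]].
  apply: sP; have [x Sx E] := all c^-1; exists x => //.
  by rewrite -E mulrA divff // mul1r.
- exists s => x Sx; exists (f x / Phi x); last by rewrite divfK ?Phi0.
  by apply: sP; exists x; rewrite ?divfK ?Phi0.
Qed.

Lemma ratio_const S D (f Phi : gl -> k) : irrg S -> zcg S -> complete S D -> reg f -> reg Phi ->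
  (forall x d, S x -> D d -> S (x *m d)) -> (forall x, S x -> Phi x != 0) ->
  (forall x d, S x -> D d -> f (x *m d) * Phi x = f x * Phi (x *m d)) ->
  exists c, forall x, S x -> f x = c * Phi x.
Proof.
move=> iS cS coS rf rPhi SD Phi0 fPhi.
have [s sP] := ratio_finite cS coS rf rPhi SD Phi0 fPhi.
have [||i ltis Si] := @irr_sub_bigU _ gl S (fun i => [set x : gl | f x - s`_i * Phi x = 0]) (size s) iS.
- move=> i _; apply: zc_eq0; apply: regB => //; exact: regM (regC _ _) rPhi.
- move=> x /sP[c cs E]; exists (index c s); first by rewrite index_mem.
  by rewrite /= nth_index // E subrr.
- by exists s`_i => x /Si /eqP; rewrite subr_eq0 => /eqP.
Qed.

(** Restriction to the line through two points turns regular functions into polynomials, up to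
    powers of the determinant; a parameter avoiding the roots of three polynomials gives a point
    where both functions are nonzero. *)
Lemma irr_lines S : S `<=` @units k n -> (exists x, S x) ->
  (forall A B (t : k), S A -> S B -> units (A + t *: (B - A)) -> S (A + t *: (B - A))) ->
  irrg S.
Proof.
move=> SU S0 Sl; split=> // f g rf rg fg0; apply: contrapT => /not_orP[].
move=> /existsNP[A /not_implyP[SA /eqP fA]] /existsNP[B /not_implyP[SB /eqP gB]].
pose l (t : A1 k) : 'M[k]_n := A + (t : k) *: (B - A).
have rl : regm l by apply: regm_add (regm_cst _ _) _; apply: regm_scale (@reg_idA1 k) (regm_cst _ _).
have [dp dE] := reg_A1_poly (reg_det rl).
have key (h : gl -> k) : reg h -> exists e (P : {poly k}),
    forall t, units (l t) -> h (l t) * dp.[t] ^+ e = P.[t].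
  case=> p hp; suff [e [P PE]] : exists e (P : {poly k}), forall t : A1 k, units (l t) ->
      peval (vgen (l t : gl)) p * dp.[t] ^+ e = P.[t].
    by exists e, P => t ut; rewrite hp PE.
  elim: p {hp} => [c|i|p [e [P PE]] q [e' [Q QE]]|p [e [P PE]] q [e' [Q QE]]] /=.
  - by exists 0%N, c%:P => t _; rewrite expr0 mulr1 hornerC.
  - have [lt|le] := ltnP i #|{: 'I_n * 'I_n}|; last first.
      have [iN|iN] := eqVneq i #|{: 'I_n * 'I_n}|; last first.
        exists 0%N, 0 => t _; rewrite horner0 nth_default ?mul0r // size_rcons size_map -cardT.
        by rewrite ltn_neqAle eq_sym iN.
      exists 1%N, 1 => t; rewrite /units /= unitmxE unitfE dE => ut.
      by rewrite iN nth_rcons size_map -cardT ltnn eqxx dE hornerC expr1 mulVf.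
    have [p0 _] : exists p0 : 'I_n * 'I_n, True.
      by move: lt; case: (pickP {: 'I_n * 'I_n}) => [p0|/eq_card0 ->] //; exists p0.
    have [P PE] := reg_A1_poly (rl (nth p0 (enum {: 'I_n * 'I_n}) i).1 (nth p0 (enum {: 'I_n * 'I_n}) i).2).
    exists 0%N, P => t _; rewrite expr0 mulr1 -PE.
    by rewrite nth_rcons size_map -cardT lt (nth_map p0) // -cardT.
  - exists (e + e')%N, (P * dp ^+ e' + Q * dp ^+ e) => t ut.
    by rewrite !hornerE -PE // -QE // exprD; ring.
  - exists (e + e')%N, (P * Q) => t ut.
    by rewrite !hornerE -PE // -QE // exprD; ring.
have [e [P PE]] := key _ rf; have [e' [Q QE]] := key _ rg.
have l0 : l 0 = A by rewrite /l scale0r addr0.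
have l1 : l 1 = B by rewrite /l scale1r addrC subrK.
have uA := SU _ SA; have uB := SU _ SB.
have dA : dp.[0] != 0 by rewrite -dE l0 -unitfE -unitmxE.
have dB : dp.[1] != 0 by rewrite -dE l1 -unitfE -unitmxE.
have P0 : P != 0.
  apply/eqP => P0; have := PE 0; rewrite l0 P0 horner0 => /(_ uA)/eqP.
  by rewrite mulf_eq0 (negbTE fA) expf_eq0 (negbTE dA) andbF.
have Q0 : Q != 0.
  apply/eqP => Q0; have := QE 1; rewrite l1 Q0 horner0 => /(_ uB)/eqP.
  by rewrite mulf_eq0 (negbTE gB) expf_eq0 (negbTE dB) andbF.
have d0 : dp != 0 by apply: contraNneq dA => ->; rewrite horner0.
have [s sE] := closed_field_poly_normal (P * Q * dp).
have [t ts] := closed_field_infinite s.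
have : ~~ root (P * Q * dp) t.
  by rewrite sE rootZ ?root_prod_XsubC // lead_coef_eq0 !mulf_neq0.
rewrite !rootM !negb_or => /andP[/andP[Pt Qt] dt].
have ut : units (l t) by rewrite /units /= unitmxE unitfE dE.
have := fg0 (l t) (Sl _ _ _ SA SB ut) => /eqP; rewrite mulf_eq0 => /orP[/eqP E|/eqP E].
  by move: Pt; rewrite rootE -PE // E mul0r eqxx.
by move: Qt; rewrite rootE -QE // E mul0r eqxx.
Qed.

Lemma Tri_zc : zcg (@Tri k n).
Proof.
have -> : @Tri k n = @units k n `&` [set g | forall i j : 'I_n, (i < j)%N -> g i j = 0].
  by apply/seteqP; split=> g [ug]; [move/is_trig_mxP|move=> gP; split=> //; apply/is_trig_mxP].
apply: zcI; first exact: zc_units.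
apply: zc_forall => i; apply: zc_forall => j; apply: zc_impl; apply: zc_eq0; exact: reg_entry.
Qed.

Lemma Tri_irr : irrg (@Tri k n).
Proof.
apply: irr_lines.
- by move=> g [].
- exists 1%:M; split; first exact: units1.
  by apply/is_trig_mxP => i j ltij; rewrite mxE; case: eqP => // ij; rewrite ij ltnn in ltij.
- move=> A B t [_ /is_trig_mxP TA] [_ /is_trig_mxP TB] u; split=> //.
  by apply/is_trig_mxP => i j ltij; rewrite !mxE TA // TB // subrr mulr0 addr0.
Qed.

Lemma Tri_subgroup : is_subgroup (@Tri k n).
Proof.
have TM (g h : 'M[k]_n) : Tri g -> Tri h -> Tri (g *m h).
  move=> [ug /is_trig_mxP Tg] [uh /is_trig_mxP Th]; split; first by apply/unitsM.
  apply/is_trig_mxP => i j ltij; rewrite mxE big1 // => l _.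
  case: (ltnP l j) => [ltlj|/(leq_trans ltij) ltil]; first by rewrite (Th l j) // mulr0.
  by rewrite (Tg i l) // mul0r.
apply: is_subgroup_ginv => //; first by move=> g [].
  split; first exact: units1.
  by apply/is_trig_mxP => i j ltij; rewrite mxE; case: eqP => // ij; rewrite ij ltnn in ltij.
move=> g [ug Tg]; split; first exact: unitsV.
(* the first nonzero entry right of the diagonal in a column of the inverse
   would survive in the product with [g] *)
have /is_trig_mxP Tg' := Tg; apply/is_trig_mxP => i j; move: i.
have gd i : g i i != 0.
  move: ug; rewrite /units /= unitmxE unitfE det_trig // => /prodf_neq0; exact.
suff key m : forall i : 'I_n, (i < m)%N -> (i < j)%N -> ginv g i j = 0 by move=> i; exact: (key i.+1).
elim: m => // m IH i ltim ltij.
have /matrixP/(_ i j) := mulgV ug; rewrite mxE [_%:M _ _]mxE (bigD1 i) //= big1 ?addr0 => [|l nl].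
  case: eqP => [ij|_]; first by rewrite ij ltnn in ltij.
  by move/eqP; rewrite mulf_eq0 (negbTE (gd i)) /= => /eqP.
case: (ltnP i l) => [ltil|leli]; first by rewrite Tg' ?mul0r.
rewrite IH ?mulr0 //; last exact: leq_ltn_trans leli ltij.
have lneq : (l != i :> nat)%N by apply: contra nl => /eqP E; apply/eqP/val_inj.
by rewrite -ltnS (leq_trans _ ltim) // ltnS ltn_neqAle lneq.
Qed.

(** Realize [D] as stabilizer of the line of [v]. By Lie-Kolchin some linear form [xi] is an
    eigenvector; it does not kill [v], whose orbit spans, so [Phi] vanishes nowhere on [R]. The
    coordinates of [rho g *m v] divided by [Phi] are functions on a complete quotient, hence
    constant, and [R] fixes the line. *)
Theorem complete_solvable R D : is_subgroup R -> zcg R -> irrg R -> is_solvable R ->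
  is_subgroup D -> D `<=` R -> zcg D -> complete R D -> R `<=` D.
Proof.
move=> sR cR iR solR sD DR cD coR.
have [m [rho [v [rrho rhoM rho1 span [v0 stab]]]]] := line_stabilizer sR sD DR cD.
have m0 : (0 < m)%N.
  rewrite lt0n; apply: contraNneq v0 => m0; apply/eqP/colP => i.
  by move: (ltn_ord i); rewrite [X in (_ < X)%N]m0.
have [xi xi0 xiP] := lie_kolchin rrho sR iR solR rhoM rho1 m0.
pose Phi (g : gl) := (xi *m (rho g *m v)) 0 0.
have rrv : regm (fun g => rho g *m v) by apply: regm_mul => //; exact: regm_cst.
have rPhi : reg Phi by apply: (regm_mul (regm_cst _ xi) rrv).
have xv : (xi *m v) 0 0 != 0.
  apply: contraNneq xi0 => xv; apply/eqP; apply: span => g Rg.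
  have [c cE] := xiP g Rg; rewrite mulmxA cE -scalemxAl [xi *m v]mx11_scalar xv.
  by rewrite raddf0 scaler0.
have PhiE g : R g -> exists2 c, c != 0 & Phi g = c * (xi *m v) 0 0.
  move=> Rg; have [c cE] := xiP g Rg; exists c; last by rewrite /Phi mulmxA cE -scalemxAl mxE.
  apply: contraNneq xi0 => c0.
  rewrite -[xi]mulmx1 -rho1 -(mulgV (sgU sR Rg)) rhoM //; last exact: sgV.
  by rewrite mulmxA cE c0 scale0r mul0mx.
have key j : exists c, forall g, R g -> (rho g *m v) j 0 = c * Phi g.
  apply: (@ratio_const R D (fun g => (rho g *m v) j 0) Phi iR cR coR (rrv j 0) rPhi).
  - by move=> x d Rx /DR Rd; exact: sgM.
  - by move=> x /PhiE[c c0 ->]; rewrite mulf_neq0.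
  - move=> x d Rx Dd; have Rd := DR _ Dd; have [c cE] := (stab d Rd).1 Dd.
    have E : rho (x *m d) *m v = c *: (rho x *m v) by rewrite rhoM // -mulmxA cE -scalemxAr.
    by rewrite /Phi E -scalemxAr !mxE; ring.
move=> g Rg; apply/stab => //.
have [c c0 cE] := PhiE g Rg; exists c; apply/colP => j; have [b bP] := key j.
rewrite bP // cE [RHS]mxE -[v in RHS]mul1mx -rho1 bP; last exact: sg1.
by rewrite /Phi rho1 mul1mx; ring.
Qed.

Lemma conj_zc (D : set 'M[k]_n) z : zcg D -> zcg [set g | D (ginv z *m g *m z)].
Proof. by move=> cD; apply: (@zc_preim _ gl gl (fun g => ginv z *m g *m z)) => //; reg_tac. Qed.

Lemma fix_coset_subgroup R D z : is_subgroup R -> is_subgroup D -> units z ->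
  is_subgroup [set r | R r /\ D (ginv z *m r *m z)].
Proof.
move=> sR sD uz; apply: is_subgroup_ginv.
- by move=> g [/(sgU sR)].
- by split; [exact: sg1|rewrite mulmx1 mulVg //; exact: sg1].
- move=> g h [Rg Dg] [Rh Dh]; split; first exact: sgM.
  have := sgM sD Dg Dh; congr D.
  by rewrite !mulmxA -[ginv z *m g *m z *m ginv z]mulmxA mulgV // mulmx1.
- move=> g [Rg Dg]; split; first exact: sgV.
  have := sgV sD Dg; congr D.
  by rewrite !ginvM ginvK // mulmxA.
Qed.

Theorem fixed_point R D S : is_subgroup R -> zcg R -> irrg R -> is_solvable R ->
  is_subgroup D -> zcg D -> irrg D -> zcg S -> S `<=` @units k n -> (exists x, S x) ->
  (forall r s d, R r -> S s -> D d -> S (r *m s *m d)) -> complete S D ->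
  exists2 z, S z & forall r, R r -> D (ginv z *m r *m z).
Proof.
move=> sR cR iR solR sD cD iD cS SU S0 RSD coS.
have [z Sz coR] := complete_fix sR cR iR sD cD iD cS SU S0 RSD coS.
have uz := SU _ Sz; exists z => //.
have sub : [set r | R r /\ D (ginv z *m r *m z)] `<=` R by move=> r [].
have RD := complete_solvable sR cR iR solR (fix_coset_subgroup sR sD uz) sub
  (zcI cR (@conj_zc D z cD)) coR.
by move=> r /RD[].
Qed.

End FixedPoint.

(** * Triangular groups *)

Section UT.
Variables (k : closedFieldType) (n : nat).
Local Notation gl := (glv k n).
Implicit Types g h t : 'M[k]_n.

(** The filtration by distance below the diagonal: at 0 all lower triangular matrices, at 1 the
    unipotent ones, at [n] only the identity. It carries the successive approximations of the
    averaging argument. *)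
Definition UT i : set 'M[k]_n :=
  [set g | units g /\ forall a b : 'I_n, (a < b + i)%N -> g a b = (a == b)%:R].

Lemma UT_zc i : @zc k gl (UT i).
Proof.
apply: zcI; first exact: zc_units.
apply: zc_forall => a; apply: zc_forall => b; apply: zc_impl.
rewrite (_ : (fun _ => _) = [set x : gl | (x : 'M[k]_n) a b - (a == b)%:R = 0]).
  by apply: zc_eq0; apply: regB; [exact: reg_entry|exact: regC].
apply/seteqP; split=> x /=; first by move=> ->; rewrite subrr.
by move/eqP; rewrite subr_eq0 => /eqP.
Qed.

Lemma UT0 g : UT 0 g -> Tri g.
Proof.
move=> [ug gP]; split=> //; apply/is_trig_mxP => a b ltab.
by rewrite gP ?addn0 //; case: eqP => // ab; rewrite ab ltnn in ltab.
Qed.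

Lemma UT_le i j : (i <= j)%N -> UT j `<=` UT i.
Proof.
by move=> leij g [ug gP]; split=> // a b lt; apply: gP; rewrite (leq_trans lt) ?leq_add2l.
Qed.

Lemma UT_Tri i g : UT i g -> Tri g.
Proof. by move/(UT_le (leq0n i))/UT0. Qed.

Lemma UTn g : UT n g -> g = 1%:M.
Proof.
move=> [_ gP]; apply/matrixP => a b; rewrite mxE gP //.
exact: leq_trans (ltn_ord a) (leq_addl _ _).
Qed.

Lemma UT_neq0 i g (a b : 'I_n) : UT i g -> g a b != 0 -> a = b \/ (b + i <= a)%N.
Proof.
move=> [_ gP] gab; case: (ltnP a (b + i)) => [lt|]; last by right.
by move: gab; rewrite gP //; case: (a =P b) => [ab _|_]; [left|rewrite eqxx].
Qed.

Lemma UTM i g h : UT i g -> UT i h -> UT i (g *m h).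
Proof.
move=> Ug Uh; have [[ug gP] [uh hP]] := (Ug, Uh); split; first by apply/unitsM.
move=> a b lt; rewrite mxE (bigD1 a) //= big1 ?addr0 => [|l nl].
  rewrite hP //; case: eqP => [ab|_]; last by rewrite mulr0.
  by rewrite mulr1 gP ?eqxx // {2}ab.
apply/eqP; rewrite mulf_eq0; apply/norP => -[/(UT_neq0 Ug)[al|lel]].
  by move: nl; rewrite al eqxx.
case/(UT_neq0 Uh) => [lb|leb]; first by move: lt; rewrite ltnNge -lb lel.
by move: lt; rewrite ltnNge (leq_trans leb) // (leq_trans (leq_addr _ _) lel).
Qed.

Lemma Tri_neq0 t (a b : 'I_n) : Tri t -> t a b != 0 -> (b <= a)%N.
Proof.
by move=> [_ /is_trig_mxP tP] tab; rewrite leqNgt; apply: contra tab => /tP ->.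
Qed.

Lemma UTV i g : UT i g -> UT i (ginv g).
Proof.
move=> Ug; have [ug gP] := Ug; split; first exact: unitsV.
have Th : Tri (ginv g) by apply: (sgV (Tri_subgroup k n)); exact: UT_Tri Ug.
move=> a b lt.
case: (posnP i) => [i0|i0].
  rewrite i0 addn0 in lt; have [_ /is_trig_mxP ->] := Th; rewrite //.
  by case: eqP => // ab; rewrite ab ltnn in lt.
have -> : ginv g = 1%:M - (g - 1%:M) *m ginv g.
  by rewrite mulmxBl mul1mx mulgV // opprB addrCA subrr addr0.
rewrite mxE [1%:M a b]mxE [X in _ + X]mxE mxE big1 ?subr0 // => l _.
apply/eqP; rewrite mulf_eq0; apply/norP => -[gal /(Tri_neq0 Th) lebl].
move: gal; rewrite !mxE; case: (ltnP a (l + i)) => [/gP ->|lel]; first by rewrite subrr eqxx.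
by move: lt; rewrite ltnNge (leq_trans _ lel) // leq_add2r.
Qed.

Lemma UT_subgroup i : is_subgroup (UT i).
Proof.
apply: is_subgroup_ginv; [by move=> g []| | |].
- by split; [exact: units1|move=> a b _; rewrite mxE].
- by move=> g h; exact: UTM.
- by move=> g; exact: UTV.
Qed.

Lemma UT_conj i g t : UT i g -> Tri t -> UT i (t *m g *m ginv t).
Proof.
move=> Ug Tt; have [ug gP] := Ug; have [ut _] := Tt.
have Th : Tri (ginv t) := sgV (Tri_subgroup k n) Tt.
split; first by apply/unitsM; split; [apply/unitsM|exact: unitsV].
have -> : t *m g *m ginv t = 1%:M + t *m (g - 1%:M) *m ginv t.
  by rewrite mulmxBr mulmxBl mulmx1 mulgV // addrC subrK.
move=> a b lt; rewrite mxE [1%:M a b]mxE [X in _ + X](_ : _ = 0) ?addr0 // mxE big1 // => m _.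
apply/eqP; rewrite mulf_eq0; apply/norP => -[tam /(Tri_neq0 Th) lebm].
case/negP: tam; apply/eqP; rewrite mxE big1 // => l _.
apply/eqP; rewrite mulf_eq0; apply/norP => -[/(Tri_neq0 Tt) lela glm].
move: glm; rewrite !mxE; case: (ltnP l (m + i)) => [/gP ->|lem]; first by rewrite subrr eqxx.
by move: lt; rewrite ltnNge (leq_trans _ lela) // (leq_trans _ lem) // leq_add2r.
Qed.

Lemma UT_nuM i g h (a b : 'I_n) : (0 < i)%N -> a = (b + i)%N :> nat ->
  UT i g -> UT i h -> (g *m h) a b = g a b + h a b.
Proof.
move=> i0 abi Ug Uh; have [[_ gP] [_ hP]] := (Ug, Uh).
have ab : b != a by apply: contraTneq i0 => E; rewrite -leqNgt -(leq_add2l b) -abi E addn0.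
have g1 : g a a = 1 by rewrite gP ?eqxx // -addn1 leq_add2l.
have h1 : h b b = 1 by rewrite hP ?eqxx // -addn1 leq_add2l.
rewrite mxE (bigD1 a) //= (bigD1 b) //= g1 h1 mul1r mulr1 big1 ?addr0 1?addrC // => l /andP[la lb].
apply/eqP; rewrite mulf_eq0; apply/norP => -[/(UT_neq0 Ug)[al|lel]].
  by move: la; rewrite al eqxx.
case/(UT_neq0 Uh) => [lb'|leb]; first by rewrite lb' eqxx in lb.
have : (l + i <= l)%N by rewrite (leq_trans lel) // abi.
by rewrite -[X in (_ <= X)%N]addn0 leq_add2l leqNgt i0.
Qed.

Lemma Tri_diagM g h (a : 'I_n) : Tri g -> Tri h -> (g *m h) a a = g a a * h a a.
Proof.
move=> Tg Th; rewrite mxE (bigD1 a) //= big1 ?addr0 // => l la.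
apply/eqP; rewrite mulf_eq0; apply/norP => -[/(Tri_neq0 Tg) lel /(Tri_neq0 Th) lea].
by case/negP: la; apply/eqP/val_inj/eqP; rewrite eqn_leq lel.
Qed.

Lemma Tri_diag_neq0 g (a : 'I_n) : Tri g -> g a a != 0.
Proof.
move=> [ug Tg]; move: ug; rewrite /units /= unitmxE unitfE det_trig // => /prodf_neq0; exact.
Qed.

Lemma Tri_diagV g (a : 'I_n) : Tri g -> ginv g a a = (g a a)^-1.
Proof.
move=> Tg; have [ug _] := Tg; have Th : Tri (ginv g) := sgV (Tri_subgroup k n) Tg.
have := Tri_diagM a Tg Th; rewrite mulgV // mxE eqxx => /esym E.
by apply: (mulfI (Tri_diag_neq0 a Tg)); rewrite E divff ?Tri_diag_neq0.
Qed.

Lemma Tri_UT1 g : Tri g -> (forall a, g a a = 1) -> UT 1 g.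
Proof.
move=> [ug /is_trig_mxP Tg] g1; split=> // a b; rewrite addn1 ltnS leq_eqVlt => /predU1P[/val_inj ->|lt].
  by rewrite g1 eqxx.
by rewrite Tg //; case: eqP => // ab; rewrite ab ltnn in lt.
Qed.

Lemma UT1_diag g a : UT 1 g -> g a a = 1.
Proof. by move=> [_ gP]; rewrite gP ?eqxx // addn1. Qed.

Lemma UT_nu_conj i g t (a b : 'I_n) : (0 < i)%N -> a = (b + i)%N :> nat ->
  UT i g -> Tri t -> (t *m g *m ginv t) a b = t a a / t b b * g a b.
Proof.
move=> i0 abi Ug Tt; have [ut _] := Tt; have [_ gP] := Ug.
have Th : Tri (ginv t) := sgV (Tri_subgroup k n) Tt.
have ab : (a == b) = false by apply/eqP => E; move: i0; rewrite -(ltn_add2l b) -abi addn0 E ltnn.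
have -> : t *m g *m ginv t = 1%:M + t *m (g - 1%:M) *m ginv t.
  by rewrite mulmxBr mulmxBl mulmx1 mulgV // addrC subrK.
have gz (l m : 'I_n) : (l < m + i)%N -> (g - 1%:M) l m = 0.
  by move=> lt; rewrite !mxE gP // subrr.
rewrite mxE [1%:M a b]mxE ab add0r mxE (bigD1 b) //= big1 ?addr0 => [|m mb].
  rewrite mxE (bigD1 a) //= big1 ?addr0 => [|l la].
    by rewrite Tri_diagV // !mxE ab subr0 mulrAC.
  apply/eqP; rewrite mulf_eq0; apply/norP => -[/(Tri_neq0 Tt) lela].
  by rewrite gz ?eqxx // -abi ltn_neqAle lela andbT; apply: contra la => /eqP E; apply/eqP/val_inj.
apply/eqP; rewrite mulf_eq0; apply/norP => -[tam /(Tri_neq0 Th) lebm].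
case/negP: tam; apply/eqP; rewrite mxE big1 // => l _.
apply/eqP; rewrite mulf_eq0; apply/norP => -[/(Tri_neq0 Tt) lela].
rewrite gz ?eqxx // (leq_ltn_trans lela) // abi ltn_add2r ltn_neqAle lebm andbT.
by apply: contra mb => /eqP E; apply/eqP/val_inj.
Qed.

Lemma UT_next i g : UT i g -> (forall a b : 'I_n, a = (b + i)%N :> nat -> g a b = (a == b)%:R) ->
  UT i.+1 g.
Proof.
move=> [ug gP] gi; split=> // a b; rewrite addnS ltnS leq_eqVlt => /predU1P[/gi//|]; exact: gP.
Qed.

Lemma UT_comm i g h : UT i g -> UT i h -> UT i.+1 (g *m h *m ginv g *m ginv h).
Proof.
case: i => [/UT_Tri Tg /UT_Tri Th|i Ug Uh].
  have sT := Tri_subgroup k n; have Tgi := sgV sT Tg; have Thi := sgV sT Th.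
  have Tgh := sgM sT Tg Th; have Tghg := sgM sT Tgh Tgi.
  apply: Tri_UT1; first exact: sgM.
  move=> a; rewrite !Tri_diagM // !Tri_diagV // [g a a * _ * _]mulrAC divff ?Tri_diag_neq0 //.
  by rewrite mul1r divff ?Tri_diag_neq0.
have sU := UT_subgroup i.+1; have Ugi := sgV sU Ug; have Uhi := sgV sU Uh.
have Ugh := sgM sU Ug Uh; have Ughg := sgM sU Ugh Ugi.
apply: UT_next; first exact: sgM.
move=> a b abi; have ab : (a == b) = false.
  by apply/eqP => E; move: (ltn0Sn i); rewrite -(ltn_add2l b) -abi addn0 E ltnn.
have nuV x : UT i.+1 x -> ginv x a b = - x a b.
  move=> Ux; have Uxi := sgV sU Ux; have [ux _] := Ux.
  have := UT_nuM (ltn0Sn i) abi Ux Uxi; rewrite mulgV // mxE ab => /eqP.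
  by rewrite eq_sym addr_eq0 => /eqP ->; rewrite opprK.
rewrite ab mulr0n !(UT_nuM (ltn0Sn i) abi) // !nuV //; ring.
Qed.

Definition cj (z g : 'M[k]_n) := ginv z *m g *m z.

Lemma cjM z g h : units z -> cj z (g *m h) = cj z g *m cj z h.
Proof.
by move=> uz; rewrite /cj !mulmxA -[ginv z *m g *m z *m ginv z]mulmxA mulgV // mulmx1.
Qed.

Lemma cj1 z : units z -> cj z 1%:M = 1%:M.
Proof. by move=> uz; rewrite /cj mulmx1 mulVg. Qed.

Lemma cjV z g : units z -> cj z (ginv g) = ginv (cj z g).
Proof. by move=> uz; rewrite /cj !ginvM ginvK // mulmxA. Qed.

Lemma cj_inj z g h : units z -> cj z g = cj z h -> g = h.
Proof.
move=> uz /(congr1 (fun x => z *m x *m ginv z)); rewrite /cj !mulmxA mulgV // !mul1mx.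
by rewrite -!mulmxA mulgV // !mulmx1.
Qed.

Lemma cj_subgroup z H : units z -> is_subgroup H -> is_subgroup [set g | H (cj z g)].
Proof.
move=> uz sH; have := fix_coset_subgroup (units_subgroup k n) sH uz; congr is_subgroup.
apply/seteqP; split=> g /=; first by case.
by move=> Hg; split=> //; move: (sgU sH Hg); rewrite /cj => /unitsM[/unitsM[]].
Qed.

Lemma cj_zc z (H : set 'M[k]_n) : @zc k gl H -> @zc k gl [set g | H (cj z g)].
Proof. exact: conj_zc. Qed.

Lemma solvable_Tri z H : units z -> is_subgroup H -> (forall g, H g -> Tri (cj z g)) ->
  is_solvable H.
Proof.
move=> uz sH HT; exists n.
have key i : is_subgroup (iter i (@derived k n) H) /\    iter i (@derived k n) H `<=` [set g | UT i (cj z g)].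
  elim: i => [|i [sI IU]].
    split=> // g /HT [ug /is_trig_mxP Tg]; split=> // a b; rewrite addn0 => lt.
    by rewrite Tg //; case: eqP => // ab; rewrite ab ltnn in lt.
  rewrite iterS; split; first exact: derived_subgroup.
  apply: gen_sub; first exact: cj_subgroup (UT_subgroup _).
  move=> g /(commsetP _ sI)[x [y [/IU Ux /IU Uy ->]]].
  by rewrite /= !cjM // !cjV //; exact: UT_comm.
have [sI IU] := key n; apply/seteqP; split=> g; last by move=> ->; exact: sg1.
by move/IU => /UTn E; apply: (cj_inj uz); rewrite cj1.
Qed.

Lemma unip_UT1 g m : Tri g -> (g - 1%:M) ^+ m = 0 -> UT 1 g.
Proof.
move=> Tg gm; apply: Tri_UT1 => // a; have [_ /is_trig_mxP tg] := Tg.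
have key j : is_trig_mx ((g - 1%:M) ^+ j) /\ ((g - 1%:M) ^+ j) a a = (g a a - 1) ^+ j.
  elim: j => [|j [/is_trig_mxP IH1 IH2]].
    rewrite !expr0 mxE eqxx; split=> //; apply/is_trig_mxP => i b lt.
    by rewrite mxE; case: eqP => // ib; rewrite ib ltnn in lt.
  have t1 (i b : 'I_n) : (i < b)%N -> (g - 1%:M) i b = 0.
    by move=> lt; rewrite !mxE tg // sub0r; case: eqP => [ib|_]; [rewrite ib ltnn in lt|rewrite oppr0].
  rewrite exprS; split.
    apply/is_trig_mxP => i b lt; rewrite mxE big1 // => l _.
    case: (ltnP i l) => [lil|leli]; first by rewrite t1 ?mul0r.
    by rewrite IH1 ?mulr0 // (leq_ltn_trans leli).
  rewrite mxE (bigD1 a) //= big1 ?addr0 => [|l la]; first by rewrite IH2 exprS !mxE eqxx.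
  case: (ltnP a l) => [lal|]; first by rewrite t1 ?mul0r.
  rewrite leq_eqVlt => /predU1P[/val_inj E|lt]; first by rewrite E eqxx in la.
  by rewrite IH1 ?mulr0.
have [_] := key m; rewrite gm mxE => /esym/eqP; rewrite expf_eq0 subr_eq0 => /andP[_ /eqP].
by [].
Qed.

Lemma UT1_unip g : UT 1 g -> (g - 1%:M) ^+ n = 0.
Proof.
move=> [_ gP]; have key j (a b : 'I_n) : (a < b + j)%N -> ((g - 1%:M) ^+ j) a b = 0.
  elim: j a b => [|j IH] a b lt.
    by rewrite expr0 mxE; case: eqP => // ab; move: lt; rewrite ab addn0 ltnn.
  rewrite exprS mxE big1 // => l _; case: (ltnP a l.+1) => [lal|ltla].
    by rewrite !mxE gP ?addn1 // subrr mul0r.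
  by rewrite IH ?mulr0 // -ltnS -addnS (leq_ltn_trans ltla).
apply/matrixP => a b; rewrite key ?mxE //.
exact: leq_trans (ltn_ord a) (leq_addl _ _).
Qed.

End UT.

(** * Algebraic groups and Borel subgroups *)

Section Conversions.
Variables (k : closedFieldType) (n : nat).
Local Notation gl := (glv k n).
Local Notation irrg X := (@irr k gl X).
Local Notation zcg X := (@zc k gl X).
Implicit Types G H B D : set 'M[k]_n.

Lemma reg_poly_at p : @reg k gl (fun A => poly_at p A).
Proof.
apply: (@reg_eq _ gl (fun A => \sum_(m <- msupp p) p@_m * \prod_i mxvec A 0 i ^+ m i)).
  by move=> A; rewrite /poly_at mevalE.
apply: reg_sum => m _; apply: regM (regC _ _) _; apply: reg_prod => i _; apply: regX.
case/mxvec_indexP: i => a b; apply: (@reg_eq k gl (fun A => (A : 'M[k]_n) a b)).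
  by move=> A; rewrite mxvecE.
exact: reg_entry.
Qed.

Lemma zclosed_zc (Z : set 'M[k]_n) : zclosed Z -> zcg Z.
Proof.
move/zclosedP => [I ->] x /existsNP[p /not_implyP[Ip px]].
exists (fun A => poly_at p A); split=> //; [exact: reg_poly_at|by move=> z; apply].
Qed.

Definition detp : {mpoly k[n * n]} := \det (\matrix_(i < n, j < n) 'X_(mxvec_index i j)).

Lemma poly_at_det A : poly_at detp A = \det A.
Proof.
rewrite /poly_at /detp -det_map_mx; congr (\det _); apply/matrixP => i j.
by rewrite !mxE /= mevalXU mxvecE.
Qed.

Lemma reg_poly_det (f : gl -> k) : reg f ->
  exists p e, forall g : 'M[k]_n, units g -> f g * \det g ^+ e = poly_at p g.
Proof.
case=> q fq; suff [p [e pE]] : exists p e, forall g : 'M[k]_n, units g ->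
    peval (vgen (g : gl)) q * \det g ^+ e = poly_at p g.
  by exists p, e => g ug; rewrite fq pE.
elim: q {fq} => [c|i|p [P [d PE]] q [Q [e QE]]|p [P [d PE]] q [Q [e QE]]] /=.
- by exists c%:MP, 0%N => g _; rewrite expr0 mulr1 /poly_at mevalC.
- have [lt|le] := ltnP i #|{: 'I_n * 'I_n}|; last first.
    have [iN|iN] := eqVneq i #|{: 'I_n * 'I_n}|; last first.
      exists 0, 0%N => g _; rewrite /poly_at meval0 nth_default ?mul0r // size_rcons size_map -cardT.
      by rewrite ltn_neqAle eq_sym iN.
    exists 1, 1%N => g; rewrite /units /= unitmxE unitfE => ug.
    by rewrite iN nth_rcons size_map -cardT ltnn eqxx /poly_at meval1 expr1 mulVf.
  have [p0 _] : exists p0 : 'I_n * 'I_n, True.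
    by move: lt; case: (pickP {: 'I_n * 'I_n}) => [p0|/eq_card0 ->] //; exists p0.
  pose ab := nth p0 (enum {: 'I_n * 'I_n}) i.
  exists 'X_(mxvec_index ab.1 ab.2), 0%N => g _; rewrite expr0 mulr1 /poly_at mevalXU mxvecE.
  by rewrite nth_rcons size_map -cardT lt (nth_map p0) // -cardT.
- exists (P * detp ^+ e + Q * detp ^+ d), (d + e)%N => g ug.
  rewrite /poly_at mevalD !mevalM !rmorphXn /= -!/(poly_at _ _) poly_at_det -PE // -QE // exprD; ring.
- exists (P * Q), (d + e)%N => g ug.
  by rewrite /poly_at mevalM -!/(poly_at _ _) -PE // -QE // exprD; ring.
Qed.

Lemma zc_zclosed (Z : set 'M[k]_n) : zcg Z -> Z `<=` @units k n ->
  exists2 Z', zclosed Z' & Z = Z' `&` [set g | g \in unitmx].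
Proof.
move=> cZ ZU; exists (zero_locus [set p | forall g, Z g -> poly_at p g = 0]).
  by apply/zclosedP; eexists.
apply/seteqP; split=> g; first by move=> Zg; split; [move=> p; apply|exact: ZU].
move=> [gZ ug]; apply: contrapT => /cZ[f [rf fZ /eqP fg]].
have [p [e pE]] := reg_poly_det rf.
have /eqP : poly_at p g = 0 by apply: gZ => h Zh; rewrite -pE ?fZ ?mul0r //; exact: ZU.
by rewrite -pE // mulf_eq0 (negbTE fg) expf_eq0 -[\det g == 0]negbK -unitfE -unitmxE ug andbF.
Qed.

Lemma algebraic_groupP H : algebraic_group H <-> is_subgroup H /\ zcg H.
Proof.
split=> [[sH [Z cZ HE]]|[sH cH]].
  by split=> //; rewrite HE; apply: zcI (zclosed_zc cZ) (@zc_units k n).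
split=> //; apply: zc_zclosed => // g; exact: sgU.
Qed.

Lemma regular_on_reg H f : H `<=` @units k n -> regular_on H f ->
  exists2 F : gl -> k, reg F & forall g, H g -> F g = f g.
Proof.
move=> HU [p [e pE]]; exists (fun g => poly_at p g * (\det (g : 'M[k]_n))^-1 ^+ e).
  by apply: regM (reg_poly_at p) _; apply: regX; exact: reg_detV.
by move=> g Hg; rewrite pE // exprVn.
Qed.

Lemma irr_zconnected H : irrg H -> zconnected H.
Proof.
move=> iH A [a Aa] [C oC AE] [C' cC' AE'].
have [|||HC|HC] := @irr_sub_setU k gl H C' (~` C) iH.
- exact: zclosed_zc.
- by apply: zclosed_zc; rewrite /zclosed closedC.
- move=> h Hh; have [Ch|nC] := pselect (C h); last by right.
  by left; have : A h by [rewrite AE; split]; rewrite AE' => -[].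
- rewrite AE'; apply/seteqP; split=> h; first by case.
  by move=> Hh; split=> //; exact: HC.
- by move: Aa; rewrite AE => -[/HC].
Qed.

(** The identity component is closed of finite index, so the union [O] of the other cosets is closed
    too, and connectedness leaves no other coset. *)
Lemma zconnected_irr H : is_subgroup H -> zcg H -> zconnected H -> irrg H.
Proof.
move=> sH cH coH; suff <- : idcomp H = H by exact: idcomp_irr.
have cI := idcomp_zc sH cH; have sI := idcomp_subgroup sH.
have [m [q [qH qP]]] := idcomp_index sH cH.
have HU : H `<=` @units k n by move=> g; exact: sgU.
have IU : idcomp H `<=` @units k n by move=> g /idcomp_sub/HU.
pose O : set 'M[k]_n := [set g | exists2 i, (i < m)%N &
  ~ idcomp H (q i) /\ idcomp H (ginv (q i) *m g)].
have cO : zcg O.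
  apply: (@zc_bigU k gl (fun i => [set g | ~ idcomp H (q i) /\ idcomp H (ginv (q i) *m g)])) => i _.
  have [nq|/contrapT iq] := pselect (~ idcomp H (q i)); last first.
    rewrite (_ : [set g | _] = set0); first exact: zc0.
    by apply/seteqP; split=> g // -[].
  rewrite (_ : [set g | _] = [set g | idcomp H (ginv (q i) *m g)]).
    by apply: (@zc_preim _ gl gl (fun g => ginv (q i) *m g)) => //; reg_tac.
  by apply/seteqP; split=> g /=; [case|].
have OU : O `<=` @units k n by move=> g [i _ [_ /IU/unitsM[]]].
have OH : forall g, H g -> O g <-> ~ idcomp H g.
  move=> g Hg; have ug := HU _ Hg; split.
    move=> [i ltim [nq Ig]] I1; apply: nq.
    have uq := HU _ (qH _ ltim).
    have := sgM sI I1 (sgV sI Ig); rewrite ginvM ginvK // mulmxA mulgV // mul1mx.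
    by [].
  move=> nI; have [i ltim Ig] := qP g Hg; exists i => //; split=> // Iq.
  apply: nI; have := sgM sI Iq Ig; rewrite mulmxA mulgV ?mul1mx //; exact: HU (qH _ ltim).
have [C cC IE] := zc_zclosed cI IU; have [C' cC' OE] := zc_zclosed cO OU.
apply: coH.
- by exists 1%:M; exact: idcomp1.
- exists (~` C'); first by move: cC'; rewrite /zclosed -openC.
  apply/seteqP; split=> g.
    move=> Ig; have Hg := idcomp_sub Ig; split=> // C'g.
    by apply: (OH g Hg).1 Ig; rewrite OE; split=> //; exact: HU.
  move=> [Hg nC']; apply: contrapT => /(OH g Hg); rewrite OE => -[C'g _]; exact: nC'.
- exists C => //; apply/seteqP; split=> g.
    by move=> Ig; split; [exact: idcomp_sub Ig|move: Ig; rewrite IE => -[]].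
  by move=> [Hg Cg]; rewrite IE; split=> //; exact: HU.
Qed.

Definition csc G H : Prop := [/\ is_subgroup H, zcg H, irrg H, is_solvable H & H `<=` G].

Lemma borelP G B : borel_subgroup G B <->
  csc G B /\ forall B', csc G B' -> B `<=` B' -> B' = B.
Proof.
have E H : csc G H <-> [/\ algebraic_group H, zconnected H, is_solvable H & H `<=` G].
  split=> [[sH cH iH solH HG]|[/algebraic_groupP[sH cH] coH solH HG]].
    by split=> //; [exact/algebraic_groupP|exact: irr_zconnected].
  by split=> //; exact: zconnected_irr.
by split=> -[/E cB maxB]; split=> // B' /E; exact: maxB.
Qed.

Lemma complete_conj S D y : units y -> complete S D ->
  (forall s, S s -> S (s *m y)) -> complete S [set g | D (cj y g)].
Proof.
move=> uy coS Sy W Y cY YS YD.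
have E x : x *m y *m ginv y = x by rewrite -mulmxA mulgV // mulmx1.
have E' x : x *m ginv y *m y = x by rewrite -mulmxA mulVg // mulmx1.
have := coS W [set p | Y (p.1 *m ginv y, p.2)].
rewrite (_ : [set w | exists x, _] = [set w | exists x, Y (x, w)]); last first.
  apply/seteqP; split=> w /= [x Yx]; first by exists (x *m ginv y).
  by exists (x *m y); rewrite E.
apply.
- by apply: (@zc_preim _ _ _ (fun p : prodv gl W => (p.1 *m ginv y, p.2) : prodv gl W)) => //; reg_tac.
- by move=> x w /YS/Sy; rewrite E'.
- move=> x w d Dd /= Yx; rewrite -[x in x *m d]E' -!mulmxA !mulmxA -[_ *m y *m d *m _]mulmxA.
  have := YD _ _ (y *m d *m ginv y) _ Yx; rewrite !mulmxA; apply=> /=.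
  by rewrite /cj !mulmxA mulVg // mul1mx E'.
Qed.

(** The finite union [Y'] of translates of a [D0]-stable family by coset representatives is stable
    under [D] and has the same image. *)
Lemma complete_index S D D0 : is_subgroup D -> is_subgroup D0 -> D0 `<=` D ->
  (exists m (q : nat -> 'M[k]_n), (forall i, (i < m)%N -> D (q i)) /\
     forall g, D g -> exists2 i, (i < m)%N & D0 (ginv (q i) *m g)) ->
  (forall s d, S s -> D d -> S (s *m d)) -> complete S D -> complete S D0.
Proof.
move=> sD sD0 D0D [m [q [qD qP]]] SD coS W Y cY YS YD.
pose Y' : set (prodv gl W) := [set p | exists2 i, (i < m)%N & Y (p.1 *m q i, p.2)].
rewrite (_ : [set w | _] = [set w | exists x, Y' (x, w)]); last first.
  apply/seteqP; split=> w /= [x Yx]; last by case: Yx => i _ Yi; exists (x *m q i).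
  have [i ltim _] := qP 1%:M (sg1 sD); have uq := sgU sD (qD _ ltim).
  by exists (x *m ginv (q i)), i => //=; rewrite -mulmxA mulVg // mulmx1.
apply: coS.
- apply: zc_bigU => i _.
  by apply: (@zc_preim _ _ _ (fun p : prodv gl W => (p.1 *m q i, p.2) : prodv gl W)) => //; reg_tac.
- move=> x w [i ltim /= /YS Sx]; have Dq := qD _ ltim; have uq := sgU sD Dq.
  by have := SD _ _ Sx (sgV sD Dq); rewrite -mulmxA mulgV // mulmx1.
- move=> x w d Dd [i ltim /= Yx]; have Dq := qD _ ltim; have uq := sgU sD Dq.
  have ud := sgU sD Dd.
  have [j ltjm D0j] := qP _ (sgM sD (sgV sD Dd) Dq); exists j => //=.
  have uqj := sgU sD (qD _ ltjm).
  have := YD _ _ _ (sgV sD0 D0j) Yx.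
  by rewrite !ginvM !ginvK // !mulmxA -[x *m q i *m _]mulmxA mulgV // mulmx1.
Qed.

Lemma csc_conj G H y : csc G H -> is_subgroup G -> G y -> csc G [set g | H (cj y g)].
Proof.
move=> [sH cH iH [m Hm] HG] sG Gy; have uy := sgU sG Gy.
have sub : [set g | H (cj y g)] `<=` G.
  move=> g /HG Gg; have := sgM sG (sgM sG Gy Gg) (sgV sG Gy).
  by rewrite /cj !mulmxA mulgV // mul1mx -mulmxA mulgV // mulmx1.
have sK := cj_subgroup uy sH; split=> //; first exact: cj_zc.
- have r : regmap ((fun h => y *m h *m ginv y) : gl -> gl) by reg_tac.
  have := irr_image r iH; congr irr; apply/seteqP; split=> g.
    by move=> [h Hh <-]; rewrite /= /cj !mulmxA mulVg // mul1mx -mulmxA mulVg // mulmx1.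
  move=> /= Hg; exists (cj y g) => //.
  by rewrite /cj !mulmxA mulgV // mul1mx -mulmxA mulgV // mulmx1.
- exists m; have key i : is_subgroup (iter i (@derived k n) H) /\
      iter i (@derived k n) [set g | H (cj y g)] = [set g | iter i (@derived k n) H (cj y g)].
    elim: i => // i [sI IE]; rewrite !iterS; split; first exact: derived_subgroup.
    have sIc := cj_subgroup uy sI; rewrite IE.
    apply/seteqP; split.
      apply: gen_sub; first by apply: cj_subgroup => //; exact: derived_subgroup.
      move=> g /(commsetP _ sIc)[a [b [Ia Ib ->]]] /=; rewrite !cjM // !cjV //.
      by apply: sub_gen; apply/(commsetP _ sI); exists (cj y a), (cj y b).
    move=> g; pose K := [set h | derived [set g | iter i (@derived k n) H (cj y g)] (y *m h *m ginv y)].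
    have uyi := unitsV uy.
    have sK' : is_subgroup K.
      have := cj_subgroup uyi (derived_subgroup sIc); congr is_subgroup.
      by apply/seteqP; split=> h; rewrite /K /cj /= ginvK.
    have : derived (iter i (@derived k n) H) `<=` K.
      apply: gen_sub => // h /(commsetP _ sI)[a [b [Ia Ib ->]]]; rewrite /K /=.
      have cc x : cj y (y *m x *m ginv y) = x.
        by rewrite /cj !mulmxA mulVg // mul1mx -mulmxA mulVg // mulmx1.
      apply: sub_gen; apply/(commsetP _ sIc).
      exists (y *m a *m ginv y), (y *m b *m ginv y); split; rewrite /= ?cc //.
      move: (cc a) (cc b); move: (y *m a *m ginv y) (y *m b *m ginv y) => a' b' Ea Eb.
      by apply: (cj_inj uy); rewrite cc !cjM // !cjV // Ea Eb.
    move=> sub' /= /sub'; rewrite /K /= /cj !mulmxA mulgV // mul1mx -mulmxA mulgV // mulmx1.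
    by [].
  have [_ ->] := key m; rewrite Hm; apply/seteqP; split=> g /=.
    by move=> E; apply: (cj_inj uy); rewrite cj1.
  by move=> ->; rewrite cj1.
Qed.

(** A closed orbit of [G] on triangular cosets gives a conjugate of [Tri] whose intersection [Q]
    with [G] has a complete quotient. Its identity component is connected, solvable and still has a
    complete quotient, so [B] fixes a point there; by maximality [B] is a conjugate of that
    component. *)
Theorem complete_borel G B : is_subgroup G -> zcg G -> irrg G -> borel_subgroup G B ->
  complete G B /\ exists2 z, units z & forall b, B b -> Tri (cj z b).
Proof.
move=> sG cG iG /borelP[cscB maxB]; have [sB cB iB solB BG] := cscB.
have GU : G `<=` @units k n by move=> g; exact: sgU.
have [z uz coQ] : exists2 z, units z & complete G [set g | G g /\ Tri (ginv z *m g *m z)].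
  apply: (complete_fix sG cG iG (Tri_subgroup k n) (@Tri_zc k n) (@Tri_irr k n) (@zc_units k n)) => //.
  - by exists 1%:M; exact: units1.
  - by move=> r s d Gr us [ud _]; apply/unitsM; split=> //; apply/unitsM; split=> //; exact: GU.
  - exact: complete_Tri.
set Q := [set g | _] in coQ.
have sQ : is_subgroup Q := fix_coset_subgroup sG (Tri_subgroup k n) uz.
have cQ : zcg Q := zcI cG (@conj_zc _ _ _ z (@Tri_zc k n)).
have sD := idcomp_subgroup sQ; have cD := idcomp_zc sQ cQ; have iD := idcomp_irr sQ.
have DQ := @idcomp_sub _ _ Q.
have coD : complete G (idcomp Q).
  apply: (complete_index sQ sD DQ (idcomp_index sQ cQ)) => // s d Gs [Gd _]; exact: sgM.
have DT g : idcomp Q g -> Tri (cj z g) by move=> /DQ[].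
have cscD : csc G (idcomp Q).
  by split=> //; [exact: solvable_Tri DT|move=> g /DQ[]].
have [|||y Gy yB] := fixed_point sB cB iB solB sD cD iD cG GU.
- by exists 1%:M; exact: sg1.
- by move=> r s d /BG Gr Gs /DQ[Gd _]; apply: sgM => //; exact: sgM.
- by [].
have uy := GU _ Gy; have cscD' := csc_conj cscD sG Gy.
have BE : [set g | idcomp Q (cj y g)] = B by apply: maxB.
split; first by rewrite -BE; apply: complete_conj => // s Gs; exact: sgM.
exists (y *m z); first by apply/unitsM.
move=> b; rewrite -BE /= => /DT; congr Tri; by rewrite /cj ginvM !mulmxA.
Qed.

Lemma borel_fixed_point G B R S : is_subgroup G -> zcg G -> irrg G -> borel_subgroup G B ->
  is_subgroup R -> zcg R -> irrg R -> is_solvable R -> zcg S -> S `<=` G -> (exists x, S x) ->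
  (forall r s b, R r -> S s -> B b -> S (r *m s *m b)) ->
  exists2 z, S z & forall r, R r -> B (ginv z *m r *m z).
Proof.
move=> sG cG iG bB sR cR iR solR cS SG S0 RSB.
have [coB _] := complete_borel sG cG iG bB; have /borelP[[sB cB iB _ _] _] := bB.
apply: fixed_point => //; last exact: complete_sub coB SG.
by move=> s /SG; exact: sgU.
Qed.

End Conversions.

(** * Unipotent elements *)

Section RegOn.
Variable k : closedFieldType.
Implicit Types X Y W : var k.

(** Regularity on a subset, for maps that agree with regular functions only there, such as roots of
    unipotent matrices or the projection to a Levi subgroup. *)
Definition regon X Y (S : set X) (h : X -> Y) : Prop :=
  forall f, reg f -> exists2 F, reg F & forall x, S x -> f (h x) = F x.

Lemma regonP X Y (S : set X) (h : X -> Y) :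
  (forall i, exists2 F, reg F & forall x, S x -> vgen (h x) i = F x) -> regon S h.
Proof.
move=> hP f [p fp]; suff [F rF FE] : exists2 F, reg F & forall x, S x -> peval (vgen (h x)) p = F x.
  by exists F => // x Sx; rewrite fp FE.
elim: p {fp} => [c|i|p [F rF FE] q [G rG GE]|p [F rF FE] q [G rG GE]] /=.
- by exists (fun=> c) => //; exact: regC.
- exact: hP.
- by exists (fun x => F x + G x) => [|x Sx]; [exact: regD|rewrite FE ?GE].
- by exists (fun x => F x * G x) => [|x Sx]; [exact: regM|rewrite FE ?GE].
Qed.

Lemma regmap_on X Y (S : set X) (h : X -> Y) : regmap h -> regon S h.
Proof. by move=> rh f rf; exists (fun x => f (h x)) => //; exact: reg_comp. Qed.

Lemma regon_comp X Y W (S : set X) (S' : set Y) (h : X -> Y) (g : Y -> W) :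
  regon S h -> (forall x, S x -> S' (h x)) -> regon S' g -> regon S (fun x => g (h x)).
Proof.
move=> rh hS rg f rf; have [F rF FE] := rg f rf; have [G rG GE] := rh F rF.
by exists G => // x Sx; rewrite FE ?GE //; exact: hS.
Qed.

Lemma regon_pair X Y W (S : set X) (g : X -> Y) (h : X -> W) :
  regon S g -> regon S h -> regon S (fun x => (g x, h x) : prodv Y W).
Proof.
move=> rg rh; apply: regonP => i; rewrite /= /prodv_gen /=; case: (i < vdim Y)%N.
  exact: rg _ (regV Y i).
exact: rh _ (regV W (i - vdim Y)).
Qed.

Lemma irr_regon X Y (S Z : set X) (h : X -> Y) : regon S h -> Z `<=` S -> irr Z -> irr (h @` Z).
Proof.
move=> rh ZS [[x Zx] iZ]; split; first by exists (h x), x.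
move=> f g /rh[F rF FE] /rh[G rG GE] fg0.
have [z Zz|F0|G0] := iZ F G rF rG.
- by have Sz := ZS _ Zz; rewrite -(FE _ Sz) -(GE _ Sz) fg0 //; exists z.
- by left=> _ [z Zz <-]; rewrite FE ?F0 //; exact: ZS.
- by right=> _ [z Zz <-]; rewrite GE ?G0 //; exact: ZS.
Qed.

Lemma zc_regon X Y (S : set X) (Z : set Y) (h : X -> Y) :
  regon S h -> zc S -> zc Z -> zc [set x | S x /\ Z (h x)].
Proof.
move=> rh cS cZ x /not_andP[/cS[f [rf fS fx]]|nZ].
  by exists f; split=> // z [Sz _]; exact: fS.
have [Sx|/cS[f [rf fS fx]]] := pselect (S x); last by exists f; split=> // z [Sz _]; exact: fS.
have [f [rf fZ fx]] := cZ _ nZ; have [F rF FE] := rh f rf.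
by exists F; split=> // [z [Sz Zz]|]; rewrite -FE // fZ.
Qed.

Variable n : nat.
Local Notation gl := (glv k n).

Lemma regonM X (S : set X) (g h : X -> 'M[k]_n) : regon (Y := gl) S g -> regon (Y := gl) S h ->
  regon (Y := gl) S (fun x => g x *m h x).
Proof.
move=> rg rh; have := regon_pair rg rh; move/regon_comp.
move=> /(_ gl setT (fun p => p.1 *m p.2) (fun _ _ => I)); apply.
by apply: regmap_on; reg_tac.
Qed.

Lemma regonV X (S : set X) (g : X -> 'M[k]_n) : regon (Y := gl) S g ->
  regon (Y := gl) S (fun x => ginv (g x)).
Proof.
move=> rg; apply: (regon_comp (S' := setT) (g := fun x : gl => ginv x : gl) rg) => //.
by apply: regmap_on; reg_tac.
Qed.

End RegOn.

Section Powers.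
Variables (k : closedFieldType) (n : nat).
Local Notation gl := (glv k n).
Implicit Types u : 'M[k]_n.

Definition unips : set 'M[k]_n := [set u | (u - 1%:M) ^+ n = 0].

Lemma sub1_exp_pchar (R : nzRingType) p (x : R) e : p \in [pchar R] ->
  (x - 1) ^+ (p ^ e) = x ^+ (p ^ e) - 1.
Proof.
move=> pR; elim: e => [|e IH]; first by rewrite !expr1.
rewrite expnSr !exprM IH -!(pFrobenius_autE pR) pFrobenius_autB_comm; last exact: commr1.
by rewrite pFrobenius_aut1.
Qed.

Lemma unip_exp_pchar p u : p \in [pchar k] -> unips u -> u ^+ (p ^ n) = 1%:M.
Proof.
rewrite /unips /=; case: n u => [|m] u pk un; first by apply/matrixP => -[].
have pM : p \in [pchar 'M[k]_m.+1] by rewrite (pchar_lalg 'M[k]_m.+1).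
apply/eqP; rewrite -subr_eq0 -[1%:M]/1 -(sub1_exp_pchar _ _ pM); apply/eqP.
have lt : (m.+1 < p ^ m.+1)%N by apply: ltn_expl; apply: prime_gt1; exact: pcharf_prime pk.
by rewrite -(subnK (ltnW lt)) exprD un mulr0.
Qed.

Section CharZero.
Hypothesis ch0 : forall m : nat, (m%:R == 0 :> k) = (m == 0%N).

(** The binomial coefficient of [x] over [j], so that [upow] is the binomial series for u^x; for
    unipotent [u] it terminates. *)
Definition bk (x : k) j : k := (\prod_(i < j) (x - i%:R)) / (j`!)%:R.

Definition upow u (x : k) : 'M[k]_n := \sum_(j < n) bk x j *: (u - 1%:M) ^+ j.

Lemma bk_nat a j : bk a%:R j = ('C(a, j))%:R.
Proof.
have jf : (j`!)%:R != 0 :> k by rewrite ch0 -lt0n fact_gt0.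
apply: (mulIf jf); rewrite divfK // -natrM bin_ffact.
have [lt|le] := ltnP a j.
  by rewrite ffact_small // (bigD1 (Ordinal lt)) //= subrr mul0r.
rewrite ffact_prod natr_prod; apply: eq_bigr => i _; rewrite natrB //.
exact: leq_trans (ltnW (ltn_ord i)) le.
Qed.

Lemma upow_nat u a : unips u -> upow u a%:R = u ^+ a.
Proof.
rewrite /unips /= => un; have -> : u ^+ a = (u - 1 + 1) ^+ a by rewrite subrK.
rewrite exprD1n /upow.
have E1 : \sum_(j < n) bk a%:R j *: (u - 1%:M) ^+ j =
    \sum_(j < n + a.+1) (u - 1) ^+ j *+ 'C(a, j).
  rewrite [RHS]big_split_ord /= [X in _ = _ + X]big1 ?addr0 => [|i _].
    by apply: eq_bigr => j _; rewrite bk_nat -scaler_nat.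
  by rewrite exprD -[u - 1]/(u - 1%:M) un mul0r mul0rn.
rewrite E1 addnC big_split_ord /= [X in _ + X = _]big1 ?addr0 // => i _.
by rewrite bin_small ?mulr0n // ltn_addr.
Qed.

Lemma poly_nat0 (p : {poly k}) : (forall a : nat, p.[a%:R] = 0) -> p = 0.
Proof.
move=> pa; apply: contrapT => /eqP p0.
have := max_poly_roots p0 (rs := [seq i%:R | i <- iota 0 (size p)]).
rewrite size_map size_iota ltnn => /(_ _ _)/negP; apply=> //.
  by apply/allP => _ /mapP[i _ ->]; apply/rootP.
rewrite map_inj_uniq ?iota_uniq // => i j.
wlog le : i j / (i <= j)%N => [W|] E.
  by case: (leqP i j) => [/W|/ltnW/W W']; [exact|apply/esym/W'].
apply/eqP; rewrite eqn_leq le /= -subn_eq0 -ch0 natrB // E subrr.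
by [].
Qed.

Lemma reg_nat0 (f : A1 k -> k) : reg f -> (forall a : nat, f (a%:R : k) = 0) -> forall x, f x = 0.
Proof.
move=> rf f0 x; have [p pE] := reg_A1_poly rf.
by rewrite pE (@poly_nat0 p) ?horner0 // => a; rewrite -pE.
Qed.

Lemma reg_bk j : @reg k (A1 k) (fun x : k => bk x j).
Proof.
apply: regM (regC _ _); apply: reg_prod => i _; apply: regB (regC _ _); exact: reg_idA1.
Qed.

Lemma regm_upow u : @regm k (A1 k) n n (upow u).
Proof. by apply: regm_sum => j _; apply: regm_scale (reg_bk j) (regm_cst _ _). Qed.

Lemma upowD u x y : unips u -> upow u (x + y) = upow u x *m upow u y.
Proof.
move=> un.
have key (f : k -> k -> 'M[k]_n) :
    (forall y, @regm k (A1 k) n n (f^~ y)) -> (forall x, @regm k (A1 k) n n (f x)) ->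
    (forall a b : nat, f a%:R b%:R = 0) -> forall x y, f x y = 0.
  move=> r1 r2 f0 {}x {}y; apply/matrixP => i j; rewrite [RHS]mxE.
  apply: (reg_nat0 (r1 y i j)) => a; apply: (reg_nat0 (r2 a%:R i j)) => b.
  by rewrite f0 mxE.
apply/eqP; rewrite -subr_eq0; apply/eqP.
apply: (key (fun x y => upow u (x + y) - upow u x *m upow u y)).
- move=> {}y; apply: regm_sub; last exact: regm_mul (regm_upow u) (regm_cst _ _).
  move=> i j; apply: (@reg_comp _ (A1 k) (A1 k) (fun x : k => x + y)) (regm_upow u i j).
  by apply/reg_A1; apply: regD (@reg_idA1 k) (regC _ _).
- move=> {}x; apply: regm_sub; last exact: regm_mul (regm_cst _ _) (regm_upow u).
  move=> i j; apply: (@reg_comp _ (A1 k) (A1 k) (fun y : k => x + y)) (regm_upow u i j).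
  by apply/reg_A1; apply: regD (regC _ _) (@reg_idA1 k).
- by move=> a b; rewrite -natrD !upow_nat // exprD subrr.
Qed.

Lemma upowN u x : unips u -> upow u x *m upow u (- x) = 1%:M.
Proof. by move=> un; rewrite -upowD // subrr -[0]/(0%:R) upow_nat. Qed.

Lemma upow_detV u x : unips u -> (\det (upow u x))^-1 = \det (upow u (- x)).
Proof.
move=> un; have E : \det (upow u x) * \det (upow u (- x)) = 1 by rewrite -det_mulmx upowN // det1.
have d0 : \det (upow u x) != 0.
  by apply: contra_eq_neq E => ->; rewrite mul0r eq_sym oner_eq0.
by apply: (mulfI d0); rewrite E divff.
Qed.

Lemma upow_regmap u : unips u -> regmap (upow u : A1 k -> gl).
Proof.
move=> un; apply: regmap_gl; first exact: regm_upow.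
apply: (@reg_eq _ (A1 k) (fun x : k => \det (upow u (- x)))) => [x|].
  by rewrite upow_detV.
apply: (@reg_comp _ (A1 k) (A1 k) (fun x : k => - x) (fun x => \det (upow u x))).
  by apply/reg_A1; apply: regN; exact: reg_idA1.
by apply: reg_det; exact: regm_upow.
Qed.

(** Along x the defining functions of [R] become polynomials that vanish at all naturals, hence
    everywhere in characteristic 0. *)
Lemma upow_in u x R : unips u -> is_subgroup R -> @zc k gl R -> R u -> R (upow u x).
Proof.
move=> un sR cR Ru; apply: contrapT => /cR[f [rf fR]]; apply.
apply: (reg_nat0 (reg_comp (upow_regmap un) rf)) => a; apply: fR.
rewrite upow_nat //; elim: a => [|a IH]; first exact: sg1.
by rewrite exprS; exact: sgM.
Qed.

Lemma upowM u x m : unips u -> (upow u x) ^+ m = upow u (x *+ m).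
Proof.
move=> un; elim: m => [|m IH]; first by rewrite mulr0n -[0]/(0%:R) upow_nat.
by rewrite exprS IH mulrS upowD.
Qed.

End CharZero.

Lemma pchar_dec : (exists p, p \in [pchar k]) \/ forall m : nat, (m%:R == 0 :> k) = (m == 0%N).
Proof.
have [?|/forallNP np] := pselect (exists p, p \in [pchar k]); first by left.
by right; apply/pcharf0P => p; apply/negP/np.
Qed.

Lemma root_fun m : m%:R != 0 :> k -> exists r : 'M[k]_n -> 'M[k]_n,
  [/\ @regon k gl gl unips r,
      forall u R, unips u -> is_subgroup R -> @zc k gl R -> R u -> R (r u)
    & forall u, unips u -> (r u) ^+ m = u].
Proof.
move=> m0; case: pchar_dec => [[p pk]|ch0].
  have cop : coprime m (p ^ n).
    rewrite coprimeXr // coprime_sym prime_coprime ?(pcharf_prime pk) //.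
    by rewrite (dvdn_pcharf pk).
  (* A multiple c = q m with c = 1 modulo p^n, so that u^(q m) = u. *)
  pose c := chinese m (p ^ n) 0 1; pose q := (c %/ m)%N.
  have cE : c = (q * m)%N.
    by apply/esym/divnK; rewrite /dvdn chinese_modl // mod0n.
  exists (fun u => u ^+ q); split.
  - by apply: regmap_on; reg_tac.
  - move=> u R _ sR _ Ru; elim: (q) => [|j IH]; first exact: sg1.
    by rewrite exprS; exact: sgM.
  - move=> u un; have up := unip_exp_pchar pk un.
    have red j : u ^+ j = u ^+ (j %% p ^ n).
      by rewrite {1}(divn_eq j (p ^ n)) exprD mulnC exprM up -[1%:M]/1 expr1n mul1r.
    by rewrite -exprM -cE red chinese_modr // -red expr1.
exists (fun u => upow u m%:R^-1); split.
- apply: regonP => i.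
  have rm x : @regm k gl n n (fun u => upow u x).
    apply: regm_sum => j _; apply: regm_scale (regC _ _) _; apply: regm_exp.
    by apply: regm_sub; [exact: regm_id|exact: regm_cst].
  have [lt|le] := ltnP i #|{: 'I_n * 'I_n}|; last first.
    have [iN|iN] := eqVneq i #|{: 'I_n * 'I_n}|; last first.
      exists (fun=> 0); first exact: regC.
      by move=> u _ /=; rewrite nth_default // size_rcons size_map -cardT ltn_neqAle eq_sym iN.
    exists (fun u => \det (upow u (- m%:R^-1))); first exact: reg_det.
    by move=> u un; rewrite -upow_detV //= iN nth_rcons size_map -cardT ltnn eqxx.
  have [p0 _] : exists p0 : 'I_n * 'I_n, True.
    by move: lt; case: (pickP {: 'I_n * 'I_n}) => [p0|/eq_card0 ->] //; exists p0.
  exists (fun u => upow u m%:R^-1 (nth p0 (enum {: 'I_n * 'I_n}) i).1 (nth p0 (enum {: 'I_n * 'I_n}) i).2).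
    exact: rm.
  by move=> u _ /=; rewrite nth_rcons size_map -cardT lt (nth_map p0) // -cardT.
- by move=> u R un sR cR Ru; exact: upow_in.
- move=> u un; rewrite upowM // -(mulr_natr m%:R^-1) mulVf //.
  by have := upow_nat ch0 1 un; rewrite expr1.
Qed.

(** In characteristic p the value has p-power order, hence is 1. In characteristic 0 the function x
    to F(u^x) is a polynomial without zeros, hence constant. *)
Lemma unip_char D (F : gl -> k) u : is_subgroup D -> @zc k gl D -> reg F ->
  (forall g h, D g -> D h -> F (g *m h) = F g * F h) -> F 1%:M = 1 ->
  D u -> unips u -> F u = 1.
Proof.
move=> sD cD rF FM F1 Du un; case: pchar_dec => [[p pk]|ch0].
  have FX j : D (u ^+ j) /\ F (u ^+ j) = F u ^+ j.
    elim: j => [|j [Dj FE]]; first by rewrite !expr0; split=> //; exact: sg1.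
    by rewrite !exprS; split; [exact: sgM|rewrite -FE FM].
  have := (FX (p ^ n)%N).2; rewrite (unip_exp_pchar pk un) F1 => /esym E.
  have /eqP : (F u - 1) ^+ (p ^ n) = 0 by rewrite (sub1_exp_pchar _ _ pk) E subrr.
  by rewrite expf_eq0 subr_eq0 => /andP[_ /eqP].
have [P PE] := reg_A1_poly (reg_comp (upow_regmap ch0 un) rF).
have Dx x : D (upow u x) by exact: upow_in.
have P0 x : ~~ root P x.
  apply/rootP => Px; have := FM _ _ (Dx x) (Dx (- x)).
  by rewrite upowN // F1 PE Px mul0r => /eqP; rewrite oner_eq0.
have sP : size P = 1%N.
  by apply: contrapT => /eqP /closed_rootP[x]; rewrite (negbTE (P0 x)).
have /size_poly1P[c _ Pc] : size P == 1%N by rewrite sP.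
have E j : F (u ^+ j) = c by have := PE j%:R; rewrite upow_nat // Pc hornerC.
by rewrite -[u]expr1 E -(E 0%N) expr0.
Qed.

End Powers.

(** * Averaging over a finite cyclic group *)

Section Average.
Variables (k : closedFieldType) (n : nat).
Local Notation gl := (glv k n).

Lemma cjX (z g : 'M[k]_n) j : units z -> cj z (g ^+ j) = cj z g ^+ j.
Proof.
move=> uz; elim: j => [|j IH]; first by rewrite !expr0 cj1.
by rewrite !exprS cjM // IH.
Qed.

Lemma cj_conj (z t g : 'M[k]_n) : units z ->
  cj z (t *m g *m ginv t) = cj z t *m cj z g *m ginv (cj z t).
Proof. by move=> uz; rewrite cjM // cjM // cjV. Qed.

Lemma cj_unips (z g : 'M[k]_n) : units z -> unips (cj z g) <-> unips g.
Proof.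
move=> uz; rewrite /unips /=.
have -> : cj z g - 1%:M = cj z (g - 1%:M).
  by rewrite /cj mulmxBr mulmxBl mulmx1 mulVg.
rewrite -cjX //; split=> [E|->]; last by rewrite /cj mulmx0 mul0mx.
by apply: (cj_inj uz); rewrite E /cj mulmx0 mul0mx.
Qed.

Lemma ginvX (g : 'M[k]_n) j : ginv (g ^+ j) = ginv g ^+ j.
Proof.
elim: j => [|j IH]; first by rewrite !expr0 ginv1.
by rewrite exprS exprSr ginvM IH.
Qed.

Variables (z : 'M[k]_n) (R : set 'M[k]_n) (m : nat) (s : 'M[k]_n).
Hypotheses (uz : units z) (sR : is_subgroup R) (cR : @zc k gl R).
Hypothesis RT : forall g, R g -> Tri (cj z g).
Hypotheses (m0 : m%:R != 0 :> k) (Rs : R s) (sm : s ^+ m = 1%:M).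

Let UTz i : set 'M[k]_n := [set g | UT i (cj z g)].

Lemma UTz_subgroup i : is_subgroup (UTz i).
Proof. exact: cj_subgroup (UT_subgroup _ _ _). Qed.

Lemma UTz_zc i : @zc k gl (UTz i).
Proof. exact: cj_zc (@UT_zc _ _ _). Qed.

Lemma UTz_unips i g : (0 < i)%N -> UTz i g -> unips g.
Proof. by move=> i0 Ug; apply/(cj_unips _ uz); apply: UT1_unip; exact: UT_le Ug. Qed.

(** A cocycle of the cyclic group of order [m]: it measures how far [b] is from intertwining the
    powers of [s] and [s']. *)
Let c (s' b : 'M[k]_n) j : 'M[k]_n := s' ^+ j *m b *m ginv s ^+ j *m ginv b.

(** Pairs (s', b) in which [b] intertwines [s] and [s'] up to a unipotent error. Letting s' vary,
    and not only s' = s, is what later extends a quotient from a centralizer to a closed set. *)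
Definition avg_dom : set (prodv gl gl) :=
  [set p | [/\ R p.1, p.1 ^+ m = 1%:M, R p.2 & UTz 1 (p.1 *m p.2 *m ginv s *m ginv p.2)]].

Lemma sgX H (g : 'M[k]_n) j : is_subgroup H -> H g -> H (g ^+ j).
Proof.
move=> sH Hg; elim: j => [|j IH]; first exact: sg1.
by rewrite exprS; exact: sgM.
Qed.

Lemma cS s' b j : units s' -> units b ->
  c s' b j.+1 = s' *m c s' b j *m ginv s' *m (s' *m b *m ginv s *m ginv b).
Proof.
move=> us ub; rewrite /c exprS exprSr !mulmxA -[_ *m ginv s' *m s']mulmxA mulVg // mulmx1.
by rewrite -[_ *m ginv b *m b]mulmxA mulVg // mulmx1.
Qed.

Lemma c_UT s' b i j : R s' -> R b -> UTz i (s' *m b *m ginv s *m ginv b) -> UTz i (c s' b j).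
Proof.
move=> Rs' Rb U1; have us := sgU sR Rs'; have ub := sgU sR Rb.
elim: j => [|j IH].
  by rewrite /c !expr0 mul1mx mulmx1 mulgV //; exact: sg1 (UTz_subgroup i).
rewrite cS //; apply: (sgM (UTz_subgroup i)) => //.
by rewrite /UTz /= cj_conj //; apply: UT_conj => //; exact: RT.
Qed.

Lemma c_R s' b j : R s' -> R b -> R (c s' b j).
Proof.
move=> Rs' Rb; have Rsi := sgV sR Rs.
by apply: (sgM sR); [apply: (sgM sR); [apply: (sgM sR)|]|exact: sgV] => //; exact: sgX.
Qed.

Variable r : 'M[k]_n -> 'M[k]_n.
Hypothesis r_reg : @regon k gl gl (@unips k n) r.
Hypothesis r_in : forall u Q, unips u -> is_subgroup Q -> @zc k gl Q -> Q u -> Q (r u).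
Hypothesis r_root : forall u, unips u -> (r u) ^+ m = u.

Let pc s' b : 'M[k]_n := \prod_(j < m) c s' b j.
Let Phi s' b : 'M[k]_n := r (pc s' b) *m b.

Lemma pc_in H s' b : is_subgroup H -> (forall j, H (c s' b j)) -> H (pc s' b).
Proof.
move=> sH Hc; rewrite /pc; elim/big_ind: _ => //; first exact: sg1.
by move=> x y Hx Hy; exact: sgM.
Qed.

(** The cocycle is trivialized one layer at a time. On an entry at distance [i] it satisfies
    nu(c_(j+1)) = rh nu(c_j) + nu(c_1) with c_0 = c_m = 1, so the sum S of the nu(c_j) satisfies S =
    rh S + m nu(c_1). The correction [w], an m-th root of the product of the c_j, has m nu(w) = S
    and cancels nu(c_1). *)
Lemma Phi_step i s' b : (0 < i)%N -> R s' -> s' ^+ m = 1%:M -> R b ->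
  UTz i (s' *m b *m ginv s *m ginv b) ->
  [/\ R (Phi s' b), UTz i (Phi s' b *m ginv b)
    & UTz i.+1 (s' *m Phi s' b *m ginv s *m ginv (Phi s' b))].
Proof.
move=> i0 Rs' s'm Rb U1; have us := sgU sR Rs'; have ub := sgU sR Rb.
have sU := UTz_subgroup i; have Uc j := c_UT j Rs' Rb U1.
have Up : UTz i (pc s' b) by apply: pc_in.
have up := UTz_unips i0 Up; set w := r (pc s' b).
have Uw : UTz i w by apply: r_in => //; exact: UTz_zc.
have Rw : R w by apply: r_in => //; apply: pc_in => // j; exact: c_R.
have uw := sgU sR Rw.
split; first exact: sgM.
  by rewrite /Phi -/w -mulmxA mulgV // mulmx1.
have Ts' := RT Rs'; have Uc1 := U1; rewrite /UTz /= in Uc1 Uw.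
have -> : s' *m Phi s' b *m ginv s *m ginv (Phi s' b) =
    s' *m w *m ginv s' *m (s' *m b *m ginv s *m ginv b) *m ginv w.
  by rewrite /Phi -/w ginvM !mulmxA -[_ *m ginv s' *m s']mulmxA mulVg // mulmx1.
have Usw : UT i (cj z (s' *m w *m ginv s')) by rewrite cj_conj //; exact: UT_conj.
have Uwi : UT i (ginv (cj z w)) by exact: sgV (UT_subgroup _ _ _) Uw.
have Usw1 := UTM Usw Uc1.
rewrite /UTz /= cjM // cjM // cjV //; apply: UT_next; first exact: UTM.
move=> a b0 abi.
have ab : (a == b0) = false.
  by apply/eqP => E; move: i0; rewrite -(ltn_add2l b0) -abi addn0 E ltnn.
rewrite ab (UT_nuM i0 abi) // (UT_nuM i0 abi) // mulr0n.
have nuwi : ginv (cj z w) a b0 = - cj z w a b0.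
  have := UT_nuM i0 abi Uw Uwi; rewrite mulgV; last by case: Uw.
  by rewrite mxE ab => /eqP; rewrite eq_sym addr_eq0 => /eqP ->; rewrite opprK.
rewrite nuwi cj_conj // (UT_nu_conj i0 abi) //; set rh := _ / _.
set nu := fun g => cj z g a b0.
rewrite -/(nu (s' *m b *m ginv s *m ginv b)) -/(nu w).
pose S := \sum_(j < m) nu (c s' b j).
have nuw : nu w *+ m = S.
  have nuX j : UT i (cj z w ^+ j) /\ (cj z w ^+ j) a b0 = nu w *+ j.
    elim: j => [|j [IH1 IH2]]; first by rewrite expr0 mxE ab; split=> //; exact: sg1 (UT_subgroup _ _ _).
    by rewrite exprS (UT_nuM i0 abi) // IH2 mulrS; split=> //; exact: (UTM Uw IH1).
  rewrite -(nuX m).2 -cjX // r_root // /S /pc.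
  suff key (l : seq 'I_m) : UT i (cj z (\prod_(j <- l) c s' b j)) /\
      nu (\prod_(j <- l) c s' b j) = \sum_(j <- l) nu (c s' b j) by case: (key (index_enum 'I_m)).
  elim: l => [|j l [IH1 IH2]].
    by rewrite !big_nil /nu cj1 // mxE ab; split=> //; exact: sg1 (UT_subgroup _ _ _).
  rewrite !big_cons -IH2 /nu (cjM (c s' b j) _ uz); split; first exact: (UTM (Uc j) IH1).
  by rewrite (UT_nuM i0 abi (Uc j) IH1).
have SE : S = rh * S + nu (s' *m b *m ginv s *m ginv b) *+ m.
  have c0 : nu (c s' b 0) = 0.
    by rewrite /nu /c !expr0 mul1mx mulmx1 mulgV // cj1 // mxE ab.
  have cm : nu (c s' b m) = 0.
    have sim : ginv s ^+ m = 1%:M by rewrite -ginvX sm ginv1.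
    by rewrite /nu /c s'm sim mul1mx mulmx1 mulgV // cj1 // mxE ab.
  have nuS j : nu (c s' b j.+1) = rh * nu (c s' b j) + nu (s' *m b *m ginv s *m ginv b).
    rewrite /nu cS // cjM // (UT_nuM i0 abi) //; last first.
      by rewrite cj_conj //; apply: UT_conj => //; exact: Uc.
    by rewrite cj_conj // (UT_nu_conj i0 abi) //; exact: Uc.
  transitivity (\sum_(j < m) nu (c s' b j.+1)).
    have E1 : \sum_(j < m.+1) nu (c s' b j) = S by rewrite big_ord_recr /= cm addr0.
    by rewrite -E1 big_ord_recl /= c0 add0r.
  under eq_bigr do rewrite nuS.
  by rewrite big_split /= -mulr_sumr sumr_const card_ord.
have : (rh * nu w + nu (s' *m b *m ginv s *m ginv b) - nu w) *+ m = 0.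
  by rewrite mulrnBl mulrnDl -mulrnAr nuw -SE subrr.
by rewrite -mulr_natr => /eqP; rewrite mulf_eq0 (negbTE m0) orbF => /eqP.
Qed.

Let Psi (p : prodv gl gl) : prodv gl gl := (p.1, Phi p.1 p.2).

Lemma Psi_dom p : avg_dom p -> avg_dom (Psi p).
Proof.
move=> [R1 pm R2 U1]; have [RP _ UP] := Phi_step (ltn0Sn 0) R1 pm R2 U1.
by split=> //; exact: UT_le UP.
Qed.

Lemma Psi_reg : regon avg_dom Psi.
Proof.
apply: regon_pair; first by apply: regmap_on; exact: regmap_fst.
apply: regonM; last by apply: regmap_on; exact: regmap_snd.
apply: (@regon_comp _ _ gl gl avg_dom (@unips k n) (fun p : prodv gl gl => pc p.1 p.2 : gl) r) => //.
  apply: regmap_on; rewrite /pc.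
  suff key (l : seq 'I_m) : regmap ((fun p => \prod_(j <- l) c p.1 p.2 j) : prodv gl gl -> gl).
    exact: key.
  elim: l => [|j l IH] i.
    by apply: reg_eq (regmap_cst (prodv gl gl) ((1%:M : 'M[k]_n) : gl) i) => p; rewrite big_nil.
  have rc : regmap ((fun p => c p.1 p.2 j) : prodv gl gl -> gl) by rewrite /c; reg_tac.
  by apply: reg_eq (rgM rc IH i) => p; rewrite big_cons.
move=> p [R1 pm R2 U1]; apply: (@UTz_unips 1) => //; apply: pc_in; first exact: UTz_subgroup.
by move=> j; exact: c_UT.
Qed.

(** After [n] corrections the error lies in [UT n.+1] and is trivial. When [b] already intertwines,
    the cocycle is 1 and no step changes [b]; this makes the map a retraction. *)
Lemma average_iter : exists A : prodv gl gl -> gl, regon avg_dom A /\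
  forall p, avg_dom p -> [/\ R (A p), UT 1 (cj z (A p *m ginv p.2)), p.1 *m A p = A p *m s
    & p.1 *m p.2 = p.2 *m s -> A p = p.2].
Proof.
exists (fun p => (iter n Psi p).2); split.
  have : forall j, regon avg_dom (fun p => iter j Psi p).
    elim=> [|j IH]; first by apply: regmap_on; exact: regmap_id.
    apply: (@regon_comp _ _ _ _ avg_dom avg_dom (fun p => iter j Psi p) Psi) => //; last exact: Psi_reg.
    by move=> p dp; elim: (j) => // i IHi; exact: Psi_dom.
  move=> /(_ n) H; apply: (@regon_comp _ _ _ gl avg_dom setT _ (fun p : prodv gl gl => p.2) H) => //.
  by apply: regmap_on; exact: regmap_snd.
move=> [s' b] dp; have [/= R1 pm R2 U1] := dp; have us := sgU sR R1; have ub := sgU sR R2.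
have usi := sgU sR Rs.
have key j : [/\ (iter j Psi (s', b)).1 = s', R (iter j Psi (s', b)).2,
    UTz 1 ((iter j Psi (s', b)).2 *m ginv b)
    & UTz j.+1 (s' *m (iter j Psi (s', b)).2 *m ginv s *m ginv (iter j Psi (s', b)).2)].
  elim: j => [|j [E1 IR IU Ic]].
    split=> //=; rewrite mulgV //; exact: sg1 (UTz_subgroup 1).
  rewrite iterS /Psi /= E1; set x := (iter j Psi (s', b)).2 in IR IU Ic *.
  have ux := sgU sR IR.
  have [RP UP cP] := Phi_step (ltn0Sn j) R1 pm IR Ic.
  split=> //; have -> : Phi s' x *m ginv b = Phi s' x *m ginv x *m (x *m ginv b).
    by rewrite mulmxA -[_ *m ginv x *m x]mulmxA mulVg // mulmx1.
  by apply: (sgM (UTz_subgroup 1)) => //; exact: UT_le UP.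
have [E1 RA UA cA] := key n; set x := (iter n Psi (s', b)).2 in RA UA cA *.
have ux := sgU sR RA; split=> //=.
  have E : s' *m x *m ginv s *m ginv x = 1%:M.
    by apply: (cj_inj uz); rewrite cj1 //; apply: UTn; exact: UT_le cA.
  move/(congr1 (fun g => g *m x *m s)): E.
  by rewrite mul1mx -[_ *m ginv x *m x]mulmxA mulVg // mulmx1 -[_ *m ginv s *m s]mulmxA mulVg // mulmx1.
move=> comm; rewrite /x; have Pb : Psi (s', b) = (s', b).
  congr pair; rewrite /= /Phi.
  have c1 j : c s' b j = 1%:M.
    elim: j => [|j IH]; first by rewrite /c !expr0 mul1mx mulmx1 mulgV.
    rewrite cS // IH mulmx1 mulgV // mul1mx comm -[b *m s *m _]mulmxA mulgV // mulmx1.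
    by rewrite mulgV.
  have -> : pc s' b = 1%:M by rewrite /pc big1.
  have u1 : unips (1%:M : 'M[k]_n).
    by apply: (@UTz_unips 1) => //; exact: sg1 (UTz_subgroup 1).
  suff -> : r 1%:M = 1%:M by rewrite mul1mx.
  apply: (cj_inj uz); rewrite cj1 //; apply: UTn.
  exact: (r_in u1 (UTz_subgroup n) (@UTz_zc n) (sg1 (UTz_subgroup n))).
have itE j : iter j Psi (s', b) = (s', b) by elim: j => // j IH; rewrite iterS IH Pb.
by rewrite itE.
Qed.

End Average.

(** * Centralizers in triangular groups, independence of characters, orthogonal projection *)

Section Centralizers.
Variables (k : closedFieldType) (n : nat).
Local Notation gl := (glv k n).
Local Notation irrg X := (@irr k gl X).
Local Notation zcg X := (@zc k gl X).

Lemma average (z : 'M[k]_n) R m s : units z -> is_subgroup R -> zcg R ->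
  (forall g, R g -> Tri (cj z g)) -> m%:R != 0 :> k -> R s -> s ^+ m = 1%:M ->
  exists A : prodv gl gl -> gl, regon (avg_dom z R m s) A /\
  forall p, avg_dom z R m s p -> [/\ R (A p), UT 1 (cj z (A p *m ginv p.2)), p.1 *m A p = A p *m s
    & p.1 *m p.2 = p.2 *m s -> A p = p.2].
Proof.
move=> uz sR cR RT m0 Rs sm; have [r [r1 r2 r3]] := @root_fun k n m m0.
exact: (average_iter uz sR cR RT m0 Rs sm r1 r2 r3).
Qed.

Lemma comm_UT1 (z : 'M[k]_n) R g h : units z -> is_subgroup R -> (forall g, R g -> Tri (cj z g)) ->
  R g -> R h -> UT 1 (cj z (g *m h *m ginv g *m ginv h)).
Proof.
move=> uz sR RT Rg Rh; rewrite !cjM // !cjV //.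
have T0 x : Tri x -> UT 0 x.
  move=> [ux /is_trig_mxP Tx]; split=> // a b; rewrite addn0 => lt.
  by rewrite Tx //; case: eqP => // ab; rewrite ab ltnn in lt.
by apply: UT_comm; apply: T0; exact: RT.
Qed.

(** Averaging retracts the irreducible [R] onto the centralizer of [s], and changes elements only by
    unipotent factors. *)
Lemma irr_centralizer (z : 'M[k]_n) R m s : units z -> is_subgroup R -> zcg R -> irrg R ->
  (forall g, R g -> Tri (cj z g)) -> m%:R != 0 :> k -> R s -> s ^+ m = 1%:M ->
  irrg [set g | R g /\ g *m s = s *m g] /\
  forall b, R b -> exists2 c, R c /\ c *m s = s *m c & UT 1 (cj z (c *m ginv b)).
Proof.
move=> uz sR cR iR RT m0 Rs sm; have [A [rA AP]] := average uz sR cR RT m0 Rs sm.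
have us := sgU sR Rs.
have dom b : R b -> avg_dom z R m s (s, b).
  by move=> Rb; split=> //=; exact: (@comm_UT1 z R).
have rAs : @regon k gl gl R (fun b => A (s, b)).
  apply: (@regon_comp k gl (prodv gl gl) gl R (avg_dom z R m s) (fun b => (s, b)) A) => //.
  by apply: regmap_on; reg_tac.
split; last first.
  by move=> b Rb; have [RA UA E _] := AP _ (dom b Rb); exists (A (s, b)) => //; split.
have := irr_regon rAs (fun _ => id) iR; congr irr; apply/seteqP; split=> g.
  by move=> [b Rb <-]; have [RA _ E _] := AP _ (dom b Rb); split.
by move=> [Rg E]; exists g => //; have [_ _ _ ->] := AP _ (dom g Rg).
Qed.

(** Entries are triples of a coefficient, a character and a value. Characters may repeat, and the
    value depends only on the character: every linear relation between the characters is inherited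
    by the values, by Dedekind's independence. *)
Lemma dedekind (B : set 'M[k]_n) (L : seq (k * ('M[k]_n -> k) * k)) : is_subgroup B ->
  (forall e, List.In e L -> (forall g h, B g -> B h -> e.1.2 (g *m h) = e.1.2 g * e.1.2 h) /\
    e.1.2 1%:M = 1) ->
  (forall e f, List.In e L -> List.In f L -> (forall b, B b -> e.1.2 b = f.1.2 b) -> e.2 = f.2) ->
  (forall b, B b -> \sum_(e <- L) e.1.1 * e.1.2 b = 0) -> \sum_(e <- L) e.1.1 * e.2 = 0.
Proof.
move=> sB; have [N] := ubnP (size L); elim: N L => // N IH L ltN multL valL relL.
case: L ltN multL valL relL => [|e1 L] ltN multL valL relL; first by rewrite big_nil.
have [same|/existsNP[e2 /not_implyP[e2L /existsNP[b0 /not_implyP[Bb0 /eqP ne]]]]] :=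
    pselect (forall e, List.In e L -> forall b, B b -> e.1.2 b = e1.1.2 b).
  have e11 : List.In e1 (e1 :: L) by left.
  have : \sum_(e <- e1 :: L) e.1.1 = 0.
    rewrite -[RHS](relL _ (sg1 sB)); elim: (e1 :: L) multL => [|e l IHl] ml; first by rewrite !big_nil.
    rewrite !big_cons IHl; last by move=> f fl; apply: ml; right.
    by have [_ ->] := ml e (or_introl erefl); rewrite mulr1.
  move=> E; transitivity ((\sum_(e <- e1 :: L) e.1.1) * e1.2); last by rewrite E mul0r.
  have : forall e, List.In e (e1 :: L) -> e.2 = e1.2.
    by move=> e [<-//|eL]; apply: valL => //; [right|exact: same].
  elim: (e1 :: L) => [|e l IHl] vl; first by rewrite !big_nil mul0r.
  rewrite !big_cons IHl ?mulrDl; first by rewrite (vl e (or_introl erefl)).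
  by move=> f fl; apply: vl; right.
have tw_sum a (g : ('M[k]_n -> k) * k -> k) l :
    \sum_(e <- [seq (e.1.1 * (e.1.2 b0 - a), e.1.2, e.2) | e <- l]) e.1.1 * g (e.1.2, e.2) =
    \sum_(e <- l) e.1.1 * (e.1.2 b0 - a) * g (e.1.2, e.2) by rewrite big_map.
have tw_in a (l : seq (k * ('M[k]_n -> k) * k)) f :
    List.In f [seq (e.1.1 * (e.1.2 b0 - a), e.1.2, e.2) | e <- l] ->
    exists2 e, List.In e l & f.1.2 = e.1.2 /\ f.2 = e.2.
  elim: l => //= e l IHl [<-|/IHl[e' el E]]; first by exists e => //; left.
  by exists e' => //; right.
(* Multiplying each coefficient by chi(b0) - chi_0(b0), where chi_0 belongs to [e0], gives a
   relation again and removes [e0]. Doing so for two entries that differ at [b0] and subtracting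
   gives a nonzero multiple of the claim. *)
have key l1 e0 l2 : e1 :: L = l1 ++ e0 :: l2 ->
    \sum_(e <- e1 :: L) e.1.1 * (e.1.2 b0 - e0.1.2 b0) * e.2 = 0.
  move=> LE; have drop (G : k * ('M[k]_n -> k) * k -> k) :
      \sum_(e <- e1 :: L) e.1.1 * (e.1.2 b0 - e0.1.2 b0) * G e =
      \sum_(e <- l1 ++ l2) e.1.1 * (e.1.2 b0 - e0.1.2 b0) * G e.
    by rewrite LE !big_cat big_cons /= subrr mulr0 mul0r add0r.
  have inL e : List.In e (l1 ++ l2) -> List.In e (e1 :: L).
    move=> el; rewrite LE; apply: List.in_or_app.
    by have [?|?] := List.in_app_or _ _ _ el; [left|right; right].
  rewrite (drop (fun e => e.2)) -(tw_sum _ (fun g => g.2)); apply: IH.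
  - rewrite size_map; have := congr1 size LE; rewrite !size_cat /= addnS => -[E].
    by rewrite -E.
  - by move=> f /tw_in[e /inL eL [-> _]]; exact: multL.
  - by move=> f f' /tw_in[e /inL eL [-> ->]] /tw_in[e' /inL eL' [-> ->]]; exact: valL.
  - move=> b Bb; rewrite (tw_sum _ (fun g => g.1 b)) -(drop (fun e => e.1.2 b)).
    transitivity (\sum_(e <- e1 :: L) e.1.1 * e.1.2 (b0 *m b) -
        e0.1.2 b0 * \sum_(e <- e1 :: L) e.1.1 * e.1.2 b); last first.
      by rewrite !relL //; [rewrite mulr0 subrr|exact: sgM].
    rewrite mulr_sumr -sumrB; elim: (e1 :: L) multL => [|e l IHl] ml; first by rewrite !big_nil.
    rewrite !big_cons IHl; last by move=> f fl; apply: ml; right.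
    by have [-> // _] := ml e (or_introl erefl); congr (_ + _); ring.
have [l1 [l2 LE]] := List.in_split _ _ e2L.
have K1 := key [::] e1 L erefl.
have K2 := key (e1 :: l1) e2 l2 (congr1 (cons e1) LE).
have : (e2.1.2 b0 - e1.1.2 b0) * \sum_(e <- e1 :: L) e.1.1 * e.2 = 0.
  transitivity (\sum_(e <- e1 :: L) e.1.1 * (e.1.2 b0 - e1.1.2 b0) * e.2 -
      \sum_(e <- e1 :: L) e.1.1 * (e.1.2 b0 - e2.1.2 b0) * e.2); last by rewrite K1 K2 subrr.
  by rewrite mulr_sumr -sumrB; apply: eq_bigr => e _; ring.
by move/eqP; rewrite mulf_eq0 subr_eq0 (negbTE ne) => /eqP.
Qed.

Lemma monomials r (p : pexp k) : exists L : seq (k * (nat -> nat)), forall y : nat -> k,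
  (forall j, (r <= j)%N -> y j = 0) -> peval y p = \sum_(e <- L) e.1 * \prod_(j < r) y j ^+ e.2 j.
Proof.
elim: p => [c|i|p [P PE] q [Q QE]|p [P PE] q [Q QE]] /=.
- exists [:: (c, fun=> 0%N)] => y _; rewrite big_seq1 big1 ?mulr1 // => j _.
- have [lt|le] := ltnP i r; last by exists [::] => y y0; rewrite big_nil y0.
  exists [:: (1, fun j => (j == i : nat))] => y _; rewrite big_seq1 mul1r.
  rewrite (bigD1 (Ordinal lt)) //= eqxx expr1 big1 ?mulr1 // => j nj.
  by rewrite (_ : (j == i :> nat) = false) //; apply: contraNF nj => /eqP E; apply/eqP/val_inj.
- by exists (P ++ Q) => y y0; rewrite big_cat PE // QE.
- exists [seq (e.1 * f.1, fun j => (e.2 j + f.2 j)%N) | e <- P, f <- Q] => y y0.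
  rewrite PE // QE // big_allpairs_dep mulr_suml; apply: eq_bigr => e _.
  rewrite mulr_sumr; apply: eq_bigr => f _ /=.
  rewrite mulrACA -big_split /=; congr (_ * _); apply: eq_bigr => j _.
  by rewrite exprD.
Qed.

(** The image of characters is cut out by their multiplicative relations. By [dedekind] the point
    [x] satisfies every polynomial that vanishes on the image, so it lies in the closure. The
    closure is stable under [x], the image contains an open part of it, and [x] is a quotient of two
    points of the image. *)
Lemma torus_image (B : set 'M[k]_n) r (d : nat -> gl -> k) (x : nat -> k) :
  is_subgroup B -> zcg B -> irrg B -> (forall j, reg (d j)) ->
  (forall j g h, B g -> B h -> d j (g *m h) = d j g * d j h) -> (forall j, d j 1%:M = 1) ->
  (forall j, x j != 0) ->
  (forall c : 'I_r -> int, (forall b, B b -> \prod_(j < r) d j b ^ c j = 1) ->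
     \prod_(j < r) x j ^ c j = 1) ->
  exists2 b, B b & forall j, (j < r)%N -> d j b = x j.
Proof.
move=> sB cB iB rd dM d1 x0 xP.
have dV j b : B b -> d j b * d j (ginv b) = 1.
  by move=> Bb; rewrite -dM ?mulgV ?d1 //; [exact: sgU Bb|exact: sgV].
have d0 j b : B b -> d j b != 0.
  by move=> Bb; apply: contra_eq_neq (dV j b Bb) => ->; rewrite mul0r eq_sym oner_eq0.
pose e (b : gl) : avar k r := fun j => d j b.
have re : regmap e.
  by move=> i; rewrite /= /avar_gen; case: (i < r)%N; [exact: rd|exact: regC].
pose mulv (y : avar k r) (w : avar k r) : avar k r := fun j => (y j : k) * (w j : k).
have rmul y : regmap (mulv y).
  move=> i; apply: (@reg_eq _ _ (fun w : avar k r => avar_gen r y i * vgen w i)).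
    by move=> w /=; rewrite /avar_gen; case: ifP => _; rewrite ?mul0r.
  by apply: regM (regC _ _) (regV _ _).
pose Z := cl (e @` B).
have Zx : Z x.
  move=> f [p fp] f0; have [L LE] := monomials r p.
  have fE y : f y = \sum_(l <- L) l.1 * \prod_(j < r) (y : nat -> k) j ^+ l.2 j.
    rewrite fp LE => [|j lej]; last by rewrite /= /avar_gen ltnNge lej.
    by apply: eq_bigr => l _; congr (_ * _); apply: eq_bigr => j _; rewrite /= /avar_gen ltn_ord.
  pose L' := [seq (l.1, (fun b : 'M[k]_n => \prod_(j < r) d j b ^+ l.2 j), \prod_(j < r) x j ^+ l.2 j) | l : k * (nat -> nat) <- L].
  have inL' E : List.In E L' -> exists mu : nat -> nat,
      E.1.2 = (fun b : 'M[k]_n => \prod_(j < r) d j b ^+ mu j) /\ E.2 = \prod_(j < r) x j ^+ mu j.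
    by rewrite /L'; elim: (L) => //= l s IH [<-|/IH//]; exists l.2.
  have := @dedekind B L' sB; rewrite /L' big_map /= -fE; apply.
  - move=> E /inL'[mu [-> _]]; split=> [g h Bg Bh|]; last by rewrite big1 // => j _; rewrite d1 expr1n.
    by rewrite -big_split; apply: eq_bigr => j _ /=; rewrite dM // exprMn.
  - move=> E F /inL'[mu [-> ->]] /inL'[nu [-> ->]] EF.
    have := xP (fun j => (mu j)%:Z - (nu j)%:Z).
    have key (y : nat -> k) : (forall j, y j != 0) ->
        \prod_(j < r) y j ^ ((mu j)%:Z - (nu j)%:Z) =
        (\prod_(j < r) y j ^+ mu j) / \prod_(j < r) y j ^+ nu j.
      by move=> y0; rewrite -prodf_div; apply: eq_bigr => j _; rewrite expfzDr // -exprnN -exprnP.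
    move=> H; have nz : \prod_(j < r) x j ^+ nu j != 0 by apply/prodf_neq0 => j _; rewrite expf_neq0.
    apply: (mulIf (invr_neq0 nz)); rewrite divff // -key //; apply: H => b Bb.
    rewrite (key (fun j => d j b)) => [|j]; last exact: d0.
    by rewrite EF // divff //; apply/prodf_neq0 => j _; rewrite expf_neq0 // d0.
  - move=> b Bb; rewrite big_map /=; rewrite -[RHS](f0 (e b)); last by exists b.
    by rewrite fE.
have aB : @affine k gl B.
  by apply: (affine_closed (@affine_units k n)) => // g; exact: sgU.
have [h [rh [z0 Zz0 hz0] hP]] := chevalley re aB iB.
have xZ z : Z z -> Z (mulv x z).
  suff sub : Z `<=` [set z | Z (mulv x z)] by exact: sub.
  apply: cl_sub; first exact: (zc_preim (rmul x) (@zc_cl _ _ _)).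
  move=> _ [b Bb <-] /=.
  have -> : mulv x (e b) = mulv (e b) x by apply/funext => j; rewrite /mulv mulrC.
  apply: (cl_stable (rmul (e b))) => // _ [b' Bb' <-]; exists (b *m b'); first exact: sgM.
  by apply/funext => j; rewrite /e /mulv dM.
pose sc i (y : avar k r) : avar k r := fun j => (x j)^-1 ^+ i * (y j : k).
have rsc i : regmap (sc i) by exact: (rmul (fun j => (x j)^-1 ^+ i)).
have xsc i y : mulv x (sc i.+1 y) = sc i y.
  by apply/funext => j; rewrite /mulv /sc exprS !mulrA divff // mul1r.
(* Stability under the inverse of [x] from stability under [x]: the closed sets of y with x^(-i) y
   in [Z] decrease in i, hence become stationary. *)
have ZxV z : Z z -> Z (sc 1%N z).
  have [|A [cA [i AE] minA]] := @zmin _ (avar k r) (fun A => exists i, A = [set y | Z (sc i y)]).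
    by exists [set y | Z (sc 0%N y)]; [exact: (zc_preim (rsc 0%N) (@zc_cl _ _ _))|exists 0%N].
  have E : [set y | Z (sc i.+1 y)] = A.
    apply: minA; [exact: (zc_preim (rsc i.+1) (@zc_cl _ _ _))|by exists i.+1|].
    by rewrite AE => y /xZ; rewrite xsc.
  move=> Zz; pose y : avar k r := fun j => x j ^+ i * (z j : k).
  have : A y.
    rewrite AE /=; have -> : sc i y = z; last by [].
    by apply/funext => j; rewrite /sc /y mulrA -exprMn mulVf // expr1n mul1r.
  rewrite -E /=; congr Z; apply/funext => j; rewrite /sc /y expr1 exprS -!mulrA; congr (_ * _).
  by rewrite mulrA -exprMn mulVf // expr1n mul1r.
have [b Bb hb] : exists2 b, B b & h (mulv x (e b)) <> 0.
  apply: contrapT => /forall2NP no; apply: hz0.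
  have -> : z0 = mulv x (sc 1%N z0).
    by apply/funext => j; rewrite /mulv /sc expr1 mulrA divff // mul1r.
  apply: (ZxV _ Zz0 (fun y => h (mulv x y))); first exact: (reg_comp (rmul x) rh).
  by move=> _ [b Bb <-]; have [//|/contrapT] := no b.
have [|b' Bb' b'E] := hP (mulv x (e b)) _ hb; first by apply: xZ; apply: sub_cl; exists b.
exists (b' *m ginv b); first by apply: sgM => //; exact: sgV.
move=> j ltj; rewrite dM //; last exact: sgV.
have := b'E j; rewrite /= /avar_gen ltj /e /mulv => ->.
by rewrite -mulrA dV // mulr1.
Qed.

(** Orthogonal projection away from a lattice, with denominators cleared: an orthogonal system in
    [M] of greatest length spans it rationally, and [N] is the product of the squared lengths. *)
Lemma int_projection (M : set 'rV[int]_n) (c : 'rV[int]_n) :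
  M 0 -> (forall u v, M u -> M v -> M (u + v)) -> (forall (t : int) u, M u -> M (t *: u)) ->
  exists (N : int) a, [/\ N != 0, M (N *: c - a)
    & forall m, M m -> \sum_i a 0 i * m 0 i = 0].
Proof.
move=> M0 MD MZ; pose dot (u v : 'rV[int]_n) : int := \sum_i u 0 i * v 0 i.
have dotC u v : dot u v = dot v u by apply: eq_bigr => i _; rewrite mulrC.
have dotB u v w : dot (u - v) w = dot u w - dot v w.
  by rewrite -sumrB; apply: eq_bigr => i _; rewrite !mxE mulrBl.
have dotZ t u w : dot (t *: u) w = t * dot u w.
  by rewrite mulr_sumr; apply: eq_bigr => i _; rewrite !mxE mulrA.
have dot_sum (I : finType) (f : I -> 'rV[int]_n) w : dot (\sum_i f i) w = \sum_i dot (f i) w.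
  rewrite exchange_big; apply: eq_bigr => i _ /=; by rewrite summxE mulr_suml.
have dot0 u : dot u u = 0 -> u = 0.
  move=> E; apply/rowP => i; rewrite mxE; apply/eqP; rewrite -sqrf_eq0 expr2; apply/eqP.
  apply: (Num.Theory.psumr_eq0P (P := xpredT) _ E) => // j _.
  by rewrite -expr2 Num.Theory.sqr_ge0.
pose ok r := exists U : 'I_r -> 'rV[int]_n, [/\ forall i, M (U i),
  forall i j, i != j -> dot (U i) (U j) = 0 & forall i, U i != 0].
have ex0 : exists r, `[< ok r >].
  by exists 0%N; apply/asboolP; exists (fun=> 0); split=> [[]|[]|[]].
have ub r : `[< ok r >] -> (r <= n)%N.
  move/asboolP => [U [_ UO U0]].
  pose A : 'M[rat]_(r, n) := \matrix_(i, j) (U i 0 j)%:~R.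
  suff : \rank A = r by move=> <-; exact: rank_leq_col.
  apply/eqP; rewrite eqn_leq rank_leq_row /=.
  have uAA : A *m A^T \in unitmx.
    have -> : A *m A^T = diag_mx (\row_i (dot (U i) (U i))%:~R).
      apply/matrixP => i j; rewrite !mxE; transitivity ((dot (U i) (U j))%:~R : rat).
        by rewrite rmorph_sum; apply: eq_bigr => l _; rewrite !mxE rmorphM.
      by case: eqP => [->|/eqP ij]; [rewrite mulr1n|rewrite UO // mulr0n].
    rewrite unitmxE det_diag unitfE; apply/prodf_neq0 => i _; rewrite mxE intr_eq0.
    by apply/eqP => /dot0 E; move: (U0 i); rewrite E eqxx.
  by rewrite -{1}(mxrank_unit uAA) mxrankM_maxl.
case: (ex_maxnP ex0 ub) => r /asboolP[U [UM UO U0]] maxr.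
pose q i := dot (U i) (U i); have q0 i : q i != 0.
  by apply/eqP => /dot0 E; move: (U0 i); rewrite E eqxx.
pose P := \prod_i q i; pose P' i := \prod_(j | j != i) q j.
have PE i : P = q i * P' i by rewrite /P (bigD1 i).
pose cmb v := \sum_i (P' i * dot v (U i)) *: U i.
have cmbM v : M (cmb v).
  by rewrite /cmb; elim/big_ind: _ => // i _; apply: MZ.
have redO v j : dot (P *: v - cmb v) (U j) = 0.
  rewrite dotB dotZ dot_sum (bigD1 j) //= big1 ?addr0 => [|i ij]; last first.
    by rewrite dotZ UO // mulr0.
  by rewrite dotZ -/(q j) (PE j); ring.
have redM m : M m -> P *: m = cmb m.
  move=> Mm; apply: contrapT => /eqP; rewrite -subr_eq0 => ne.
  have : (r.+1 <= r)%N; last by rewrite ltnn.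
  apply: maxr; apply/asboolP.
  exists (fun i => if unlift ord0 i is Some j then U j else P *: m - cmb m); split.
  - move=> i; case: (unliftP ord0 i) => [j _|_] //.
    by apply: MD; [exact: MZ|rewrite -scaleN1r; exact: MZ].
  - move=> i j; case: (unliftP ord0 i) => [i' ->|->]; case: (unliftP ord0 j) => [j' ->|->] //.
    + by move=> ij; apply: UO; apply: contraNneq ij => ->.
    + by move=> _; rewrite dotC redO.
  - by move=> i; case: (unliftP ord0 i).
exists P, (P *: c - cmb c); split.
- by apply/prodf_neq0.
- by rewrite opprB addrCA subrr addr0.
move=> m Mm; rewrite -/(dot _ m); apply: (mulfI (x := P)); first exact/prodf_neq0.
rewrite mulr0 dotC -dotZ redM // /cmb dot_sum big1 // => i _.
by rewrite dotZ [dot (U i) _]dotC redO mulr0.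
Qed.

End Centralizers.

(** * Tori dual to characters *)

Section Torus.
Variables (k : closedFieldType) (n : nat).
Local Notation gl := (glv k n).
Local Notation irrg X := (@irr k gl X).
Local Notation zcg X := (@zc k gl X).

Definition dg (z : 'M[k]_n) (i : 'I_n) (b : 'M[k]_n) : k := cj z b i i.

Lemma dg_reg z i : @reg k gl (dg z i).
Proof.
have r : regmap ((fun b => cj z b) : gl -> gl) by rewrite /cj; reg_tac.
by apply: (@reg_comp _ gl gl (fun b => cj z b) (fun A : gl => (A : 'M[k]_n) i i) r); exact: reg_entry.
Qed.

Lemma dg1 z i : units z -> dg z i 1%:M = 1.
Proof. by move=> uz; rewrite /dg cj1 // mxE eqxx. Qed.

Lemma zc_comm (t : 'M[k]_n) : zcg [set g | g *m t = t *m g].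
Proof.
rewrite (_ : [set g | _] = [set g : gl | forall i j, (g *m t - t *m g) i j = 0]).
  apply: zc_forall => i; apply: zc_forall => j; apply: zc_eq0.
  have rm : @regm k gl n n (fun g => g *m t - t *m g).
    apply: regm_sub; apply: regm_mul; by [exact: regm_id|exact: regm_cst].
  exact: rm.
apply/seteqP; split=> g /=; first by move=> -> i j; rewrite subrr mxE.
by move=> E; apply/eqP; rewrite -subr_eq0; apply/eqP/matrixP => i j; rewrite E mxE.
Qed.

Lemma centralizer_subgroup (H : set 'M[k]_n) t : is_subgroup H ->
  is_subgroup [set g | H g /\ g *m t = t *m g].
Proof.
move=> sH; apply: is_subgroup_ginv; first by move=> g [/(sgU sH)].
- by split; [exact: sg1|rewrite mul1mx mulmx1].
- move=> g h [Hg gt] [Hh ht]; split; first exact: sgM.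
  by rewrite -mulmxA ht mulmxA gt -mulmxA.
- move=> g [Hg gt]; split; first exact: sgV.
  have ug := sgU sH Hg; apply: (can_inj (mulKmx ug)).
  by rewrite !mulmxA mulgV // mul1mx gt -mulmxA mulgV // mulmx1.
Qed.

Lemma large_prime N : exists l, [/\ prime l, (N < l)%N & l%:R != 0 :> k].
Proof.
have [[p pk]|ch0] := pchar_dec k; last first.
  have [l ltl pl] := prime_above N; exists l; split=> //.
  by rewrite ch0 -lt0n prime_gt0.
have [l ltl pl] := prime_above (maxn N p); exists l; split=> //.
  exact: leq_ltn_trans (leq_maxl _ _) ltl.
rewrite -(dvdn_pcharf pk) dvdn_prime2 ?(pcharf_prime pk) //.
by apply: contraTneq ltl => ->; rewrite -leqNgt leq_maxr.
Qed.

(** A root of 1 + X + ... + X^(l-1), whose value at 1 is [l]. *)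
Lemma prime_root l : prime l -> l%:R != 0 :> k -> exists2 ze : k, ze ^+ l = 1 & ze != 1.
Proof.
move=> pl l0; pose q : {poly k} := \sum_(i < l) 'X^i.
have sq : size q != 1%N.
  have -> : q = \poly_(i < l) 1 by rewrite poly_def; apply: eq_bigr => i _; rewrite scale1r.
  by rewrite size_poly_eq ?oner_eq0 // gtn_eqF ?prime_gt1.
have [ze /rootP rze] := closed_rootP _ sq; exists ze.
  apply/eqP; rewrite -subr_eq0 subrX1; apply/eqP.
  by move: rze; rewrite horner_sum => E; rewrite -[RHS](mulr0 (ze - 1)) -[X in _ = _ * X]E; congr (_ * _); apply: eq_bigr => i _; rewrite hornerXn.
apply: contra_neq l0 => E; move: rze; rewrite E horner_sum => E'; rewrite -[RHS]E'.
by rewrite (eq_bigr (fun=> 1)) ?sumr_const ?card_ord // => i _; rewrite hornerXn expr1n.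
Qed.

End Torus.

Section TorusPart.
Variables (k : closedFieldType) (n : nat).
Local Notation gl := (glv k n).
Local Notation irrg X := (@irr k gl X).
Local Notation zcg X := (@zc k gl X).

Lemma prodfz I (r : seq I) (f : I -> k) (t : int) :
  \prod_(i <- r) f i ^ t = (\prod_(i <- r) f i) ^ t.
Proof. by rewrite (big_morph _ (fun x y => expfzMl x y t) (exp1rz _ t)). Qed.

Variables (z : 'M[k]_n) (R : set 'M[k]_n).
Hypotheses (uz : units z) (sR : is_subgroup R) (cR : zcg R) (iR : irrg R)
  (RT : forall g, R g -> Tri (cj z g)).

Lemma dgM i g h : R g -> R h -> dg z i (g *m h) = dg z i g * dg z i h.
Proof. by move=> Rg Rh; rewrite /dg cjM // Tri_diagM //; exact: RT. Qed.

Lemma dg_neq0 i g : R g -> dg z i g != 0.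
Proof. by move=> Rg; apply: Tri_diag_neq0; exact: RT. Qed.

Lemma dgX i g m : R g -> dg z i (g ^+ m) = dg z i g ^+ m.
Proof.
move=> Rg; elim: m => [|m IH]; first by rewrite !expr0 dg1.
by rewrite !exprS dgM // ?IH //; exact: sgX.
Qed.

Lemma dgV i g : R g -> dg z i (ginv g) = (dg z i g)^-1.
Proof. by move=> Rg; rewrite /dg cjV // Tri_diagV //; exact: RT. Qed.

Lemma dg_UT1 g : R g -> (forall i, dg z i g = 1) -> UT 1 (cj z g).
Proof. by move=> Rg g1; apply: Tri_UT1 => //; exact: RT. Qed.

Lemma dg_unips g : R g -> (forall i, dg z i g = 1) -> unips g.
Proof. by move=> Rg g1; apply/(cj_unips g uz); apply: UT1_unip; exact: dg_UT1. Qed.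

Section Character.
Variable psi : gl -> k.
Hypotheses (rpsi : reg psi) (psiM : forall g h, R g -> R h -> psi (g *m h) = psi g * psi h)
  (psi1 : psi 1%:M = 1).

Let dn (j : nat) (b : gl) : k := if (insub j : option 'I_n) is Some i then dg z i b else psi b.

Let dn_ord (i : 'I_n) b : dn i b = dg z i b.
Proof. by rewrite /dn valK. Qed.

Let dn_n b : dn n b = psi b.
Proof. by rewrite /dn insubN // ltnn. Qed.

Let dn_reg j : reg (dn j).
Proof. by rewrite /dn; case: insub => [i|//]; exact: dg_reg. Qed.

Let dnM j g h : R g -> R h -> dn j (g *m h) = dn j g * dn j h.
Proof. by rewrite /dn; case: insub => [i|] Rg Rh; [exact: dgM|exact: psiM]. Qed.

Let dn1 j : dn j 1%:M = 1.
Proof. by rewrite /dn; case: insub => [i|//]; exact: dg1. Qed.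

Lemma dg_image (x : 'I_n -> k) : (forall i, x i != 0) ->
  (forall c : 'I_n -> int, (forall b, R b -> \prod_i dg z i b ^ c i = 1) -> \prod_i x i ^ c i = 1) ->
  exists2 b, R b & forall i, dg z i b = x i.
Proof.
move=> x0 xP; pose xn j := if (insub j : option 'I_n) is Some i then x i else 1.
have xnE (i : 'I_n) : xn i = x i by rewrite /xn valK.
have [|c cP|b Rb bE] := @torus_image k n R n dn xn sR cR iR dn_reg dnM dn1.
- by move=> j; rewrite /xn; case: insub => [i|]; rewrite ?oner_eq0.
- rewrite -[RHS](xP c); first by apply: eq_bigr => i _; rewrite xnE.
  by move=> b Rb; rewrite -[RHS](cP b Rb); apply: eq_bigr => i _; rewrite dn_ord.
- by exists b => // i; rewrite -dn_ord bE // xnE.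
Qed.

(** Otherwise no relation would involve [psi], and by [torus_image] some element would have diagonal
    1 and psi different from 1; but it is unipotent, and [unip_char] applies. *)
Lemma char_power : exists K (a : 'I_n -> int), K != 0 /\
  forall g, R g -> psi g ^ K = \prod_i dg z i g ^ a i.
Proof.
apply: contrapT => /forallNP no.
have [t t0 t1] : exists2 t : k, t != 0 & t != 1.
  have [t] := closed_field_infinite [:: 0; 1 : k].
  by rewrite !inE negb_or => /andP[]; exists t.
pose x j := if j == n then t else 1.
have [|c cP|b Rb bE] := @torus_image k n R n.+1 dn x sR cR iR dn_reg dnM dn1.
- by move=> j; rewrite /x; case: (j == n); rewrite ?oner_eq0.
- have rel g : R g -> (\prod_i dg z i g ^ c (widen_ord (leqnSn n) i)) * psi g ^ c ord_max = 1.
    move=> Rg; rewrite -[RHS](cP g Rg) big_ord_recr /= dn_n; congr (_ * _).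
    by apply: eq_bigr => i _; rewrite -dn_ord.
  have [c0|cn] := eqVneq (c ord_max) 0.
    rewrite big_ord_recr /= c0 expr0z mulr1 big1 // => i _.
    by rewrite /x /= ltn_eqF // exp1rz.
  case: (no (c ord_max)); exists (fun i => - c (widen_ord (leqnSn n) i)); split=> // g Rg.
  have p0 : \prod_i dg z i g ^ c (widen_ord (leqnSn n) i) != 0.
    by apply/prodf_neq0 => i _; rewrite expfz_neq0 // dg_neq0.
  apply: (mulfI p0); rewrite rel // -big_split big1 // => i _ /=.
  by rewrite -expfzDr ?dg_neq0 // subrr expr0z.
- have b1 i : dg z i b = 1.
    by rewrite -dn_ord bE ?ltnS ?(ltnW (ltn_ord i)) // /x ltn_eqF.
  have := unip_char sR cR rpsi psiM psi1 Rb (dg_unips Rb b1).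
  by rewrite -dn_n bE // /x eqxx => E; move: t1; rewrite E eqxx.
Qed.

(** The exponents are replaced by their component orthogonal to the relations. The difference is a
    relation, so on [R] the monomial is only raised to the power [N]; if the exponent of [psi] is
    negative, both sides are inverted. *)
Lemma char_dual : exists (K : nat) (a : 'I_n -> int), [/\ (0 < K)%N,
    forall g, R g -> psi g ^+ K = \prod_i dg z i g ^ a i
  & forall m : 'I_n -> int, (forall g, R g -> \prod_i dg z i g ^ m i = 1) -> \sum_i a i * m i = 0].
Proof.
have [K0 [a0 [K00 E0]]] := char_power.
pose M := [set m : 'rV[int]_n | forall g, R g -> \prod_i dg z i g ^ m 0 i = 1].
have [|||N [a [N0 Ma aM]]] := @int_projection n M (\row_i a0 i).
- by move=> g Rg; rewrite big1 // => i _; rewrite mxE expr0z.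
- move=> u v Mu Mv g Rg.
  transitivity ((\prod_i dg z i g ^ u 0 i) * \prod_i dg z i g ^ v 0 i); last by rewrite Mu // Mv // mulr1.
  by rewrite -big_split; apply: eq_bigr => i _; rewrite mxE expfzDr // dg_neq0.
- move=> t u Mu g Rg; rewrite -[RHS](exp1rz _ t) -[in RHS](Mu g Rg) -prodfz.
  by apply: eq_bigr => i _; rewrite mxE mulrC -exprz_exp.
have key g : R g -> psi g ^ (K0 * N) = \prod_i dg z i g ^ a 0 i.
  move=> Rg; rewrite -exprz_exp E0 // -prodfz.
  have pn : \prod_i dg z i g ^ a 0 i != 0.
    by apply/prodf_neq0 => i _; rewrite expfz_neq0 // dg_neq0.
  apply: (mulIf (invr_neq0 pn)); rewrite divff // -[RHS](Ma g Rg) -prodfV -big_split.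
  by apply: eq_bigr => i _; rewrite !mxE expfzDr ?dg_neq0 // exprz_exp mulrC -invr_expz.
have KN0 : K0 * N != 0 by rewrite mulf_neq0.
have aM' s (m : 'I_n -> int) : (forall g, R g -> \prod_i dg z i g ^ m i = 1) ->
    \sum_i (s * a 0 i) * m i = 0.
  move=> mP; transitivity (s * \sum_i a 0 i * (\row_i m i) 0 i).
    by rewrite mulr_sumr; apply: eq_bigr => i _; rewrite mxE mulrA.
  by rewrite aM ?mulr0 // => g Rg; rewrite -[RHS](mP g Rg); apply: eq_bigr => i _; rewrite mxE.
case: (K0 * N) KN0 key => [K|K] KN0 key.
  exists K, (fun i => a 0 i); split=> //; first by rewrite lt0n.
  by move=> m mP; rewrite -[RHS](aM' 1 m mP); apply: eq_bigr => i _; rewrite mul1r.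
exists K.+1, (fun i => - a 0 i); split=> // [g Rg|m mP].
  have := key g Rg; rewrite NegzE -invr_expz => /(congr1 GRing.inv); rewrite invrK => E.
  by rewrite exprnP E -prodfV; apply: eq_bigr => i _; rewrite invr_expz.
by rewrite -[RHS](aM' (-1) m mP); apply: eq_bigr => i _; rewrite mulN1r.
Qed.

End Character.

Section Lattice.
Variable a : 'I_n -> int.

(** A substitute for a maximal torus. By [irr_centralizer] the centralizer in [C] of a torsion
    element of [C], of order prime to the characteristic, still realizes all diagonals, so by
    minimality it is [C]. *)
Lemma dg_minimal : exists C, [/\ is_subgroup C /\ zcg C, irrg C /\ C `<=` R,
    forall b, R b -> exists2 c, C c & forall i, dg z i c = dg z i b
  & forall t m, C t -> m%:R != 0 :> k -> t ^+ m = 1%:M -> forall g, C g -> g *m t = t *m g].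
Proof.
have [|C [cC [sC iC CR CP] minC]] := @zmin _ gl (fun C => [/\ is_subgroup C, irrg C, C `<=` R &
    forall b, R b -> exists2 c, C c & forall i, dg z i c = dg z i b]).
  by exists R => //; split=> // b Rb; exists b.
exists C; split=> // t m Ct m0 tm g Cg.
have CT x : C x -> Tri (cj z x) by move/CR; exact: RT.
have [i1 i2] := irr_centralizer uz sC cC iC CT m0 Ct tm.
have E : [set g | C g /\ g *m t = t *m g] = C; last by move: Cg; rewrite -E => -[].
apply: minC; [exact: (zcI cC (@zc_comm _ _ t))| |by move=> x []].
split=> //; [exact: centralizer_subgroup|by move=> x [/CR]|].
move=> b /CP[c Cc cE]; have [c' [Cc' c't] U1] := i2 c Cc; exists c' => // i; rewrite -cE.
have := UT1_diag i U1; rewrite -/(dg z i _) dgM ?dgV; try exact: CR; last by apply: CR; exact: sgV.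
move=> E; apply: (mulIf (invr_neq0 (dg_neq0 i (CR _ Cc)))); rewrite E divff // dg_neq0 //; exact: CR.
Qed.

(* The condition on the sums says that t |-> (t^(a i))_i takes values in the image of [dg]. *)
Hypothesis aP : forall m : 'I_n -> int, (forall g, R g -> \prod_i dg z i g ^ m i = 1) ->
  \sum_i a i * m i = 0.

(** Orthogonality of [a] to the relations gives an element [c] of [C] with the prescribed diagonal.
    Its power c^m is unipotent; dividing [c] by an m-th root of it makes the order divide m. *)
Lemma dg_lift C (ze : k) m : is_subgroup C -> zcg C -> C `<=` R ->
  (forall b, R b -> exists2 c, C c & forall i, dg z i c = dg z i b) ->
  m%:R != 0 :> k -> ze ^+ m = 1 ->
  exists2 t, C t /\ t ^+ m = 1%:M & forall i, dg z i t = ze ^ a i.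
Proof.
move=> sC cC CR CP m0 zm.
have z0 : ze != 0.
  apply: contra_eq_neq zm => ->; case: m m0 => [|m] m0; first by rewrite eqxx in m0.
  by rewrite exprS mul0r eq_sym oner_eq0.
have [||i|c cP|b Rb bE] := @dg_image (fun=> 1) (regC _ 1) _ _ (fun i => ze ^ a i).
- by move=> *; rewrite mulr1.
- by [].
- by rewrite expfz_neq0.
- transitivity (ze ^ (\sum_i a i * c i)); last by rewrite aP.
  rewrite (big_morph (fun t => ze ^ t) (id1 := 1) (op1 := *%R)) //; last by move=> u v; rewrite expfzDr.
  by apply: eq_bigr => i _; rewrite exprz_exp.
have {Rb} [c Cc cE] := CP b Rb; have {bE cE} cE i : dg z i c = ze ^ a i by rewrite cE bE.
have Rc := CR _ Cc; have uc := sgU sC Cc.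
have cm1 i : dg z i (c ^+ m) = 1 by rewrite dgX // cE exprnP exprz_exp mulrC -exprz_exp -exprnP zm exp1rz.
have Rcm := CR _ (sgX m sC Cc).
have [r [_ r2 r3]] := @root_fun k n m m0.
have un := dg_unips Rcm cm1.
(* The root lies in every closed subgroup containing c^m, in particular in the centralizer of [c],
   so it can be divided off without disturbing powers. *)
have [Cr rc] := r2 _ [set g | C g /\ g *m c = c *m g] un (centralizer_subgroup c sC)
  (zcI cC (@zc_comm _ _ c)) (conj (sgX m sC Cc) (esym (commrX m (erefl _)))).
have Ur := r2 _ [set g | UT 1 (cj z g)] un (cj_subgroup uz (UT_subgroup k n 1)) (cj_zc (z := z) (@UT_zc k n 1))
  (dg_UT1 Rcm cm1).
have rE := r3 _ un; set u := r _ in Cr rc Ur rE.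
have uu := sgU sC Cr; have Cui : C (ginv u) := sgV sC Cr.
exists (c *m ginv u).
  split; first exact: sgM.
  have com : GRing.comm c (ginv u).
    rewrite /GRing.comm -[c * _]/(c *m ginv u) -[_ * c]/(ginv u *m c).
    apply: (can_inj (mulKmx uu)); rewrite !mulmxA mulgV // mul1mx rc -mulmxA mulgV // mulmx1.
    by [].
  rewrite -[c *m _]/(c * ginv u) exprMn_comm // -ginvX // rE -[_ * _]/(_ *m _) mulgV //.
  exact: sgU sC (sgX m sC Cc).
move=> i; rewrite dgM //; [|exact: CR]; rewrite dgV; last exact: CR.
by rewrite -cE {2}/dg (UT1_diag i Ur) invr1 mulr1.
Qed.

End Lattice.

End TorusPart.

Section DualTorus.
Variables (k : closedFieldType) (n : nat).
Local Notation gl := (glv k n).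
Local Notation irrg X := (@irr k gl X).
Local Notation zcg X := (@zc k gl X).

(** The irreducible component lies in the closure of the part of [H] in a single coset; that coset
    is closed, so it contains 1 and is the component. *)
Lemma idcomp_dense (H : set 'M[k]_n) : is_subgroup H ->
  idcomp (@cl k gl H) `<=` @cl k gl (H `&` idcomp (@cl k gl H)).
Proof.
move=> sH; set A := @cl k gl H; have sA : is_subgroup A := cl_subgroup sH.
have cA : zcg A := @zc_cl _ gl H.
have sI := idcomp_subgroup sA; have [m [q [Aq qP]]] := idcomp_index sA cA.
have rq i : regmap ((fun g => ginv (q i) *m g) : gl -> gl) by reg_tac.
have cI i : zcg [set g | idcomp A (ginv (q i) *m g)].
  exact: (zc_preim (rq i) (idcomp_zc sA cA)).
have [|||i lti IF] := @irr_sub_bigU _ gl (idcomp A)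
    (fun i => @cl k gl [set g | H g /\ idcomp A (ginv (q i) *m g)]) m.
- exact: idcomp_irr.
- by move=> i _; exact: zc_cl.
- apply: subset_trans (@idcomp_sub _ _ A) _; apply: (@cl_sub _ gl).
    by apply: zc_bigU => i _; exact: zc_cl.
  move=> g Hg; have [i lti Ii] := qP g (@sub_cl _ gl _ _ Hg).
  by exists i => //; apply: (@sub_cl _ gl); split.
have uq := sgU sA (Aq i lti).
have Iq : idcomp A (q i).
  have : idcomp A (ginv (q i) *m 1%:M).
    by apply: (@cl_sub _ gl _ _ (cI i) _ _ (IF _ (sg1 sI))) => g [].
  by rewrite mulmx1 => /(sgV sI); rewrite ginvK.
move=> g /IF; apply: cl_mono => h [Hh Ih]; split=> //.
by have := sgM sI Iq Ih; rewrite mulmxA mulgV // mul1mx.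
Qed.

(** By the pigeonhole principle two of the first powers of [t] lie in the same coset, and their
    difference of exponents is smaller than [l], hence invertible modulo [l]. *)
Lemma prime_order_idcomp (A : set 'M[k]_n) : is_subgroup A -> zcg A -> exists N,
  forall l t, prime l -> (N < l)%N -> A t -> t ^+ l = 1%:M -> idcomp A t.
Proof.
move=> sA cA; have sI := idcomp_subgroup sA; have [m [q [Aq qP]]] := idcomp_index sA cA.
exists m => l t pl ltl At tl; have ut := sgU sA At.
have /choice[f fP] : forall i : 'I_m.+1, exists j : 'I_m, idcomp A (ginv (q j) *m t ^+ i).
  by move=> i; have [j ltj Ij] := qP _ (sgX i sA At); exists (Ordinal ltj).
have [i [j [ltij fE]]] : exists i j : 'I_m.+1, (i < j)%N /\ f i = f j.
  apply: contrapT => no; have inj : injective f.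
    move=> i j fE; case: (ltngtP i j) => [lt|lt|/val_inj//]; case: no; first by exists i, j.
    by exists j, i.
  by have := leq_card f inj; rewrite !card_ord ltnn.
have uq := sgU sA (Aq (f i) (ltn_ord _)).
have Id : idcomp A (t ^+ (j - i)).
  have := sgM sI (sgV sI (fP i)) (fP j); rewrite -fE ginvM ginvK // mulmxA -(mulmxA _ (q (f i))) mulgV //.
  rewrite mulmx1 -{1}(subnKC (ltnW ltij)) exprD -[_ * _]/(t ^+ i *m t ^+ (j - i)) mulmxA mulVg ?mul1mx //.
  exact: sgU sA (sgX i sA At).
have cop : coprime (j - i) l.
  rewrite coprime_sym prime_coprime //; apply/negP => /dvdn_leq.
  rewrite subn_gt0 => /(_ ltij); rewrite leqNgt => /negP; apply.
  by apply: leq_ltn_trans (leq_subr _ _) _; apply: leq_ltn_trans ltl; rewrite -ltnS.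
have ji0 : (0 < j - i)%N by rewrite subn_gt0.
have [u v uvE _] := egcdnP l ji0; move: cop; rewrite /coprime => /eqP cop.
have := sgX u sI Id; rewrite -exprM mulnC uvE cop addn1 exprSr mulnC exprM tl.
by rewrite -[1%:M]/1 expr1n mul1r.
Qed.

(* [Th] consists of values at roots of unity of the cocharacter dual to [psi ^+ K],
   and [La] is the closure of its image. *)
Lemma torus_part (z : 'M[k]_n) R (psi : gl -> k) : units z -> is_subgroup R -> zcg R -> irrg R ->
  (forall g, R g -> Tri (cj z g)) ->
  reg psi -> (forall g h, R g -> R h -> psi (g *m h) = psi g * psi h) -> psi 1%:M = 1 ->
  exists (K : nat) (a : 'I_n -> int) La Th, [/\
    (0 < K)%N /\ forall g, R g -> psi g ^+ K = \prod_i dg z i g ^ a i,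
    [/\ is_subgroup La, zcg La, irrg La, La `<=` R & forall g h, La g -> La h -> g *m h = h *m g],
    Th `<=` La /\ La `<=` @cl k gl Th,
    forall t, Th t -> exists m ze, [/\ m%:R != 0 :> k, t ^+ m = 1%:M, ze != 0
      & forall i, dg z i t = ze ^ a i]
  & forall N, exists l t ze, [/\ prime l, (N < l)%N, l%:R != 0 :> k, Th t &
      [/\ t ^+ l = 1%:M, ze ^+ l = 1, ze != 1 & forall i, dg z i t = ze ^ a i]]].
Proof.
move=> uz sR cR iR RT rpsi psiM psi1.
have [K [a [K0 Ka aP]]] := char_dual uz sR cR iR RT rpsi psiM psi1.
have [C [[sC cC] [iC CR] CP Ccen]] := dg_minimal uz sR cR iR RT.
(* [H] is a group because such torsion elements are central in [C]. Its closure may be disconnected;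
   [La] is the identity component, and lifts of large prime order fall into it by
   [prime_order_idcomp]. *)
pose H := [set t | C t /\ exists m ze, [/\ m%:R != 0 :> k, t ^+ m = 1%:M, ze ^+ m = 1
  & forall i, dg z i t = ze ^ a i]].
have z0 (ze : k) m : m%:R != 0 :> k -> ze ^+ m = 1 -> ze != 0.
  move=> m0 zm; apply: contra_eq_neq zm => ->; case: m m0 => [|m] m0; first by rewrite eqxx in m0.
  by rewrite exprS mul0r eq_sym oner_eq0.
have sH : is_subgroup H.
  apply: is_subgroup_ginv.
  - by move=> t [/(sgU sC)].
  - split; first exact: sg1.
    exists 1%N, 1; rewrite !expr1; split=> // [|i]; first exact: oner_neq0.
    by rewrite exp1rz dg1.
  - move=> t t' [Ct [m [ze [m0 tm zm tE]]]] [Ct' [m' [ze' [m0' tm' zm' tE']]]].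
    split; first exact: sgM.
    exists (m * m')%N, (ze * ze'); split.
    + by rewrite natrM mulf_neq0.
    + rewrite -[t *m t']/(t * t') exprMn_comm; last exact: Ccen Ct' m0' tm' _ Ct.
      by rewrite exprM tm mulnC exprM tm' -[1%:M]/1 !expr1n mul1r.
    + by rewrite exprMn exprM zm expr1n mulnC exprM zm' expr1n mul1r.
    + by move=> i; rewrite (dgM uz RT) ?tE ?tE' ?expfzMl //; exact: CR.
  - move=> t [Ct [m [ze [m0 tm zm tE]]]]; split; first exact: sgV.
    exists m, ze^-1; split=> //; first by rewrite -ginvX tm ginv1.
      by rewrite exprVn zm invr1.
    by move=> i; rewrite (dgV uz RT) ?tE; [rewrite invr_expz -exprz_inv|exact: CR].
set A := @cl k gl H; have sA : is_subgroup A := cl_subgroup sH.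
have cA : zcg A := @zc_cl _ gl H.
have AC : A `<=` C by apply: cl_sub => // t [].
have Acen g : C g -> forall t, A t -> g *m t = t *m g.
  move=> Cg t At; apply/esym; move: t At; apply: cl_sub; first exact: zc_comm.
  by move=> t [Ct [m [ze [m0 tm _ _]]]] /=; rewrite (Ccen t m Ct m0 tm g Cg).
have IA := @idcomp_sub _ _ A.
exists K, a, (idcomp A), (H `&` idcomp A); split=> //.
- split; [exact: idcomp_subgroup|exact: idcomp_zc|exact: idcomp_irr|by move=> g /IA/AC/CR|].
  by move=> g h /IA/AC Cg /IA; exact: Acen.
- by split; [move=> t []|exact: idcomp_dense].
- move=> t [[_ [m [ze [m0 tm zm tE]]]] _]; exists m, ze; split=> //; exact: z0 zm.
- move=> N; have [N' N'P] := prime_order_idcomp sA cA.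
  have [l [pl ltl l0]] := large_prime k (maxn N N').
  have [ze zl z1] := prime_root pl l0.
  have [t [Ct tl] tE] := dg_lift uz sR cR iR RT aP sC cC CR CP l0 zl.
  have Ht : H t by split=> //; exists l, ze.
  exists l, t, ze; split=> //; first exact: leq_ltn_trans (leq_maxl _ _) ltl.
  split=> //; apply: N'P tl => //; last exact: (@sub_cl _ gl).
  exact: leq_ltn_trans (leq_maxr _ _) ltl.
Qed.

End DualTorus.

(** * Unipotent radicals and closedness of parabolic subgroups *)

Section Radical.
Variable k : closedFieldType.

Lemma regon_gl n (X : var k) (S : set X) (h : X -> 'M[k]_n) :
  (forall i j, exists2 F, reg F & forall x, S x -> h x i j = F x) ->
  (exists2 F, reg F & forall x, S x -> (\det (h x))^-1 = F x) -> regon (Y := glv k n) S h.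
Proof.
move=> hP [d rd dP]; apply: regonP => i.
have [lt|le] := ltnP i #|{: 'I_n * 'I_n}|; last first.
  have [iN|iN] := eqVneq i #|{: 'I_n * 'I_n}|; last first.
    exists (fun=> 0); first exact: regC.
    by move=> u _ /=; rewrite nth_default // size_rcons size_map -cardT ltn_neqAle eq_sym iN.
  by exists d => // u un; rewrite -dP //= iN nth_rcons size_map -cardT ltnn eqxx.
have [p0 _] : exists p0 : 'I_n * 'I_n, True.
  by move: lt; case: (pickP {: 'I_n * 'I_n}) => [p0|/eq_card0 ->] //; exists p0.
have [F rF FE] := hP (nth p0 (enum {: 'I_n * 'I_n}) i).1 (nth p0 (enum {: 'I_n * 'I_n}) i).2.
by exists F => // u Su /=; rewrite -FE // nth_rcons size_map -cardT lt (nth_map p0) // -cardT.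
Qed.

Lemma morphism1 m n (H : set 'M[k]_m) (K : set 'M[k]_n) f : is_subgroup H -> K `<=` @units k n ->
  morphism H K f -> f 1%:M = 1%:M.
Proof.
move=> sH KU [fK _ fM]; have H1 := sg1 sH; have u1 := KU _ (fK _ H1).
by apply: (can_inj (mulKmx u1)); rewrite -fM // !mulmx1.
Qed.

Lemma morphismV m n (H : set 'M[k]_m) (K : set 'M[k]_n) f g : is_subgroup H -> K `<=` @units k n ->
  morphism H K f -> H g -> f (ginv g) = ginv (f g).
Proof.
move=> sH KU mf Hg; have [fK _ fM] := mf; have ug := KU _ (fK _ Hg).
apply: (can_inj (mulKmx ug)); rewrite mulgV // -fM ?mulgV ?(morphism1 sH KU mf) //.
  exact: sgU Hg.
exact: sgV.
Qed.

Lemma morphism_regon m n (H : set 'M[k]_m) (K : set 'M[k]_n) f : is_subgroup H ->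
  K `<=` @units k n -> morphism H K f -> @regon k (glv k m) (glv k n) H f.
Proof.
move=> sH KU mf; have [fK fr fM] := mf.
have HU : H `<=` @units k m by move=> g; exact: sgU.
have ent i j : exists2 F : glv k m -> k, reg F & forall x, H x -> f x i j = F x.
  by have [F rF FE] := regular_on_reg HU (fr i j); exists F => // x Hx; rewrite FE.
apply: regon_gl => //.
have /choice[F FP] : forall i, exists F : 'I_n -> glv k m -> k, forall j, reg (F j) /\
    forall x, H x -> f x i j = F j x.
  move=> i; have /choice[F FP] := fun j => let: ex_intro2 F a b := ent i j in ex_intro
    (fun F : glv k m -> k => reg F /\ forall x, H x -> f x i j = F x) F (conj a b).
  by exists F.
exists (fun g : glv k m => \det (\matrix_(i, j) F i j (ginv g))).
  apply: reg_det => i j; apply: (@reg_eq _ (glv k m) (fun g => F i j (ginv g))) => [x|].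
    by rewrite mxE.
  apply: (@reg_comp _ (glv k m) (glv k m) (fun g => ginv g) (F i j)); first by reg_tac.
  by have [] := FP i j.
move=> g Hg; have Hgi := sgV sH Hg.
have -> : \matrix_(i, j) F i j (ginv g) = f (ginv g).
  by apply/matrixP => i j; rewrite mxE; have [_ ->] := FP i j.
by rewrite -[RHS]invrK (morphismV sH KU mf Hg) det_ginv.
Qed.

Lemma eigen_char n m (rho : glv k n -> 'M[k]_m) (v : 'cV[k]_m) : regm rho -> v != 0 ->
  exists2 psi : glv k n -> k, reg psi & forall g c, rho g *m v = c *: v -> psi g = c.
Proof.
move=> rr v0; have [i vi] : exists i, v i 0 != 0.
  apply: contrapT => /forallNP no; case/negP: v0; apply/eqP/matrixP => i j.
  by rewrite (ord1 j) mxE; apply/eqP; apply: contrapT => /negP; exact: no.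
exists (fun g => (rho g *m v) i 0 / v i 0).
  apply: regM (regC _ _); exact: (regm_mul rr (regm_cst _ v)).
by move=> g c ->; rewrite mxE mulfK.
Qed.

Lemma parallel_col m (v w : 'cV[k]_m) : v != 0 ->
  (forall xi : 'rV_m, xi *m v = 0 -> xi *m w = 0) -> exists c, w = c *: v.
Proof.
move=> v0 vw; have [i vi] : exists i, v i 0 != 0.
  apply: contrapT => /forallNP no; case/negP: v0; apply/eqP/matrixP => i j.
  by rewrite (ord1 j) mxE; apply/eqP; apply: contrapT => /negP; exact: no.
have dm (u : 'cV[k]_m) l : (delta_mx (0 : 'I_1) l *m u) = (u l 0)%:M.
  by rewrite -rowE; apply/matrixP => a b; rewrite !ord1 !mxE eqxx.
exists (w i 0 / v i 0); apply/matrixP => j b; rewrite (ord1 b) mxE.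
have := vw (v i 0 *: delta_mx 0 j - v j 0 *: delta_mx 0 i).
rewrite !mulmxBl -!scalemxAl !dm => H.
have {}H : v i 0 * w j 0 = v j 0 * w i 0.
  apply/eqP; rewrite -subr_eq0; apply/eqP; move: H.
  have E : v i 0 *: (v j 0)%:M - v j 0 *: (v i 0)%:M = 0 :> 'M[k]_1.
    by rewrite !scale_scalar_mx mulrC subrr.
  by move=> /(_ E)/matrixP/(_ 0 0); rewrite !mxE eqxx !mulr1n.
by apply: (mulfI vi); rewrite H mulrA [v i 0 * _]mulrC divfK // mulrC.
Qed.

Variable n : nat.
Local Notation gl := (glv k n).
Local Notation irrg X := (@irr k gl X).
Local Notation zcg X := (@zc k gl X).

(** A closed orbit on triangular cosets has a stabilizer [D] with complete quotient. Characters of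
    [D] are trivial, so the vector [v] of the line stabilized by [D] is fixed by [D]; its orbit map
    is then a function on a complete quotient, hence constant, and [D] is all of [U]. *)
Lemma kolchin (U : set 'M[k]_n) : is_subgroup U -> zcg U -> irrg U -> unipotent_group U ->
  exists2 z, units z & forall u, U u -> Tri (cj z u).
Proof.
move=> sU cU iU uU; have UU : U `<=` @units k n by move=> g; exact: sgU.
have [z uz coD] : exists2 z, units z & complete U [set g | U g /\ Tri (ginv z *m g *m z)].
  apply: (complete_fix sU cU iU (Tri_subgroup k n) (@Tri_zc k n) (@Tri_irr k n) (@zc_units k n)) => //.
  - by exists 1%:M; exact: units1.
  - by move=> r s d Ur us [ud _]; apply/unitsM; split=> //; apply/unitsM; split=> //; exact: UU.
  - exact: complete_Tri.
set D := [set g | _] in coD; exists z => //.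
have sD : is_subgroup D := fix_coset_subgroup sU (Tri_subgroup k n) uz.
have cD : zcg D := zcI cU (@conj_zc _ _ _ z (@Tri_zc k n)).
have DU : D `<=` U by move=> g [].
have [m [rho [v [rr rM r1 _ [v0 rD]]]]] := line_stabilizer sU sD DU cD.
have [psi rpsi psiE] := eigen_char rr v0.
have rhoD d : D d -> rho d *m v = psi d *: v.
  by move=> Dd; have [c E] := (rD d (DU _ Dd)).1 Dd; rewrite (psiE _ _ E).
have psi1 d : D d -> psi d = 1.
  move=> Dd; apply: (unip_char sD cD rpsi) => //.
  - move=> g h Dg Dh; apply: psiE; have [Ug Uh] := (DU _ Dg, DU _ Dh).
    by rewrite rM // -mulmxA rhoD // -scalemxAr rhoD // scalerA mulrC.
  - by apply: psiE; rewrite r1 mul1mx scale1r.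
  - have [Ud Td] := Dd; have [j dj] := uU _ Ud; apply/(cj_unips d uz); apply: UT1_unip.
    apply: (@unip_UT1 _ _ _ j) => //.
    have -> : cj z d - 1%:M = cj z (d - 1%:M) by rewrite /cj mulmxBr mulmxBl mulmx1 mulVg.
    by rewrite -cjX // dj /cj mulmx0 mul0mx.
have inv u : U u -> rho u *m v = v.
  move=> Uu; apply/matrixP => i j; rewrite (ord1 j).
  have [||x Ux|x d Ux Dd|c cE] := @ratio_const k n U D (fun g => (rho g *m v) i 0) (fun=> 1) iU cU coD _
      (regC _ 1).
  - exact: (regm_mul rr (regm_cst _ v)).
  - by move=> x d Ux [Ud _]; exact: sgM.
  - exact: oner_neq0.
  - by have Ud := DU _ Dd; rewrite rM // -mulmxA rhoD // psi1 // scale1r.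
  - by rewrite cE // -(cE 1%:M (sg1 sU)) r1 mul1mx.
by move=> u Uu; have [] : D u by apply/(rD u Uu); exists 1; rewrite inv // scale1r.
Qed.

(** A regular function is inverse to the determinant on [S]; this identity persists on the closure,
    so the extended entries still give invertible matrices. *)
Lemma regon_cl (X : var k) (S : set X) (h : X -> 'M[k]_n) : @regon k X gl S h ->
  (forall x, S x -> units (h x)) ->
  exists h', @regon k X gl (cl S) h' /\ forall x, S x -> h' x = h x.
Proof.
move=> rh hU.
have /choice[F FP] : forall p : 'I_n * 'I_n, exists F : X -> k, reg F /\
    forall x, S x -> h x p.1 p.2 = F x.
  by move=> p; have [F rF FE] := rh _ (reg_entry k p.1 p.2); exists F.
have [d rd dE] := rh _ (@reg_detV k n).
pose h' x : 'M[k]_n := \matrix_(i, j) F (i, j) x.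
have h'E x : S x -> h' x = h x.
  by move=> Sx; apply/matrixP => i j; rewrite mxE; have [_ <-] := FP (i, j).
have rh' : regm h' by move=> i j; apply: (@reg_eq _ _ (F (i, j))) => [x|]; [rewrite mxE|have [] := FP (i, j)].
exists h'; split=> //; apply: regon_gl => [i j|].
  by exists (F (i, j)) => [|x _]; [have [] := FP (i, j)|rewrite mxE].
exists d => // x cx.
have E : \det (h' x) * d x = 1.
  apply/eqP; rewrite -subr_eq0; apply/eqP.
  apply: (cx (fun x => \det (h' x) * d x - 1)).
    by apply: regB (regC _ _); apply: regM => //; exact: reg_det.
  move=> y Sy; have := hU _ Sy; rewrite h'E // -dE // /units /= unitmxE unitfE => dn.
  by rewrite divff // subrr.
have d0 : \det (h' x) != 0 by apply: contra_eq_neq E => ->; rewrite mul0r eq_sym oner_eq0.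
by apply: (mulfI d0); rewrite divff.
Qed.

End Radical.

Section Parabolic.
Variables (k : closedFieldType) (n : nat).
Local Notation gl := (glv k n).
Local Notation irrg X := (@irr k gl X).
Local Notation zcg X := (@zc k gl X).
Variables G B : set 'M[k]_n.
Hypotheses (sG : is_subgroup G) (cG : zcg G) (iG : irrg G) (bB : borel_subgroup G B).

Section RadicalOf.
Variable P : set 'M[k]_n.
Hypotheses (sP : is_subgroup P) (BP : B `<=` P) (PG : P `<=` G).

(** [U] is solvable by [kolchin], so it fixes a coset yB with y in the closure of [P], and y still
    normalizes [U]. The closure is taken because [P] is not yet known to be closed. *)
Lemma normal_unipotent_borel U : is_subgroup U -> zcg U -> irrg U -> unipotent_group U ->
  normal_in P U -> U `<=` B.
Proof.
move=> sU cU iU uU [UP Un]; have [z uz UT] := kolchin sU cU iU uU.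
have solU := solvable_Tri uz sU UT; have sC : is_subgroup (@cl k gl P) := cl_subgroup sP.
have PC : P `<=` @cl k gl P := @sub_cl _ gl P.
have CG : @cl k gl P `<=` G by exact: cl_sub.
have [||y Py yU] := borel_fixed_point sG cG iG bB sU cU iU solU (@zc_cl _ gl P) CG.
- by exists 1%:M; exact: sg1 sC.
- by move=> r s b Ur Cs Bb; apply: (sgM sC); [apply: (sgM sC) => //; apply: PC; exact: UP|apply: PC; exact: BP].
have norm u : U u -> U (y *m u *m ginv y).
  move=> Uu; move: y Py {yU}; apply: cl_sub => [|g Pg] /=; last first.
    by rewrite ginvE; [exact: Un|exact: sgU Pg].
  by apply: (@zc_preim _ gl gl (fun g => g *m u *m ginv g)) => //; reg_tac.
move=> u Uu; have uy := sgU sC Py; have := yU _ (norm u Uu).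
by rewrite !mulmxA mulVg // mul1mx -mulmxA mulVg // mulmx1.
Qed.

Let fam := [set U : set 'M[k]_n | [/\ algebraic_group U, zconnected U, normal_in P U & unipotent_group U]].

Let famP U : fam U -> [/\ is_subgroup U, zcg U, irrg U, U `<=` B & unipotent_group U].
Proof.
move=> [/algebraic_groupP[sU cU] coU nU uU]; have iU := zconnected_irr sU cU coU.
by split=> //; exact: normal_unipotent_borel.
Qed.

Let radE : unipotent_radical P = gen [set g | exists i : {U | fam U}, sval i g].
Proof.
congr gen; apply/seteqP; split=> g; first by move=> [U fU Ug]; exists (exist _ U fU).
by move=> [[U fU] /= Ug]; exists U.
Qed.

Let genU : [set g | exists i : {U | fam U}, sval i g] `<=` @units k n.
Proof. by move=> g [[U fU] /= Ug]; have [sU _ _ _ _] := famP fU; exact: sgU Ug. Qed.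

Lemma radical_subgroup : is_subgroup (unipotent_radical P).
Proof. by rewrite radE; exact: gen_subgroup. Qed.

Lemma radical_irr : irrg (unipotent_radical P).
Proof.
rewrite radE; apply: irr_gen => -[U fU] /=; have [sU _ iU _ _] := famP fU => //.
  exact: sg1.
by move=> g; exact: sgU.
Qed.

Lemma radical_borel : unipotent_radical P `<=` B.
Proof.
have /borelP[[sB _ _ _ _] _] := bB.
by rewrite radE; apply: gen_sub => // g [[U fU] /= Ug]; have [_ _ _ UB _] := famP fU; exact: UB.
Qed.

Lemma radical_UT1 z : units z -> (forall b, B b -> Tri (cj z b)) ->
  unipotent_radical P `<=` [set g | UT 1 (cj z g)].
Proof.
move=> uz BT; rewrite radE; apply: gen_sub; first exact: cj_subgroup (UT_subgroup k n 1).
move=> g [[U fU] /= Ug]; have [_ _ _ UB uU] := famP fU; have [m gm] := uU _ Ug.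
apply: (@unip_UT1 _ _ _ m); first by apply: BT; exact: UB.
have -> : cj z g - 1%:M = cj z (g - 1%:M) by rewrite /cj mulmxBr mulmxBl mulmx1 mulVg.
by rewrite -cjX // gm /cj mulmx0 mul0mx.
Qed.

Lemma sub_radical U : is_subgroup U -> zcg U -> irrg U -> U `<=` P ->
  (forall g u, P g -> U u -> U (g *m u *m ginv g)) -> U `<=` @unips k n ->
  U `<=` unipotent_radical P.
Proof.
move=> sU cU iU UP Un uU; apply: subset_trans (@sub_gen _ _ _) => u Uu; exists U => //.
split; [exact/algebraic_groupP|exact: irr_zconnected| |by move=> x Ux; exists n; exact: uU].
by split=> // g x Pg Ux; rewrite -ginvE; [exact: Un|exact: sgU Pg].
Qed.

Lemma radical_normal g v : P g -> unipotent_radical P v -> unipotent_radical P (g *m v *m ginv g).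
Proof.
move=> Pg; have ug := sgU sP Pg; have ugi := unitsV ug.
have sK : is_subgroup [set v | unipotent_radical P (g *m v *m ginv g)].
  have := cj_subgroup ugi radical_subgroup; congr is_subgroup.
  by apply/seteqP; split=> x; rewrite /= /cj ginvK.
move: v; rewrite {1}/unipotent_radical; apply: gen_sub => // u [U fU Uu].
apply: (@sub_gen _ _ (\bigcup_(U in fam) U)); exists U => //.
by have [_ _ [_ Un] _] := fU; rewrite ginvE //; exact: Un.
Qed.

(** The closure of the radical is again connected, normal and unipotent, hence contained in the
    radical. *)
Lemma radical_zc : zcg (unipotent_radical P).
Proof.
have [_ [z uz BT]] := complete_borel sG cG iG bB.
have sV := radical_subgroup; have sC : is_subgroup (@cl k gl (unipotent_radical P)) := cl_subgroup sV.
suff <- : @cl k gl (unipotent_radical P) = unipotent_radical P by exact: zc_cl.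
apply/seteqP; split; last exact: (@sub_cl _ gl).
have CU : @cl k gl (unipotent_radical P) `<=` [set g | UT 1 (cj z g)].
  exact: (@cl_sub _ gl _ _ (cj_zc (z := z) (@UT_zc k n 1)) (radical_UT1 uz BT)).
have /borelP[[sB cB _ _ _] _] := bB.
apply: sub_radical => //; [exact: zc_cl|exact: irr_cl radical_irr| | |].
- by apply: subset_trans BP; exact: (@cl_sub _ gl _ _ cB radical_borel).
- move=> g u Pg; apply: (@cl_stable _ gl _ (fun u => g *m u *m ginv g)); first by reg_tac.
  by move=> x Vx; exact: radical_normal.
- by move=> g /CU Ug; apply/(cj_unips g uz); exact: UT1_unip.
Qed.

(* For x in the closure of P the product pr(x)^-1 x is still in the closed radical. *)
Lemma levi_closed L : levi_subgroup P L -> zcg P.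
Proof.
move=> [/algebraic_groupP[sL cL] LP [pr [mpr prL prV]]].
have LU : L `<=` @units k n by move=> g; exact: sgU.
have [prK _ prM] := mpr; have rpr := morphism_regon sP LU mpr.
have [h [rh hE]] := regon_cl rpr (fun x Px => LU _ (prK x Px)).
have sV := radical_subgroup; have cV := radical_zc.
suff <- : @cl k gl P = P by exact: zc_cl.
apply/seteqP; split; last exact: (@sub_cl _ gl).
have rid : @regon k gl gl (@cl k gl P) (fun x => x) by apply: regmap_on; exact: regmap_id.
have rq := regonM (regonV rh) rid.
have sub : @cl k gl P `<=` [set x | @cl k gl P x /\ unipotent_radical P (ginv (h x) *m x)] `&`
    [set x | @cl k gl P x /\ L (h x)].
  apply: (@cl_sub _ gl).
    exact: (zcI (zc_regon rq (@zc_cl _ gl P) cV) (zc_regon rh (@zc_cl _ gl P) cL)).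
  move=> x Px; have Cx : @cl k gl P x by exact: (@sub_cl _ gl).
  have Lx := prK x Px; split; split=> //; rewrite hE //.
  have PL := LP _ Lx; have PLi := sgV sP PL.
  apply/prV; first exact: sgM.
  by rewrite prM // (morphismV sP LU mpr PL) prL // mulVg //; exact: LU.
have VB := radical_borel.
move=> x /sub[[_ Vx] [_ Lx]]; have := sgM sP (LP _ Lx) (BP (VB _ Vx)).
by rewrite mulmxA mulgV ?mul1mx //; exact: LU.
Qed.

End RadicalOf.

Lemma ga_subgroup : is_subgroup (range (@ga k)).
Proof.
have gaM (x y : k) : ga x *m ga y = ga (x + y).
  rewrite /ga mulmxDl mul1mx mulmxDr mulmx1 -scalemxAl -scalemxAr mul_delta_mx_0 // !scaler0 addr0.
  by rewrite -addrA -scalerDl addrC [y + x]addrC addrC.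
have ga0 : ga 0 = 1%:M :> 'M[k]_2 by rewrite /ga scale0r addr0.
have unit (x : k) : ga x \in unitmx.
  by have /mulmx1_unit[] : ga x *m ga (- x) = 1%:M by rewrite gaM subrr.
split.
- by move=> _ [x _ <-] /=.
- by exists 0.
- by move=> _ _ [x _ <-] [y _ <-]; exists (x + y).
- move=> _ [x _ <-]; exists (- x) => //.
  by rewrite -[LHS]mulmx1 -(mulmxV (unit x)) mulmxA gaM addNr ga0 mul1mx.
Qed.

Lemma ga_irr : @irr k (glv k 2) (range (@ga k)).
Proof.
apply: irr_lines.
- by move=> g; exact: sgU ga_subgroup.
- by exists (ga 0), 0.
move=> _ _ t [x _ <-] [y _ <-] _; exists (x + t * (y - x)) => //.
rewrite /ga -addrA opprD addrACA subrr add0r -scalerBl scalerA -scalerDl.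
by [].
Qed.

Lemma root_subgroup_irr T a U : is_root_subgroup G T a U -> irrg U /\ is_subgroup U.
Proof.
move=> [/algebraic_groupP[sU cU] UG [u [mu [v [mv vu uv]]] _]].
have UU : U `<=` @units k n by move=> g; exact: sgU.
have ru := morphism_regon ga_subgroup UU mu; split=> //.
have := irr_regon ru (fun _ => id) ga_irr; congr irr; apply/seteqP; split=> g.
  by move=> [x gx <-]; have [uK _ _] := mu; exact: uK.
by move=> Ug; exists (v g); [have [vK _ _] := mv; exact: vK|exact: uv].
Qed.

(** Irreducibility comes from [irr_gen], root subgroups being images of the additive group.
    Closedness is absent here: it is deduced from the Levi decomposition in [levi_closed]. *)
Lemma standard_parabolicP T J : let P := standard_parabolic G B T J in
  [/\ is_subgroup P, irrg P, B `<=` P & P `<=` G].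
Proof.
have /borelP[[sB cB iB _ BG] _] := bB.
set A := B `|` \bigcup_(a in J) root_subgroup G T (char_opp a) => /=.
have AG : A `<=` G by move=> g [/BG//|[a Ja [U [_ UG _] Ug]]]; exact: UG.
have AU : A `<=` @units k n by move=> g /AG; exact: sgU.
split; [exact: gen_subgroup| |by move=> g Bg; apply: sub_gen; left|exact: gen_sub].
pose I := {U : set 'M[k]_n | [/\ irrg U, is_subgroup U & U `<=` A]}.
rewrite /standard_parabolic -/A (_ : A = [set g | exists i : I, sval i g]).
  apply: irr_gen => -[U [iU sU UA]] //=; first exact: sg1.
  by move=> g; exact: sgU.
apply/seteqP; split=> g; last by move=> [[U [iU sU UA]] /= /UA].
move=> [Bg|[a Ja [U rU Ug]]].
  have h : [/\ irrg B, is_subgroup B & B `<=` A] by split=> // x Bx; left.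
  by exists (exist _ B h).
have [iU sU] := root_subgroup_irr rU.
have h : [/\ irrg U, is_subgroup U & U `<=` A] by split=> // x Ux; right; exists a => //; exists U.
by exists (exist _ U h).
Qed.

End Parabolic.

(** * Averaging operators and torsion elements *)

Section Averages.
Variables (k : closedFieldType) (n : nat).
Local Notation gl := (glv k n).
Local Notation irrg X := (@irr k gl X).
Local Notation zcg X := (@zc k gl X).

Definition avgm (x : 'M[k]_n) m : 'M[k]_n := m%:R^-1 *: \sum_(j < m) x ^+ j.

Lemma avgm_fix x m : x ^+ m = 1 -> x * avgm x m = avgm x m.
Proof.
move=> xm; rewrite /avgm -[x * _]/(x *m _) -scalemxAr; congr (_ *: _).
rewrite -[x *m _]/(x * _).
case: m xm => [|m] xm; first by rewrite !big_ord0 mulr0.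
rewrite mulr_sumr big_ord_recr /= -exprS xm [in RHS]big_ord_recl expr0 addrC; congr (_ + _).
by apply: eq_bigr => j _; rewrite -exprS.
Qed.

Lemma avgm_comm x y m : GRing.comm y x -> GRing.comm y (avgm x m).
Proof.
move=> c; rewrite /GRing.comm /avgm -[y * _]/(y *m _) -[_ * y]/(_ *m y) -scalemxAr -scalemxAl; congr (_ *: _).
by apply: commr_sum => j _; exact: commrX.
Qed.

Lemma avgm_act x m p (w : 'M[k]_(n, p)) : m%:R != 0 :> k -> x *m w = w -> avgm x m *m w = w.
Proof.
move=> m0 xw; rewrite /avgm -scalemxAl mulmx_suml (eq_bigr (fun=> w)) => [|j _].
  by rewrite sumr_const card_ord -scaler_nat scalerA mulVf // scale1r.
elim: (nat_of_ord j) => [|i IH]; first by rewrite expr0 mul1mx.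
by rewrite exprSr -[_ * _]/(_ *m _) -mulmxA xw.
Qed.

Lemma avgm_idem x m : m%:R != 0 :> k -> x ^+ m = 1 -> avgm x m * avgm x m = avgm x m.
Proof. by move=> m0 xm; apply: (avgm_act m0); exact: avgm_fix. Qed.

(** If (u-1)^(j+2) = 0 then (u-1)^j u^m = (u-1)^j + m (u-1)^(j+1), so u^m = 1 forces (u-1)^(j+1) =
    0; the exponent descends to 1. *)
Lemma unips_torsion (u : 'M[k]_n) m : m%:R != 0 :> k -> unips u -> u ^+ m = 1 -> u = 1.
Proof.
move=> m0 un um; apply/eqP; rewrite -subr_eq0; apply/eqP.
have down j : (u - 1) ^+ j.+2 = 0 -> (u - 1) ^+ j.+1 = 0.
  move=> E; have key i : (u - 1) ^+ j * u ^+ i = (u - 1) ^+ j + (u - 1) ^+ j.+1 *+ i.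
    elim: i => [|i IH]; first by rewrite expr0 mulr1 mulr0n addr0.
    have fx : (u - 1) ^+ j.+1 * u = (u - 1) ^+ j.+1.
      by apply/eqP; rewrite -subr_eq0 -{2}[(u - 1) ^+ j.+1]mulr1 -mulrBr -exprSr E.
    rewrite exprSr mulrA IH mulrDl mulrnAl fx mulrS addrA; congr (_ + _).
    by rewrite exprSr mulrBr mulr1 addrCA subrr addr0.
  have := key m; rewrite um mulr1 -{1}[(u - 1) ^+ j]addr0 => /addrI/esym.
  by rewrite -scaler_nat => /eqP; rewrite scaler_eq0 (negbTE m0) => /eqP.
have : (u - 1) ^+ n.+1 = 0 by rewrite exprS -[1]/(1%:M) un mulr0.
by elim: n.+1 => [|[|j] IH]; [rewrite expr0 => E; rewrite -[LHS]mul1r E mul0r|rewrite expr1|move/down].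
Qed.

(** A conjugation that maps a closed set into itself maps it onto itself: the iterated conjugates
    [T i] decrease and become stationary. *)
Lemma conj_noether (C : set 'M[k]_n) q : zcg C -> units q ->
  (forall c, C c -> C (cj q c)) -> forall c, C c -> C (q *m c *m ginv q).
Proof.
move=> cC uq Cq; pose T i := [set g : gl | C (q ^+ i *m g *m ginv (q ^+ i))].
have cT i : zcg (T i) by apply: (@zc_preim _ gl gl (fun g => q ^+ i *m g *m ginv (q ^+ i))) => //; reg_tac.
have [|Z [_ [i ->] minZ]] := @zmin _ gl (fun Z => exists i, Z = T i); first by exists (T 0%N) => //; exists 0%N.
have uqi : units (q ^+ i) := sgX i (units_subgroup k n) uq.
have E : T i.+1 = T i.
  apply: minZ => //; first by exists i.+1.
  move=> g /Cq; rewrite /T /= exprS -[q * _]/(q *m _) ginvM /cj !mulmxA mulVg // mul1mx.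
  by rewrite -!mulmxA mulVg // mulmx1.
move=> c Cc; have : T i (ginv (q ^+ i) *m c *m q ^+ i).
  by rewrite /T /= !mulmxA mulgV // mul1mx -mulmxA mulgV // mulmx1.
rewrite -E /T /= exprS -[q * _]/(q *m _) ginvM !mulmxA -(mulmxA q (q ^+ i)) mulgV // mulmx1.
by rewrite -[_ *m q ^+ i *m _]mulmxA mulgV // mulmx1.
Qed.

Lemma zc_regm0 p q (F : gl -> 'M[k]_(p, q)) : regm F -> zcg [set x | F x = 0].
Proof.
move=> rF; rewrite (_ : [set x | _] = [set x : gl | forall i j, F x i j = 0]).
  by apply: zc_forall => i; apply: zc_forall => j; apply: zc_eq0; exact: rF.
by apply/seteqP; split=> x /= E; [move=> i j; rewrite E mxE|apply/matrixP => i j; rewrite E mxE].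
Qed.

Lemma gen_conj (X : set 'M[k]_n) h : units h -> X `<=` @units k n ->
  (forall x, X x -> X (h *m x *m ginv h)) -> forall x, gen X x -> gen X (h *m x *m ginv h).
Proof.
move=> uh XU Xh; have sK : is_subgroup [set x | gen X (h *m x *m ginv h)].
  have := cj_subgroup (unitsV uh) (gen_subgroup XU); congr is_subgroup.
  by apply/seteqP; split=> x; rewrite /= /cj ginvK.
by apply: gen_sub => // x /Xh; exact: sub_gen.
Qed.

End Averages.

(** * Permutations of diagonal entries under conjugation *)

Section Eigenvalues.
Variables (k : closedFieldType) (n : nat).
Local Notation gl := (glv k n).
Local Notation irrg X := (@irr k gl X).
Local Notation zcg X := (@zc k gl X).

Lemma char_poly_cj (z g : 'M[k]_n) : units z -> char_poly (cj z g) = char_poly g.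
Proof.
move=> uz; rewrite /char_poly.
have E : map_mx polyC (ginv z) *m map_mx polyC z = 1%:M.
  by rewrite -map_mxM /= mulVg // map_scalar_mx.
have -> : char_poly_mx (cj z g) = map_mx polyC (ginv z) *m char_poly_mx g *m map_mx polyC z.
  rewrite /char_poly_mx mulmxBr mulmxBl scalar_mxC -['X%:M *m _ *m _]mulmxA E mulmx1.
  by rewrite /cj !map_mxM.
by rewrite !det_mulmx mulrC mulrA -det_mulmx (mulmx1C E) det1 mul1r.
Qed.

(** Each element has the same eigenvalues before and after conjugation, so some permutation matches
    its diagonals; there are finitely many, and irreducibility makes one of them serve all of
    [D]. *)
Lemma dg_perm (z y : 'M[k]_n) (D : set 'M[k]_n) : units z -> units y -> irrg D ->
  (forall g, D g -> Tri (cj z g) /\ Tri (cj z (cj y g))) ->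
  exists s : 'S_n, forall g i, D g -> dg z i (cj y g) = dg z (s i) g.
Proof.
move=> uz uy iD DT.
have ry i : @reg k gl (fun g => dg z i (cj y g)).
  apply: (@reg_comp _ gl gl (fun g => cj y g) (dg z i)); last exact: dg_reg.
  by rewrite /cj; reg_tac.
pose F j := [set g : gl | forall i, dg z i (cj y g) - dg z ((nth 1%g (enum 'S_n) j) i) g = 0].
have [||j ltj DF] := @irr_sub_bigU _ gl D F #|'S_n| iD.
- move=> j _; apply: zc_forall => i; apply: zc_eq0; apply: regB => //; exact: dg_reg.
- move=> g Dg; have [[ug Tg] [ug' Tg']] := DT g Dg.
  have : \prod_(x <- [tuple dg z i (cj y g) | i < n]) ('X - x%:P) =
      \prod_(x <- [tuple dg z i g | i < n]) ('X - x%:P).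
    have E h : is_trig_mx (cj z h) -> \prod_(x <- [tuple dg z i h | i < n]) ('X - x%:P) = char_poly h.
      move=> Th; rewrite -(char_poly_cj h uz) char_poly_trig // big_map big_enum.
      by [].
    by rewrite !E // char_poly_cj.
  move/prod_XsubC_eq/tuple_permP => [s sE].
  exists (index s (enum 'S_n)); first by rewrite cardE index_mem mem_enum.
  move=> i; rewrite nth_index ?mem_enum //; apply/eqP; rewrite subr_eq0; apply/eqP.
  have := congr1 (fun t => nth 0 t i) sE.
  by rewrite -!tnth_nth !tnth_mktuple.
by exists (nth 1%g (enum 'S_n) j) => g i /DF/(_ i)/eqP; rewrite subr_eq0 => /eqP.
Qed.

(* If sum a_i a_(s i) = sum a_i^2 modulo l then l divides sum (a_i - a_(s i))^2 <= 4 sum a_i^2. *)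
Lemma perm_invariant (a : 'I_n -> int) (s : 'S_n) (l : nat) (ze : k) :
  prime l -> (absz (4 * \sum_i a i * a i)%R < l)%N -> ze ^+ l = 1 -> ze != 1 ->
  ze ^ (\sum_i a i * a (s i)) = ze ^ (\sum_i a i * a i) -> forall i, a (s i) = a i.
Proof.
move=> pl ltl zl z1 E.
have z0 : ze != 0.
  by apply: contra_eq_neq zl => ->; rewrite expr0n gtn_eqF ?prime_gt0 //= eq_sym oner_eq0.
pose A := \sum_i a i * a i; pose X := \sum_i a i * a (s i).
have AE : \sum_i a (s i) * a (s i) = A by rewrite /A [RHS](reindex_inj (@perm_inj _ s)).
pose Q := \sum_i (a i - a (s i)) ^+ 2.
have QE : Q = 2 * (A - X).
  transitivity (\sum_i (a i * a i + a (s i) * a (s i) - 2 * (a i * a (s i)))).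
    by apply: eq_bigr => i _; ring.
  by rewrite sumrB big_split /= AE -mulr_sumr -/A -/X; ring.
have Q'E : 4 * A - Q = \sum_i (a i + a (s i)) ^+ 2.
  transitivity (\sum_i (a i * a i + a (s i) * a (s i) + 2 * (a i * a (s i)))).
    by rewrite !big_split /= AE -mulr_sumr -/A -/X QE; ring.
  by apply: eq_bigr => i _; ring.
have Q0 : 0 <= Q by apply: Num.Theory.sumr_ge0 => i _; exact: Num.Theory.sqr_ge0.
have QA : Q <= 4 * A.
  by rewrite -Num.Theory.subr_ge0 Q'E; apply: Num.Theory.sumr_ge0 => i _; exact: Num.Theory.sqr_ge0.
have zQ : ze ^ Q = 1.
  have ZAX : ze ^ (A - X) = 1 by rewrite expfzDr // -invr_expz /X E mulfV // expfz_neq0.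
  by rewrite QE mulrC -exprz_exp ZAX exp1rz.
have {}zQ : ze ^+ `|Q| = 1 by rewrite exprnP abszE Num.Theory.ger0_norm.
have Ql : (`|Q| < l)%N.
  apply: leq_ltn_trans ltl; rewrite -lez_nat !abszE (Num.Theory.ger0_norm Q0).
  by rewrite Num.Theory.ger0_norm //; exact: Order.POrderTheory.le_trans Q0 QA.
have /eqP Qz : `|Q|%N == 0%N.
  apply: contraTT isT => Qn; case/eqP: z1.
  have : (l %| 1)%N = false by rewrite dvdn1 gtn_eqF // prime_gt1.
  have Q1 : (0 < `|Q|)%N by rewrite lt0n.
  have [u v uvE _] := egcdnP l Q1.
  have cop : gcdn `|Q| l = 1%N.
    apply/eqP; rewrite -/(coprime _ _) coprime_sym prime_coprime //.
    by apply/negP => /(dvdn_leq Q1); rewrite leqNgt Ql.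
  move: uvE; rewrite cop addn1 => uvE _.
  have := congr1 (fun m => ze ^+ m) uvE; rewrite exprSr mulnC exprM zQ expr1n mulnC exprM zl expr1n mul1r.
  by [].
have {}Qz : Q = 0 by apply/eqP; rewrite -absz_eq0 Qz.
move=> i; apply/esym/eqP; rewrite -subr_eq0 -sqrf_eq0; apply/eqP.
by apply: (Num.Theory.psumr_eq0P (P := xpredT) _ Qz) => // j _; exact: Num.Theory.sqr_ge0.
Qed.

End Eigenvalues.

(** * Weights of an element of prime order *)

Section Weights.
Variables (k : closedFieldType) (n : nat).
Implicit Types (A B : 'M[k]_n) (d e : 'I_n -> k).

Definition trigd A d := forall i j : 'I_n, (i <= j)%N -> A i j = d i *+ (i == j).

Lemma trigd_ext A d e : (forall i, d i = e i) -> trigd A d -> trigd A e.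
Proof. by move=> de Ad i j le; rewrite Ad // de. Qed.

Lemma trigdM A B d e : trigd A d -> trigd B e -> trigd (A *m B) (fun i => d i * e i).
Proof.
move=> Ad Be i j le; rewrite mxE (bigD1 i) //= big1 ?addr0 => [|l li].
  by rewrite Ad // Be // eqxx mulr1n mulrnAr.
have [lel|ltl] := leqP i l; first by rewrite Ad // eq_sym (negbTE li) mul0r.
rewrite Be ?(leq_trans (ltnW ltl)) // (_ : (l == j) = false) ?mulr0 //.
by apply/eqP => E; move: ltl; rewrite E ltnNge le.
Qed.

Lemma trigdD A B d e : trigd A d -> trigd B e -> trigd (A + B) (fun i => d i + e i).
Proof. by move=> Ad Be i j le; rewrite mxE Ad // Be // mulrnDl. Qed.

Lemma trigdZ c A d : trigd A d -> trigd (c *: A) (fun i => c * d i).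
Proof. by move=> Ad i j le; rewrite mxE Ad // mulrnAr. Qed.

Lemma trigd1 : trigd 1%:M (fun=> 1).
Proof. by move=> i j _; rewrite mxE. Qed.

Lemma trigdX A d m : trigd A d -> trigd (A ^+ m) (fun i => d i ^+ m).
Proof.
move=> Ad; elim: m => [|m IH]; first exact: trigd1.
by move=> i j le; rewrite !exprS; exact: (trigdM Ad IH).
Qed.

Lemma trigd_sum m (A : 'I_m -> 'M[k]_n) (d : 'I_m -> 'I_n -> k) : (forall j, trigd (A j) (d j)) ->
  trigd (\sum_j A j) (fun i => \sum_j d j i).
Proof.
move=> Ad i j le; rewrite summxE -sumrMnl; apply: eq_bigr => l _; exact: Ad.
Qed.

Lemma trigd_avgm A d m : trigd A d -> trigd (avgm A m) (fun i => m%:R^-1 * \sum_(j < m) d i ^+ j).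
Proof. by move=> Ad; apply: trigdZ; apply: trigd_sum => j; exact: trigdX. Qed.

Lemma trigd_det A d : trigd A d -> \det A = \prod_i d i.
Proof.
move=> Ad; rewrite det_trig; first by apply: eq_bigr => i _; rewrite Ad // eqxx.
by apply/is_trig_mxP => i j lt; rewrite Ad ?(ltnW lt) // (ltn_eqF lt : (i == j) = false).
Qed.

Lemma Tri_trigd (z b : 'M[k]_n) : Tri (cj z b) -> trigd (cj z b) (fun i => dg z i b).
Proof.
move=> [_ /is_trig_mxP T] i j; rewrite leq_eqVlt => /predU1P[/val_inj ->|lt].
  by rewrite eqxx.
by rewrite T // (ltn_eqF lt : (i == j) = false).
Qed.

(** Orthogonality of the powers of a root of unity; [u + (l - w)] is the difference u - w modulo l,
    kept natural. *)
Lemma sum_root_unity l (ze : k) (u w : 'I_l) : prime l -> l%:R != 0 :> k -> ze ^+ l = 1 -> ze != 1 ->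
  l%:R^-1 * (\sum_(j < l) (ze ^+ (u + (l - w))) ^+ j) = (w == u)%:R.
Proof.
move=> pl l0 zl z1; set c := ze ^+ _.
have cl : c ^+ l = 1 by rewrite /c -exprM mulnC exprM zl expr1n.
have [E|ne] := eqVneq w u.
  have -> : c = 1 by rewrite /c E subnKC ?zl // ltnW.
  by rewrite (eq_bigr (fun=> 1)) ?sumr_const ?card_ord ?mulVf // => j _; rewrite expr1n.
have c1 : c != 1.
  apply: contraNneq z1 => cE.
  have t0 : (0 < u + (l - w))%N by rewrite addn_gt0 subn_gt0 ltn_ord orbT.
  have cop : gcdn (u + (l - w)) l = 1%N.
    apply/eqP; rewrite -/(coprime _ _) coprime_sym prime_coprime //; apply/negP => /dvdnP[q qE].
    have [lt|lt|E] := ltngtP u w; last by case/eqP: ne; apply/val_inj.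
      have : (u + (l - w) < l)%N.
        rewrite -(ltn_add2r w) -addnA subnK ?(ltnW (ltn_ord w)) // addnC ltn_add2l.
        by [].
      by rewrite qE -{2}[l]mul1n ltn_mul2r ltnS leqn0 => /andP[_ /eqP q0]; rewrite qE q0 in t0.
    have lu : (l < u + (l - w))%N.
      by rewrite -(ltn_add2r w) -addnA subnK ?(ltnW (ltn_ord w)) // addnC ltn_add2r.
    have : (u + (l - w) < 2 * l)%N.
      by rewrite mul2n -addnn -addSn leq_add // leq_subr.
    rewrite qE ltn_mul2r => /andP[_ q2]; move: lu; rewrite qE -{1}[l]mul1n ltn_mul2r => /andP[_ q1].
    by move: q2; rewrite ltnS leqNgt q1.
  have [x y xyE _] := egcdnP l t0; move: xyE; rewrite cop addn1 => xyE.
  have := congr1 (fun m => ze ^+ m) xyE; rewrite exprSr mulnC exprM -/c cE expr1n mulnC exprM zl expr1n mul1r.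
  by move=> <-.
have : (c - 1) * \sum_(j < l) c ^+ j = 0 by rewrite -subrX1 cl subrr.
by move/eqP; rewrite mulf_eq0 subr_eq0 (negbTE c1) => /eqP ->; rewrite mulr0.
Qed.

End Weights.

Section WeightCharacter.
Variables (k : closedFieldType) (n : nat).
Local Notation gl := (glv k n).
Local Notation irrg X := (@irr k gl X).
Local Notation zcg X := (@zc k gl X).
Variables (s z : 'M[k]_n) (l N : nat) (ze : k) (a : 'I_n -> int).
Hypotheses (pl : prime l) (l0 : l%:R != 0 :> k) (sl : s ^+ l = 1%:M) (zl : ze ^+ l = 1)
  (z1 : ze != 1) (uz : units z) (Ts : Tri (cj z s)) (sE : forall i, dg z i s = ze ^ a i).
Variable u : 'I_n -> 'I_l.
Hypothesis uE : forall i, (u i : nat)%:Z = a i + N%:Z.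

(* [wproj w] projects onto the eigenspace of [s] for the eigenvalue [ze ^ (w - N)];
   [wchar c] is the product of [det (c | eigenspace w) ^+ w] over all w < l. *)
Definition wproj (w : 'I_l) : 'M[k]_n := avgm (ze ^+ (N + (l - w)) *: s) l.

Definition wblock w (c : 'M[k]_n) : 'M[k]_n := wproj w *m c + (1%:M - wproj w).

Definition wchar (c : 'M[k]_n) : k := \prod_(w < l) \det (wblock w c) ^+ w.

Lemma wchar_reg : @reg k gl wchar.
Proof.
apply: reg_prod => w _; apply: regX; apply: reg_det.
by apply: regm_add (regm_cst _ _); apply: regm_mul (regm_cst _ _) _; exact: regm_id.
Qed.

Lemma wproj_comm w c : c *m s = s *m c -> GRing.comm c (wproj w).
Proof.
move=> cs; apply: avgm_comm.
rewrite /GRing.comm -[c * _]/(c *m _) -[_ * c]/(_ *m c) -scalemxAr -scalemxAl.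
by rewrite cs.
Qed.

Lemma scaleXmx (c : k) (A : 'M[k]_n) j : (c *: A) ^+ j = c ^+ j *: A ^+ j.
Proof.
elim: j => [|j IH]; first by rewrite !expr0 scale1r.
by rewrite !exprS IH -[(c *: A) * _]/(_ *m _) -scalemxAl -scalemxAr scalerA.
Qed.

Lemma wproj_idem w : wproj w * wproj w = wproj w.
Proof.
apply: avgm_idem => //; rewrite scaleXmx sl -exprM mulnC exprM zl expr1n scale1r.
by [].
Qed.

Lemma idem_blockM (R : pzRingType) (E c d : R) : E * E = E -> GRing.comm c E ->
  (E * c + (1 - E)) * (E * d + (1 - E)) = E * (c * d) + (1 - E).
Proof.
move=> EE cE; have EF : E * (1 - E) = 0 by rewrite mulrBr mulr1 EE subrr.
have FE : (1 - E) * E = 0 by rewrite mulrBl mul1r EE subrr.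
have FF : (1 - E) * (1 - E) = 1 - E by rewrite mulrBr mulr1 FE subr0.
rewrite mulrDl (mulrDr (E * c) (E * d)) (mulrDr (1 - E) (E * d)) FF [(1 - E) * (E * d)]mulrA FE mul0r add0r.
have -> : E * c * (1 - E) = 0 by rewrite -cE -mulrA EF mulr0.
by rewrite addr0 mulrA -[E * c * E]mulrA cE !mulrA EE.
Qed.

Lemma wcharM c d : c *m s = s *m c -> d *m s = s *m d -> wchar (c *m d) = wchar c * wchar d.
Proof.
move=> cs ds; rewrite /wchar -big_split; apply: eq_bigr => w _ /=.
rewrite -exprMn -det_mulmx; congr (\det _ ^+ _); rewrite /wblock.
have EE := wproj_idem w; have cE := wproj_comm w cs; set E := wproj w in EE cE *.
exact: (esym (idem_blockM d EE cE)).
Qed.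

Lemma wchar1 : wchar 1%:M = 1.
Proof. by rewrite /wchar big1 // => w _; rewrite /wblock mulmx1 addrCA subrr addr0 det1 expr1n. Qed.

(** In triangular form the projector [wproj w] has diagonal entry 1 exactly at the indices with
    [u i = w], so each diagonal entry of [b] receives the exponent a_i + N. The shift by [N] makes
    exponents natural and is the source of the factor \det b ^+ N. *)
Lemma wchar_Tri b : Tri (cj z b) -> wchar b = \prod_i dg z i b ^ a i * \det b ^+ N.
Proof.
move=> Tb; have z0 : ze != 0.
  by apply: contra_eq_neq zl => ->; rewrite expr0n gtn_eqF ?prime_gt0 //= eq_sym oner_eq0.
have cjD x y : cj z (x + y) = cj z x + cj z y by rewrite /cj mulmxDr mulmxDl.
have cjZ c x : cj z (c *: x) = c *: cj z x by rewrite /cj -scalemxAr -scalemxAl.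
have cjS m (F : 'I_m -> 'M[k]_n) : cj z (\sum_j F j) = \sum_j cj z (F j).
  by rewrite /cj mulmx_sumr mulmx_suml.
have det_cj x : \det (cj z x) = \det x.
  by rewrite /cj !det_mulmx mulrC mulrA -det_mulmx mulgV // det1 mul1r.
have Ed w : trigd (cj z (wproj w)) (fun i => (w == u i)%:R).
  have -> : cj z (wproj w) = avgm (cj z (ze ^+ (N + (l - w)) *: s)) l.
    by rewrite /wproj /avgm (cjZ l%:R^-1) cjS; congr (_ *: _); apply: eq_bigr => j _; rewrite cjX.
  rewrite cjZ; have := trigd_avgm l (trigdZ (ze ^+ (N + (l - w))) (Tri_trigd Ts)).
  apply: trigd_ext => i; rewrite -(sum_root_unity (u i) w pl l0 zl z1); congr (_ * _).
  apply: eq_bigr => j _; congr (_ ^+ j); rewrite sE exprnP -expfzDr // exprnP; congr (_ ^ _).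
  by rewrite !PoszD uE; ring.
have det_b : \det b = \prod_i dg z i b by rewrite -det_cj (trigd_det (Tri_trigd Tb)).
have blockE w : \det (wblock w b) = \prod_i (if w == u i then dg z i b else 1).
  rewrite -det_cj /wblock cjD cjM // -scaleN1r cjD (cjZ (-1) (wproj w)) cj1 //.
  rewrite (trigd_det (trigdD (trigdM (Ed w) (Tri_trigd Tb)) (trigdD (@trigd1 k n) (trigdZ (-1) (Ed w))))).
  apply: eq_bigr => i _; case: (w == u i); last by rewrite mul0r mulr0 addr0 add0r.
  by rewrite mul1r mulr1 subrr addr0.
rewrite /wchar (eq_bigr (fun w : 'I_l => \prod_i (if w == u i then dg z i b else 1) ^+ w)) => [|w _]; last first.
  by rewrite blockE prodrXl.
rewrite exchange_big det_b -prodrXl -big_split; apply: eq_bigr => i _ /=.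
rewrite (bigD1 (u i)) //= eqxx big1 ?mulr1 => [|w /negbTE ->]; last by rewrite expr1n.
by rewrite !exprnP uE expfzDr // Tri_diag_neq0.
Qed.

Variables (G B P : set 'M[k]_n) (m K : nat) (rho : gl -> 'M[k]_m) (v : 'cV[k]_m) (chi : gl -> k).
Hypotheses (sG : is_subgroup G) (cG : zcg G) (iG : irrg G) (bB : borel_subgroup G B).
Hypotheses (BT : forall b, B b -> Tri (cj z b)) (Bs : B s).
Hypotheses (rr : regm rho) (rM : forall g h, G g -> G h -> rho (g *m h) = rho g *m rho h)
  (r1 : rho 1%:M = 1%:M) (v0 : v != 0)
  (rP : forall g, G g -> (exists c, rho g *m v = c *: v) -> P g).
Hypotheses (K0 : (0 < K)%N) (rhoB : forall b, B b -> rho b *m v = chi b *: v)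
  (chiK : forall b, B b -> chi b ^+ K = \prod_i dg z i b ^ a i).

(* The quotient of [(xi rho(c) v) ^+ K * det c ^+ N] by [wchar c] is invariant under
   right multiplication by the centralizer of s in B. It extends to the closed set
   [Y] of all y with y^-1 s y in B having the same diagonal as s, and completeness
   of [Y / B] leaves it only finitely many values. *)
Lemma prime_centralizer D : irrg D -> D 1%:M -> D `<=` [set c | G c /\ c *m s = s *m c] -> D `<=` P.
Proof.
move=> iD D1 DC; have /borelP[[sB cB iB _ BG] _] := bB; have [coB _] := complete_borel sG cG iG bB.
have us := sgU sB Bs; have Gs := BG _ Bs.
have sC := centralizer_subgroup s sG; set C := [set g | _] in sC.
have wB b : B b -> b *m s = s *m b -> wchar b = chi b ^+ K * \det b ^+ N.
  by move=> Bb bs; rewrite chiK // wchar_Tri //; exact: BT.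
have w0 c : C c -> wchar c != 0.
  move=> Cc; have [_ cs] := Cc; have [_ cs'] := sgV sC Cc.
  have := wcharM cs cs'; rewrite mulgV ?wchar1; last exact: sgU Cc.
  by move=> E; apply: contra_eq_neq E => ->; rewrite mul0r oner_eq0.
pose Y : set gl := [set y | G y /\ (B (cj y s) /\ forall i, dg z i (cj y s) - dg z i s = 0)].
have rs : regmap ((fun y => cj y s) : gl -> gl) by rewrite /cj; reg_tac.
have cY : zcg Y.
  apply: (zcI cG); apply: zcI; first exact: (zc_preim rs cB).
  apply: zc_forall => i; apply: zc_eq0; apply: regB (regC _ _).
  exact: (reg_comp rs (@dg_reg k n z i)).
have YG : Y `<=` G by move=> y [].
have YB y b : Y y -> B b -> Y (y *m b).
  move=> [Gy [By yE]] Bb; have Bbi := sgV sB Bb; have ub := sgU sB Bb.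
  have E : cj (y *m b) s = cj b (cj y s) by rewrite /cj ginvM !mulmxA.
  split; first by apply: sgM => //; exact: BG.
  rewrite E; split; first by apply: (sgM sB) => //; exact: (sgM sB).
  move=> i; rewrite -[RHS](yE i); congr (_ - _); rewrite {1}/cj.
  have Bby := sgM sB Bbi By.
  by rewrite (dgM uz BT) // (dgM uz BT) // (dgV uz BT) // mulrAC mulVf ?mul1r // (dg_neq0 BT).
have [A [rA AP]] := average uz sB cB BT l0 Bs sl.
have dom y : Y y -> avg_dom z B l s (cj y s, 1%:M).
  move=> [Gy [By yE]]; have uy := sgU sG Gy; have Bsi := sgV sB Bs; split=> //=.
  - by rewrite -cjX // sl cj1.
  - exact: sg1.
  - rewrite mulmx1 ginv1 mulmx1; apply: (dg_UT1 BT); first exact: (sgM sB).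
    move=> i; rewrite (dgM uz BT) // (dgV uz BT) //.
    by have /eqP := yE i; rewrite subr_eq0 => /eqP ->; rewrite divff // (dg_neq0 BT).
(* The averaged factor lies in [B] and intertwines y^-1 s y with s, so [c y] commutes with [s] and
   represents the same coset of [B] as [y]. *)
pose c (y : gl) : gl := y *m A (cj y s, 1%:M).
have rc : @regon k gl gl Y c.
  apply: regonM; first by apply: regmap_on; exact: regmap_id.
  apply: (@regon_comp k gl (prodv gl gl) gl Y (avg_dom z B l s) (fun y => (cj y s, 1%:M)) A) => //.
  by apply: regmap_on; exact: (regmap_pair rs (regmap_cst _ _)).
have cC y : Y y -> C (c y).
  move=> Yy; have [Gy [By _]] := Yy; have [BA _ AE _] := AP _ (dom y Yy).
  have uy := sgU sG Gy; split; first by apply: sgM => //; exact: BG.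
  by rewrite /c -mulmxA -AE /= /cj !mulmxA mulgV // mul1mx.
have cid y : C y -> Y y /\ c y = y.
  move=> [Gy ys]; have uy := sgU sG Gy.
  have E : cj y s = s by rewrite /cj -mulmxA -ys mulmxA mulVg // mul1mx.
  have Yy : Y y by split=> //; rewrite E; split=> // i; rewrite subrr.
  split=> //; have [_ _ _ AE] := AP _ (dom y Yy); have E2 : cj y s *m 1%:M = 1%:M *m s by rewrite E mulmx1 mul1mx.
  by rewrite /c (AE E2) /= mulmx1.
move=> d Dd; have [Gd _] := DC _ Dd; apply: rP => //; apply: parallel_col => // xi xv.
pose f (y : gl) : k := (xi *m (rho y *m v)) 0 0 ^+ K * \det (y : 'M[k]_n) ^+ N.
have rf : reg f.
  apply: regM; apply: regX; last by apply: reg_det; exact: regm_id.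
  exact: (regm_mul (regm_cst _ xi) (regm_mul rr (regm_cst _ v))).
have [F1 rF1 F1E] := rc _ rf; have [F2 rF2 F2E] := rc _ wchar_reg.
have [|||vals valsP] := @ratio_finite k n Y B F1 F2 cY (complete_sub coB YG) rF1 rF2.
- exact: YB.
- by move=> y Yy; rewrite -F2E // w0 //; exact: cC.
- move=> y b Yy Bb; have Yyb := YB _ _ Yy Bb; rewrite -!F1E // -!F2E //.
  have [BA _ _ _] := AP _ (dom _ Yy); have [BA' _ _ _] := AP _ (dom _ Yyb).
  have Cy := cC _ Yy; have Cyb := cC _ Yyb.
  pose be := ginv (c y) *m c (y *m b).
  have cE : c (y *m b) = c y *m be by rewrite /be mulmxA mulgV ?mul1mx //; exact: (sgU sC Cy).
  have Cbe : C be by apply: (sgM sC) => //; exact: (sgV sC Cy).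
  have Bbe : B be.
    have uy : units y by have [Gy _] := Yy; exact: sgU Gy.
    have -> : be = ginv (A (cj y s, 1%:M)) *m b *m A (cj (y *m b) s, 1%:M).
      by rewrite /be /c ginvM !mulmxA -(mulmxA _ (ginv y)) mulVg // mulmx1.
    by apply: (sgM sB) => //; apply: (sgM sB) => //; exact: (sgV sB).
  clearbody be; have [_ bes] := Cbe; have [Gc cs] := Cy.
  rewrite cE wcharM // (wB be) // /f (rM Gc (BG _ Bbe)).
  have -> : (xi *m (rho (c y) *m rho be *m v)) 0 0 = chi be * (xi *m (rho (c y) *m v)) 0 0.
    by rewrite -[_ *m v]mulmxA rhoB // -!scalemxAr [LHS]mxE.
  rewrite det_mulmx !exprMn; set x1 := _ ^+ K; set x2 := _ ^+ K; set x3 := _ ^+ N; set x4 := _ ^+ N.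
  by move: x1 x2 x3 x4 (wchar (c y)) => x1 x2 x3 x4 x5; ring.
have [|||i lti DF] := @irr_sub_bigU _ gl D (fun i => [set y | f y - nth 0 vals i * wchar y = 0]) (size vals).
- by [].
- by move=> i _; apply: zc_eq0; apply: regB => //; apply: regM (regC _ _) wchar_reg.
- move=> y /DC Cy; have [Yy yE] := cid y Cy; have [x xv' E] := valsP y Yy.
  exists (index x vals); first by rewrite index_mem.
  by rewrite /= nth_index // -{1 2}yE F1E // F2E // E subrr.
(* At 1 the function [f] vanishes, because [xi] kills [v], while [wchar] is 1. So the constant ratio
   is 0, and every linear form that kills [v] kills [rho d *m v]. *)
have c0 : nth 0 vals i = 0.
  have := DF _ D1; rewrite /= /f r1 mul1mx xv mxE expr0n gtn_eqF // mul0r sub0r wchar1 mulr1.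
  by move/eqP; rewrite oppr_eq0 => /eqP.
have := DF _ Dd; rewrite /= c0 mul0r subr0 /f => /eqP.
have dd0 : \det d ^+ N != 0.
  by rewrite expf_neq0 // -unitfE -unitmxE; exact: sgU sG Gd.
rewrite mulf_eq0 (negbTE dd0) orbF expf_eq0 K0 => /eqP E.
by apply/matrixP => x y; rewrite !ord1 E mxE.
Qed.

End WeightCharacter.

(** * Levi subgroups *)

Section Levi.
Variables (k : closedFieldType) (n : nat).
Local Notation gl := (glv k n).
Local Notation irrg X := (@irr k gl X).
Local Notation zcg X := (@zc k gl X).
Variables (G B P L V : set 'M[k]_n) (pr : 'M[k]_n -> 'M[k]_n) (z : 'M[k]_n).
Hypotheses (sG : is_subgroup G) (cG : zcg G) (iG : irrg G) (bB : borel_subgroup G B).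
Hypotheses (uz : units z) (BT : forall b, B b -> Tri (cj z b)).
Hypotheses (sP : is_subgroup P) (cP : zcg P) (BP : B `<=` P) (PG : P `<=` G).
Hypotheses (sL : is_subgroup L) (cL : zcg L) (LP : L `<=` P) (mpr : morphism P L pr).
Hypotheses (prL : forall g, L g -> pr g = g) (prV : forall g, P g -> pr g = 1%:M <-> V g).
Hypotheses (iV : irrg V) (VB : V `<=` B)
  (VU : forall v, V v -> UT 1 (cj z v)).
Hypothesis radP : forall U, is_subgroup U -> zcg U -> irrg U -> U `<=` P ->
  (forall g u, P g -> U u -> U (g *m u *m ginv g)) -> U `<=` @unips k n -> U `<=` V.

Let LU : L `<=` @units k n.
Proof. by move=> g; exact: sgU. Qed.

Let prK g : P g -> L (pr g).
Proof. by have [H _ _] := mpr; exact: H. Qed.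

Let prM g h : P g -> P h -> pr (g *m h) = pr g *m pr h.
Proof. by have [_ _ H] := mpr; exact: H. Qed.

Let prI g : P g -> pr (ginv g) = ginv (pr g).
Proof. exact: (morphismV sP LU mpr). Qed.

Let rpr : @regon k gl gl P pr.
Proof. exact: (morphism_regon sP LU mpr). Qed.

Let cscB : csc G B.
Proof. by have /borelP[] := bB. Qed.

Let sB : is_subgroup B. Proof. by have [] := cscB. Qed.
Let cB : zcg B. Proof. by have [] := cscB. Qed.
Let iB : irrg B. Proof. by have [] := cscB. Qed.
Let BG : B `<=` G. Proof. by have [] := cscB. Qed.

Lemma radical_part g : P g -> V (ginv (pr g) *m g).
Proof.
move=> Pg; have Lg := prK Pg; have PL := LP Lg; have PLi := sgV sP PL.
by apply/prV; [exact: sgM|rewrite prM // prI // prL // mulVg //; exact: LU].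
Qed.

Definition levi_borel : set 'M[k]_n := L `&` B.
Local Notation BL := levi_borel.

Lemma pr_borel b : B b -> BL (pr b).
Proof.
move=> Bb; have Pb := BP Bb; have Lb := prK Pb; split=> //.
have := sgM sB Bb (sgV sB (VB (radical_part Pb))).
by rewrite ginvM ginvK ?mulmxA ?mulgV ?mul1mx //; [exact: sgU Bb|exact: LU].
Qed.

Lemma levi_borel_irr : irrg BL.
Proof.
have := irr_regon rpr BP iB; congr irr; apply/seteqP; split=> g.
  by move=> [b Bb <-]; exact: pr_borel.
by move=> [Lg Bg]; exists g => //; exact: prL.
Qed.

Lemma levi_borel_subgroup : is_subgroup BL.
Proof. exact: sgI. Qed.

Lemma levi_borel_zc : zcg BL.
Proof. exact: zcI. Qed.

Lemma levi_borel_Tri g : BL g -> Tri (cj z g).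
Proof. by case=> _; exact: BT. Qed.

(** A larger connected solvable [C] in [L] fixes a coset of [B] in [P]; projecting to [L] conjugates
    [C] into [BL], hence [C] into itself. By [conj_noether] this conjugation is onto, which gives
    the missing inclusion. *)
Lemma levi_borel_borel l : L l -> borel_subgroup L [set g | BL (cj l g)].
Proof.
move=> Ll; have ul := LU Ll.
have cscBL : csc L BL.
  split; [exact: levi_borel_subgroup|exact: levi_borel_zc|exact: levi_borel_irr| |by move=> g []].
  exact: (solvable_Tri uz levi_borel_subgroup levi_borel_Tri).
apply/borelP; split; first exact: csc_conj.
move=> C [sC cC iC solC CL] BLC; apply/seteqP; split=> // c Cc.
have [||y Py yC] := borel_fixed_point sG cG iG bB sC cC iC solC cP PG.
- by exists 1%:M; exact: sg1.
- by move=> r s b /CL/LP Pr Ps /BP Pb; apply: sgM => //; exact: sgM.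
have Lm := prK Py; set m := pr y in Lm; have um := LU Lm; have Pyi := sgV sP Py.
have BLm x : C x -> BL (cj m x).
  move=> Cx; have Lx := CL _ Cx; have Px := LP Lx.
  have := pr_borel (yC _ Cx); rewrite prM ?prM ?prI ?(prL Lx) //; exact: sgM.
pose q := m *m ginv l; have uq : units q by apply/unitsM; split=> //; exact: unitsV.
have lq x : cj l (cj q x) = cj m x.
  by rewrite /cj /q ginvM ginvK // !mulmxA mulVg // mul1mx -!mulmxA mulVg // mulmx1.
clearbody q.
have Cq x : C x -> C (cj q x) by move=> Cx; apply: BLC; rewrite /= lq; exact: BLm.
have E : cj q (q *m c *m ginv q) = c.
  by rewrite /cj !mulmxA mulVg // mul1mx -mulmxA mulVg // mulmx1.
by have := BLm _ (conj_noether cC uq Cq Cc); rewrite -lq E.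
Qed.

Section Dual.
Variables (chi : gl -> k) (K : nat) (a : 'I_n -> int) (La Th : set 'M[k]_n).
Hypotheses (rchi : reg chi) (chiM : forall g h, P g -> P h -> chi (g *m h) = chi g * chi h)
  (chi1 : chi 1%:M = 1).
Hypotheses (K0 : (0 < K)%N) (Ka : forall g, BL g -> chi g ^+ K = \prod_i dg z i g ^ a i).
Hypotheses (sLa : is_subgroup La) (cLa : zcg La) (iLa : irrg La) (LaB : La `<=` BL)
  (LaC : forall g h, La g -> La h -> g *m h = h *m g).
Hypotheses (ThLa : Th `<=` La) (LaTh : La `<=` @cl k gl Th).
Hypothesis Th_tors : forall t, Th t -> exists m ze, [/\ m%:R != 0 :> k, t ^+ m = 1%:M, ze != 0
  & forall i, dg z i t = ze ^ a i].
Hypothesis Th_prime : forall N, exists l t ze, [/\ prime l, (N < l)%N, l%:R != 0 :> k, Th t &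
  [/\ t ^+ l = 1%:M, ze ^+ l = 1, ze != 1 & forall i, dg z i t = ze ^ a i]].

(** The formula is known on the Borel subgroup of [L]; the remaining factor lies in [V], is
    unipotent, and contributes 1 to both sides. *)
Lemma chi_borel g : B g -> chi g ^+ K = \prod_i dg z i g ^ a i.
Proof.
move=> Bg; have Pg := BP Bg; have BLg := pr_borel Bg; have [Lg Bg'] := BLg.
have Vg := radical_part Pg; have Bv := VB Vg.
have -> : g = pr g *m (ginv (pr g) *m g) by rewrite mulmxA mulgV ?mul1mx //; exact: LU.
rewrite chiM; [|exact: LP|exact: BP].
have -> : chi (ginv (pr g) *m g) = 1.
  apply: (unip_char sB cB rchi) => //; first by move=> *; apply: chiM; exact: BP.
  by apply/(cj_unips _ uz); apply: UT1_unip; exact: VU.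
rewrite mulr1 Ka //; apply: eq_bigr => i _; rewrite (dgM uz BT) //.
by rewrite [dg z i (_ *m g)]UT1_diag ?mulr1 //; exact: VU.
Qed.

Let LaBB : La `<=` B. Proof. by move=> g /LaB[]. Qed.
Let LaL : La `<=` L. Proof. by move=> g /LaB[]. Qed.

(** Conjugation by [y] permutes the diagonal characters of [La] and preserves [chi]. On an element
    of large prime order this is the equality needed for [perm_invariant], so the permutation
    preserves [a], hence the diagonals on the dense subset [Th]. *)
Lemma fixed_dg y : P y -> (forall g, La g -> B (cj y g)) ->
  forall g i, La g -> dg z i (cj y g) = dg z i g.
Proof.
move=> Py yLa; have uy := sgU sP Py.
have [|s sE] := dg_perm uz uy iLa; first by move=> g Lg; split; apply: BT; [exact: LaBB|exact: yLa].
have [l [t [ze [pl ltl l0 Tt [tl zl z1 tE]]]]] := Th_prime (absz (4 * \sum_i a i * a i)).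
have Lt := ThLa Tt; have Bt := LaBB Lt; have Pt := BP Bt.
have z0 : ze != 0.
  by apply: contra_eq_neq zl => ->; rewrite expr0n gtn_eqF ?prime_gt0 //= eq_sym oner_eq0.
have prodz (c : 'I_n -> int) : \prod_i (ze ^ c i) ^ a i = ze ^ (\sum_i a i * c i).
  rewrite (big_morph (fun t => ze ^ t) (id1 := 1) (op1 := *%R)) //; last by move=> u v; rewrite expfzDr.
  by apply: eq_bigr => i _; rewrite exprz_exp mulrC.
have sa : forall i, a (s i) = a i.
  apply: (perm_invariant pl ltl zl z1); rewrite -!prodz.
  transitivity (\prod_i dg z i (cj y t) ^ a i); first by apply: eq_bigr => i _; rewrite sE // tE.
  rewrite -chi_borel; last exact: yLa.
  transitivity (\prod_i dg z i t ^ a i); last by apply: eq_bigr => i _; rewrite tE.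
  rewrite -chi_borel //; congr (_ ^+ _); have Pyi := sgV sP Py.
  rewrite /cj !chiM //; last exact: sgM.
  by rewrite mulrC mulrA -chiM // mulgV // chi1 mul1r.
move=> g i Lg; rewrite sE //; apply/eqP; rewrite -subr_eq0; apply/eqP.
have := LaTh Lg (f := fun g => dg z (s i) g - dg z i g); apply; first by apply: regB; exact: dg_reg.
by move=> h /Th_tors[m [xi [_ _ _ hE]]]; rewrite !hE sa subrr.
Qed.

Lemma fixed_char (psi : gl -> k) y g : reg psi ->
  (forall g h, B g -> B h -> psi (g *m h) = psi g * psi h) -> psi 1%:M = 1 ->
  P y -> (forall g, La g -> B (cj y g)) -> La g -> psi (cj y g) = psi g.
Proof.
move=> rpsi psiM psi1 Py yLa Lg; have Bg := LaBB Lg; have By := yLa _ Lg.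
have ug := sgU sB Bg; have Bgi := sgV sB Bg.
have -> : cj y g = cj y g *m ginv g *m g by rewrite -mulmxA mulVg // mulmx1.
rewrite psiM //; last exact: sgM.
rewrite (unip_char sB cB rpsi psiM psi1) ?mul1r //; first exact: sgM.
apply: (dg_unips uz BT); first exact: sgM.
by move=> i; rewrite (dgM uz BT) // (dgV uz BT) // fixed_dg // divff // (dg_neq0 BT).
Qed.

(** With [B] the stabilizer of the line of [v], [fixed_char] says that [La] has the same weight
    [psi] on the lines of all its fixed points in the quotient of [P] by [B]. Project to that weight
    space by [E]: on the closure [Z] of La p B the vector E rho(y) v never vanishes and keeps its
    direction, so dividing by it turns the coordinates of rho(y) v into constant functions on a
    complete quotient. *)
Lemma torus_fixes p g : P p -> La g -> B (cj p g).
Proof.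
move=> Pp Lg0; have [m [rho [v [rr rM r1 _ [v0 rB]]]]] := line_stabilizer sP sB BP cB.
have [psi rpsi psiE] := eigen_char rr v0; have LaP : La `<=` P by move=> x /LaBB/BP.
have rhoB b : B b -> rho b *m v = psi b *: v.
  by move=> Bb; have [c E] := (rB b (BP Bb)).1 Bb; rewrite (psiE _ _ E).
have psi1 : psi 1%:M = 1 by apply: psiE; rewrite r1 mul1mx scale1r.
have psiM x y : B x -> B y -> psi (x *m y) = psi x * psi y.
  move=> Bx By; apply: psiE; have [Px Py] := (BP Bx, BP By).
  by rewrite rM // -mulmxA rhoB // -scalemxAr rhoB // scalerA mulrC.
have rinj y : P y -> rho y *m v <> 0.
  move=> Py E; case/eqP: v0; rewrite -[v]mul1mx -r1 -(mulVg (sgU sP Py)) rM //; last exact: sgV.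
  by rewrite -mulmxA E mulmx0.
(* An operator of minimal rank with these properties serves as projector onto the weight space. For
   a torsion element t the average of psi(t)^-1 rho(t) can be composed with [E] without losing rank,
   so [E] absorbs it and E rho(t) = psi(t) E; density extends this to [La]. *)
pose good (E : 'M[k]_m) := (forall x, La x -> GRing.comm (rho x) E) /\
  forall w : 'cV[k]_m, (forall x, La x -> rho x *m w = psi x *: w) -> E *m w = w.
have [E [[Ec Ew] minE]] : exists E, good E /\ forall E', good E' -> (\rank E <= \rank E')%N.
  have ex : exists r, `[< exists2 E, good E & \rank E = r >].
    exists (\rank (1%:M : 'M[k]_m)); apply/asboolP; exists 1%:M => //.
    by split=> [x _|w _]; [exact: commr1|rewrite mul1mx].
  case: (ex_minnP ex) => r /asboolP[E gE <-] minr; exists E; split=> // E' gE'.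
  by apply: minr; apply/asboolP; exists E'.
have ETh t : Th t -> E *m rho t = psi t *: E.
  move=> Tt; have [l [_ [l0 tl _ _]]] := Th_tors Tt.
  have Lt := ThLa Tt; have Bt := LaBB Lt; have Pt := BP Bt.
  have rX j : rho (t ^+ j) = rho t ^+ j /\ psi (t ^+ j) = psi t ^+ j.
    elim: j => [|j [IH1 IH2]]; first by rewrite !expr0.
    have Bj := sgX j sB Bt; have Pj := BP Bj.
    by rewrite !exprS -[t * _]/(t *m _) rM // psiM // IH1 IH2.
  have [rl pl] := rX l; move: rl pl; rewrite tl r1 psi1 => rl pl.
  have p0 : psi t != 0.
    apply: contra_eq_neq pl => ->; case: (l) l0 => [|l'] l0; first by rewrite eqxx in l0.
    by rewrite exprS mul0r oner_eq0.
  pose x := (psi t)^-1 *: rho t.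
  have xr : rho t = psi t *: x by rewrite /x scalerA divff // scale1r.
  have xX j : x ^+ j = (psi t)^-1 ^+ j *: rho t ^+ j.
    elim: j => [|j IH]; first by rewrite !expr0 scale1r.
    by rewrite !exprS IH -[x * _]/(x *m _) /x -scalemxAl -scalemxAr scalerA.
  have xl : x ^+ l = 1 by rewrite xX exprVn -pl invr1 scale1r -rl.
  have cx y : GRing.comm y (rho t) -> GRing.comm y x.
    move=> c; rewrite /GRing.comm /x -[y * _]/(y *m _) -[_ * y]/(_ *m y) -scalemxAr -scalemxAl.
    by rewrite -[y *m _]/(y * _) c.
  pose A := avgm x l.
  have AE : GRing.comm A E by apply/commr_sym/avgm_comm/cx/commr_sym/Ec.
  have gAE : good (A *m E).
    split=> [y Ly|w wP].
      apply: commrM; last exact: Ec.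
      apply: avgm_comm; apply: cx; rewrite /GRing.comm -[rho y * _]/(rho y *m _) -[_ * rho y]/(_ *m rho y).
      by rewrite -!rM ?(LaC Ly Lt) //; exact: LaP.
    by rewrite -mulmxA Ew // avgm_act // /x -scalemxAl wP // scalerA mulVf // scale1r.
  have := minE _ gAE; rewrite (geq_leqif (mxrank_leqif_sup (submxMl A E))) => /submxP[D DE].
  have Ax : A *m x = A by rewrite -[RHS](avgm_fix xl); apply/esym/avgm_comm.
  rewrite xr -scalemxAr; congr (_ *: _).
  by rewrite {1}DE -[A *m E]/(A * E) AE -[E * A]/(E *m A) -!mulmxA Ax -[E *m A]/(E * A) -AE -DE.
have ELa x : La x -> E *m rho x = psi x *: E.
  move=> Lx; apply/eqP; rewrite -subr_eq0; apply/eqP.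
  have : cl (Th : set gl) `<=` [set x | E *m rho x - psi x *: E = 0]; last by apply; exact: LaTh.
  apply: cl_sub; last by move=> t Tt /=; rewrite ETh // subrr.
  apply: zc_regm0; apply: regm_sub; first exact: regm_mul (regm_cst _ _) rr.
  exact: regm_scale rpsi (regm_cst _ _).
have rpb : regmap ((fun b => p *m b) : gl -> gl) by reg_tac.
pose O := [set g : gl | exists x y, [/\ La x, ((fun b : gl => p *m b : gl) @` B) y & g = x *m y]].
have iO : irrg O := irr_mulset iLa (irr_image rpb iB).
pose Z := @cl k gl O; have iZ : irrg Z := irr_cl iO; have cZ : zcg Z := @zc_cl _ gl O.
have OZ : O `<=` Z := @sub_cl _ gl O.
have ZP : Z `<=` P.
  by apply: cl_sub => // _ [x [_ [/LaP Px [b /BP Pb <-] ->]]]; apply: sgM => //; exact: sgM.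
have ZG : Z `<=` G by move=> y /ZP/PG.
have LaZ x y : La x -> Z y -> Z (x *m y).
  move=> Lx; apply: (@cl_stable _ gl O (fun y => x *m y)); first by reg_tac.
  by move=> _ [x' [y' [Lx' By' ->]]]; exists (x *m x'), y'; rewrite mulmxA; split=> //; exact: sgM.
have ZB y b : Z y -> B b -> Z (y *m b).
  move=> Zy Bb; move: y Zy; apply: (@cl_stable _ gl O (fun y => y *m b)); first by reg_tac.
  move=> _ [x [_ [Lx [b' Bb' <-] ->]]]; exists x, (p *m (b' *m b)).
  by rewrite !mulmxA; split=> //; exists (b' *m b); [exact: sgM|rewrite mulmxA].
have Zp : Z p.
  apply: OZ; exists 1%:M, p; rewrite mul1mx; split=> //; first exact: sg1.
  by exists 1%:M; [exact: sg1|rewrite mulmx1].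
have rEv : @regm k gl m 1 (fun y => E *m (rho y *m v)).
  by apply: regm_mul (regm_cst _ _) _; exact: regm_mul rr (regm_cst _ _).
have Evb y b : P y -> B b -> E *m (rho (y *m b) *m v) = psi b *: (E *m (rho y *m v)).
  by move=> Py Bb; have Pb := BP Bb; rewrite rM // -mulmxA rhoB // -!scalemxAr.
have Egv x y : La x -> P y -> E *m (rho (x *m y) *m v) = psi x *: (E *m (rho y *m v)).
  move=> Lx Py; rewrite rM //; last exact: LaP.
  by rewrite -mulmxA mulmxA ELa // -scalemxAl.
have solLa : is_solvable La by apply: (solvable_Tri uz sLa) => x /LaBB; exact: BT.
(* The zeros would form a closed set stable under [La] and [B], and contain a fixed point of [La].
   There rho(y) v has weight [psi], so [E] leaves it unchanged and nonzero. *)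
have EvN y : Z y -> E *m (rho y *m v) <> 0.
  move=> Zy Ey; pose S := [set y : gl | Z y /\ E *m (rho y *m v) = 0].
  have [||||y0 [Zy0 Ey0] y0La] := @borel_fixed_point k n G B La S sG cG iG bB sLa cLa iLa solLa.
  - exact: (zcI cZ (zc_regm0 rEv)).
  - by move=> x [/ZG].
  - by exists y.
  - move=> r s b Lr [Zs Es] Bb; split; first by apply: ZB => //; exact: LaZ.
    by rewrite -mulmxA Egv ?Evb ?Es ?scaler0 //; [exact: ZP|apply: sgM (ZP _ Zs) (BP Bb)].
  have Py0 := ZP _ Zy0; apply: (rinj _ Py0); rewrite -Ey0 Ew // => x Lx.
  have Px := LaP _ Lx; rewrite -(fixed_char rpsi psiM psi1 Py0 y0La Lx).
  have Bc := y0La _ Lx; have Pc := BP Bc.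
  rewrite scalemxAr -rhoB // !mulmxA -!rM //; congr (rho _ *m v).
  by rewrite /cj !mulmxA mulgV ?mul1mx //; exact: sgU Py0.
pose w0 := E *m (rho p *m v); have w00 : w0 != 0 by apply/eqP; exact: EvN.
have [i0 wi] : exists i, w0 i 0 != 0.
  apply: contrapT => /forallNP no; case/negP: w00; apply/eqP/matrixP => i j.
  by rewrite (ord1 j) [RHS]mxE; apply/eqP; apply: contrapT => /negP; exact: no.
pose Phi (y : gl) := (E *m (rho y *m v)) i0 0 / w0 i0 0.
have rPhi : reg Phi by apply: regM (regC _ _); exact: rEv.
have par y : Z y -> E *m (rho y *m v) = Phi y *: w0.
  move=> Zy; apply/eqP; rewrite -subr_eq0; apply/eqP.
  have : Z `<=` [set y | E *m (rho y *m v) - Phi y *: w0 = 0]; last by apply.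
  apply: cl_sub; first by apply: zc_regm0; apply: regm_sub => //; exact: regm_scale rPhi (regm_cst _ _).
  move=> _ [x [_ [Lx [b Bb <-] ->]]] /=; have Pb := BP Bb.
  have Px := LaP _ Lx; have Ppb := sgM sP Pp Pb.
  by rewrite /Phi Egv // Evb // -/w0 scalerA [X in _ - (X / _) *: _]mxE mulfK // subrr.
have Phi0 y : Z y -> Phi y != 0.
  by move=> Zy; apply/eqP => E0; apply: (EvN y Zy); rewrite par // E0 scale0r.
have /choice[c cE] : forall j : 'I_m, exists c, forall y, Z y -> (rho y *m v) j 0 = c * Phi y.
  move=> j; have [coB _] := complete_borel sG cG iG bB.
  apply: (@ratio_const k n Z B (fun y => (rho y *m v) j 0) Phi iZ cZ (complete_sub coB ZG)) => //.
    exact: (regm_mul rr (regm_cst _ v)).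
  move=> y b Zy Bb; have Py := ZP _ Zy; have Pb := BP Bb.
  by rewrite rM // -mulmxA rhoB // -scalemxAr mxE /Phi Evb // [X in _ = _ * (X / _)]mxE; ring.
have Pg0 := LaP _ Lg0; have Pgp := sgM sP Pg0 Pp; have Ppi := sgV sP Pp.
have Pc : P (cj p g) by apply: sgM => //; exact: sgM.
apply/(rB _ Pc); exists (Phi (g *m p) / Phi p).
have E1 : rho (g *m p) *m v = (Phi (g *m p) / Phi p) *: (rho p *m v).
  apply/matrixP => j l; rewrite (ord1 l) [RHS]mxE !cE //; last exact: LaZ.
  by rewrite [RHS]mulrCA divfK // Phi0.
rewrite /cj -mulmxA rM // -mulmxA E1 -scalemxAr mulmxA -rM // mulVg ?r1 ?mul1mx //.
exact: sgU Pp.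
Qed.

(** The preimage of [D] under [pr] is the product of [D] and [V], a connected normal unipotent
    subgroup of [P]; it lies in [V], which [pr] kills. *)
Lemma normal_in_levi_trivial D : is_subgroup D -> zcg D -> irrg D -> D `<=` L ->
  (forall d, D d -> UT 1 (cj z d)) -> (forall l d, L l -> D d -> D (l *m d *m ginv l)) ->
  D `<=` [set 1%:M].
Proof.
move=> sD cD iD DL DU Dn; pose U := [set g | P g /\ D (pr g)].
have DV d v : D d -> V v -> P (d *m v) /\ pr (d *m v) = d.
  move=> /DL Ld Vv; have Pd := LP Ld; have Pv := BP (VB Vv).
  by split; [exact: sgM|rewrite prM // prL // (prV Pv).2 // mulmx1].
have US g : U g -> exists d v, [/\ D d, V v & g = d *m v].
  move=> [Pg Dg]; exists (pr g), (ginv (pr g) *m g); split=> //; first exact: radical_part.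
  by rewrite mulmxA mulgV ?mul1mx //; apply: LU; exact: DL.
have sU : is_subgroup U.
  apply: is_subgroup_ginv.
  - by move=> g [Pg _]; exact: sgU Pg.
  - by split; [exact: sg1|rewrite prL; [exact: sg1|exact: sg1]].
  - by move=> g h [Pg Dg] [Ph Dh]; split; [exact: sgM|rewrite prM //; exact: sgM].
  - by move=> g [Pg Dg]; split; [exact: sgV|rewrite prI //; exact: sgV].
have UV : U `<=` V.
  apply: radP => //.
  - exact: (zc_regon rpr cP cD).
  - have := irr_mulset iD iV; congr irr; apply/seteqP; split=> g; last first.
      by move=> /US[d [v [Dd Vv ->]]]; exists d, v.
    by move=> [d [v [Dd Vv ->]]]; have [Pdv E] := DV d v Dd Vv; split=> //; rewrite E.
  - by move=> g [].
  - move=> g u Pg [Pu Du]; have Pgi := sgV sP Pg; have Pgu := sgM sP Pg Pu.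
    split; first exact: sgM.
    by rewrite !prM // prI //; apply: Dn => //; exact: prK.
  - move=> g /US[d [v [Dd Vv ->]]]; apply/(cj_unips _ uz); apply: UT1_unip.
    by rewrite cjM //; apply: UTM; [exact: DU|exact: VU].
move=> d Dd; have Ld := DL _ Dd; have Pd := LP Ld.
have Ud : U d by split=> //; rewrite prL.
by have := (prV Pd).2 (UV _ Ud); rewrite prL.
Qed.

(** All L-conjugates of [La] lie in [BL] by [torus_fixes]; let [M] be the closure of the group they
    generate. Its derived group is normal in [L] and unipotent, hence trivial, so [M] is
    commutative. For t in [Th] the quotient of l t l^-1 by t is then both torsion and unipotent,
    hence 1. *)
Lemma torus_central l g : L l -> La g -> g *m l = l *m g.
Proof.
have LaL' : csc L La.
  by split=> //; apply: (solvable_Tri uz sLa) => x /LaBB; exact: BT.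
pose X := [set x | exists l : {l | L l}, La (cj (sval l) x)].
have cjK h x : units h -> cj h (h *m x *m ginv h) = x.
  by move=> uh; rewrite /cj !mulmxA mulVg // mul1mx -mulmxA mulVg // mulmx1.
have XBL x : X x -> BL x.
  move=> [[h Lh] /= Lx]; have uh := LU Lh.
  have xE : x = cj (ginv h) (cj h x).
    by rewrite /cj ginvK // !mulmxA mulgV // mul1mx -mulmxA mulgV // mulmx1.
  have [Lcx _] := LaB Lx; split; rewrite xE; last by apply: torus_fixes => //; apply: LP; exact: sgV.
  by rewrite {1}/cj ginvK //; exact: (sgM sL (sgM sL Lh Lcx) (sgV sL Lh)).
have XU : X `<=` @units k n by move=> x /XBL[/LU].
pose M := @cl k gl (gen X).
have sM0 := gen_subgroup XU; have sM : is_subgroup M := cl_subgroup sM0.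
have iM0 : irrg (gen X).
  apply: (@irr_gen k n {l | L l} (fun i => [set x | La (cj (sval i) x)])) => -[h Lh] /=;
    have [sC cC iC _ CL] := csc_conj LaL' sL Lh => //.
    exact: (sg1 sC).
  by move=> x Cx; exact: (sgU sC Cx).
have iM : irrg M := irr_cl iM0.
have XM : X `<=` M by move=> x Xx; apply: (@sub_cl _ gl); exact: sub_gen.
have MBL : M `<=` BL.
  by apply: cl_sub; [exact: levi_borel_zc|apply: gen_sub => //; exact: levi_borel_subgroup].
have Mn h x : L h -> M x -> M (h *m x *m ginv h).
  move=> Lh; have uh := LU Lh.
  apply: (@cl_stable _ gl _ (fun x => h *m x *m ginv h)); first by reg_tac.
  apply: gen_conj => // y [[h' Lh'] /= Ly]; exists (exist _ (h *m h') (sgM sL Lh Lh')) => /=.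
  have -> : cj (h *m h') (h *m y *m ginv h) = cj h' (cj h (h *m y *m ginv h)).
    by rewrite /cj ginvM !mulmxA.
  by rewrite cjK.
have sDM := derived_subgroup sM; pose D := @cl k gl (derived M).
have sD : is_subgroup D := cl_subgroup sDM.
have D1 : D `<=` [set 1%:M].
  apply: normal_in_levi_trivial => //; [exact: zc_cl|exact: irr_cl (irr_derived sM iM)| | |].
  - by apply: (@cl_sub _ gl _ _ cL) => x /(derived_sub sM)/MBL[].
  - move=> d; apply: (@cl_sub _ gl _ _ (cj_zc (z := z) (@UT_zc k n 1))).
    apply: gen_sub; first exact: cj_subgroup (UT_subgroup k n 1).
    move=> x /(commsetP _ sM)[x1 [x2 [/MBL B1 /MBL B2 ->]]].
    exact: (comm_UT1 uz levi_borel_subgroup levi_borel_Tri B1 B2).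
  - move=> h d Lh; have uh := LU Lh.
    apply: (@cl_stable _ gl _ (fun x => h *m x *m ginv h)); first by reg_tac.
    apply: gen_conj => //; first by move=> x /(commset_sub sM)/MBL[/LU].
    move=> x /(commsetP _ sM)[x1 [x2 [M1 M2 ->]]]; apply/(commsetP _ sM).
    exists (h *m x1 *m ginv h), (h *m x2 *m ginv h); split; try exact: Mn.
    have uhi := unitsV uh.
    have cE y : h *m y *m ginv h = cj (ginv h) y by rewrite /cj ginvK.
    by rewrite !cE !cjM // !cjV.
have comM x y : M x -> M y -> x *m y = y *m x.
  move=> Mx My; have ux := sgU sM Mx; have uy := sgU sM My.
  have : D (x *m y *m ginv x *m ginv y).
    by apply: (@sub_cl _ gl); apply: (@sub_gen _ _ (commset M)); apply/(commsetP _ sM); exists x, y.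
  move=> /D1/(congr1 (fun q => q *m y *m x)) /=.
  by rewrite mul1mx -(mulmxA _ (ginv y)) mulVg // mulmx1 -(mulmxA _ (ginv x)) mulVg // mulmx1.
move=> Ll Lg; have ul := LU Ll; have Lli := sgV sL Ll.
have : @cl k gl Th `<=` [set g | g *m l = l *m g]; last by apply; exact: LaTh.
apply: cl_sub => [|t Tt /=]; first exact: zc_comm.
have Lt := ThLa Tt; have Bt := LaBB Lt; have ut := sgU sB Bt.
pose x := l *m t *m ginv l.
have Mx : M x by apply: XM; exists (exist _ l Ll); rewrite /= cjK.
have Mt : M t by apply: XM; exists (exist _ 1%:M (sg1 sL)); rewrite /= /cj ginv1 mul1mx mulmx1.
have [m [ze [m0 tm _ _]]] := Th_tors Tt.
have xE : x = cj (ginv l) t by rewrite /cj ginvK.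
have Bx : B x by have [] := MBL _ Mx.
have Bti := sgV sB Bt; have q1 : x * ginv t = 1.
  apply: (unips_torsion m0).
    apply: (dg_unips uz BT); first exact: (sgM sB Bx Bti).
    move=> i; rewrite -[x * _]/(x *m _) (dgM uz BT) // (dgV uz BT) // xE fixed_dg //.
    - by rewrite divff // (dg_neq0 BT).
    - exact: LP.
    - by move=> h Lh; apply: torus_fixes => //; exact: LP.
  rewrite exprMn_comm; last exact: (comM _ _ Mx (sgV sM Mt)).
  by rewrite -ginvX tm ginv1 xE -cjX ?tm ?cj1 ?mulr1 //; exact: unitsV.
have {q1} : x = t.
  move/(congr1 (fun q => q *m t)): q1; rewrite -[x * _]/(x *m _) -mulmxA mulVg // mulmx1.
  by rewrite -[1]/(1%:M) mul1mx.
move/(congr1 (fun q => q *m l)); rewrite /x -[_ *m l]mulmxA mulVg // mulmx1.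
by [].
Qed.

End Dual.
Lemma levi_stabilizer g (H : set 'M[k]_n) : G g -> H `<=` L -> (forall h, H h -> B (cj g h)) ->
  exists2 l, L l & forall h, H h -> BL (cj l h).
Proof.
move=> Gg HL gH; have [m [rho [v [rr rM r1 _ [v0 rP]]]]] := line_stabilizer sG sP PG cP.
have [chi rchi chiE] := eigen_char rr v0.
have rhoP p : P p -> rho p *m v = chi p *: v.
  by move=> Pp; have [c E] := (rP p (PG Pp)).1 Pp; rewrite (chiE _ _ E).
have chi1 : chi 1%:M = 1 by apply: chiE; rewrite r1 mul1mx scale1r.
have chiM x y : P x -> P y -> chi (x *m y) = chi x * chi y.
  move=> Px Py; apply: chiE; have [Gx Gy] := (PG Px, PG Py).
  by rewrite rM // -mulmxA rhoP // -scalemxAr rhoP // scalerA mulrC.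
have BLP : BL `<=` P by move=> x [/LP].
have [K [a [La [Th [[K0 Ka] [sLa cLa iLa LaB LaC] [ThLa LaTh] Ttors Tprime]]]]] :=
  torus_part uz levi_borel_subgroup levi_borel_zc levi_borel_irr levi_borel_Tri rchi
    (fun x y Bx By => chiM x y (BLP _ Bx) (BLP _ By)) chi1.
have cen l x : L l -> La x -> x *m l = l *m x.
  by apply: (@torus_central chi K a La Th).
have chiB : forall b, B b -> chi b ^+ K = \prod_i dg z i b ^ a i by exact: chi_borel.
have solLa : is_solvable La by apply: (solvable_Tri uz sLa) => x /LaB[_]; exact: BT.
(* The points of the flag variety fixed by [H]. Since [La] centralizes [H] it acts on them, and a
   fixed point of [La] gives a conjugate of [B] that contains both groups. *)
pose S : set gl := [set y | G y /\ forall h, H h -> B (cj y h)].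
have [||||y [Gy yH] yLa] := @borel_fixed_point k n G B La S sG cG iG bB sLa cLa iLa solLa.
- apply: (zcI cG); apply: zc_forall => h; apply: (@zc_impl _ gl (H h) [set y | B (cj y h)]).
  by apply: (@zc_preim _ gl gl (fun y => cj y h)) => //; rewrite /cj; reg_tac.
- by move=> y [].
- by exists g.
- move=> r s b Lr [Gs sH] Bb; have [Lr' Br] := LaB _ Lr; have ur := sgU sB Br.
  split; first exact: (sgM sG (sgM sG (BG Br) Gs) (BG Bb)).
  move=> h Hh; have -> : cj (r *m s *m b) h = cj b (cj s (cj r h)) by rewrite /cj !ginvM !mulmxA.
  have -> : cj r h = h by rewrite /cj -mulmxA -(cen h) ?mulmxA ?mulVg ?mul1mx //; exact: HL.
  by apply: (sgM sB) => //; apply: (sgM sB); [exact: sgV|exact: sH].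
(* All exponents lie between -N and N; a prime beyond 2N keeps the shifted exponents a_i + N below
   [l], so distinct exponents belong to distinct eigenvalues. *)
have uy := sgU sG Gy; pose N := (\sum_i absz (a i))%N.
have [l [s [ze [pl ltl l0 Ts [sl zl z1 sE]]]]] := Tprime (N + N)%N.
have Ls := ThLa _ Ts; have [_ Bs] := LaB _ Ls.
have aN i : (absz (a i) <= N)%N by rewrite /N (bigD1 i) //= leq_addr.
have aN' i : - N%:Z <= a i <= N%:Z by rewrite -Num.Theory.ler_norml -abszE lez_nat.
have aN0 i : 0 <= a i + N%:Z by have /andP[+ _] := aN' i; rewrite -Num.Theory.subr_ge0 opprK.
have ltu i : (absz (a i + N%:Z)%R < l)%N.
  apply: leq_ltn_trans ltl; rewrite -lez_nat gez0_abs // PoszD Num.Theory.lerD2r.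
  by have /andP[] := aN' i.
pose u i : 'I_l := Ordinal (ltu i).
have uE i : (u i : nat)%:Z = a i + N%:Z by rewrite /= gez0_abs.
have [sB' cB' iB' _ B'G] := csc_conj cscB sG Gy.
set B' := [set g | B (cj y g)] in sB' cB' iB' B'G.
have uyz : units (y *m z) by apply/unitsM.
have BT' x : B' x -> Tri (cj (y *m z) x).
  by move=> /BT; congr Tri; rewrite /cj ginvM !mulmxA.
have [iC _] := irr_centralizer uyz sB' cB' iB' BT' l0 (yLa _ Ls) sl.
have sC := centralizer_subgroup s sB'; set C := [set g | _] in iC sC.
have cC : zcg C := zcI cB' (@zc_comm k n s).
have solC : is_solvable C by apply: (solvable_Tri uyz sC) => x [/BT'].
have CP : C `<=` P.
  (* The diagonal of [s] is read in [B] itself, while the lemma accepts any irreducible set through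
     1 that commutes with [s]; so it applies to [C], which lies in the conjugate [B']. *)
  apply: (prime_centralizer pl l0 sl zl z1 uz (BT Bs) sE uE sG cG iG bB BT Bs rr rM r1 v0 _ K0 _ chiB iC).
  - by move=> x Gx /(rP x Gx).
  - by move=> b /BP; exact: rhoP.
  - exact: sg1 sC.
  - by move=> x [/B'G].
have [||p Pp pC] := borel_fixed_point sG cG iG bB sC cC iC solC cP PG.
- by exists 1%:M; exact: sg1.
- by move=> r t b /CP Pr Pt /BP Pb; apply: sgM => //; exact: sgM.
exists (pr p); first exact: prK.
move=> h Hh; have Lh := HL _ Hh; have Ph := LP Lh; have Ppi := sgV sP Pp.
have Ch : C h by split; [exact: yH|apply/esym; exact: cen].
have := pr_borel (pC _ Ch); rewrite prM ?prM ?prI ?(prL Lh) //; exact: sgM.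
Qed.

End Levi.

(** * Points of Schubert varieties and their stabilizers *)

Section Stabilizers.
Variables (k : closedFieldType) (n : nat).

(** The flag variety is itself closed in its quotient topology and contains the cell, so it contains
    the smallest closed set around the cell. *)
Lemma schubert_flag (G B T w : set 'M[k]_n) dw x : algebraic_group G -> B `<=` G -> B 1%:M ->
  weyl_group G T w -> w dw -> schubert G B dw x -> flag_variety G B x.
Proof.
move=> [sG [Z cZ GE]] BG B1 [d [Gd _] <-] [c [Gc _] <-] xP; apply: xP; split.
  split=> //; exists Z => //; apply/seteqP; split=> g.
    move=> [_ [h Gh <-] [b Bb <-]]; have Gg := sgM sG Gh (BG _ Bb); split=> //.
    by move: Gg; rewrite {1}GE => -[].
  by move=> [_ Gg]; exists (lcoset g B); [exists g|exists 1%:M => //; rewrite mulmx1].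
move=> _ [b Bb <-]; exists (b *m (d *m c)) => //.
by apply: sgM => //; [exact: BG|exact: sgM].
Qed.

Lemma stabilizer_subgroup (L x : set 'M[k]_n) : is_subgroup L -> is_subgroup (stabilizer L x).
Proof.
move=> sL; apply: is_subgroup_ginv.
- by move=> l [Ll _]; exact: sgU Ll.
- split; first exact: sg1.
  by apply/seteqP; split=> g; [move=> [h xh <-]; rewrite mul1mx|move=> xg; exists g; rewrite ?mul1mx].
- move=> l m [Ll lx] [Lm mx]; split; first exact: sgM.
  rewrite -{2}lx -{2}mx; apply/seteqP; split=> g.
    by move=> [h xh <-]; exists (m *m h); [exists h|rewrite mulmxA].
  by move=> [_ [h xh <-] <-]; exists h; rewrite ?mulmxA.
- move=> l [Ll lx]; have ul := sgU sL Ll; split; first exact: sgV.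
  rewrite -{1}lx; apply/seteqP; split=> g.
    by move=> [_ [h xh <-] <-]; rewrite mulmxA mulVg // mul1mx.
  by move=> xg; exists (l *m g); [exists g|rewrite mulmxA mulVg // mul1mx].
Qed.

Lemma stabilizer_coset (B L : set 'M[k]_n) g l : units g -> B 1%:M ->
  stabilizer L (lcoset g B) l -> B (cj g l).
Proof.
move=> ug B1 [_ lx]; have : [set l *m h | h in lcoset g B] (l *m g).
  by exists g => //; exists 1%:M => //; rewrite mulmx1.
rewrite lx => -[b Bb bE].
by rewrite /cj -mulmxA -bE mulmxA mulVg // mul1mx.
Qed.

End Stabilizers.

Theorem theorem1p2 (k : closedFieldType) (n : nat) (G B T : set 'M[k]_n)
    (hG : algebraic_group G) (hGconn : zconnected G) (hGred : reductive G)
    (hB : borel_subgroup G B) (hT : maximal_torus G T) (hTB : T `<=` B)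
    (w : set 'M[k]_n) (hw : weyl_group G T w)
    (dw : 'M[k]_n) (hdw : w dw)
    (J : set ('M[k]_n -> k)) (hJ : J `<=` left_descents B T dw)
    (L : set 'M[k]_n) (hL : levi_subgroup (standard_parabolic G B T J) L)
    (hTL : T `<=` L)
    (x : set 'M[k]_n) (hx : schubert G B dw x) :
  strongly_solvable L (stabilizer L x).
Proof.
have [sG cG] := (algebraic_groupP G).1 hG; have iG := zconnected_irr sG cG hGconn.
have /borelP[[sB _ _ _ BG] _] := hB; have B1 := sg1 sB.
have [_ [z uz BT]] := complete_borel sG cG iG hB.
have [sP iP BP PG] := standard_parabolicP sG hB T J.
have cP := levi_closed sG cG iG hB sP BP PG hL.
have [/algebraic_groupP[sL cL] LP [pr [mpr prL prV]]] := hL.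
have sH := stabilizer_subgroup x sL; split=> //; first by move=> l [].
have [g Gg xE] := schubert_flag hG BG B1 hw hdw hx.
have gH h : stabilizer L x h -> B (cj g h).
  by rewrite -xE; apply: stabilizer_coset => //; exact: sgU Gg.
have iV := radical_irr sG cG iG hB sP BP PG.
have VB := radical_borel sG cG iG hB sP BP PG.
have VU := radical_UT1 sG cG iG hB sP BP PG uz BT.
have radP := sub_radical sP.
have [l Ll lH] := levi_stabilizer sG cG iG hB uz BT sP cP BP PG sL cL LP mpr prL prV iV VB VU
  radP Gg (fun h (Hh : stabilizer L x h) => Hh.1) gH.
exists [set h | levi_borel B L (cj l h)] => //.
exact: (levi_borel_borel sG cG iG hB uz BT sP cP BP PG sL cL LP mpr prL prV VB Ll).
Qed.
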